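(* Let $f=0$ and $v\in L^2(\Omega)$. Let $u_h$ be the semidiscrete Galerkin solution with $u_h(0)=v_h$, and let $U_h^n$, $1\le n\le N$, be the solution of the corrected fractional Crank–Nicolson scheme with $U_h^0=v_h$, where $v_h:=P_hv$ (and $f_h=0$, $F_h^n=0$). Then there is a constant $c$, independent of the mesh size $h$ and the time step size $\tau$, such that $$\|u_h(t_n)-U_h^n\|_{L^2(\Omega)}\le c\,\tau^2 t_n^{-2}\|v\|_{L^2(\Omega)},\qquad n\ge 1 .$$
   Context: Setting. $\Omega\subset\mathbb R^d$ ($d=1,2,3$) is a bounded convex polygonal domain, $T>0$ is fixed, $0<\alpha<1$. The problem is $\partial_t^\alpha u(t)-\Delta u(t)=f(t)$ for $t\in(0,T)$, $u(0)=v$, with zero Dirichlet boundary condition, where $\partial_t^\alpha u(t)=\frac1{\Gamma(1-\alpha)}\int_0^t(t-s)^{-\alpha}\frac{d}{ds}u(s)\,ds$ is the Caputo derivative. Space discretization. $\mathcal T_h$ is a shape regular quasi-uniform triangulation of $\Omega$ into $d$-simplexes with mesh size $h$; $X_h\subset H_0^1(\Omega)$ is the space of continuous piecewise linear functions over $\mathcal T_h$ vanishing on $\partial\Omega$. $P_h:L^2(\Omega)\to X_h$ is the $L^2(\Omega)$-projection, and $\Delta_h:X_h\to X_h$ is defined by $-(\Delta_h\varphi_h,\chi_h)=(\nabla\varphi_h,\nabla\chi_h)$ for all $\varphi_h,\chi_h\in X_h$. The semidiscrete solution $u_h(t)\in X_h$ satisfies $\partial_t^\alpha u_h(t)-\Delta_hu_h(t)=f_h(t)$,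 $t>0$, $u_h(0)=v_h\in X_h$, where $f_h=P_hf$. Time discretization. $\tau=T/N$, $N\in\mathbb N$, $t_n=n\tau$, $F_h^n=f_h(t_n)$. For a sequence $\varphi^n$, $\bar\partial_\tau^\alpha\varphi^n:=\tau^{-\alpha}\sum_{j=0}^n b_{n-j}\varphi^j$ with $\sum_{j=0}^\infty b_j\xi^j=(1-\xi)^\alpha$. The corrected fractional Crank–Nicolson scheme is: $U_h^0=v_h$ and $$\bar\partial_\tau^\alpha(U_h-v_h)^1-(1-\tfrac\alpha2)\Delta_hU_h^1-(\tfrac12-\tfrac\alpha4)\Delta_hv_h=(1-\tfrac\alpha2)(F_h^1+\tfrac12F_h^0),$$ $$\bar\partial_\tau^\alpha(U_h-v_h)^2-(1-\tfrac\alpha2)\Delta_hU_h^2-\tfrac\alpha2\Delta_hU_h^1-\tfrac\alpha4\Delta_hv_h=(1-\tfrac\alpha2)F_h^2+\tfrac\alpha2F_h^1+\tfrac\alpha4F_h^0,$$ $$\bar\partial_\tau^\alpha(U_h-v_h)^n-(1-\tfrac\alpha2)\Delta_hU_h^n-\tfrac\alpha2\Delta_hU_h^{n-1}=(1-\tfrac\alpha2)F_h^n+\tfrac\alpha2F_h^{n-1},\quad 3\le n\le N.$$ *)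

(* Defs.v *)
From HB Require Import structures.
From mathcomp Require Import all_boot all_order all_algebra.
From mathcomp Require Import all_classical all_reals all_analysis.

Set Implicit Arguments.
Unset Strict Implicit.
Unset Printing Implicit Defensive.

Import Order.TTheory GRing.Theory Num.Theory.
Import numFieldNormedType.Exports.

Local Open Scope classical_set_scope.
Local Open Scope ring_scope.

(* 'rV[R]_d carries the product sigma-algebra, generated by the coordinates
   (equivalently, its Borel sigma-algebra). *)
Definition rV_display : measure_display. Proof. exact: default_measure_display. Qed.

Section measurable_rV.
Context (R : realType) (d : nat).

Let coord : 'I_d -> 'rV[R]_d -> measurableTypeR R := fun i x => x 0 i.

Let rV_set0 : g_sigma_preimage coord set0.
Proof. exact: sigma_algebra0. Qed.

Let rV_setC A : g_sigma_preimage coord A -> g_sigma_preimage coord (~` A).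
Proof. exact: sigma_algebraC. Qed.

Let rV_bigcup (F : (set 'rV[R]_d)^nat) :
  (forall i, g_sigma_preimage coord (F i)) ->
  g_sigma_preimage coord (\bigcup_i F i).
Proof. exact: sigma_algebra_bigcup. Qed.

HB.instance Definition _ := @isMeasurable.Build rV_display
  'rV[R]_d (g_sigma_preimage coord) rV_set0 rV_setC rV_bigcup.

End measurable_rV.

Section lebesgue_measure_rV.
Context (R : realType).

Lemma measurable_coord d (i : 'I_d) :
  measurable_fun [set: 'rV[R]_d] (fun x => x 0 i).
Proof.
move=> _ Y mY; rewrite setTI; apply: sub_sigma_algebra => /=.
rewrite -bigcup_seq/=; exists i => /=; first by rewrite mem_index_enum.
by exists Y => //; rewrite setTI.
Qed.

Lemma measurable_fun_rV d0 (T : measurableType d0) d (f : T -> 'rV[R]_d) :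
  (forall i, measurable_fun [set: T] (fun t => f t 0 i)) ->
  measurable_fun [set: T] f.
Proof.
move=> mf; set G := \big[setU/set0]_(i < d)
  preimage_set_system setT (fun x : 'rV[R]_d => x 0 i : measurableTypeR R)
    measurable.
apply: (@measurability _ _ _ _ setT f G) => //.
move=> _ [A GA <-]; move: GA; rewrite /G -bigcup_seq /= => -[i _ [B mB <-]].
by rewrite setTI; exact: mf.
Qed.

Definition rV_snoc d (p : 'rV[R]_d * R) : 'rV[R]_d.+1 :=
  \row_i (if unlift ord_max i is Some j then p.1 0 j else p.2).

Lemma measurable_rV_snoc d :
  measurable_fun [set: 'rV[R]_d * measurableTypeR R] (@rV_snoc d).
Proof.
apply: measurable_fun_rV => i.
case: (unliftP ord_max i) => [j ->|->].
  under eq_fun do rewrite mxE liftK.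
  exact: measurableT_comp (measurable_coord j) measurable_fst.
by under eq_fun do rewrite mxE unlift_none; exact: measurable_snd.
Qed.

Fixpoint lebesgue_rV d : {measure set 'rV[R]_d -> \bar R} :=
  match d with
  | 0 => \d_(0 : 'rV[R]_0)
  | k.+1 => measure_function_pushforward__canonical__measure_function_Measure
      (lebesgue_rV k \x (@lebesgue_measure R))%E (@measurable_rV_snoc k)
  end.

Lemma lebesgue_rV_box d (A : 'I_d -> set R) :
  (forall i, measurable (A i : set (measurableTypeR R))) ->
  lebesgue_rV d [set x | forall i, A i (x 0 i)] =
  (\prod_(i < d) lebesgue_measure (A i))%E.
Proof.
elim: d A => [|d IHd] A mA.
  rewrite big_ord0 /= diracE mem_set//; by case.
have mB n (B : 'I_n -> set R) : (forall i, measurable (B i)) ->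
    measurable [set x : 'rV[R]_n | forall i, B i (x 0 i)].
  move=> mBi; rewrite (_ : [set x | _] =
    \bigcap_(i in [set: 'I_n]) ((fun x : 'rV[R]_n => x 0 i) @^-1` B i)).
    apply: fin_bigcap_measurable => // i _.
    by rewrite -[X in measurable X]setTI; exact: measurable_coord.
  by apply/seteqP; split => x /= h i; [move=> _; exact: h|exact: h].
rewrite big_ord_recr /= /pushforward.
pose B : set 'rV[R]_d :=
  [set x | forall i, A (widen_ord (leqnSn d) i) (x 0 i)].
pose C : set (measurableTypeR R) := A ord_max.
transitivity ((lebesgue_rV d \x (@lebesgue_measure R))%E (B `*` C)).
  congr (product_measure1 _ _ _).
  apply/seteqP; split => -[x t] /=.
    move=> h; split=> [i|].
      have := h (lift ord_max i); rewrite mxE liftK.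
      by rewrite (_ : lift _ _ = widen_ord (leqnSn d) i)//; apply/val_inj;
        rewrite /= /bump leqNgt ltn_ord.
    by have := h ord_max; rewrite mxE unlift_none.
  move=> [hx ht] i; rewrite mxE; case: (unliftP ord_max i) => [j ->|-> //] /=.
  by rewrite (_ : lift _ _ = widen_ord (leqnSn d) j)//; apply/val_inj;
    rewrite /= /bump leqNgt ltn_ord.
rewrite product_measure1E; [| |exact: mA].
  by congr (_ * _)%E; apply: (IHd (fun i => A (widen_ord (leqnSn d) i))).
by apply: (mB d (fun i => A (widen_ord (leqnSn d) i))) => i; exact: mA.
Qed.

End lebesgue_measure_rV.

Section finite_elements.
Context (R : realType) (d : nat).
Implicit Types (Omega A : set 'rV[R]_d) (u w : 'rV[R]_d -> R).

(* Square integrability and the norm on Omega are those of the extension by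
   zero to 'rV[R]_d. *)
Definition L2 Omega u := u \_ Omega \in Lfun (lebesgue_rV R d) 2%:E.

Definition L2norm Omega u : \bar R :=
  'N[lebesgue_rV R d]_2%:E[EFin \o (u \_ Omega)]%E.

Definition L2dot Omega u w : R :=
  \int[lebesgue_rV R d]_(x in Omega) (u x * w x).

(* A bounded nonempty finite intersection of open half-spaces; it is open and
   convex. *)
Definition convex_polygonal_domain Omega :=
  [/\ Omega !=set0, bounded_set Omega &
    exists m (A : 'M[R]_(m, d)) (c : 'cV[R]_m),
      Omega = [set x | forall i, (A *m x^T) i 0 < c i 0]].

(* The library norm on 'rV[R]_d is the maximum norm. *)
Definition euclid (x : 'rV[R]_d) : R := Num.sqrt (\sum_i x 0 i ^+ 2).

Definition diam A : R := sup [set euclid (x - y) | x in A & y in A].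

Definition inradius A : R :=
  sup [set r | 0 <= r /\ exists c, forall y, euclid (y - c) <= r -> A y].

(* A cell is given by the set of the indices of its vertices. *)
Record mesh := Mesh {
  nnode : nat;
  node : 'I_nnode -> 'rV[R]_d;
  cells : {set {set 'I_nnode}} }.

Definition hull (Th : mesh) (S : {set 'I_(nnode Th)}) : set 'rV[R]_d :=
  [set x | exists lam : 'I_(nnode Th) -> R,
    [/\ forall i, 0 <= lam i, \sum_(i in S) lam i = 1 &
        x = \sum_(i in S) lam i *: node i]].

Definition nondegenerate (Th : mesh) (S : {set 'I_(nnode Th)}) :=
  #|S| = d.+1 /\
  forall mu : 'I_(nnode Th) -> R, \sum_(i in S) mu i = 0 ->
    \sum_(i in S) mu i *: node i = 0 -> forall i, i \in S -> mu i = 0.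

(* Since hull set0 is empty, the second condition says that two cells are
   disjoint or meet along a common face. *)
Definition triangulation Omega (Th : mesh) :=
  [/\ forall S, S \in cells Th -> nondegenerate S,
      forall S S', S \in cells Th -> S' \in cells Th ->
        hull S `&` hull S' = hull (S :&: S')%SET &
      \bigcup_(S in [set` cells Th]) hull S = closure Omega].

Definition mesh_size (Th : mesh) : R :=
  \big[Num.max/0]_(S in cells Th) diam (hull S).

Definition shape_regular (Ths : set mesh) :=
  exists sigma : R, forall Th, Ths Th -> forall S, S \in cells Th ->
    diam (hull S) <= sigma * inradius (hull S).

Definition quasi_uniform (Ths : set mesh) :=
  exists rho : R, forall Th, Ths Th -> forall S, S \in cells Th ->
    mesh_size Th <= rho * diam (hull S).

(* The space X_h; its elements are extended by zero outside Omega. *)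
Definition fe_space Omega (Th : mesh) : set ('rV[R]_d -> R) :=
  [set u | [/\ continuous u, forall x, ~ Omega x -> u x = 0 &
    forall S, S \in cells Th -> exists (g : 'cV[R]_d) (c : R),
      forall x, hull S x -> u x = (x *m g) 0 0 + c]].

(* The L^2 inner product of the weak gradients of two elements of X_h: the
   weak gradient of a continuous piecewise linear function is its classical
   gradient in the interior of every cell, and cell boundaries are null. *)
Definition grad_dot (Th : mesh) u w : R :=
  \sum_(S in cells Th) \int[lebesgue_rV R d]_(x in (hull S)°)
    (\sum_(i < d) 'D_(delta_mx 0 i) u x * 'D_(delta_mx 0 i) w x).

Definition is_L2_projection Omega Th (Ph : ('rV[R]_d -> R) -> 'rV[R]_d -> R) :=
  forall u, L2 Omega u -> fe_space Omega Th (Ph u) /\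
    forall w, fe_space Omega Th w -> L2dot Omega (Ph u) w = L2dot Omega u w.

Definition is_discrete_laplacian Omega Th
    (Lh : ('rV[R]_d -> R) -> 'rV[R]_d -> R) :=
  forall u, fe_space Omega Th u -> fe_space Omega Th (Lh u) /\
    forall w, fe_space Omega Th w -> - L2dot Omega (Lh u) w = grad_dot Th u w.

End finite_elements.

Section time_fractional.
Context (R : realType).

Definition Gamma (x : R) : R :=
  \int[lebesgue_measure]_(t in `]0, +oo[) (t `^ (x - 1) * expR (- t)).

Definition caputo (alpha : R) (g : R -> R) (t : R) : R :=
  (Gamma (1 - alpha))^-1 *
  \int[lebesgue_measure]_(s in `]0, t[) ((t - s) `^ (- alpha) * derive1 g s).

Definition frac_weights (alpha : R) (b : nat -> R) :=
  forall xi : R, `|xi| < 1 ->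
    series (fun j => b j * xi ^+ j) @ \oo --> (1 - xi) `^ alpha.

Definition frac_difference (V : lmodType R) (alpha tau : R) (b : nat -> R)
    (phi : nat -> V) (n : nat) : V :=
  tau `^ (- alpha) *: \sum_(j < n.+1) b (n - j)%N *: phi j.

Context (d : nat) (Omega : set 'rV[R]_d) (Th : mesh R d).
Context (alpha : R) (Lh : ('rV[R]_d -> R) -> 'rV[R]_d -> R).

(* X_h being finite dimensional, regularity and derivatives in time are taken
   pointwise in space. *)
Record semidiscrete_solution (fh : R -> 'rV[R]_d -> R) (vh : 'rV[R]_d -> R)
    (uh : R -> 'rV[R]_d -> R) : Prop := {
  sds_space : forall t, 0 <= t -> fe_space Omega Th (uh t);
  sds_init : uh 0 = vh;
  sds_cont : forall x, {within `[0, +oo[, continuous (uh ^~ x)};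
  sds_derivable : forall x t, 0 < t -> derivable (uh ^~ x) t 1;
  sds_C1 : forall x t, 0 < t -> {for t, continuous (derive1 (uh ^~ x))};
  sds_integrable : forall x t, 0 < t ->
    lebesgue_measure.-integrable `]0, t[ (EFin \o derive1 (uh ^~ x));
  sds_eq : forall t, 0 < t ->
    (fun x => caputo alpha (uh ^~ x) t) - Lh (uh t) = fh t }.

Record corrected_CN_solution (b : nat -> R) (tau : R) (N : nat)
    (fh : R -> 'rV[R]_d -> R) (vh : 'rV[R]_d -> R)
    (U : nat -> 'rV[R]_d -> R) : Prop := {
  cn_space : forall n, (n <= N)%N -> fe_space Omega Th (U n);
  cn_init : U 0%N = vh;
  cn_step1 : (1 <= N)%N ->
    frac_difference alpha tau b (fun j => U j - vh) 1
      - (1 - alpha / 2) *: Lh (U 1%N) - (1 / 2 - alpha / 4) *: Lh vh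
    = (1 - alpha / 2) *: (fh (1%:R * tau) + (1 / 2) *: fh (0%:R * tau));
  cn_step2 : (2 <= N)%N ->
    frac_difference alpha tau b (fun j => U j - vh) 2
      - (1 - alpha / 2) *: Lh (U 2%N) - (alpha / 2) *: Lh (U 1%N)
      - (alpha / 4) *: Lh vh
    = (1 - alpha / 2) *: fh (2%:R * tau) + (alpha / 2) *: fh (1%:R * tau)
      + (alpha / 4) *: fh (0%:R * tau);
  cn_step : forall n, (3 <= n <= N)%N ->
    frac_difference alpha tau b (fun j => U j - vh) n
      - (1 - alpha / 2) *: Lh (U n) - (alpha / 2) *: Lh (U n.-1)
    = (1 - alpha / 2) *: fh (n%:R * tau) + (alpha / 2) *: fh (n.-1%:R * tau) }.

End time_fractional.

(* Main.v *)
(* In the eigenbasis of the discrete Laplacian both schemes decouple, so it is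
   enough to bound [y (n tau) - Y n] by [C n^-2 |y 0|] for the scalar equation
   [caputo alpha y = - lambda y], uniformly in [mu = lambda tau^alpha >= 0].

   Halving the step turns [mu] into [2^-alpha mu]. If [W] and [W2] are the
   generating functions of [Y n / Y 0 - 1] for the steps [tau] and [tau / 2], the
   coefficient of index [2 n] of [2 W(z^2) - W2(z) - W2(-z)] is twice the difference
   of the two approximations at time [n tau]. The third derivative of this series is
   [O(|1 - z|^-2 + |1 + z|^-2)] uniformly in [mu]: at [z = 1] the residues cancel,
   and the correction of the first two steps cancels the next order. Averaging over
   a circle then bounds the difference by [C n^-2].

   Along the steps [tau / 2^k] the index of a fixed time doubles, so these bounds
   sum geometrically. The limit is identified through the backward Euler scheme:
   its [N]-th value differs from that of Crank-Nicolson by [O(1/N)], and it is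
   exactly the mean of [y] against an Erlang density that concentrates at the given
   time, because both have generating functions determined by the Laplace transform
   of [y]. *)
Require Import Defs.
From HB Require Import structures.
From mathcomp Require Import all_boot all_order all_algebra.
From mathcomp Require Import all_classical all_reals all_analysis.
From mathcomp Require Import measurable_realfun.
From mathcomp Require Import complex ring lra zify.

Set Implicit Arguments.
Unset Strict Implicit.
Unset Printing Implicit Defensive.

Import Order.TTheory GRing.Theory Num.Theory.
Import numFieldNormedType.Exports.
Import ComplexField.Normc.

Local Open Scope classical_set_scope.
Local Open Scope ring_scope.

(** * Formal power series *)

(** The obstacle is uniformity in [mu]: either term of the symbol [b + mu a] may dominate, so every
    estimate is relative to [|b(z)| + mu], which absorbs the factors [mu] and [b] of the numerators.
    The grid values of the exact solution have no algebraic generating function; comparing two steps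
    of one scheme leaves only quotients of explicit symbols.

    The order of differentiation is dictated by the extraction of coefficients: at radius 1 - 1/(2m)
    a function of size |1 - z|^-2 has circle mean O(m), and the factor m^3 gained by three
    derivatives turns this into m^-2. Adding [W2(-z)] makes the series even, so that only the
    half-plane Re z >= 0 has to be studied, where the singularity of (1 + z)^alpha at -1 is at
    distance at least 1.

    Complex powers and contour integrals do not appear: (1 - z)^alpha is the series [b], known
    through its differential equation and through Re b > 0. On the side of the space, an
    annihilating polynomial of the error vector replaces a full eigenbasis. *)

Definition fps (K : Type) : Type := nat -> K.

Section fps_ring.
Context (K : comNzRingType).
Implicit Types f g h : fps K.

HB.instance Definition _ := gen_eqMixin (fps K).
HB.instance Definition _ := gen_choiceMixin (fps K).

Definition fps_add f g : fps K := fun n => f n + g n.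
Definition fps_opp f : fps K := fun n => - f n.
Definition fpsC (c : K) : fps K := fun n => if n is 0 then c else 0.

Let fps_addA : associative fps_add.
Proof. by move=> f g h; apply/funext => n; rewrite /fps_add addrA. Qed.
Let fps_addC : commutative fps_add.
Proof. by move=> f g; apply/funext => n; rewrite /fps_add addrC. Qed.
Let fps_add0 : left_id (fpsC 0) fps_add.
Proof. by move=> f; apply/funext => -[|n]; rewrite /fps_add /= add0r. Qed.
Let fps_addN : left_inverse (fpsC 0) fps_opp fps_add.
Proof. by move=> f; apply/funext => -[|n]; rewrite /fps_add /fps_opp addNr. Qed.

HB.instance Definition _ :=
  GRing.isZmodule.Build (fps K) fps_addA fps_addC fps_add0 fps_addN.

Definition fps_mul f g : fps K := fun n => \sum_(i < n.+1) f i * g (n - i)%N.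

Definition fps_trunc N f : {poly K} := \poly_(i < N) f i.

Lemma fps_trunc_coef N f i : (i < N)%N -> (fps_trunc N f)`_i = f i.
Proof. by move=> iN; rewrite coef_poly iN. Qed.

Lemma fps_mul_trunc N f g i : (i < N)%N ->
  fps_mul f g i = (fps_trunc N f * fps_trunc N g)`_i.
Proof.
move=> iN; rewrite coefM; apply: eq_bigr => j _.
by rewrite !fps_trunc_coef//; apply: leq_ltn_trans iN; rewrite ?leq_subr// -ltnS.
Qed.

Lemma polyM_low N (p p' q q' : {poly K}) :
    (forall i, (i < N)%N -> p`_i = p'`_i) ->
    (forall i, (i < N)%N -> q`_i = q'`_i) ->
  forall i, (i < N)%N -> (p * q)`_i = (p' * q')`_i.
Proof.
move=> pp qq i iN; rewrite !coefM; apply: eq_bigr => j _.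
by rewrite pp ?qq//; apply: leq_ltn_trans iN; rewrite ?leq_subr// -ltnS.
Qed.

Let fps_mulC : commutative fps_mul.
Proof. by move=> f g; apply/funext => n; rewrite !(@fps_mul_trunc n.+1)// mulrC. Qed.

Let fps_mulA : associative fps_mul.
Proof.
move=> f g h; apply/funext => n; rewrite !(@fps_mul_trunc n.+1)//.
transitivity (fps_trunc n.+1 f * (fps_trunc n.+1 g * fps_trunc n.+1 h))`_n.
  apply: polyM_low (ltnSn n) => // i iN.
  by rewrite fps_trunc_coef// (@fps_mul_trunc n.+1).
rewrite mulrA; apply: polyM_low (ltnSn n) => // i iN.
by rewrite fps_trunc_coef// (@fps_mul_trunc n.+1).
Qed.

Let fps_mul1 : left_id (fpsC 1) fps_mul.
Proof.
move=> f; apply/funext => n; rewrite /fps_mul big_ord_recl /= mul1r subn0 big1 ?addr0//.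
by move=> i _; rewrite mul0r.
Qed.

Let fps_mulDl : left_distributive fps_mul fps_add.
Proof.
move=> f g h; apply/funext => n; rewrite /fps_mul /fps_add -big_split/=.
by apply: eq_bigr => i _; rewrite mulrDl.
Qed.

Let fps_1neq0 : fpsC 1 != 0.
Proof. by apply/eqP => /(congr1 (fun f : fps K => f 0%N))/eqP; apply/negP; exact: oner_neq0. Qed.

HB.instance Definition _ := GRing.Zmodule_isComNzRing.Build (fps K)
  fps_mulA fps_mulC fps_mul1 fps_mulDl fps_1neq0.

Lemma fpsDE f g n : (f + g) n = f n + g n. Proof. by []. Qed.
Lemma fpsNE f n : (- f) n = - f n. Proof. by []. Qed.
Lemma fpsBE f g n : (f - g) n = f n - g n. Proof. by []. Qed.
Lemma fpsME f g n : (f * g) n = \sum_(i < n.+1) f i * g (n - i)%N.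
Proof. by []. Qed.
Lemma fpsM_trunc N f g i : (i < N)%N ->
  (f * g) i = (fps_trunc N f * fps_trunc N g)`_i.
Proof. exact: fps_mul_trunc. Qed.

Lemma fps0E n : (0 : fps K) n = 0. Proof. by case: n. Qed.

Lemma fpsCM c f n : (fpsC c * f) n = c * f n.
Proof.
rewrite fpsME big_ord_recl /= subn0 big1 ?addr0// => i _; by rewrite mul0r.
Qed.

Let fpsC_zmod : zmod_morphism fpsC.
Proof. by move=> c c'; apply/funext => -[|n]; rewrite fpsBE//= subrr. Qed.
Let fpsC_monoid : monoid_morphism fpsC.
Proof.
split=> // c c'; apply/funext => n; rewrite fpsCM; case: n => [//|n] /=.
by rewrite mulr0.
Qed.
HB.instance Definition _ := GRing.isZmodMorphism.Build _ _ fpsC fpsC_zmod.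
HB.instance Definition _ := GRing.isMonoidMorphism.Build _ _ fpsC fpsC_monoid.

Definition fpsX : fps K := fun n => (n == 1%N)%:R.

Lemma fpsXM f n : (fpsX * f) n = if n is m.+1 then f m else 0.
Proof.
rewrite fpsME; case: n => [|n]; first by rewrite big_ord1 mul0r.
rewrite big_ord_recl mul0r add0r big_ord_recl/= mul1r big1 ?addr0.
  by rewrite /bump /= add1n subSS subn0.
by move=> i _; rewrite mul0r.
Qed.

Definition fpsD f : fps K := fun n => f n.+1 *+ n.+1.

Lemma fpsD_add f g : fpsD (f + g) = fpsD f + fpsD g.
Proof. by apply/funext => n; rewrite /fpsD fpsDE mulrnDl. Qed.
Lemma fpsD_opp f : fpsD (- f) = - fpsD f.
Proof. by apply/funext => n; rewrite /fpsD fpsNE mulNrn. Qed.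
Lemma fpsD_sub f g : fpsD (f - g) = fpsD f - fpsD g.
Proof. by rewrite fpsD_add fpsD_opp. Qed.
Lemma fpsD_C c : fpsD (fpsC c) = 0.
Proof. by apply/funext => n; rewrite /fpsD /= mul0rn fps0E. Qed.
Lemma fpsD_1 : fpsD 1 = 0. Proof. exact: fpsD_C. Qed.
Lemma fpsD_X : fpsD fpsX = 1.
Proof. by apply/funext => -[|n]; rewrite /fpsD /fpsX//= mul0rn. Qed.

Lemma fpsD_mul f g : fpsD (f * g) = fpsD f * g + f * fpsD g.
Proof.
apply/funext => n; rewrite /fpsD (fpsM_trunc f g (leqnn n.+2)) -coef_deriv derivM.
rewrite coefD fpsDE; congr (_ + _); rewrite coefM fpsME; apply: eq_bigr => i _;
  rewrite coef_deriv ?fps_trunc_coef//.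
all: by have := ltn_ord i; lia.
Qed.

Lemma fpsD_CM c f : fpsD (fpsC c * f) = fpsC c * fpsD f.
Proof. by rewrite fpsD_mul fpsD_C mul0r add0r. Qed.

Definition fps_neg f : fps K := fun n => (-1) ^+ n * f n.
Definition fps_sqr f : fps K := fun n => if odd n then 0 else f n./2.

Let fps_neg_zmod : zmod_morphism fps_neg.
Proof. by move=> f g; apply/funext => n; rewrite /fps_neg !fpsBE mulrBr. Qed.
Let fps_neg_monoid : monoid_morphism fps_neg.
Proof.
split=> [|f g]; apply/funext => n; rewrite /fps_neg.
  by case: n => [|n]; rewrite /= ?mulr0// mulr1.
rewrite !fpsME mulr_sumr; apply: eq_bigr => i _.
by rewrite mulrACA -exprD subnKC// -ltnS.
Qed.
HB.instance Definition _ := GRing.isZmodMorphism.Build _ _ fps_neg fps_neg_zmod.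
HB.instance Definition _ := GRing.isMonoidMorphism.Build _ _ fps_neg fps_neg_monoid.

Let fps_sqr_zmod : zmod_morphism fps_sqr.
Proof.
by move=> f g; apply/funext => n; rewrite fpsBE /fps_sqr; case: odd; rewrite ?subr0.
Qed.
Lemma fps_trunc_sqr N f i : (i < N)%N ->
  fps_sqr f i = (fps_trunc N f \Po 'X^2)`_i.
Proof.
move=> iN; rewrite coef_comp_poly_Xn// dvdn2 divn2 /fps_sqr; case: odd => //=.
rewrite fps_trunc_coef//; apply: leq_ltn_trans iN.
by lia.
Qed.
Let fps_sqr_monoid : monoid_morphism fps_sqr.
Proof.
split=> [|f g]; apply/funext => n.
  by case: n => [|[|n]] //; rewrite /fps_sqr /=; case: odd.
rewrite (fps_trunc_sqr _ (ltnSn n)).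
transitivity (((fps_trunc n.+1 f * fps_trunc n.+1 g) \Po 'X^2)`_n).
  rewrite !coef_comp_poly_Xn//; case: ifP => // _.
  rewrite fps_trunc_coef ?(@fpsM_trunc n.+1)//; rewrite ltnS; exact: leq_div.
rewrite comp_polyM fpsME coefM; apply: eq_bigr => i _.
by rewrite -!fps_trunc_sqr// ltnS leq_subr.
Qed.
HB.instance Definition _ := GRing.isZmodMorphism.Build _ _ fps_sqr fps_sqr_zmod.
HB.instance Definition _ := GRing.isMonoidMorphism.Build _ _ fps_sqr fps_sqr_monoid.

Lemma fps_neg_C c : fps_neg (fpsC c) = fpsC c.
Proof. by apply/funext => -[|n]; rewrite /fps_neg /= ?mulr0// mul1r. Qed.
Lemma fps_neg_X : fps_neg fpsX = - fpsX.
Proof.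
apply/funext => n; rewrite fpsNE /fps_neg /fpsX; case: eqP => [->|_].
  by rewrite mulr1.
by rewrite mulr0 oppr0.
Qed.
Lemma fps_sqr_C c : fps_sqr (fpsC c) = fpsC c.
Proof. by apply/funext => -[|[|n]] //; rewrite /fps_sqr /=; case: odd. Qed.
Lemma fps_sqr_X : fps_sqr fpsX = fpsX * fpsX.
Proof.
apply/funext => n; rewrite fpsXM; case: n => [//|n]; rewrite /fps_sqr /fpsX.
by case: n => [|[|[|n]]]//=; case: odd.
Qed.
Lemma fpsD_neg f : fpsD (fps_neg f) = - fps_neg (fpsD f).
Proof.
by apply/funext => n; rewrite /fpsD fpsNE /fps_neg exprS mulN1r mulNr mulNrn mulrnAr.
Qed.

End fps_ring.

(** * Evaluation in the open unit disc *)

Section normc_facts.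
Context (R : rcfType).
Implicit Types (x y z : R[i]) (a : R).

Lemma normcD x y : normc (x + y) <= normc x + normc y.
Proof. exact: le_normcD. Qed.

Lemma normcNN x : normc (- x) = normc x.
Proof. exact: normcN. Qed.

Lemma normcB x y : normc (x - y) = normc (y - x).
Proof. by rewrite -opprB normcNN. Qed.

Lemma normcR a : normc a%:C%C = `|a|.
Proof. by rewrite /normc /= expr0n /= addr0 sqrtr_sqr. Qed.

Lemma normc_ge0 x : 0 <= normc x.
Proof. by case: x => a b; exact: sqrtr_ge0. Qed.

Lemma normcX x n : normc (x ^+ n) = normc x ^+ n.
Proof.
elim: n => [|n IH]; first by rewrite !expr0 normc1.
by rewrite !exprS normcM IH.
Qed.

Lemma normc_sum (I : Type) (s : seq I) (P : pred I) (F : I -> R[i]) :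
  normc (\sum_(i <- s | P i) F i) <= \sum_(i <- s | P i) normc (F i).
Proof.
apply: (big_ind2 (fun x a => normc x <= a)) => //; first by rewrite normc0.
by move=> x a y b xa yb; apply: (le_trans (normcD _ _)); exact: lerD.
Qed.

Lemma normc_distD x y z : normc (x - z) <= normc (x - y) + normc (y - z).
Proof. by have -> : x - z = (x - y) + (y - z); [ring|exact: normcD]. Qed.

Lemma sqr_normcE x : normc x ^+ 2 = complex.Re x ^+ 2 + complex.Im x ^+ 2.
Proof. by case: x => a b /=; rewrite sqr_sqrtr// addr_ge0// sqr_ge0. Qed.

Lemma Re_le_normc x : `|complex.Re x| <= normc x.
Proof.
rewrite -(@ler_pXn2r _ 2)// ?nnegrE ?normr_ge0 ?normc_ge0//.
by rewrite sqr_normcE real_normK ?num_real// lerDl sqr_ge0.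
Qed.

Lemma Im_le_normc x : `|complex.Im x| <= normc x.
Proof.
rewrite -(@ler_pXn2r _ 2)// ?nnegrE ?normr_ge0 ?normc_ge0//.
by rewrite sqr_normcE real_normK ?num_real// lerDr sqr_ge0.
Qed.

Lemma normc_le_ReIm x : normc x <= `|complex.Re x| + `|complex.Im x|.
Proof.
rewrite -(@ler_pXn2r _ 2)// ?nnegrE ?normc_ge0 ?addr_ge0//.
rewrite sqr_normcE sqrrD !real_normK ?num_real// -addrA lerD2l lerDr.
by rewrite mulrn_wge0// mulr_ge0.
Qed.

Lemma normc_eq0 x : (normc x == 0) = (x == 0).
Proof. by apply/eqP/eqP => [/eq0_normc|->]; rewrite ?normc0. Qed.

Lemma normc_gt0 x : (0 < normc x) = (x != 0).
Proof. by rewrite lt_def normc_ge0 andbT normc_eq0. Qed.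

End normc_facts.

Arguments normc : simpl never.

Section radius.
Context (R : realType).
Implicit Types (f g : fps R) (r q : R).

(** Each of the n + 1 terms 1, q, ..., q^n is at least q^n. This absorbs the number of terms of a
    Cauchy product, and the factor produced by a derivative, into a slightly larger radius. *)
Lemma geo_linear q n : 0 <= q < 1 -> n.+1%:R * q ^+ n <= (1 - q)^-1.
Proof.
move=> /andP[q0 q1]; have q1' : 0 < 1 - q by rewrite subr_gt0.
rewrite -[leRHS]mul1r ler_pdivlMr//.
apply: (@le_trans _ _ ((\sum_(i < n.+1) q ^+ i) * (1 - q))).
  rewrite ler_wpM2r ?(ltW q1')//.
  have -> : n.+1%:R * q ^+ n = \sum_(i < n.+1) q ^+ n.
    by rewrite sumr_const card_ord mulr_natl.
  apply: ler_sum => i _; apply: ler_wiXn2l => //; first exact: ltW.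
  by rewrite -ltnS.
have := subrX1 q n.+1; have := exprn_ge0 n.+1 q0; nra.
Qed.

Lemma geo_tail q n m : 0 <= q < 1 ->
  \sum_(n <= k < m) q ^+ k <= q ^+ n / (1 - q).
Proof.
move=> /andP[q0 q1]; have q1' : 0 < 1 - q by rewrite subr_gt0.
rewrite ler_pdivlMr//.
have [nm|mn] := leqP n m; last first.
  by rewrite big_geq ?(ltnW mn)// mul0r exprn_ge0.
suff -> : (\sum_(n <= k < m) q ^+ k) * (1 - q) = q ^+ n - q ^+ m.
  by rewrite gerBl exprn_ge0.
elim: m nm => [|m IH]; first by rewrite leqn0 => /eqP ->; rewrite big_geq// mul0r subrr.
rewrite leq_eqVlt => /orP[/eqP ->|]; first by rewrite big_geq// mul0r subrr.
by rewrite ltnS => nm; rewrite big_nat_recr//= mulrDl IH// exprS; ring.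
Qed.

(* The radius of convergence is at least 1. *)
Definition fps_conv f := forall r, 0 < r < 1 -> exists K, forall n, `|f n| * r ^+ n <= K.

Lemma fps_conv_bounded f K : (forall n, `|f n| <= K) -> fps_conv f.
Proof.
move=> fK r /andP[r0 r1]; exists K => n; rewrite -[leRHS]mulr1.
by rewrite ler_pM ?exprn_ge0 ?exprn_ile1// ltW.
Qed.

Lemma fps_convC c : fps_conv (fpsC c).
Proof. by apply: (@fps_conv_bounded _ `|c|) => -[|n] //=; rewrite normr0. Qed.

Lemma fps_convX : fps_conv (fpsX R).
Proof. by apply: (@fps_conv_bounded _ 1) => n; rewrite /fpsX; case: eqP; rewrite ?normr1 ?normr0. Qed.

Lemma fps_convD f g : fps_conv f -> fps_conv g -> fps_conv (f + g).
Proof.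
move=> cf cg r rr; have [K fK] := cf r rr; have [K' gK] := cg r rr.
case/andP: rr => r0 _.
exists (K + K') => n; rewrite fpsDE; apply: (@le_trans _ _ ((`|f n| + `|g n|) * r ^+ n)).
  by rewrite ler_wpM2r ?exprn_ge0 ?ler_normD// ltW.
by rewrite mulrDl lerD.
Qed.

Lemma fps_convN f : fps_conv f -> fps_conv (- f).
Proof.
by move=> cf r /cf[K fK]; exists K => n; rewrite fpsNE normrN.
Qed.

Lemma fps_convB f g : fps_conv f -> fps_conv g -> fps_conv (f - g).
Proof. by move=> cf cg; apply: fps_convD => //; exact: fps_convN. Qed.

Lemma fps_conv_geo f r s : fps_conv f -> 0 <= r -> r < s -> s < 1 ->
  exists2 K, 0 <= K & forall n, `|f n| * r ^+ n <= K * (r / s) ^+ n.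
Proof.
move=> cf r0 rs s1; have s0 : 0 < s by apply: le_lt_trans rs.
have [|K fK] := cf s; first by rewrite s0.
exists K; first by apply: le_trans (fK 0%N); rewrite mulr_ge0.
move=> n; rewrite expr_div_n mulrA ler_pdivlMr ?exprn_gt0//.
by rewrite mulrAC ler_wpM2r// exprn_ge0.
Qed.

Lemma fps_convM f g : fps_conv f -> fps_conv g -> fps_conv (f * g).
Proof.
move=> cf cg r /andP[r0 r1]; pose s := (r + 1) / 2.
have rs : r < s by rewrite /s; lra.
have s1 : s < 1 by rewrite /s; lra.
have [K K0 fK] := fps_conv_geo cf (ltW r0) rs s1.
have [K' K'0 gK] := fps_conv_geo cg (ltW r0) rs s1.
have s0 := lt_trans r0 rs.
have q01 : 0 <= r / s < 1 by rewrite divr_ge0 ?ltW//= ltr_pdivrMr// mul1r.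
exists (K * K' * (1 - r / s)^-1) => n; rewrite fpsME.
apply: (@le_trans _ _ (\sum_(i < n.+1) K * K' * (r / s) ^+ n)).
  apply: le_trans (ler_wpM2r _ (ler_norm_sum _ _ _)) _; first by rewrite exprn_ge0// ltW.
  rewrite mulr_suml; apply: ler_sum => i _; rewrite normrM.
  have -> : `|f i| * `|g (n - i)%N| * r ^+ n =
      (`|f i| * r ^+ i) * (`|g (n - i)%N| * r ^+ (n - i)).
    rewrite mulrACA -exprD subnKC// -ltnS//.
  have -> : K * K' * (r / s) ^+ n = (K * (r / s) ^+ i) * (K' * (r / s) ^+ (n - i)).
    rewrite mulrACA -exprD subnKC// -ltnS//.
  by rewrite ler_pM ?mulr_ge0 ?exprn_ge0// ltW.
rewrite sumr_const card_ord -mulr_natl mulrCA ler_wpM2l ?mulr_ge0//.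
exact: geo_linear.
Qed.

Lemma fps_conv_deriv f : fps_conv f -> fps_conv (fpsD f).
Proof.
move=> cf r /andP[r0 r1]; pose s := (r + 1) / 2.
have rs : r < s by rewrite /s; lra.
have s1 : s < 1 by rewrite /s; lra.
have [K K0 fK] := fps_conv_geo cf (ltW r0) rs s1.
have s0 := lt_trans r0 rs.
have q01 : 0 <= r / s < 1 by rewrite divr_ge0 ?ltW//= ltr_pdivrMr// mul1r.
exists (r^-1 * K * (r / s) * (1 - r / s)^-1) => n; rewrite /fpsD normrMn.
rewrite -mulr_natl.
have -> : n.+1%:R * `|f n.+1| * r ^+ n = r^-1 * n.+1%:R * (`|f n.+1| * r ^+ n.+1).
  by rewrite exprS; field; rewrite lt0r_neq0.
apply: (@le_trans _ _ (r^-1 * n.+1%:R * (K * (r / s) ^+ n.+1))).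
  by rewrite ler_wpM2l// mulr_ge0// invr_ge0 ltW.
rewrite exprS.
have -> : r^-1 * n.+1%:R * (K * (r / s * (r / s) ^+ n)) =
    (r^-1 * K * (r / s)) * (n.+1%:R * (r / s) ^+ n) by ring.
rewrite ler_wpM2l ?geo_linear// !mulr_ge0// ?invr_ge0 ltW//.
Qed.

Lemma fps_conv_neg f : fps_conv f -> fps_conv (fps_neg f).
Proof.
move=> cf r /cf[K fK]; exists K => n.
by rewrite /fps_neg normrM normrX normrN1 expr1n mul1r.
Qed.

Lemma fps_conv_sqr f : fps_conv f -> fps_conv (fps_sqr f).
Proof.
move=> cf r /andP[r0 r1]; have [|K fK] := cf (r ^+ 2).
  by rewrite exprn_gt0//= exprn_ilt1// ltW.
have K0 : 0 <= K by apply: le_trans (fK 0%N); rewrite mulr_ge0.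
exists K => n; rewrite /fps_sqr; case: ifPn => [_|]; first by rewrite normr0 mul0r.
by move=> on; have := fK n./2; rewrite -exprM mul2n even_halfK.
Qed.

Local Notation C := R[i].
Implicit Types z : C.

Definition fps_part f z n : C := \sum_(k < n) (f k)%:C%C * z ^+ k.

(** Real limits of the two coordinates; convergence itself is always expressed by [normc] of the
    difference. The value is meaningful under [fps_conv f] and [normc z < 1]. *)
Definition fps_ev f z : C :=
  (limn (fun n => complex.Re (fps_part f z n)) +i*
   limn (fun n => complex.Im (fps_part f z n)))%C.

Arguments fps_ev : simpl never.

(** Ratio of [r] to the midpoint of [r] and 1: boundedness at the midpoint radius becomes geometric
    decay with this ratio, uniformly on the disc of radius [r]. *)
Definition fps_q r : R := r / ((r + 1) / 2).

Lemma fps_q_01 r : 0 <= r < 1 -> 0 <= fps_q r < 1.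
Proof.
move=> /andP[r0 r1]; have s0 : 0 < (r + 1) / 2 by lra.
by rewrite /fps_q divr_ge0 ?(ltW s0)//= ltr_pdivrMr//; lra.
Qed.

Lemma fps_term_geo f r : fps_conv f -> 0 <= r < 1 ->
  exists2 K, 0 <= K & forall z, normc z <= r ->
    forall n, normc ((f n)%:C%C * z ^+ n) <= K * fps_q r ^+ n.
Proof.
move=> cf /andP[r0 r1].
have [||K K0 fK] := @fps_conv_geo f r ((r + 1) / 2) cf r0; [by lra|by lra|].
exists K => // z zr n; rewrite normcM normcR normcX; apply: le_trans (fK n).
by rewrite ler_wpM2l// lerXn2r// ?nnegrE ?normc_ge0.
Qed.

Lemma geo_series_lim (u : nat -> R) K q : 0 <= q < 1 -> (forall n, `|u n| <= K * q ^+ n) ->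
  forall n, `|\sum_(k < n) u k - limn (fun m => \sum_(k < m) u k)| <= K / (1 - q) * q ^+ n.
Proof.
move=> q01 uK n; have /andP[q0 q1] := q01.
have K0 : 0 <= K by have := uK 0%N; rewrite expr0 mulr1; apply: le_trans.
have cu : cvgn (fun m => \sum_(k < m) u k).
  have : cvgn (series u).
    apply: normed_cvg; apply: (@series_le_cvg _ _ (geometric K q)) => //.
    - by move=> k; rewrite /= normr_ge0.
    - by move=> k; rewrite /geometric /= mulr_ge0// exprn_ge0.
    - by apply: is_cvg_geometric_series; rewrite ger0_norm.
  suff -> : (fun m => \sum_(k < m) u k) = series u by [].
  by apply/funext => m; rewrite /series /= big_mkord.
have cd : (fun m => `|\sum_(k < n) u k - \sum_(k < m) u k|) @ \oo -->
   `|\sum_(k < n) u k - limn (fun m => \sum_(k < m) u k)|.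
  by apply: cvg_norm; apply: cvgB => //; exact: cvg_cst.
apply: (cvgr_to_le cd); near=> m.
have nm : (n <= m)%N by near: m; exact: nbhs_infty_ge.
rewrite distrC -(big_mkord predT u) -(big_mkord predT u) (@big_cat_nat _ _ _ n)//=.
rewrite addrAC subrr add0r; apply: (le_trans (ler_norm_sum _ _ _)).
apply: (@le_trans _ _ (\sum_(n <= k < m) K * q ^+ k)); first exact: ler_sum.
by rewrite -mulr_sumr -mulrA (mulrC _ (q ^+ n)) ler_wpM2l// geo_tail.
Unshelve. all: by end_near.
Qed.

Lemma Re_sum (I : Type) (s : seq I) (P : pred I) (F : I -> C) :
  complex.Re (\sum_(i <- s | P i) F i) = \sum_(i <- s | P i) complex.Re (F i).
Proof. by elim/big_rec2: _ => //= i a z _ <-; case: (F i) => ? ?; case: z. Qed.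
Lemma Im_sum (I : Type) (s : seq I) (P : pred I) (F : I -> C) :
  complex.Im (\sum_(i <- s | P i) F i) = \sum_(i <- s | P i) complex.Im (F i).
Proof. by elim/big_rec2: _ => //= i a z _ <-; case: (F i) => ? ?; case: z. Qed.

Lemma fps_part_geo f r : fps_conv f -> 0 <= r < 1 ->
  exists2 K, 0 <= K & forall z, normc z <= r ->
    forall n, normc (fps_part f z n - fps_ev f z) <= K * fps_q r ^+ n.
Proof.
move=> cf r01; have [K K0 fK] := fps_term_geo cf r01.
have q01 := fps_q_01 r01; have /andP[q0 q1] := q01.
exists (K / (1 - fps_q r) + K / (1 - fps_q r)).
  by rewrite addr_ge0// divr_ge0// subr_ge0 ltW.
move=> z zr n; apply: (le_trans (normc_le_ReIm _)); rewrite mulrDl; apply: lerD.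
- have -> : complex.Re (fps_part f z n - fps_ev f z) =
    \sum_(k < n) complex.Re ((f k)%:C%C * z ^+ k) -
      limn (fun m => \sum_(k < m) complex.Re ((f k)%:C%C * z ^+ k)).
    rewrite -Re_sum /fps_ev -/(fps_part f z n); case: (fps_part f z n) => a b /=.
    by congr (_ - limn _); apply/funext => m; rewrite /fps_part Re_sum.
  apply: (@geo_series_lim (fun k => complex.Re ((f k)%:C%C * z ^+ k)) K _ q01) => k.
  by apply: le_trans (fK _ zr k); exact: Re_le_normc.
- have -> : complex.Im (fps_part f z n - fps_ev f z) =
    \sum_(k < n) complex.Im ((f k)%:C%C * z ^+ k) -
      limn (fun m => \sum_(k < m) complex.Im ((f k)%:C%C * z ^+ k)).
    rewrite -Im_sum /fps_ev -/(fps_part f z n); case: (fps_part f z n) => a b /=.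
    by congr (_ - limn _); apply/funext => m; rewrite /fps_part Im_sum.
  apply: (@geo_series_lim (fun k => complex.Im ((f k)%:C%C * z ^+ k)) K _ q01) => k.
  by apply: le_trans (fK _ zr k); exact: Im_le_normc.
Qed.

Lemma cvg_geo0 K q : 0 <= q < 1 -> (fun n => K * q ^+ n) @ \oo --> (0 : R).
Proof.
move=> /andP[q0 q1]; rewrite -[X in _ --> X](mulr0 K); apply: cvgM; first exact: cvg_cst.
by apply: cvg_expr; rewrite ger0_norm.
Qed.

Lemma cvg0_le (u v : nat -> R) : (forall n, 0 <= u n <= v n) ->
  v @ \oo --> (0 : R) -> u @ \oo --> (0 : R).
Proof.
move=> uv v0; apply: (@squeeze_cvgr _ \oo _ R (fun=> 0) v) => //; last exact: cvg_cst.
by apply: nearW => n; exact: uv.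
Qed.

Lemma fps_part_cvg f z : fps_conv f -> normc z < 1 ->
  (fun n => normc (fps_part f z n - fps_ev f z)) @ \oo --> (0 : R).
Proof.
move=> cf z1; have z01 : 0 <= normc z < 1 by rewrite normc_ge0.
have [K K0 fK] := fps_part_geo cf z01.
apply: (@cvg0_le _ (fun n => K * fps_q (normc z) ^+ n)).
  by move=> n; rewrite normc_ge0 fK.
by apply: cvg_geo0; exact: fps_q_01.
Qed.

Lemma fps_ev_uniq f z l : fps_conv f -> normc z < 1 ->
  (fun n => normc (fps_part f z n - l)) @ \oo --> (0 : R) -> fps_ev f z = l.
Proof.
move=> cf z1 fl; apply/eqP; rewrite -subr_eq0 -normc_eq0 eq_le normc_ge0 andbT.
have h : (fun n => normc (fps_part f z n - fps_ev f z) + normc (fps_part f z n - l))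
    @ \oo --> (0 : R).
  by rewrite -[X in _ --> X]addr0; apply: cvgD => //; exact: fps_part_cvg.
apply: (cvgr_to_ge h); apply: nearW => n.
by rewrite [X in _ <= X + _]normcB normc_distD.
Qed.

Lemma fps_evD f g z : fps_conv f -> fps_conv g -> normc z < 1 ->
  fps_ev (f + g) z = fps_ev f z + fps_ev g z.
Proof.
move=> cf cg z1; apply: fps_ev_uniq => //; first exact: fps_convD.
apply: (@cvg0_le _ (fun n => normc (fps_part f z n - fps_ev f z) +
    normc (fps_part g z n - fps_ev g z))).
  move=> n; rewrite normc_ge0 andTb.
  have -> : fps_part (f + g) z n = fps_part f z n + fps_part g z n.
    rewrite /fps_part -big_split/=; apply: eq_bigr => i _.
    by rewrite fpsDE rmorphD mulrDl.
  by rewrite opprD addrACA normcD.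
by rewrite -[X in _ --> X]addr0; apply: cvgD; exact: fps_part_cvg.
Qed.

Lemma fps_evN f z : fps_conv f -> normc z < 1 -> fps_ev (- f) z = - fps_ev f z.
Proof.
move=> cf z1; apply: fps_ev_uniq => //; first exact: fps_convN.
apply: (@cvg0_le _ (fun n => normc (fps_part f z n - fps_ev f z))); last exact: fps_part_cvg.
move=> n; rewrite normc_ge0 andTb.
have -> : fps_part (- f) z n = - fps_part f z n.
  by rewrite /fps_part -sumrN; apply: eq_bigr => i _; rewrite fpsNE rmorphN mulNr.
by rewrite -opprD normcNN.
Qed.

Lemma fps_evB f g z : fps_conv f -> fps_conv g -> normc z < 1 ->
  fps_ev (f - g) z = fps_ev f z - fps_ev g z.
Proof. by move=> *; rewrite fps_evD ?fps_evN//; exact: fps_convN. Qed.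

Lemma fps_ev_near f z l N : fps_conv f -> normc z < 1 ->
  (forall n, (N <= n)%N -> fps_part f z n = l) -> fps_ev f z = l.
Proof.
move=> cf z1 h; apply: fps_ev_uniq => //.
apply: (@cvg_near_cst _ R); near=> n.
by rewrite h ?subrr ?normc0//; near: n; exact: nbhs_infty_ge.
Unshelve. all: by end_near.
Qed.

Lemma fps_evC c z : normc z < 1 -> fps_ev (fpsC c) z = c%:C%C.
Proof.
move=> z1; apply: (@fps_ev_near _ _ _ 1%N (@fps_convC c) z1) => -[//|n] _.
by rewrite /fps_part big_ord_recl/= mulr1 big1 ?addr0// => i _; rewrite mul0r.
Qed.

Lemma fps_evX z : normc z < 1 -> fps_ev (fpsX R) z = z.
Proof.
move=> z1; apply: (@fps_ev_near _ _ _ 2%N fps_convX z1) => -[|[|n]]// _.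
rewrite /fps_part !big_ord_recl/= /fpsX/= mul0r add0r expr1 mul1r big1 ?addr0//.
by move=> i _; rewrite mul0r.
Qed.

Lemma fps_evM f g z : fps_conv f -> fps_conv g -> normc z < 1 ->
  fps_ev (f * g) z = fps_ev f z * fps_ev g z.
Proof.
move=> cf cg z1; apply: fps_ev_uniq => //; first exact: fps_convM.
have z01 : 0 <= normc z < 1 by rewrite normc_ge0.
have [K K0 /(_ z (lexx _)) fK] := fps_term_geo cf z01.
have [K' K'0 /(_ z (lexx _)) gK] := fps_term_geo cg z01.
have /andP[q0 q1] := fps_q_01 z01; set q := fps_q _ in q0 q1 fK gK.
pose s := (q + 1) / 2.
have qs : q < s by rewrite /s; lra.
have s1 : s < 1 by rewrite /s; lra.
have s0 : 0 < s by apply: le_lt_trans qs.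
have qs01 : 0 <= q / s < 1 by rewrite divr_ge0 ?(ltW s0)//= ltr_pdivrMr// mul1r.
pose u n := fps_part f z n - fps_ev f z.
pose v n := fps_part g z n - fps_ev g z.
(* By [geo_linear] for the ratio [q / s], the k + 1 products in the k-th Cauchy coefficient, each at
   most K K' q^k, add up to at most M s^k. *)
pose M := K * K' * (1 - q / s)^-1.
apply: (@cvg0_le _ (fun n => M / (1 - s) * s ^+ n + (normc (u n) * normc (v n) +
  (normc (fps_ev f z) * normc (v n) + normc (u n) * normc (fps_ev g z))))); last first.
  have cu : (fun n => normc (u n)) @ \oo --> (0 : R) by exact: fps_part_cvg.
  have cv : (fun n => normc (v n)) @ \oo --> (0 : R) by exact: fps_part_cvg.
  have -> : (0 : R) = 0 + (0 * 0 + (normc (fps_ev f z) * 0 + 0 * normc (fps_ev g z))).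
    by rewrite !mulr0 mul0r !addr0.
  apply: cvgD; first by apply: cvg_geo0; rewrite (ltW s0).
  apply: cvgD; first exact: cvgM.
  by apply: cvgD; apply: cvgM => //; exact: cvg_cst.
move=> n; rewrite normc_ge0 andTb.
(* With the powers of [z] put into the coefficients, partial sums are values at 1. The product
   polynomial agrees with the Cauchy product below degree [n], and only its degrees from [n] to 2n -
   1 have to be estimated. *)
pose P : {poly C} := \poly_(i < n) ((f i)%:C%C * z ^+ i).
pose Q : {poly C} := \poly_(i < n) ((g i)%:C%C * z ^+ i).
have PE : fps_part f z n = P.[1].
  by rewrite horner_poly; apply: eq_bigr => i _; rewrite expr1n mulr1.
have QE : fps_part g z n = Q.[1].
  by rewrite horner_poly; apply: eq_bigr => i _; rewrite expr1n mulr1.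
have cfE k : (k < n)%N -> ((f * g) k)%:C%C * z ^+ k = (P * Q)`_k.
  move=> kn; rewrite fpsME rmorph_sum mulr_suml coefM; apply: eq_bigr => i _.
  have ik : (i <= k)%N by rewrite -ltnS.
  rewrite !coef_poly (leq_ltn_trans ik kn) (leq_ltn_trans (leq_subr _ _) kn) rmorphM.
  by rewrite mulrACA -exprD subnKC.
have sz : (size (P * Q)%R <= n + n)%N.
  apply: leq_trans (size_polyMleq _ _) _; apply: leq_trans (leq_pred _) _.
  by apply: leq_add; exact: size_poly.
have PQE : fps_part f z n * fps_part g z n =
    fps_part (f * g) z n + \sum_(n <= k < n + n) (P * Q)`_k.
  rewrite PE QE -hornerM (horner_coef_wide _ sz).
  rewrite -(big_mkord predT (fun k => (P * Q)`_k * 1 ^+ k)) (@big_cat_nat _ _ _ n)//=; last exact: leq_addr.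
  congr (_ + _); last by apply: eq_bigr => k _; rewrite expr1n mulr1.
  by rewrite big_mkord; apply: eq_bigr => k _; rewrite expr1n mulr1 cfE.
have rem : normc (\sum_(n <= k < n + n) (P * Q)`_k) <= M / (1 - s) * s ^+ n.
  apply: (le_trans (normc_sum _ _ _)).
  apply: (@le_trans _ _ (\sum_(n <= k < n + n) M * s ^+ k)); last first.
    rewrite -mulr_sumr -mulrA (mulrC _ (s ^+ n)) ler_wpM2l ?geo_tail ?(ltW s0)//.
    by rewrite /M !mulr_ge0// invr_ge0 subr_ge0; case/andP: qs01 => _ /ltW.
  apply: ler_sum => k _; rewrite coefM.
  apply: (@le_trans _ _ (\sum_(i < k.+1) K * K' * q ^+ k)).
    apply: (le_trans (normc_sum _ _ _)); apply: ler_sum => i _; rewrite normcM.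
    have ik : (i <= k)%N by rewrite -ltnS.
    have -> : K * K' * q ^+ k = (K * q ^+ i) * (K' * q ^+ (k - i)).
      by rewrite mulrACA -exprD subnKC.
    rewrite !coef_poly.
    by apply: ler_pM; rewrite ?normc_ge0//; case: ifP => _; rewrite ?fK ?gK// normc0 mulr_ge0// exprn_ge0.
  rewrite sumr_const card_ord -mulr_natl mulrCA /M -(mulrA _ (_^-1)) ler_wpM2l ?mulr_ge0//.
  rewrite -ler_pdivrMr ?exprn_gt0//; apply: le_trans (geo_linear k qs01).
  by rewrite -mulrA -expr_div_n.
have -> : fps_part (f * g) z n - fps_ev f z * fps_ev g z =
   - (\sum_(n <= k < n + n) (P * Q)`_k) + (u n * v n + (fps_ev f z * v n + u n * fps_ev g z)).
  by rewrite /u /v; have := PQE; move: (\sum_(n <= k < n + n) _) => S E; ring: E.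
apply: (le_trans (normcD _ _)); rewrite normcNN lerD//.
by do 2 (apply: (le_trans (normcD _ _)); rewrite normcM lerD ?normcM//).
Qed.

Lemma fps_ev_neg f z : fps_conv f -> normc z < 1 -> fps_ev (fps_neg f) z = fps_ev f (- z).
Proof.
move=> cf z1; apply: fps_ev_uniq => //; first exact: fps_conv_neg.
rewrite (_ : (fun _ => _) = fun n => normc (fps_part f (- z) n - fps_ev f (- z))).
  by apply: fps_part_cvg; rewrite ?normcNN.
apply/funext => n; congr (normc (_ - _)); apply: eq_bigr => i _.
by rewrite /fps_neg [in RHS]exprNn rmorphM rmorphXn rmorphN1 mulrCA mulrA.
Qed.

Lemma fps_ev_sqr f z : fps_conv f -> normc z < 1 -> fps_ev (fps_sqr f) z = fps_ev f (z ^+ 2).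
Proof.
move=> cf z1.
have z21 : normc (z ^+ 2) < 1 by rewrite normcX exprn_ilt1// normc_ge0.
apply/eqP; rewrite -subr_eq0 -normc_eq0 eq_le normc_ge0 andbT.
pose u n := normc (fps_part (fps_sqr f) z n - fps_ev (fps_sqr f) z).
pose v n := normc (fps_part f (z ^+ 2) n - fps_ev f (z ^+ 2)).
have cu : u @ \oo --> (0 : R) by apply: fps_part_cvg => //; exact: fps_conv_sqr.
have cv : v @ \oo --> (0 : R) by exact: fps_part_cvg.
have cu2 : (fun n => u n.*2) @ \oo --> (0 : R).
  apply: cvg_comp cu; apply/cvgnyPge => M; near=> n; apply: (@leq_trans n).
    by near: n; exact: nbhs_infty_ge.
  by rewrite -addnn leq_addr.
have h : (fun n => u n.*2 + v n) @ \oo --> (0 : R).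
  move: cu2 cv; clear; clearbody u v; move=> cu2 cv.
  by have := cvgD cu2 cv; rewrite addr0; apply.
apply: (cvgr_to_ge h); apply: nearW => n.
have E : fps_part (fps_sqr f) z n.*2 = fps_part f (z ^+ 2) n.
  rewrite /fps_part; elim: n => [|n IH]; first by rewrite !big_ord0.
  rewrite doubleS !big_ord_recr/= IH /fps_sqr /= odd_double/=.
  by rewrite doubleK rmorph0 mul0r addr0 -mul2n exprM.
by rewrite /u /v E [X in _ <= X + _]normcB normc_distD.
Unshelve. all: by end_near.
Qed.

Lemma fps_ev_bound f z r B : fps_conv f -> normc z <= r -> r < 1 ->
  (forall n, \sum_(k < n) `|f k| * r ^+ k <= B) -> normc (fps_ev f z) <= B.
Proof.
move=> cf zr r1 fB; have z1 := le_lt_trans zr r1.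
have h : (fun n => normc (fps_part f z n - fps_ev f z) + B) @ \oo --> B.
  by rewrite -[X in _ --> X]add0r; apply: cvgD; [exact: fps_part_cvg|exact: cvg_cst].
apply: (cvgr_to_ge h); apply: nearW => n.
rewrite -[X in normc X <= _](subKr (fps_part f z n)) addrC.
apply: (le_trans (normcD _ _)); rewrite normcNN lerD2l.
apply: le_trans (fB n); apply: (le_trans (normc_sum _ _ _)); apply: ler_sum => k _.
by rewrite normcM normcR normcX ler_wpM2l// lerXn2r// nnegrE ?normc_ge0// (le_trans _ zr) ?normc_ge0.
Qed.

End radius.

(** * Coefficients as means over roots of unity *)

Section identity_theorem.
Context (R : realType).
Implicit Types (f g : fps R) (z : R[i]).

Definition fps_shift f : fps R := fun n => f n.+1.

Lemma fps_shiftE f : f = fpsC (f 0%N) + fpsX R * fps_shift f.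
Proof. by apply/funext => -[|n]; rewrite fpsDE fpsXM/= ?addr0// add0r. Qed.

Lemma fps_conv_shift f : fps_conv f -> fps_conv (fps_shift f).
Proof.
move=> cf r /[dup] rr /cf[K fK]; case/andP: rr => r0 _; exists (K / r) => n.
by rewrite ler_pdivlMr// -mulrA -exprSr; exact: fK.
Qed.

Lemma fps_ev_real f (x l : R) : fps_conv f -> `|x| < 1 ->
  (fun n => \sum_(k < n) f k * x ^+ k) @ \oo --> l -> fps_ev f x%:C%C = l%:C%C.
Proof.
move=> cf x1 fl; apply: fps_ev_uniq => //; first by rewrite normcR.
rewrite (_ : (fun _ => _) = fun n => `|\sum_(k < n) f k * x ^+ k - l|); last first.
  apply/funext => n; rewrite -normcR rmorphB rmorph_sum; congr (normc (_ - _)).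
  by apply: eq_bigr => i _; rewrite rmorphM rmorphXn.
have := cvg_norm (cvgB fl (cvg_cst l)); rewrite subrr normr0; exact.
Qed.

(** On the segment, f 0 = - x g(x) where g is the shifted series; g is bounded for x <= 1/2, so x
    can be made small. *)
Lemma fps_identity0 f : fps_conv f ->
  (forall x : R, 0 < x < 1 -> fps_ev f x%:C%C = 0) -> f 0%N = 0.
Proof.
move=> cf f0; have csf := fps_conv_shift cf.
have h01 : 0 <= (2^-1 : R) < 1 by lra.
have [K K0 fK] := fps_part_geo csf h01.
have le x : 0 < x <= 2^-1 -> `|f 0%N| <= x * K.
  move=> /andP[x0 x1]; have x11 : x < 1 by lra.
  have xx : normc (x%:C)%C < 1 by rewrite normcR gtr0_norm.
  have := f0 x; rewrite x0 x11 => /(_ isT).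
  rewrite {1}(fps_shiftE f) fps_evD ?fps_evM ?fps_evX ?fps_evC//; last first.
  - by apply: fps_convM => //; exact: fps_convX.
  - exact: fps_convC.
  - exact: fps_convX.
  move/eqP; rewrite addrC addr_eq0 => /eqP/(congr1 (@normc R)).
  rewrite normcNN normcM !normcR (gtr0_norm x0) => <-; rewrite ler_wpM2l ?(ltW x0)//.
  have := fK (x%:C)%C; rewrite normcR gtr0_norm// => /(_ x1 0%N).
  by rewrite /fps_part big_ord0 sub0r normcNN expr0 mulr1.
apply/eqP; rewrite -normr_eq0 eq_le normr_ge0 andbT; apply/ler_addgt0Pr => e e0.
rewrite add0r; pose x := Num.min (2^-1) (e / (K + 1)).
have K1 : 0 < K + 1 by rewrite ltr_wpDl.
have x0 : 0 < x by rewrite lt_min invr_gt0 ltr0n divr_gt0.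
apply: (le_trans (le x _)); first by rewrite x0 ge_min lexx.
apply: (@le_trans _ _ (e / (K + 1) * K)).
  by rewrite ler_wpM2r// ge_min lexx orbT.
by rewrite mulrAC ler_pdivrMr// ler_wpM2l ?(ltW e0)// lerDl.
Qed.

(** Transfers an identity between real powers on ]0, 1[ to formal series, hence to the whole complex
    disc. *)
Lemma fps_identity f : fps_conv f ->
  (forall x : R, 0 < x < 1 -> fps_ev f x%:C%C = 0) -> f = 0.
Proof.
move=> cf f0; apply/funext => n; rewrite fps0E.
elim: n f cf f0 => [|n IH] f cf f0; first exact: fps_identity0.
apply: (IH (fps_shift f)) => [|x x01]; first exact: fps_conv_shift.
have /andP[x0 x1] := x01.
have := f0 x x01; rewrite {1}(fps_shiftE f) (fps_identity0 cf f0) rmorph0 add0r.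
rewrite fps_evM ?normcR ?gtr0_norm//; [|exact: fps_convX|exact: fps_conv_shift].
rewrite fps_evX ?normcR ?gtr0_norm// => /eqP; rewrite mulf_eq0 => /orP[|/eqP//].
by rewrite -normc_eq0 normcR gtr0_norm// gt_eqF.
Qed.

End identity_theorem.

Section roots_of_unity.
Context (R : realType).
Local Notation C := R[i].
Implicit Types (f g : fps R) (z : C).

(* A primitive root of unity of order [2^(m+1)]. *)
Fixpoint rou m : C := if m is m'.+1 then sqrtc (rou m') else -1.

Lemma rou_pow m : rou m ^+ (2 ^ m) = -1.
Proof. by elim: m => [//|m IH]; rewrite expnS exprM sqr_sqrtc IH. Qed.

Lemma rou_pow_full m : rou m ^+ (2 ^ m.+1) = 1.
Proof. by rewrite expnSr exprM rou_pow sqrrN expr1n. Qed.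

(** Write k = 2^e o with o odd; then e <= m, and the power 2^(m - e) of w^k is (w^(2^m))^o = -1. *)
Lemma rou_neq1 m k : (0 < k < 2 ^ m.+1)%N -> rou m ^+ k != 1.
Proof.
move=> /andP[k0 km]; apply/eqP => w1.
have [e eo ek] : exists2 e, (e <= m)%N & exists2 o, odd o & k = (2 ^ e * o)%N.
  have [e ne ke] := pfactor_coprime (isT : prime 2) k0.
  exists (logn 2 k).
    rewrite -ltnS -(ltn_exp2l _ _ (isT : (1 < 2)%N)); apply: leq_ltn_trans km.
    by apply: dvdn_leq => //; exact: pfactor_dvdnn.
  by exists e; [rewrite -coprime2n|rewrite mulnC].
case: ek => o oo kE.
have : rou m ^+ (k * 2 ^ (m - e)) = -1.
  rewrite kE mulnAC -expnD subnKC// exprM rou_pow -signr_odd oo expr1//.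
rewrite exprM w1 expr1n => /eqP; rewrite -subr_eq0 opprK -mulr2n.
by rewrite pnatr_eq0.
Qed.

Lemma rou_sum m k : (0 < k < 2 ^ m.+1)%N ->
  \sum_(j < 2 ^ m.+1) (rou m ^+ j) ^+ k = 0.
Proof.
move=> k0; have := subrX1 (rou m ^+ k) (2 ^ m.+1).
rewrite exprAC rou_pow_full expr1n subrr => /esym/eqP; rewrite mulf_eq0 subr_eq0.
rewrite (negbTE (rou_neq1 k0))/= => /eqP h.
by rewrite -[RHS]h; apply: eq_bigr => j _; rewrite exprAC.
Qed.

(** Orthogonality of characters. The exponent M - l represents - l, that is, the conjugate of the
    l-th power, while remaining a natural number. *)
Lemma rou_orth m k l : (k < 2 ^ m.+1)%N -> (l < 2 ^ m.+1)%N ->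
  \sum_(j < 2 ^ m.+1) (rou m ^+ j) ^+ k * (rou m ^+ j) ^+ (2 ^ m.+1 - l) =
    (k == l)%:R * (2 ^ m.+1)%:R.
Proof.
set M := (2 ^ m.+1)%N => kM lM.
have zM (j : 'I_M) n : (rou m ^+ j) ^+ (n + M) = (rou m ^+ j) ^+ n.
  by rewrite exprD -[X in _ * X]exprM mulnC exprM rou_pow_full expr1n mulr1.
under eq_bigr do rewrite -exprD.
case: (ltngtP k l) => kl.
- by rewrite mul0r; apply: rou_sum; rewrite -/M; lia.
- rewrite mul0r -[RHS](@rou_sum m (k - l)%N); last by rewrite -/M; lia.
  by apply: eq_bigr => j _; rewrite -[RHS]zM; congr (_ ^+ _); rewrite addnBA ?(ltnW lM)// addnBAC ?(ltnW kl).
- rewrite kl subnKC ?(ltnW lM)// mul1r.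
  rewrite -[M in RHS]card_ord -sumr_const; apply: eq_bigr => j _.
  by rewrite -[RHS](expr0 (rou m ^+ j)) -[RHS]zM add0n.
Qed.

Lemma rou_norm m j : normc (rou m ^+ j) = 1.
Proof.
rewrite normcX (_ : normc (rou m) = 1) ?expr1n//.
apply/eqP; rewrite -(@pexpr_eq1 _ _ (2 ^ m.+1)%N) ?normc_ge0 ?expn_gt0//.
by rewrite -normcX rou_pow_full normc1.
Qed.

Lemma sqr_normc_conj z : ((normc z ^+ 2)%:C)%C = z * (conjc z).
Proof.
rewrite sqr_normcE; case: z => a b /=; apply/eqP.
by rewrite eq_complex /=; apply/andP; split; apply/eqP; ring.
Qed.

Lemma rou_conj m j s : (s <= 2 ^ m.+1)%N ->
  conjc ((rou m ^+ j) ^+ s) = (rou m ^+ j) ^+ (2 ^ m.+1 - s).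
Proof.
move=> sM; have z0 : (rou m ^+ j) ^+ s != 0.
  by rewrite -normc_eq0 normcX rou_norm expr1n oner_eq0.
apply: (mulfI z0); rewrite -sqr_normc_conj normcX rou_norm !expr1n -exprD subnKC//.
by rewrite exprAC rou_pow_full expr1n.
Qed.

(** Parseval's identity on the M-th roots of unity z: there 1 / (1 - c z) is (1 - c^M)^-1 times the
    geometric sum of length M, whose mean square is the sum of the c^(2r), at most 1 / (1 - c^2). *)
Lemma rou_mean (c : R) m : `|c| < 1 ->
  \sum_(j < 2 ^ m.+1) (normc (1 - c%:C%C * rou m ^+ j) ^- 2) <=
    (2 ^ m.+1)%:R / ((1 - c ^+ 2) * (1 - c ^+ (2 ^ m.+1)) ^+ 2).
Proof.
move=> c1; set M := (2 ^ m.+1)%N.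
have cM : 0 < 1 - c ^+ M.
  rewrite subr_gt0; apply: le_lt_trans (ler_norm _) _.
  by rewrite normrX exprn_ilt1// /M -lt0n expn_gt0.
have c2 : 0 < 1 - c ^+ 2.
  by rewrite subr_gt0; apply: le_lt_trans (ler_norm _) _; rewrite normrX exprn_ilt1.
pose g (j : 'I_M) := \sum_(r < M) (c ^+ r)%:C%C * (rou m ^+ j) ^+ r.
have gE (j : 'I_M) : (1 - c%:C%C * rou m ^+ j) * g j = (1 - c ^+ M)%:C%C.
  have := subrX1 (c%:C%C * rou m ^+ j) M; rewrite exprMn exprAC rou_pow_full expr1n mulr1.
  rewrite rmorphB rmorph1 rmorphXn => h.
  have -> : g j = \sum_(i < M) (c%:C%C * rou m ^+ j) ^+ i.
    by apply: eq_bigr => i _; rewrite exprMn rmorphXn.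
  rewrite -(opprB (c%:C%C * rou m ^+ j)) mulNr -h opprB.
  by congr (1 - _); rewrite -rmorphXn.
have gN (j : 'I_M) : normc (1 - c%:C%C * rou m ^+ j) ^- 2 = normc (g j) ^+ 2 / (1 - c ^+ M) ^+ 2.
  have := congr1 (@normc R) (gE j); rewrite normcM normcR gtr0_norm// => E.
  have : normc (1 - c%:C%C * rou m ^+ j) * normc (g j) != 0 by rewrite E gt_eqF.
  rewrite -E mulf_eq0 negb_or; move: (normc _) (normc (g j)) => x y /andP[x0 y0].
  by field; rewrite x0 y0.
under eq_bigr do rewrite gN.
rewrite -mulr_suml [in leRHS]invfM [leRHS]mulrA ler_wpM2r ?invr_ge0 ?exprn_ge0 ?(ltW cM)//.
suff E : \sum_j normc (g j) ^+ 2 = M%:R * \sum_(r < M) (c ^+ 2) ^+ r.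
  rewrite E ler_wpM2l// -[leRHS]mul1r ler_pdivlMr//.
  have := subrX1 (c ^+ 2) M; rewrite -exprM mulnC exprM.
  by have := sqr_ge0 (c ^+ M); move: (\sum_(i < M) _) => S; nra.
apply: (@complexI R); rewrite rmorph_sum rmorphM rmorph_sum/=.
rewrite (eq_bigr (fun j : 'I_M => \sum_(r < M) \sum_(s < M) (c ^+ (r + s))%:C%C *
   ((rou m ^+ j) ^+ r * (rou m ^+ j) ^+ (M - s)))); last first.
  move=> j _; rewrite sqr_normc_conj /g rmorph_sum/= mulr_suml; apply: eq_bigr => r _.
  rewrite mulr_sumr; apply: eq_bigr => s _.
  have cj : conjc ((c ^+ s)%:C%C * (rou m ^+ j) ^+ s) =
      (c ^+ s)%:C%C * (rou m ^+ j) ^+ (M - s).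
    rewrite -rou_conj ?(ltnW (ltn_ord s))// -[in RHS](conjc_real (c ^+ s)).
    exact: (rmorphM (@conjc R)).
  transitivity ((c ^+ r)%:C%C * (rou m ^+ j) ^+ r * ((c ^+ s)%:C%C * (rou m ^+ j) ^+ (M - s))).
    by congr (_ * _); exact: cj.
  rewrite mulrACA; congr (_ * _); rewrite exprD.
  exact: (esym (rmorphM (real_complex R) _ _)).
rewrite exchange_big mulr_sumr; apply: eq_bigr => r _; rewrite exchange_big.
rewrite (bigD1 r)//= -mulr_sumr rou_orth ?ltn_ord// eqxx mul1r big1 ?addr0.
  rewrite mulrC addnn -mul2n exprM; congr (_ * _).
  exact: (esym (rmorph_nat (real_complex R) _)).
move=> s sr; rewrite -mulr_sumr rou_orth ?ltn_ord//.
by rewrite (_ : (_ == _) = false) ?mul0r ?mulr0//; apply/negbTE; rewrite eq_sym.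
Qed.

Lemma rou_coef f (r : R) n m : fps_conv f -> 0 < r < 1 -> (n < 2 ^ m.+1)%N ->
  (2 ^ m.+1)%:R * (`|f n| * r ^+ n) <=
    \sum_(j < 2 ^ m.+1) normc (fps_part f (r%:C%C * rou m ^+ j) (2 ^ m.+1)).
Proof.
move=> cf /andP[r0 r1]; set M := (2 ^ m.+1)%N => nM.
have : \sum_(j < M) fps_part f (r%:C%C * rou m ^+ j) M * (rou m ^+ j) ^+ (M - n) =
    (f n * r ^+ n)%:C%C * M%:R.
  transitivity (\sum_(j < M) \sum_(k < M) (f k * r ^+ k)%:C%C *
     ((rou m ^+ j) ^+ k * (rou m ^+ j) ^+ (M - n))).
    apply: eq_bigr => j _; rewrite mulr_suml; apply: eq_bigr => k _.
    by rewrite exprMn rmorphM rmorphXn !mulrA.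
  rewrite exchange_big (bigD1 (Ordinal nM))//= -mulr_sumr rou_orth// eqxx mul1r.
  rewrite big1 ?addr0// => k kn; rewrite -mulr_sumr rou_orth ?ltn_ord//.
  by rewrite (_ : (_ == _) = false) ?mul0r ?mulr0//; apply/negbTE.
move/(congr1 (@normc R)); rewrite normcM normcR -(rmorph_nat (real_complex R)) normcR.
rewrite normrM normrX (gtr0_norm r0) normr_nat mulrC => <-.
apply: (le_trans (normc_sum _ _ _)); apply: ler_sum => j _.
by rewrite normcM normcX rou_norm expr1n mulr1.
Qed.

(* Plays the part of Cauchy's integral formula: integrals over the circle are
   replaced by finite means, whose aliasing error is [O(r^M)]. *)
Lemma fps_coef_bound f (r A : R) n : fps_conv f -> 0 < r < 1 -> 0 <= A ->
  (forall z, normc z = r ->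
     normc (fps_ev f z) <= A * (normc (1 - z) ^- 2 + normc (1 + z) ^- 2)) ->
  `|f n| * r ^+ n <= 8 * A / (1 - r).
Proof.
move=> cf /[dup] r01 /andP[r0 r1] A0 fA; apply/ler_addgt0Pr => e e0.
have r01' : 0 <= r < 1 by rewrite (ltW r0).
have [K K0 fK] := fps_part_geo cf r01'.
have cpow (q d : R) : 0 <= q < 1 -> 0 < d -> exists N, forall k, (N <= k)%N -> q ^+ k <= d.
  move=> q01 d0; have := @cvg_geo0 R 1 q q01 => /cvgrPdist_le/(_ _ d0)[N _ hN].
  exists N => k Nk; have := hN k Nk; rewrite mul1r sub0r normrN; apply: le_trans.
  exact: ler_norm.
have [N1 hN1] := cpow r 2^-1 r01' ltac:(lra).
have [N2 hN2] := cpow _ (e / (K + 1)) (fps_q_01 r01') (divr_gt0 e0 (ltr_wpDl K0 ltr01)).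
(* M exceeds n, N1 and N2: the first makes the n-th coefficient one of the M that are seen, the
   second gives r^M <= 1/2, the third a truncation error of at most e. *)
pose m := (n + N1 + N2)%N; set M := (2 ^ m.+1)%N.
have mM : (m < M)%N by apply: (@leq_trans m.+1); rewrite // ltnW// ltn_expl.
have nM : (n < M)%N by apply: leq_ltn_trans mM; rewrite /m; lia.
have N1M : (N1 <= M)%N by apply: ltnW; apply: leq_ltn_trans mM; rewrite /m; lia.
have N2M : (N2 <= M)%N by apply: ltnW; apply: leq_ltn_trans mM; rewrite /m; lia.
have M0 : 0 < M%:R :> R by rewrite ltr0n expn_gt0.
rewrite -(ler_pM2l M0); apply: (le_trans (rou_coef cf r01 nM)).
have KqM : K * fps_q r ^+ M <= e.
  apply: (@le_trans _ _ (K * (e / (K + 1)))); first by rewrite ler_wpM2l// hN2.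
  by rewrite mulrCA ler_piMr ?(ltW e0)// ler_pdivrMr ?ltr_wpDl// mul1r lerDl.
have nz j : normc (r%:C%C * rou m ^+ j) = r by rewrite normcM normcR rou_norm mulr1 gtr0_norm.
have mean c : c = r \/ c = - r ->
    \sum_(j < M) normc (1 - c%:C%C * rou m ^+ j) ^- 2 <= M%:R * (4 / (1 - r)).
  move=> cr; have c1 : `|c| < 1 by case: cr => ->; rewrite ?normrN gtr0_norm.
  apply: (le_trans (rou_mean m c1)); rewrite -/M ler_wpM2l ?(ltW M0)//.
  have -> : c ^+ 2 = r ^+ 2 by case: cr => ->; rewrite ?sqrrN.
  have -> : c ^+ M = r ^+ M.
    by case: cr => -> //; rewrite /M expnS [in LHS]exprM [in RHS]exprM sqrrN.
  have rM := hN1 M N1M; have rM0 : 0 <= r ^+ M by rewrite exprn_ge0// ltW.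
  have h1 : 4^-1 <= (1 - r ^+ M) ^+ 2.
    have -> : (4^-1 : R) = 2^-1 ^+ 2 by rewrite exprVn -natrX.
    by rewrite lerXn2r ?nnegrE//; lra.
  have h2 : 1 - r <= 1 - r ^+ 2 by nra.
  have h3 : (1 - r) / 4 <= (1 - r ^+ 2) * (1 - r ^+ M) ^+ 2 by rewrite ler_pM//; lra.
  rewrite -[4 / _]invf_div lef_pV2 ?posrE//; last by lra.
  by apply: lt_le_trans h3; lra.
apply: (@le_trans _ _ (\sum_(j < M) (A * (normc (1 - r%:C%C * rou m ^+ j) ^- 2 +
    normc (1 - (- r)%:C%C * rou m ^+ j) ^- 2) + e))).
  apply: ler_sum => j _; rewrite rmorphN mulNr opprK.
  have h1 := fA _ (nz j).
  have h2 : normc (fps_part f (r%:C%C * rou m ^+ j) M - fps_ev f (r%:C%C * rou m ^+ j)) <=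
    K * fps_q r ^+ M by apply: fK; rewrite nz.
  rewrite -[X in normc X <= _](subrK (fps_ev f (r%:C%C * rou m ^+ j))) addrC.
  apply: (le_trans (normcD _ _)); apply: lerD => //; exact: le_trans h2 KqM.
rewrite big_split/= -mulr_sumr big_split/= sumr_const card_ord -[e *+ _]mulr_natl [leRHS]mulrDr lerD//.
have -> : M%:R * (8 * A / (1 - r)) = A * (M%:R * (4 / (1 - r)) + M%:R * (4 / (1 - r))) by lra.
by rewrite ler_wpM2l// lerD// mean; [|left| |right].
Qed.

End roots_of_unity.

(** * Jets near the singularity *)

Section jet_classes.
Context (R : realType) (I : Type) (z : I -> R[i]).
Hypothesis z1 : forall i, normc (z i) < 1.
Implicit Types (f g h : I -> fps R) (m : I -> R).

Let r i := normc (1 - z i).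

Lemma jet_r_gt0 i : 0 < r i.
Proof.
rewrite normc_gt0 subr_eq0; apply/eqP => z1E; have := z1 i.
by rewrite -z1E normc1 ltxx.
Qed.
Hint Resolve jet_r_gt0 : core.

Lemma jet_r_le2 i : r i <= 2.
Proof.
apply: (le_trans (normcD _ _)); rewrite normcNN normc1.
by have := z1 i; lra.
Qed.

Definition jet k (f : fps R) : fps R := iter k (@fpsD R) f.

Lemma jet_conv k (f : fps R) : fps_conv f -> fps_conv (jet k f).
Proof. by move=> cf; elim: k => //= k; exact: fps_conv_deriv. Qed.

(* Uniformly in [i], the jet of [f i] at [z i] has size [m i] when derivatives are
   weighted by powers of the distance to the singularity [1]. *)
Definition ucls m f := [/\ forall i, 0 <= m i, forall i, fps_conv (f i) &
  exists2 K, 0 <= K & forall i k, (k <= 3)%N ->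
    normc (fps_ev (jet k (f i)) (z i)) * r i ^+ k <= K * m i].

Lemma ucls_le m m' c f : 0 <= c -> (forall i, m i <= c * m' i) -> (forall i, 0 <= m' i) ->
  ucls m f -> ucls m' f.
Proof.
move=> c0 mm m'0 [m0 cf [K K0 fK]]; split=> //; exists (K * c); first exact: mulr_ge0.
move=> i k k3; apply: (le_trans (fK i k k3)).
by rewrite -mulrA ler_wpM2l.
Qed.

Lemma ucls_add m f g : ucls m f -> ucls m g -> ucls m (fun i => f i + g i).
Proof.
move=> [m0 cf [K K0 fK]] [_ cg [K' K'0 gK]]; split=> //.
  by move=> i; exact: fps_convD.
exists (K + K'); first exact: addr_ge0.
move=> i k k3; have -> : jet k (f i + g i) = jet k (f i) + jet k (g i).
  by elim: k {k3} => //= k ->; rewrite fpsD_add.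
rewrite fps_evD//; [|exact: jet_conv|exact: jet_conv]; rewrite [leRHS]mulrDl.
apply: le_trans (lerD (fK i k k3) (gK i k k3)).
by rewrite -mulrDl ler_wpM2r ?exprn_ge0 ?normcD ?(ltW (jet_r_gt0 i)).
Qed.

Lemma ucls_opp m f : ucls m f -> ucls m (fun i => - f i).
Proof.
move=> [m0 cf [K K0 fK]]; split=> //; first by move=> i; exact: fps_convN.
exists K => // i k k3; have -> : jet k (- f i) = - jet k (f i).
  by elim: k {k3} => //= k ->; rewrite fpsD_opp.
by rewrite fps_evN//; [rewrite normcNN fK|exact: jet_conv].
Qed.

Lemma jet1M (f g : fps R) : jet 1 (f * g) = jet 1 f * g + f * jet 1 g.
Proof. exact: fpsD_mul. Qed.
(** Binomial multiples are written as repeated sums here and in [jet3M], so that every summand is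
    one product of jets and gets the same bound. *)
Lemma jet2M (f g : fps R) : jet 2 (f * g) =
  jet 2 f * g + (jet 1 f * jet 1 g + jet 1 f * jet 1 g + f * jet 2 g).
Proof. by rewrite /jet /= fpsD_mul fpsD_add !fpsD_mul !addrA. Qed.
Lemma jet3M (f g : fps R) : jet 3 (f * g) =
  jet 3 f * g + (jet 2 f * jet 1 g + jet 2 f * jet 1 g + jet 2 f * jet 1 g +
   (jet 1 f * jet 2 g + jet 1 f * jet 2 g + jet 1 f * jet 2 g) + f * jet 3 g).
Proof. by rewrite /jet /= fpsD_mul fpsD_add !fpsD_mul !fpsD_add !fpsD_mul; ring. Qed.

Lemma jet_ev1M (f g : fps R) i : fps_conv f -> fps_conv g ->
  let e k u := fps_ev (jet k u) (z i) in
  e 1%N (f * g) = e 1%N f * e 0%N g + e 0%N f * e 1%N g.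
Proof.
move=> cf cg e; rewrite /e; have h1 := @jet_conv 1 _ cf; have h2 := @jet_conv 1 _ cg.
rewrite jet1M fps_evD ?fps_evM//; exact: fps_convM.
Qed.

Lemma jet_ev2M (f g : fps R) i : fps_conv f -> fps_conv g ->
  let e k u := fps_ev (jet k u) (z i) in
  e 2%N (f * g) = e 2%N f * e 0%N g + (e 1%N f * e 1%N g + e 1%N f * e 1%N g +
    e 0%N f * e 2%N g).
Proof.
move=> cf cg e; rewrite /e.
have hf k := @jet_conv k _ cf; have hg k := @jet_conv k _ cg.
rewrite jet2M.
have hM j k := fps_convM (hf j) (hg k).
have eM j k := fps_evM (hf j) (hg k) (z1 i).
have h11 := hM 1%N 1%N; have eD u v cu cv := @fps_evD R u v _ cu cv (z1 i).
rewrite (eD _ _ (hM 2%N 0%N) (fps_convD (fps_convD h11 h11) (hM 0%N 2%N))).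
rewrite (eD _ _ (fps_convD h11 h11) (hM 0%N 2%N)) (eD _ _ h11 h11).
by rewrite (eM 2%N 0%N) (eM 1%N 1%N) (eM 0%N 2%N).
Qed.

Lemma jet_ev3M (f g : fps R) i : fps_conv f -> fps_conv g ->
  let e k u := fps_ev (jet k u) (z i) in
  e 3%N (f * g) = e 3%N f * e 0%N g + (e 2%N f * e 1%N g + e 2%N f * e 1%N g +
    e 2%N f * e 1%N g + (e 1%N f * e 2%N g + e 1%N f * e 2%N g + e 1%N f * e 2%N g) +
    e 0%N f * e 3%N g).
Proof.
move=> cf cg e; rewrite /e.
have hf k := @jet_conv k _ cf; have hg k := @jet_conv k _ cg.
rewrite jet3M.
have hM j k := fps_convM (hf j) (hg k).
have eM j k := fps_evM (hf j) (hg k) (z1 i).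
have h21 := hM 2%N 1%N; have h12 := hM 1%N 2%N.
have h22 := fps_convD (fps_convD h21 h21) h21; have h11 := fps_convD (fps_convD h12 h12) h12.
have eD u v cu cv := @fps_evD R u v _ cu cv (z1 i).
rewrite (eD _ _ (hM 3%N 0%N) (fps_convD (fps_convD h22 h11) (hM 0%N 3%N))).
rewrite (eD _ _ (fps_convD h22 h11) (hM 0%N 3%N)) (eD _ _ h22 h11).
rewrite (eD _ _ (fps_convD h21 h21) h21) (eD _ _ h21 h21).
rewrite (eD _ _ (fps_convD h12 h12) h12) (eD _ _ h12 h12).
by rewrite (eM 3%N 0%N) (eM 2%N 1%N) (eM 1%N 2%N) (eM 0%N 3%N).
Qed.

Lemma normcM_scaled (x y : R[i]) (s A B : R) j k : 0 <= s ->
  normc x * s ^+ j <= A -> normc y * s ^+ k <= B -> normc (x * y) * s ^+ (j + k) <= A * B.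
Proof.
move=> s0 xA yB; rewrite normcM exprD mulrACA ler_pM// mulr_ge0// ?normc_ge0// exprn_ge0//.
Qed.

Lemma normcD_scaled (x y : R[i]) (s A B : R) : 0 <= s ->
  normc x * s <= A -> normc y * s <= B -> normc (x + y) * s <= A + B.
Proof.
move=> s0 xA yB; apply: le_trans (lerD xA yB).
by rewrite -mulrDl ler_wpM2r ?normcD.
Qed.

Lemma ucls_mul m m' f g : ucls m f -> ucls m' g ->
  ucls (fun i => m i * m' i) (fun i => f i * g i).
Proof.
move=> [m0 cf [K K0 fK]] [m'0 cg [K' K'0 gK]]; split.
- by move=> i; exact: mulr_ge0.
- by move=> i; exact: fps_convM.
(* 8 = 1 + 3 + 3 + 1 is the largest sum of binomial coefficients in the Leibniz formulas up to order
   3. *)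
exists (8 * (K * K')); first by rewrite !mulr_ge0.
move=> i k; have ri0 : 0 <= r i by exact: ltW.
have B0 : 0 <= (K * m i) * (K' * m' i) by rewrite !mulr_ge0.
have -> : 8 * (K * K') * (m i * m' i) = 8 * ((K * m i) * (K' * m' i)) by ring.
have hM j l : (j <= 3)%N -> (l <= 3)%N ->
    normc (fps_ev (jet j (f i)) (z i) * fps_ev (jet l (g i)) (z i)) * r i ^+ (j + l) <=
    (K * m i) * (K' * m' i).
  by move=> j3 l3; apply: normcM_scaled => //; [exact: fK|exact: gK].
set B := (K * m i) * (K' * m' i) in B0 hM *.
case: k => [|[|[|[|//]]]] _.
- rewrite /jet /= fps_evM//; apply: (le_trans (hM 0%N 0%N isT isT)); lra.
- rewrite jet_ev1M//; apply: (@le_trans _ _ (B + B)); last by lra.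
  apply: normcD_scaled; rewrite ?exprn_ge0//; [exact: (hM 1%N 0%N)|exact: (hM 0%N 1%N)].
- rewrite jet_ev2M//; apply: (@le_trans _ _ (B + (B + B + B))); last by lra.
  do ?[apply: normcD_scaled]; rewrite ?exprn_ge0//;
    [exact: (hM 2%N 0%N)|exact: (hM 1%N 1%N)|exact: (hM 1%N 1%N)|exact: (hM 0%N 2%N)].
- rewrite jet_ev3M//; apply: (@le_trans _ _ (B + (B + B + B + (B + B + B) + B))); last by lra.
  by do ?[apply: normcD_scaled]; rewrite ?exprn_ge0//;
    [exact: (hM 3%N 0%N)|exact: (hM 2%N 1%N)|exact: (hM 2%N 1%N)|exact: (hM 2%N 1%N)
    |exact: (hM 1%N 2%N)|exact: (hM 1%N 2%N)|exact: (hM 1%N 2%N)|exact: (hM 0%N 3%N)].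
Qed.

Lemma ucls_C (c : I -> R) : (forall i, 0 <= c i) -> ucls c (fun i => fpsC (c i)).
Proof.
move=> c0; split=> // [i|]; first exact: fps_convC.
exists 1 => // i k _; rewrite mul1r; case: k => [|k].
  by rewrite /jet /= expr0 mulr1 fps_evC// normcR ger0_norm.
rewrite /jet iterSr fpsD_C -[X in iter k _ X]/(0 : fps R).
have -> : iter k (@fpsD R) 0 = fpsC 0.
  by elim: k => [|k IH]; [rewrite rmorph0|rewrite iterS IH fpsD_C rmorph0].
by rewrite fps_evC// normc0 mul0r.
Qed.

Lemma ucls_const (c : R) : ucls (fun=> 1) (fun=> fpsC c).
Proof.
have [c0|c0] := lerP 0 c.
  apply: (@ucls_le (fun=> c) _ c) => //; first by move=> i; rewrite mulr1.
  exact: (@ucls_C (fun=> c)).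
have -> : (fun=> fpsC c) = (fun i : I => - fpsC (- c)).
  by apply/funext => i; rewrite rmorphN opprK.
apply: ucls_opp; apply: (@ucls_le (fun=> - c) _ (- c)) => //.
- by rewrite oppr_ge0 ltW.
- by move=> i; rewrite mulr1.
- by apply: (@ucls_C (fun=> - c)) => i; rewrite oppr_ge0 ltW.
Qed.

Lemma jetSS_X k : jet k.+2 (fpsX R) = fpsC 0.
Proof.
rewrite /jet !iterSr fpsD_X fpsD_1.
by elim: k => [|k IH]; [rewrite rmorph0|rewrite iterS IH fpsD_C rmorph0].
Qed.

Lemma ucls_X : ucls (fun=> 1) (fun=> fpsX R).
Proof.
split=> // [i|]; first exact: fps_convX.
exists 2 => // i k _; rewrite mulr1; case: k => [|[|k]].
- by rewrite expr0 mulr1 fps_evX//; have := z1 i; lra.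
- rewrite /jet /= fpsD_X expr1 -[1]/(fpsC 1) fps_evC// normcR normr1 mul1r.
  exact: jet_r_le2.
- by rewrite jetSS_X fps_evC// normc0 mul0r.
Qed.

Lemma ucls_1X : ucls r (fun=> 1 - fpsX R).
Proof.
split=> [i|i|]; first exact: ltW.
  by apply: fps_convB; [exact: fps_convC|exact: fps_convX].
exists 1 => // i k _; rewrite mul1r.
have jE : jet k (1 - fpsX R) = jet k (fpsC 1) - jet k (fpsX R).
  by elim: k => //= k ->; rewrite fpsD_sub.
have cX j : fps_conv (jet j (fpsX R)) by apply: jet_conv; exact: fps_convX.
have cC j : fps_conv (jet j (fpsC (1 : R))) by apply: jet_conv; exact: fps_convC.
rewrite jE fps_evB//; case: k jE => [|[|k]] _.
- by rewrite fps_evC// fps_evX// expr0 mulr1.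
- rewrite /jet /= fpsD_X fpsD_C -(rmorph0 (@fpsC R)) -[1]/(fpsC 1) !fps_evC//.
  by rewrite sub0r normcNN normcR normr1 mul1r expr1.
- rewrite jetSS_X /jet iterSr fpsD_C -(rmorph0 (@fpsC R)).
  have -> : iter k.+1 (@fpsD R) (fpsC 0) = fpsC 0.
    by elim: (k.+1) => // n IH; rewrite iterS IH fpsD_C rmorph0.
  by rewrite subrr normc0 mul0r ltW.
Qed.

Lemma solve_scaled (x y v : R[i]) (s A mg c : R) : 0 <= s -> 0 < c -> 0 < mg ->
  c * mg <= normc y -> normc (x * y) * s <= A -> normc x * s <= A / (c * mg).
Proof.
move=> s0 c0 mg0 yg xA; rewrite ler_pdivlMr ?mulr_gt0// mulrAC.
apply: le_trans xA; rewrite normcM; apply: ler_wpM2r => //.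
by apply: ler_wpM2l => //; exact: normc_ge0.
Qed.

Lemma le_sum4 (a b c d : R) : 0 <= a -> 0 <= b -> 0 <= c -> 0 <= d ->
  [/\ a <= a + b + c + d, b <= a + b + c + d, c <= a + b + c + d & d <= a + b + c + d].
Proof. by move=> *; split; lra. Qed.

(** The Leibniz formulas of f g = h are solved one after the other for the highest derivative of f.
    Each step divides by |g| >= c mg, and the constants [F0], ..., [F3] involve only c and the
    constants of g and h, never the index. No inverse series of g is formed. *)
Lemma ucls_div mg mh c f g h : 0 < c -> (forall i, 0 < mg i) ->
  (forall i, c * mg i <= normc (fps_ev (g i) (z i))) -> (forall i, fps_conv (f i)) ->
  (forall i, f i * g i = h i) -> ucls mg g -> ucls mh h -> ucls (fun i => mh i / mg i) f.
Proof.
move=> c0 mg0 gc cf fgh [_ cg [Kg Kg0 gK]] [mh0 ch [Kh Kh0 hK]].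
pose F0 := Kh / c; pose F1 := (Kh + F0 * Kg) / c.
pose F2 := (Kh + (F1 * Kg + F1 * Kg + F0 * Kg)) / c.
pose F3 := (Kh + (F2 * Kg + F2 * Kg + F2 * Kg + (F1 * Kg + F1 * Kg + F1 * Kg) + F0 * Kg)) / c.
have F0_0 : 0 <= F0 by rewrite divr_ge0 ?(ltW c0).
have P0 := mulr_ge0 F0_0 Kg0.
have F1_0 : 0 <= F1 := divr_ge0 (addr_ge0 Kh0 P0) (ltW c0).
have P1 := mulr_ge0 F1_0 Kg0.
have F2_0 : 0 <= F2 := divr_ge0 (addr_ge0 Kh0 (addr_ge0 (addr_ge0 P1 P1) P0)) (ltW c0).
have P2 := mulr_ge0 F2_0 Kg0.
have F3_0 : 0 <= F3 := divr_ge0 (addr_ge0 Kh0 (addr_ge0 (addr_ge0 (addr_ge0 (addr_ge0 P2 P2) P2)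
  (addr_ge0 (addr_ge0 P1 P1) P1)) P0)) (ltW c0).
split=> // [i|]; first by rewrite divr_ge0// ltW.
exists (F0 + F1 + F2 + F3); first by rewrite !addr_ge0.
move=> i k k3; have ri0 : 0 <= r i by exact: ltW.
pose M := mh i / mg i; have M0 : 0 <= M by rewrite divr_ge0// ltW.
have mgM : M * mg i = mh i by rewrite /M divfK// gt_eqF.
have mgi := mg0 i.
have solve x A j : normc (x * fps_ev (g i) (z i)) * r i ^+ j <= A * mh i ->
    normc x * r i ^+ j <= A / c * M.
  move=> /(@solve_scaled _ _ 0 _ _ (mg i) c) h1.
  have -> : A / c * M = A * mh i / (c * mg i).
    by rewrite /M; field; rewrite !gt_eqF.
  by apply: h1 => //; rewrite exprn_ge0.
have hh j : (j <= 3)%N -> normc (fps_ev (jet j (f i * g i)) (z i)) * r i ^+ j <= Kh * mh i.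
  by rewrite fgh; exact: hK.
have gg j : (j <= 3)%N -> normc (fps_ev (jet j (g i)) (z i)) * r i ^+ j <= Kg * mg i.
  exact: gK.
pose e j u := fps_ev (jet j u) (z i).
have prod j l F : (l <= 3)%N -> normc (e j (f i)) * r i ^+ j <= F * M ->
    normc (- (e j (f i) * e l (g i))) * r i ^+ (j + l) <= F * Kg * mh i.
  move=> l3 h1; rewrite normcNN; have -> : F * Kg * mh i = (F * M) * (Kg * mg i).
    by rewrite -mgM; ring.
  by apply: normcM_scaled => //; exact: gg.
have h0 : normc (e 0%N (f i)) * r i ^+ 0 <= F0 * M.
  by apply: solve; rewrite /e /jet /= -fps_evM//; exact: (hh 0%N).
have h1 : normc (e 1%N (f i)) * r i ^+ 1 <= F1 * M.
  apply: solve; have := jet_ev1M i (cf i) (cg i) => /= E.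
  have -> : e 1%N (f i) * fps_ev (g i) (z i) =
    fps_ev (jet 1 (f i * g i)) (z i) + - (e 0%N (f i) * e 1%N (g i)).
    by rewrite E addrK.
  rewrite mulrDl; apply: normcD_scaled; rewrite ?exprn_ge0//; first exact: hh.
  exact: (prod 0%N 1%N).
have h2 : normc (e 2%N (f i)) * r i ^+ 2 <= F2 * M.
  apply: solve; have := jet_ev2M i (cf i) (cg i) => /= E.
  have -> : e 2%N (f i) * fps_ev (g i) (z i) =
    fps_ev (jet 2 (f i * g i)) (z i) + (- (e 1%N (f i) * e 1%N (g i)) +
     - (e 1%N (f i) * e 1%N (g i)) + - (e 0%N (f i) * e 2%N (g i))).
    by rewrite E -!opprD addrK.
  rewrite !mulrDl; do ?[apply: normcD_scaled]; rewrite ?exprn_ge0//;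
    [exact: hh|exact: (prod 1%N 1%N)|exact: (prod 1%N 1%N)|exact: (prod 0%N 2%N)].
have h3 : normc (e 3%N (f i)) * r i ^+ 3 <= F3 * M.
  apply: solve; have := jet_ev3M i (cf i) (cg i) => /= E.
  have -> : e 3%N (f i) * fps_ev (g i) (z i) =
    fps_ev (jet 3 (f i * g i)) (z i) + (- (e 2%N (f i) * e 1%N (g i)) +
     - (e 2%N (f i) * e 1%N (g i)) + - (e 2%N (f i) * e 1%N (g i)) +
     (- (e 1%N (f i) * e 2%N (g i)) + - (e 1%N (f i) * e 2%N (g i)) +
      - (e 1%N (f i) * e 2%N (g i))) + - (e 0%N (f i) * e 3%N (g i))).
    by rewrite E -!opprD addrK.
  by rewrite !mulrDl; do ?[apply: normcD_scaled]; rewrite ?exprn_ge0//;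
    [exact: hh|exact: (prod 2%N 1%N)|exact: (prod 2%N 1%N)|exact: (prod 2%N 1%N)
    |exact: (prod 1%N 2%N)|exact: (prod 1%N 2%N)|exact: (prod 1%N 2%N)|exact: (prod 0%N 3%N)].
have step F : F <= F0 + F1 + F2 + F3 -> F * M <= (F0 + F1 + F2 + F3) * M.
  by move=> ?; rewrite ler_wpM2r.
have [s0 s1 s2 s3] := le_sum4 F0_0 F1_0 F2_0 F3_0.
by case: k k3 => [|[|[|[|//]]]] _; [apply: (le_trans h0)|apply: (le_trans h1)|
  apply: (le_trans h2)|apply: (le_trans h3)]; exact: step.
Qed.

End jet_classes.

(** * The binomial series *)

Section fps_real.
Context (R : realType).
Implicit Types (f : fps R) (x : R).

Lemma fps_conv_pseries f x : fps_conv f -> `|x| < 1 -> cvgn (pseries f x).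
Proof.
move=> cf x1; have x01 : 0 <= `|x| < 1 by rewrite normr_ge0.
have [K K0 fK] := fps_term_geo cf x01.
have q01 := fps_q_01 x01; have /andP[q0 q1] := q01.
apply: normed_cvg; apply: (@series_le_cvg _ _ (geometric K (fps_q `|x|))).
- by move=> n /=; rewrite normr_ge0.
- by move=> n; rewrite /geometric /= mulr_ge0// exprn_ge0.
- move=> n /=; have := fK (x%:C)%C; rewrite normcR => /(_ (lexx _) n).
  by rewrite normcM normcX !normcR normrM normrX.
- by apply: is_cvg_geometric_series; rewrite ger0_norm.
Qed.

Lemma fps_ev_pseries f x : fps_conv f -> `|x| < 1 ->
  fps_ev f x%:C%C = (limn (pseries f x))%:C%C.
Proof.
move=> cf x1; apply: fps_ev_real => //.
have := fps_conv_pseries cf x1; rewrite /pseries => /cvg_ex[l hl].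
rewrite (cvg_lim _ hl)//; move: hl.
by rewrite /series /=; under eq_fun do rewrite big_mkord.
Qed.

Lemma fps_conv_of_cvg f : (forall x, 0 < x < 1 -> cvgn (pseries f x)) -> fps_conv f.
Proof.
move=> h r /[dup] r01 /h/cvg_series_cvg_0/cvgP/cvg_seq_bounded/pinfty_ex_gt0[M M0 /= hM].
case/andP: r01 => r0 _; exists M => n; have := hM n I.
by rewrite normrM normrX (gtr0_norm r0).
Qed.

Lemma fpsD_real f x : fps_conv f -> `|x| < 1 ->
  is_derive x (1 : R) (fun y => limn (pseries f y)) (limn (pseries (fpsD f) x)).
Proof.
move=> cf x1; pose K := (`|x| + 1) / 2; have K0 : `|x| < K by rewrite /K; lra.
have K1 : `|K| < 1.
  by rewrite ger0_norm; rewrite /K; have := normr_ge0 x; lra.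
have dE g : pseries_diffs g = fpsD g.
  by apply/funext => n; rewrite /pseries_diffs /fpsD mulr_natl.
have KK : K <= `|K| by exact: ler_norm.
have := @pseries_snd_diffs R f K x; rewrite !dE; apply.
- exact: fps_conv_pseries.
- by apply: fps_conv_pseries => //; exact: fps_conv_deriv.
- by apply: fps_conv_pseries => //; do 2 apply: fps_conv_deriv.
- exact: lt_le_trans KK.
Qed.

End fps_real.

Section binomial_series.
Context (R : realType) (alpha : R) (b : fps R).
Hypothesis alpha01 : 0 < alpha < 1.
Hypothesis hb : frac_weights alpha b.

Lemma fw_conv : fps_conv b.
Proof.
apply: fps_conv_of_cvg => x /andP[x0 x1]; apply/cvg_ex; exists ((1 - x) `^ alpha).
by apply: hb; rewrite gtr0_norm.
Qed.

Lemma fw_lim (x : R) : `|x| < 1 -> limn (pseries b x) = (1 - x) `^ alpha.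
Proof. by move=> /hb h; apply: cvg_lim. Qed.

Lemma fw_ev (x : R) : `|x| < 1 -> fps_ev b x%:C%C = ((1 - x) `^ alpha)%:C%C.
Proof. by move=> x1; rewrite fps_ev_pseries ?fw_lim//; exact: fw_conv. Qed.

Lemma fw_derive (x : R) : `|x| < 1 ->
  (1 - x) * limn (pseries (fpsD b) x) = - alpha * (1 - x) `^ alpha.
Proof.
move=> x1; have x1' : 0 < 1 - x by rewrite subr_gt0; exact: le_lt_trans (ler_norm _) _.
have h1 : is_derive x (1 : R) (fun y => (1 - y) `^ alpha) (limn (pseries (fpsD b) x)).
  apply: (@near_eq_is_derive _ _ _ (fun y => limn (pseries b y))); last first.
    by apply: fpsD_real => //; exact: fw_conv.
  have e0 : 0 < 1 - `|x| by rewrite subr_gt0.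
  apply: filterS (nbhsx_ballx x _ e0) => y; rewrite /ball /= => xy; apply: fw_lim.
  by have := ler_normD (y - x) x; rewrite subrK distrC; lra.
have h2 : is_derive x (1 : R) (fun y => (1 - y) `^ alpha) (alpha * (1 - x) `^ (alpha - 1) * (-1)).
  have h0 : is_derive x (1 : R) (fun y : R => 1 - y) (-1).
    by have := is_deriveB (is_derive_cst (1 : R) x 1) (is_derive_id x (1 : R)); rewrite sub0r.
  have h3 := is_derive1_powR alpha x1'.
  exact (@is_derive1_comp R (fun y => y `^ alpha) (fun y => 1 - y) x _ _ h3 h0).
rewrite -(@derive_val _ _ _ _ _ _ _ h1) (@derive_val _ _ _ _ _ _ _ h2).
rewrite mulrN1 mulrN mulrCA mulr_powRB1 ?(ltW x1')//; last by case/andP: alpha01.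
by rewrite mulNr.
Qed.

(** Stands in for the complex power: the equation gives the recursion and the signs of the weights,
    and bounds |1 - z|^k times the k-th derivative by |b(z)| itself. *)
Lemma fw_ode : (1 - fpsX R) * fpsD b = - (fpsC alpha * b).
Proof.
have cb := fw_conv; have cdb := fps_conv_deriv cb.
have c1X : fps_conv (1 - fpsX R) by apply: fps_convB; [exact: fps_convC|exact: fps_convX].
have cab : fps_conv (fpsC alpha * b) by apply: fps_convM => //; exact: fps_convC.
apply/eqP; rewrite -subr_eq0 opprK; apply/eqP; apply: fps_identity.
  by apply: fps_convD => //; exact: fps_convM.
move=> x /andP[x0 x1]; have nx : `|x| < 1 by rewrite gtr0_norm.
have cx : normc (x%:C)%C < 1 by rewrite normcR.
rewrite fps_evD ?fps_evM ?fps_evB ?fps_evX ?fps_evC//;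
  do ?[exact: fps_convC|exact: fps_convX|exact: fps_convM|exact: (@fps_convC R 1)].
rewrite fw_ev// fps_ev_pseries// -!(rmorphM, rmorphB, rmorph1 (real_complex R)).
by rewrite fw_derive// -rmorphD mulNr addNr rmorph0.
Qed.

Lemma fw_rec n : n.+1%:R * b n.+1 = (n%:R - alpha) * b n.
Proof.
have := congr1 (fun f : fps R => f n) fw_ode.
rewrite mulrBl mul1r fpsBE fpsNE fpsCM fpsXM /fpsD; case: n => [|n].
  by rewrite subr0 sub0r mulNr mulr1n mul1r.
by rewrite -[b n.+2 *+ _]mulr_natl -[b n.+1 *+ _]mulr_natl => /eqP; rewrite subr_eq => /eqP ->; ring.
Qed.

Lemma fw_0 : b 0%N = 1.
Proof.
have := @fw_ev 0; rewrite normr0 subr0 powR1 => /(_ ltr01).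
rewrite (@fps_ev_near _ _ _ (b 0%N)%:C%C 1%N fw_conv); last 2 first.
- by rewrite rmorph0 normc0.
- move=> [//|n] _; rewrite /fps_part big_ord_recl/= mulr1 big1 ?addr0// => i _.
  by rewrite rmorph0 exprS mul0r mulr0.
by move=> [].
Qed.

Lemma fw_lt0 n : b n.+1 < 0.
Proof.
have /andP[a0 a1] := alpha01; elim: n => [|n IH].
  by have := fw_rec 0; rewrite mul1r fw_0 mulr1 sub0r => ->; rewrite oppr_lt0.
have h := fw_rec n.+1.
have n0 : 0 < (n.+1%:R - alpha) :> R by rewrite subr_gt0 (lt_le_trans a1)// ler1n.
have : n.+2%:R * b n.+2 < 0 by rewrite h pmulr_rlt0.
by rewrite pmulr_rlt0// ltr0n.
Qed.

(** The partial sums are the coefficients of (1 - x)^(alpha - 1). Since b (n + 1) is negative they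
    are positive, which is what bounds the sum of |b k| over k >= 1 by b 0 = 1. *)
Lemma fw_partial n : alpha * \sum_(k < n.+1) b k = - (n.+1%:R * b n.+1).
Proof.
elim: n => [|n IH]; first by rewrite big_ord1 fw_rec fw_0 sub0r !mulr1 opprK.
by rewrite big_ord_recr/= mulrDr IH [in RHS]fw_rec; ring.
Qed.

Lemma fw_abs_tail n : \sum_(k < n) `|b k.+1| <= 1.
Proof.
have /andP[a0 a1] := alpha01.
have h : 0 <= \sum_(k < n.+1) b k.
  rewrite -(pmulr_rge0 _ a0) fw_partial oppr_ge0; apply: ltW.
  by rewrite pmulr_rlt0 ?ltr0n// fw_lt0.
rewrite (eq_bigr (fun k : 'I_n => - b k.+1)); last by move=> k _; rewrite ltr0_norm ?fw_lt0.
by move: h; rewrite big_ord_recl/= fw_0 sumrN; under eq_bigr do rewrite /bump /= add1n; lra.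
Qed.

Lemma fw_abs n : \sum_(k < n) `|b k| <= 2.
Proof.
case: n => [|n]; first by rewrite big_ord0.
rewrite big_ord_recl/= fw_0 normr1; under eq_bigr do rewrite /bump /= add1n.
by have := fw_abs_tail n; lra.
Qed.

(** By [fw_abs_tail], |b(z) - 1| <= |z| < 1. This positivity is all that is needed of the argument
    of (1 - z)^alpha to keep b + mu a away from zero. *)
Lemma fw_Re_gt0 z : normc z < 1 -> 0 < complex.Re (fps_ev b z).
Proof.
move=> z1; have cs := fps_conv_shift fw_conv.
have : fps_ev b z - 1 = z * fps_ev (fps_shift b) z.
  rewrite {1}(fps_shiftE b) fps_evD ?fps_evM ?fps_evX ?fps_evC//; first last.
  - by apply: fps_convM => //; exact: fps_convX.
  - exact: fps_convC.
  - exact: fps_convX.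
  by rewrite fw_0 rmorph1 addrC addKr.
move=> /(congr1 (@normc R)); rewrite normcM => E.
have h : normc (fps_ev b z - 1) < 1.
  rewrite E; apply: (le_lt_trans _ z1); rewrite ler_piMr ?normc_ge0//.
  apply: (@fps_ev_bound _ _ _ ((1 + normc z) / 2)) => //; [lra|lra|].
  move=> n; apply: le_trans (fw_abs_tail n); apply: ler_sum => k _.
  by rewrite ler_piMr ?exprn_ile1//; have := normc_ge0 z; lra.
have := le_lt_trans (Re_le_normc _) h; case: (fps_ev b z) => u v /=.
by rewrite ltr_norml; lra.
Qed.

Lemma fw_neq0 z : normc z < 1 -> 0 < normc (fps_ev b z).
Proof.
move=> /fw_Re_gt0 h; apply: lt_le_trans h _; exact: le_trans (ler_norm _) (Re_le_normc _).
Qed.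

Lemma fw_neg_real (x : R) : `|x| < 1 -> fps_ev (fps_neg b) x%:C%C = ((1 + x) `^ alpha)%:C%C.
Proof.
move=> x1; rewrite fps_ev_neg ?normcR//; last exact: fw_conv.
by rewrite -rmorphN fw_ev ?normrN// opprK.
Qed.

(** (1 - x)^alpha (1 + x)^alpha = (1 - x^2)^alpha. It relates the symbol at z^2, which belongs to
    the coarse step, to the symbol at z. *)
Lemma fw_mul_neg : b * fps_neg b = fps_sqr b.
Proof.
have cb := fw_conv; have cn := fps_conv_neg cb; have cs := fps_conv_sqr cb.
apply/eqP; rewrite -subr_eq0; apply/eqP; apply: fps_identity.
  by apply: fps_convB => //; exact: fps_convM.
move=> x /andP[x0 x1]; have nx : `|x| < 1 by rewrite gtr0_norm.
have cx : normc (x%:C)%C < 1 by rewrite normcR.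
rewrite fps_evB ?fps_evM//; last exact: fps_convM.
rewrite fps_ev_sqr// -rmorphXn fw_neg_real// !fw_ev//; last first.
  by rewrite normrX exprn_ilt1.
rewrite -rmorphM -powRM; [|lra|lra].
by rewrite (_ : (1 - x) * (1 + x) = 1 - x ^+ 2) ?subrr//; ring.
Qed.

End binomial_series.

(** * The symbols of the scheme *)

Section absolutely_summable.
Context (R : realType).
Implicit Types (f g : fps R) (z w : R[i]).

(** The Wiener algebra: its elements are bounded on the whole open disc, up to the singular points
    on the circle. *)
Definition asum f := exists K, forall n, \sum_(k < n) `|f k| <= K.

Lemma asum_conv f : asum f -> fps_conv f.
Proof.
move=> [K fK]; apply: (@fps_conv_bounded _ _ K) => n; apply: le_trans (fK n.+1).
by rewrite big_ord_recr/= lerDr sumr_ge0.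
Qed.

Lemma asumD f g : asum f -> asum g -> asum (f + g).
Proof.
move=> [K fK] [K' gK]; exists (K + K') => n; apply: le_trans (lerD (fK n) (gK n)).
by rewrite -big_split/=; apply: ler_sum => k _; exact: ler_normD.
Qed.

Lemma asumN f : asum f -> asum (- f).
Proof.
by move=> [K fK]; exists K => n; under eq_bigr do rewrite fpsNE normrN.
Qed.

Lemma asumC c : asum (fpsC c).
Proof.
exists `|c| => -[|n]; first by rewrite big_ord0.
by rewrite big_ord_recl/= big1 ?addr0// => i _; rewrite normr0.
Qed.

Lemma asumX : asum (fpsX R).
Proof.
exists 1 => -[|[|n]]; rewrite ?big_ord0// !big_ord_recl ?big_ord0/= /fpsX/= !normr0.
  by rewrite addr0.
by rewrite normr1 add0r big1 ?addr0// => i _; rewrite normr0.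
Qed.

Lemma asumM f g : asum f -> asum g -> asum (f * g).
Proof.
move=> [K fK] [K' gK]; exists (K * K') => n.
(* The coefficients of F G majorize those of f g below [n] and are nonnegative, so the partial sum
   is at most (F G)(1) = F(1) G(1). *)
pose F : {poly R} := \poly_(i < n) `|f i|; pose G : {poly R} := \poly_(i < n) `|g i|.
have F0 i : 0 <= F`_i by rewrite coef_poly; case: ifP.
have G0 i : 0 <= G`_i by rewrite coef_poly; case: ifP.
apply: (@le_trans _ _ (\sum_(k < n) (F * G)`_k)).
  apply: ler_sum => k _; rewrite fpsME coefM; apply: (le_trans (ler_norm_sum _ _ _)).
  apply: ler_sum => i _; rewrite normrM !coef_poly.
  rewrite (leq_ltn_trans _ (ltn_ord k)) ?(leq_ltn_trans (leq_subr _ _) (ltn_ord k))//.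
  by rewrite -ltnS.
have sz : (size (F * G)%R <= n + n)%N.
  apply: leq_trans (size_polyMleq _ _) _; apply: leq_trans (leq_pred _) _.
  by apply: leq_add; exact: size_poly.
apply: (@le_trans _ _ ((F * G).[1])).
  rewrite (horner_coef_wide _ sz) big_split_ord/= -[leLHS]addr0.
  apply: lerD; first by apply: ler_sum => i _; rewrite expr1n mulr1.
  apply: sumr_ge0 => i _; rewrite expr1n mulr1 coefM.
  by apply: sumr_ge0 => j _; exact: mulr_ge0.
rewrite hornerM !horner_poly ler_pM ?sumr_ge0//; do ?by move=> i _; rewrite expr1n mulr1.
- by apply: le_trans (fK n); apply: ler_sum => i _; rewrite expr1n mulr1.
- by apply: le_trans (gK n); apply: ler_sum => i _; rewrite expr1n mulr1.
Qed.

Lemma asum_neg f : asum f -> asum (fps_neg f).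
Proof.
move=> [K fK]; exists K => n; apply: le_trans (fK n); apply: ler_sum => k _.
by rewrite /fps_neg normrM normrX normrN1 expr1n mul1r.
Qed.

Lemma asum_ev f K z : (forall n, \sum_(k < n) `|f k| <= K) -> normc z < 1 ->
  normc (fps_ev f z) <= K.
Proof.
move=> fK z1; apply: (@fps_ev_bound _ _ _ ((1 + normc z) / 2)); [|lra|lra|].
  by apply: asum_conv; exists K.
move=> n; apply: le_trans (fK n); apply: ler_sum => k _.
by rewrite ler_piMr ?exprn_ile1//; have := normc_ge0 z; lra.
Qed.

Lemma pow_lip z w k : normc z < 1 -> normc w < 1 ->
  normc (z ^+ k - w ^+ k) <= k%:R * normc (z - w).
Proof.
move=> z1 w1; elim: k => [|k IH]; first by rewrite !expr0 subrr normc0 mul0r.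
have -> : z ^+ k.+1 - w ^+ k.+1 = z * (z ^+ k - w ^+ k) + (z - w) * w ^+ k.
  by rewrite !exprS; ring.
rewrite -[k.+1%:R]natr1 [leRHS]mulrDl mul1r; apply: (le_trans (normcD _ _)); apply: lerD.
  by rewrite normcM; apply: le_trans IH; rewrite ler_piMl ?normc_ge0// ltW.
by rewrite normcM ler_piMr ?normc_ge0// normcX exprn_ile1// ?normc_ge0// ltW.
Qed.

Lemma pow_taylor z w k : normc z < 1 -> normc w < 1 ->
  normc (z ^+ k.+1 - w ^+ k.+1 - (z - w) * (k.+1%:R * w ^+ k)) <=
    (k.+1 * k)%:R * normc (z - w) ^+ 2.
Proof.
move=> z1 w1; elim: k => [|k IH].
  by rewrite !expr1 expr0 !mulr1 subrr normc0 muln0 mul0r.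
have -> : z ^+ k.+2 - w ^+ k.+2 - (z - w) * (k.+2%:R * w ^+ k.+1) =
    z * (z ^+ k.+1 - w ^+ k.+1 - (z - w) * (k.+1%:R * w ^+ k)) +
    (z - w) ^+ 2 * (k.+1%:R * w ^+ k).
  by rewrite !exprS -[k.+2%:R]natr1; ring.
apply: (le_trans (normcD _ _)).
apply: (@le_trans _ _ ((k.+1 * k)%:R * normc (z - w) ^+ 2 + k.+1%:R * normc (z - w) ^+ 2)).
  apply: lerD.
    by rewrite normcM; apply: le_trans IH; rewrite ler_piMl ?normc_ge0// ltW.
  rewrite normcM normcX [leRHS]mulrC ler_wpM2l ?exprn_ge0 ?normc_ge0//.
  rewrite normcM -(rmorph_nat (real_complex R)) normcR normr_nat ler_piMr//.
  by rewrite normcX exprn_ile1// ?normc_ge0// ltW.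
rewrite -mulrDl ler_wpM2r ?exprn_ge0 ?normc_ge0// -natrD ler_nat.
by rewrite -mulnSr mulnC leq_mul.
Qed.

Lemma fps_taylor1 f K z w : fps_conv f -> (forall n, \sum_(k < n) `|fpsD f k| <= K) ->
  normc z < 1 -> normc w < 1 ->
  normc (fps_ev f z - fps_ev f w) <= K * normc (z - w).
Proof.
move=> cf fK z1 w1.
have h : (fun n => normc (fps_part f z n - fps_ev f z) + normc (fps_part f w n - fps_ev f w) +
    K * normc (z - w)) @ \oo --> K * normc (z - w).
  rewrite -[X in _ --> X]add0r -[X in _ --> X + _](addr0 0).
  apply: cvgD; [apply: cvgD; exact: fps_part_cvg|exact: cvg_cst].
apply: (cvgr_to_ge h); apply: nearW => n.
have alg (u v u' v' : R[i]) : u - v = - (u' - u) + (v' - v) + (u' - v') by ring.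
rewrite (alg _ _ (fps_part f z n) (fps_part f w n)).
apply: (le_trans (normcD _ _)); apply: lerD.
  by apply: (le_trans (normcD _ _)); rewrite normcNN.
rewrite /fps_part -sumrB; apply: (le_trans (normc_sum _ _ _)).
case: n => [|n].
  by rewrite big_ord0 mulr_ge0 ?normc_ge0//; apply: le_trans (fK 0%N); rewrite big_ord0.
rewrite big_ord_recl/= subrr normc0 add0r; apply: (@le_trans _ _ (\sum_(k < n) `|fpsD f k| * normc (z - w))).
  apply: ler_sum => k _; rewrite /bump /= add1n -mulrBr normcM normcR /fpsD normrMn -mulr_natr -mulrA.
  by rewrite ler_wpM2l// pow_lip.
by rewrite -mulr_suml ler_wpM2r ?normc_ge0.
Qed.

Lemma fps_taylor2 f K z w : fps_conv f -> (forall n, \sum_(k < n) `|fpsD (fpsD f) k| <= K) ->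
  normc z < 1 -> normc w < 1 ->
  normc (fps_ev f z - fps_ev f w - (z - w) * fps_ev (fpsD f) w) <= K * normc (z - w) ^+ 2.
Proof.
move=> cf fK z1 w1; have cdf := fps_conv_deriv cf.
have cS g x : fps_conv g -> normc x < 1 ->
    (fun n => normc (fps_part g x n.+1 - fps_ev g x)) @ \oo --> (0 : R).
  move=> cg x1; have := fps_part_cvg cg x1; rewrite -(cvg_shiftS (fun n => normc (fps_part g x n - fps_ev g x))); exact.
(* The derivative of a partial sum of length n + 2 is a partial sum of length n + 1 of the
   derivative, hence the shifted lengths. The Taylor remainder is then estimated power by power. *)
have h : (fun n => normc (fps_part f z n.+2 - fps_ev f z) +
    normc (fps_part f w n.+2 - fps_ev f w) +
    normc (z - w) * normc (fps_part (fpsD f) w n.+1 - fps_ev (fpsD f) w) +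
    K * normc (z - w) ^+ 2) @ \oo --> K * normc (z - w) ^+ 2.
  rewrite [X in _ --> X](_ : _ = 0 + 0 + normc (z - w) * 0 + K * normc (z - w) ^+ 2); last first.
    by rewrite mulr0 !add0r.
  apply: cvgD; last exact: cvg_cst.
  apply: cvgD; last by apply: cvgM; [exact: cvg_cst|exact: cS].
  have cSS x : normc x < 1 -> (fun n => normc (fps_part f x n.+2 - fps_ev f x)) @ \oo --> (0 : R).
    move=> x1; have := cS _ _ cf x1; rewrite -(cvg_shiftS (fun n => normc (fps_part f x n.+1 - fps_ev f x))); exact.
  by apply: cvgD; exact: cSS.
apply: (cvgr_to_ge h); apply: nearW => n.
have alg (u v e u' v' e' d : R[i]) : u - v - d * e =
  - (u' - u) + (v' - v) + d * (e' - e) + (u' - v' - d * e') by ring.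
rewrite (alg _ _ _ (fps_part f z n.+2) (fps_part f w n.+2) (fps_part (fpsD f) w n.+1)).
apply: (le_trans (normcD _ _)); apply: lerD.
  apply: (le_trans (normcD _ _)); apply: lerD; last by rewrite normcM.
  by apply: (le_trans (normcD _ _)); rewrite normcNN.
rewrite /fps_part -sumrB big_ord_recl/= subrr add0r mulr_sumr -sumrB.
rewrite (eq_bigr (fun k : 'I_n.+1 => (f k.+1)%:C%C *
   (z ^+ k.+1 - w ^+ k.+1 - (z - w) * (k.+1%:R * w ^+ k)))); last first.
  by move=> k _; rewrite /bump /= add1n /fpsD rmorphMn -mulr_natr/=; ring.
rewrite big_ord_recl/= !expr1 expr0 mulr1 mulr1 subrr mulr0 add0r.
apply: (le_trans (normc_sum _ _ _)).
apply: (@le_trans _ _ (\sum_(k < n) `|fpsD (fpsD f) k| * normc (z - w) ^+ 2)).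
  apply: ler_sum => k _; rewrite /bump /= add1n normcM normcR /fpsD !normrMn -mulrnA.
  rewrite -[_ *+ (k.+2 * k.+1)]mulr_natr -[leRHS]mulrA.
  by rewrite ler_wpM2l// pow_taylor.
by rewrite -mulr_suml ler_wpM2r ?exprn_ge0 ?normc_ge0.
Qed.

Definition asum3 f := forall k, (k <= 3)%N -> asum (jet k f).

Lemma jetD k f g : jet k (f + g) = jet k f + jet k g.
Proof. by elim: k => //= k ->; rewrite fpsD_add. Qed.
Lemma jetN k f : jet k (- f) = - jet k f.
Proof. by elim: k => //= k ->; rewrite fpsD_opp. Qed.
Lemma jetC k c : jet k.+1 (fpsC c) = 0 :> fps R.
Proof.
rewrite /jet iterSr fpsD_C; elim: k => //= k ->.
by rewrite -(rmorph0 (@fpsC R)) fpsD_C rmorph0.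
Qed.

Lemma asum3D f g : asum3 f -> asum3 g -> asum3 (f + g).
Proof. by move=> sf sg k k3; rewrite jetD; apply: asumD; [exact: sf|exact: sg]. Qed.
Lemma asum3N f : asum3 f -> asum3 (- f).
Proof. by move=> sf k k3; rewrite jetN; apply: asumN; exact: sf. Qed.
Lemma asum3C c : asum3 (fpsC c).
Proof.
move=> [|k] _; first exact: asumC.
by rewrite jetC -(rmorph0 (@fpsC R)); exact: asumC.
Qed.
Lemma asum3X : asum3 (fpsX R).
Proof.
move=> [|[|k]] _; [exact: asumX| |by rewrite jetSS_X; exact: asumC].
by rewrite /jet /= fpsD_X; exact: (asumC 1).
Qed.
Lemma asum3M f g : asum3 f -> asum3 g -> asum3 (f * g).
Proof.
move=> sf sg k k3.
have h j l : (j <= 3)%N -> (l <= 3)%N -> asum (jet j f * jet l g).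
  by move=> j3 l3; apply: asumM; [exact: sf|exact: sg].
case: k k3 => [|[|[|[|//]]]] _; rewrite ?jet1M ?jet2M ?jet3M; do ?apply: asumD;
  do ?[exact: (h 0%N 0%N)|exact: (h 1%N 0%N)|exact: (h 0%N 1%N)|exact: (h 2%N 0%N)|exact: (h 0%N 2%N)
  |exact: (h 3%N 0%N)|exact: (h 0%N 3%N)|exact: (h 1%N 1%N)|exact: (h 2%N 1%N)|exact: (h 1%N 2%N)].
Qed.

End absolutely_summable.

Section fps_morphisms.
Context (K : comNzRingType).
Implicit Types (f g : fps K) (c : K).
Lemma fps_negM f g : fps_neg (f * g) = fps_neg f * fps_neg g. Proof. exact: rmorphM. Qed.
Lemma fps_negB f g : fps_neg (f - g) = fps_neg f - fps_neg g. Proof. exact: rmorphB. Qed.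
Lemma fps_negN f : fps_neg (- f) = - fps_neg f. Proof. exact: rmorphN. Qed.
Lemma fps_neg1 : fps_neg 1 = 1 :> fps K. Proof. exact: rmorph1. Qed.
Lemma fps_sqrM f g : fps_sqr (f * g) = fps_sqr f * fps_sqr g. Proof. exact: rmorphM. Qed.
Lemma fps_sqrD f g : fps_sqr (f + g) = fps_sqr f + fps_sqr g. Proof. exact: rmorphD. Qed.
Lemma fps_sqrB f g : fps_sqr (f - g) = fps_sqr f - fps_sqr g. Proof. exact: rmorphB. Qed.
Lemma fps_sqrN f : fps_sqr (- f) = - fps_sqr f. Proof. exact: rmorphN. Qed.
Lemma fpsC_D c d : fpsC (c + d) = fpsC c + fpsC d. Proof. exact: rmorphD. Qed.
Lemma fpsC_M c d : fpsC (c * d) = fpsC c * fpsC d. Proof. exact: rmorphM. Qed.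
Lemma fpsC_N c : fpsC (- c) = - fpsC c. Proof. exact: rmorphN. Qed.
Lemma fpsC_B c d : fpsC (c - d) = fpsC c - fpsC d. Proof. exact: rmorphB. Qed.
Lemma fpsC_1 : fpsC 1 = 1 :> fps K. Proof. by []. Qed.
Lemma fpsC_nat n : fpsC n%:R = n%:R :> fps K. Proof. exact: rmorph_nat. Qed.
End fps_morphisms.

Section corrected_CN_symbols.
Context (R : realType) (alpha : R) (b : fps R).
Hypothesis alpha01 : 0 < alpha < 1.
Hypothesis hb : frac_weights alpha b.
Local Notation X := (fpsX R).
Local Notation "c %:S" := (fpsC c) (at level 2, format "c %:S").

Let cb := fw_conv hb.

(** Symbol of the average (1 - alpha / 2) U^n + (alpha / 2) U^(n-1). *)
Definition cn_a : fps R := (1 - alpha / 2)%:S + (alpha / 2)%:S * X.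

Lemma asum3_1X : asum3 (1 + X).
Proof. by apply: asum3D; [exact: (asum3C 1)|exact: asum3X]. Qed.

Lemma asum3_cn_a : asum3 cn_a.
Proof. by apply: asum3D; [|apply: asum3M]; [exact: asum3C|exact: asum3C|exact: asum3X]. Qed.

Let q := fps_neg b.

Lemma fw_neg_ode : (1 + X) * fpsD q = alpha%:S * q.
Proof.
have := congr1 (@fps_neg R) (fw_ode alpha01 hb).
rewrite fps_negM fps_negB fps_neg1 fps_neg_X opprK fps_negN fps_negM fps_neg_C.
by rewrite -[fps_neg (fpsD b)]opprK -fpsD_neg mulrN => /oppr_inj.
Qed.

Lemma fpsD_1X f : fpsD ((1 + X) * f) = f + (1 + X) * fpsD f.
Proof. by rewrite fpsD_mul fpsD_add fpsD_1 fpsD_X add0r mul1r. Qed.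

(** The powers (1 + X)^(alpha + k), k = 1, 2, 3. A derivative lowers the exponent by one, so three
    derivatives of [q3] end at a multiple of [q], which is still absolutely summable. *)
Let q1 := (1 + X) * q.
Let q2 := (1 + X) * q1.
Let q3 := (1 + X) * q2.

Lemma fpsD_q1 : fpsD q1 = (1 + alpha)%:S * q.
Proof. by rewrite fpsD_1X fw_neg_ode fpsC_D fpsC_1; ring. Qed.
Lemma fpsD_q2 : fpsD q2 = (2 + alpha)%:S * q1.
Proof. by rewrite fpsD_1X fpsD_q1 !fpsC_D fpsC_1 /q1; ring. Qed.
Lemma fpsD_q3 : fpsD q3 = (3 + alpha)%:S * q2.
Proof. by rewrite fpsD_1X fpsD_q2 !fpsC_D !fpsC_1 /q2; ring. Qed.

Lemma asum3_q3 : asum3 q3.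
Proof.
have sq : asum q by apply: asum_neg; exists 2; exact: (fw_abs alpha01 hb).
have s1 : asum (1 + X) by exact: (asum3_1X (isT : (0 <= 3)%N)).
have sq1 : asum q1 by exact: asumM.
have sq2 : asum q2 by exact: asumM.
case=> [|[|[|[|//]]]] _; rewrite /jet /=.
- exact: asumM.
- by rewrite fpsD_q3; apply: asumM => //; exact: asumC.
- rewrite fpsD_q3 fpsD_CM fpsD_q2; apply: asumM; first exact: asumC.
  by apply: asumM => //; exact: asumC.
- rewrite fpsD_q3 fpsD_CM fpsD_q2 fpsD_CM fpsD_CM fpsD_q1.
  by apply: asumM; [exact: asumC|]; apply: asumM; [exact: asumC|]; apply: asumM => //; exact: asumC.
Qed.

Let p3 := (1 + X) * ((1 + X) * (1 + X)).

(* [(1 + X)^3 (2^alpha a(X^2) - (1 + X)^alpha a(X))]: the factor [(1 + X)^3] makes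
   the third derivative absolutely summable at the singularity [X = -1]. *)
Definition cn_T : fps R := (2 `^ alpha)%:S * (p3 * fps_sqr cn_a) - q3 * cn_a.

Lemma fps_sqr_cn_a : fps_sqr cn_a = (1 - alpha / 2)%:S + (alpha / 2)%:S * (X * X).
Proof. by rewrite fps_sqrD fps_sqrM !fps_sqr_C fps_sqr_X. Qed.

Lemma asum3_cn_T : asum3 cn_T.
Proof.
have s1 := asum3_1X; have sa := asum3_cn_a.
apply: asum3D; last by apply: asum3N; apply: asum3M => //; exact: asum3_q3.
apply: asum3M; first exact: asum3C.
apply: asum3M; first by do 2 apply: asum3M => //.
rewrite fps_sqr_cn_a; apply: asum3D; first exact: asum3C.
by apply: asum3M; [exact: asum3C|apply: asum3M; exact: asum3X].
Qed.

Lemma fpsD_cn_T : fpsD cn_T = (2 `^ alpha)%:S *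
   (3 * ((1 + X) * (1 + X)) * fps_sqr cn_a + p3 * ((alpha / 2)%:S * (2 * X))) -
   ((3 + alpha)%:S * q2 * cn_a + q3 * (alpha / 2)%:S).
Proof.
rewrite /cn_T fpsD_sub fpsD_CM (fpsD_mul q3) fpsD_q3 fps_sqr_cn_a /cn_a.
rewrite !(fpsD_add, fpsD_C, fpsD_mul, fpsD_X, fpsD_1) /p3; ring.
Qed.

Lemma cn_T_real (x : R) : `|x| < 1 -> fps_ev cn_T x%:C%C =
  (2 `^ alpha * ((1 + x) * ((1 + x) * (1 + x)) * (1 - alpha / 2 + alpha / 2 * (x * x))) -
   (1 + x) * ((1 + x) * ((1 + x) * (1 + x) `^ alpha)) * (1 - alpha / 2 + alpha / 2 * x))%:C%C.
Proof.
move=> x1; have cx : normc (x%:C)%C < 1 by rewrite normcR.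
have cX := @fps_convX R; have cC := @fps_convC R; have cq := fps_conv_neg cb.
have eq : fps_ev q x%:C%C = _ := fw_neg_real hb x1.
have c1 := fps_convD (cC 1) cX; have cq1 := fps_convM c1 cq.
have cq2 := fps_convM c1 cq1; have cq3 := fps_convM c1 cq2.
have ca : fps_conv cn_a by apply: fps_convD => //; exact: fps_convM.
have ca2 := fps_conv_sqr ca; have cp2 := fps_convM c1 c1; have cp := fps_convM c1 cp2.
have e1 : fps_ev (1 + X) x%:C%C = (1 + x)%:C%C.
  by rewrite (fps_evD (cC 1) cX cx) fps_evX// (fps_evC 1 cx) -rmorphD.
have ea : fps_ev cn_a x%:C%C = (1 - alpha / 2 + alpha / 2 * x)%:C%C.
  by rewrite (fps_evD (cC _) (fps_convM (cC _) cX) cx) (fps_evM (cC _) cX cx) !fps_evC// fps_evX// -rmorphM -rmorphD.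
have ea2 : fps_ev (fps_sqr cn_a) x%:C%C = (1 - alpha / 2 + alpha / 2 * (x * x))%:C%C.
  rewrite fps_sqr_cn_a (fps_evD (cC _) (fps_convM (cC _) (fps_convM cX cX)) cx).
  by rewrite (fps_evM (cC _) (fps_convM cX cX) cx) (fps_evM cX cX cx) !fps_evC// fps_evX// -!rmorphM -rmorphD.
rewrite /cn_T (fps_evB (fps_convM (cC _) (fps_convM cp ca2)) (fps_convM cq3 ca) cx).
rewrite (fps_evM (cC _) (fps_convM cp ca2) cx) (fps_evM cp ca2 cx) (fps_evM c1 cp2 cx) (fps_evM c1 c1 cx).
rewrite (fps_evM cq3 ca cx) (fps_evM c1 cq2 cx) (fps_evM c1 cq1 cx) (fps_evM c1 cq cx).
by rewrite fps_evC// e1 ea ea2 eq -!rmorphM -rmorphB.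
Qed.

Lemma cn_DT_real (x : R) : `|x| < 1 -> fps_ev (fpsD cn_T) x%:C%C =
  (2 `^ alpha * (3 * ((1 + x) * (1 + x)) * (1 - alpha / 2 + alpha / 2 * (x * x)) +
     (1 + x) * ((1 + x) * (1 + x)) * (alpha / 2 * (2 * x))) -
   ((3 + alpha) * ((1 + x) * ((1 + x) * (1 + x) `^ alpha)) * (1 - alpha / 2 + alpha / 2 * x) +
    (1 + x) * ((1 + x) * ((1 + x) * (1 + x) `^ alpha)) * (alpha / 2)))%:C%C.
Proof.
move=> x1; have cx : normc (x%:C)%C < 1 by rewrite normcR.
have cX := @fps_convX R; have cC := @fps_convC R; have cq := fps_conv_neg cb.
have eq : fps_ev q x%:C%C = _ := fw_neg_real hb x1.
have c1 := fps_convD (cC 1) cX; have cq1 := fps_convM c1 cq.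
have cq2 := fps_convM c1 cq1; have cq3 := fps_convM c1 cq2.
have ca : fps_conv cn_a by apply: fps_convD => //; exact: fps_convM.
have ca2 := fps_conv_sqr ca; have cp2 := fps_convM c1 c1; have cp := fps_convM c1 cp2.
have e1 : fps_ev (1 + X) x%:C%C = (1 + x)%:C%C.
  by rewrite (fps_evD (cC 1) cX cx) fps_evX// (fps_evC 1 cx) -rmorphD.
have ea : fps_ev cn_a x%:C%C = (1 - alpha / 2 + alpha / 2 * x)%:C%C.
  by rewrite (fps_evD (cC _) (fps_convM (cC _) cX) cx) (fps_evM (cC _) cX cx) !fps_evC// fps_evX// -rmorphM -rmorphD.
have ea2 : fps_ev (fps_sqr cn_a) x%:C%C = (1 - alpha / 2 + alpha / 2 * (x * x))%:C%C.
  rewrite fps_sqr_cn_a (fps_evD (cC _) (fps_convM (cC _) (fps_convM cX cX)) cx).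
  by rewrite (fps_evM (cC _) (fps_convM cX cX) cx) (fps_evM cX cX cx) !fps_evC// fps_evX// -!rmorphM -rmorphD.
rewrite fpsD_cn_T -!fpsC_nat.
have c3 := fps_convM (cC 3) cp2; have cA := fps_convM c3 ca2.
have c2X := fps_convM (cC 2) cX; have caX := fps_convM (cC (alpha / 2)) c2X.
have cB := fps_convM cp caX; have cD := fps_convM (cC (3 + alpha)) cq2.
have cE := fps_convM cD ca; have cF := fps_convM cq3 (cC (alpha / 2)).
rewrite (fps_evB (fps_convM (cC _) (fps_convD cA cB)) (fps_convD cE cF) cx).
rewrite (fps_evM (cC _) (fps_convD cA cB) cx) (fps_evD cA cB cx) (fps_evD cE cF cx).
rewrite (fps_evM c3 ca2 cx) (fps_evM (cC _) cp2 cx) (fps_evM cp caX cx) (fps_evM (cC _) c2X cx).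
rewrite (fps_evM (cC _) cX cx) (fps_evM c1 cp2 cx) (fps_evM c1 c1 cx) (fps_evM cD ca cx).
rewrite (fps_evM (cC _) cq2 cx) (fps_evM cq3 (cC _) cx) (fps_evM c1 cq2 cx) (fps_evM c1 cq1 cx) (fps_evM c1 cq cx).
by rewrite !fps_evC// e1 ea ea2 eq fps_evX// -!(rmorphM, rmorphD, rmorphB).
Qed.

Lemma at_left_1_cvg : (fun x : R => x) @ 1^'- --> (1 : R).
Proof. by apply: cvg_at_left_filter; exact: cvg_id. Qed.

Lemma powR_1D_cvg : (fun x : R => (1 + x) `^ alpha) @ 1^'- --> (2 `^ alpha : R).
Proof.
apply: cvg_at_left_filter.
have h3 : is_derive (1 + 1 : R) (1 : R) (fun y => y `^ alpha) (alpha * (1 + 1) `^ (alpha - 1)).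
  by apply: is_derive1_powR; rewrite addr_gt0.
have /derivable1_diffP/differentiable_continuous h4 := @ex_derive _ _ _ _ _ _ _ h3.
apply: (@cvg_comp _ _ _ (fun x : R => 1 + x) (fun y => y `^ alpha) _ (nbhs (1 + 1 : R))) => //.
by apply: cvgD; [exact: cvg_cst|exact: cvg_id].
Qed.

Let lim1 (f : R -> R) (l : R) := f @ (1 : R)^'- --> l.
Let lim1C (c : R) : lim1 (fun=> c) c. Proof. exact: cvg_cst. Qed.
Arguments lim1C : clear implicits.
Let lim1D f g k l : lim1 f k -> lim1 g l -> lim1 (fun x => f x + g x) (k + l).
Proof. exact: cvgD. Qed.
Let lim1B f g k l : lim1 f k -> lim1 g l -> lim1 (fun x => f x - g x) (k - l).
Proof. exact: cvgB. Qed.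
Let lim1M f g k l : lim1 f k -> lim1 g l -> lim1 (fun x => f x * g x) (k * l).
Proof. exact: cvgM. Qed.

Lemma cn_T_cvg : (fun x : R => normc (fps_ev cn_T x%:C%C)) @ 1^'- --> (0 : R).
Proof.
pose t0 (x : R) := 2 `^ alpha * ((1 + x) * ((1 + x) * (1 + x)) * (1 - alpha / 2 + alpha / 2 * (x * x))) -
   (1 + x) * ((1 + x) * ((1 + x) * (1 + x) `^ alpha)) * (1 - alpha / 2 + alpha / 2 * x).
have h : t0 @ 1^'- --> (0 : R).
  rewrite [X in _ --> X](_ : _ =
    2 `^ alpha * ((1 + 1) * ((1 + 1) * (1 + 1)) * (1 - alpha / 2 + alpha / 2 * (1 * 1))) -
    (1 + 1) * ((1 + 1) * ((1 + 1) * 2 `^ alpha)) * (1 - alpha / 2 + alpha / 2 * 1)); last by ring.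
  have hx := at_left_1_cvg; have hp := powR_1D_cvg.
  have h1 := lim1D (lim1C 1) hx.
  have ha := lim1D (lim1C (1 - alpha / 2)) (lim1M (lim1C (alpha / 2)) hx).
  have ha2 := lim1D (lim1C (1 - alpha / 2)) (lim1M (lim1C (alpha / 2)) (lim1M hx hx)).
  exact: (lim1B (lim1M (lim1C (2 `^ alpha)) (lim1M (lim1M h1 (lim1M h1 h1)) ha2))
     (lim1M (lim1M h1 (lim1M h1 (lim1M h1 hp))) ha)).
have h' : (fun x => `|t0 x|) @ 1^'- --> (0 : R) by rewrite -(normr0 R); exact: cvg_norm h.
apply: cvg_trans h'; apply: near_eq_cvg; near=> x.
have x0 : 0 < x by near: x; exact: nbhs_left_gt.
have x1 : x < 1 by near: x; exact: nbhs_left_lt.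
have nx : `|x| < 1 by rewrite gtr0_norm.
by rewrite cn_T_real// normcR.
Unshelve. all: by end_near.
Qed.

(** This is where the weight alpha / 2 of the scheme matters: at 1 the derivative of 2^alpha a(x^2)
    is alpha 2^alpha, and so is that of (1 + x)^alpha a(x). With [cn_T_cvg], [cn_T] vanishes to
    second order at 1. *)
Lemma cn_DT_cvg : (fun x : R => normc (fps_ev (fpsD cn_T) x%:C%C)) @ 1^'- --> (0 : R).
Proof.
pose t1 (x : R) := 2 `^ alpha * (3 * ((1 + x) * (1 + x)) * (1 - alpha / 2 + alpha / 2 * (x * x)) +
     (1 + x) * ((1 + x) * (1 + x)) * (alpha / 2 * (2 * x))) -
   ((3 + alpha) * ((1 + x) * ((1 + x) * (1 + x) `^ alpha)) * (1 - alpha / 2 + alpha / 2 * x) +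
    (1 + x) * ((1 + x) * ((1 + x) * (1 + x) `^ alpha)) * (alpha / 2)).
have h : t1 @ 1^'- --> (0 : R).
  rewrite [X in _ --> X](_ : _ =
    2 `^ alpha * (3 * ((1 + 1) * (1 + 1)) * (1 - alpha / 2 + alpha / 2 * (1 * 1)) +
      (1 + 1) * ((1 + 1) * (1 + 1)) * (alpha / 2 * (2 * 1))) -
    ((3 + alpha) * ((1 + 1) * ((1 + 1) * 2 `^ alpha)) * (1 - alpha / 2 + alpha / 2 * 1) +
     (1 + 1) * ((1 + 1) * ((1 + 1) * 2 `^ alpha)) * (alpha / 2))); last by field.
  have hx := at_left_1_cvg; have hp := powR_1D_cvg.
  have h1 := lim1D (lim1C 1) hx.
  have ha := lim1D (lim1C (1 - alpha / 2)) (lim1M (lim1C (alpha / 2)) hx).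
  have ha2 := lim1D (lim1C (1 - alpha / 2)) (lim1M (lim1C (alpha / 2)) (lim1M hx hx)).
  exact: (lim1B (lim1M (lim1C (2 `^ alpha)) (lim1D (lim1M (lim1M (lim1C 3) (lim1M h1 h1)) ha2)
       (lim1M (lim1M h1 (lim1M h1 h1)) (lim1M (lim1C (alpha / 2)) (lim1M (lim1C 2) hx)))))
     (lim1D (lim1M (lim1M (lim1C (3 + alpha)) (lim1M h1 (lim1M h1 hp))) ha)
       (lim1M (lim1M h1 (lim1M h1 (lim1M h1 hp))) (lim1C (alpha / 2))))).
have h' : (fun x => `|t1 x|) @ 1^'- --> (0 : R) by rewrite -(normr0 R); exact: cvg_norm h.
apply: cvg_trans h'; apply: near_eq_cvg; near=> x.
have x0 : 0 < x by near: x; exact: nbhs_left_gt.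
have x1 : x < 1 by near: x; exact: nbhs_left_lt.
have nx : `|x| < 1 by rewrite gtr0_norm.
by rewrite cn_DT_real// normcR.
Unshelve. all: by end_near.
Qed.

End corrected_CN_symbols.

(** * Uniform jet bounds for the symbols *)

Section symbol_classes.
Context (R : realType) (alpha : R) (b : fps R).
Hypothesis alpha01 : 0 < alpha < 1.
Hypothesis hb : frac_weights alpha b.
Local Notation X := (fpsX R).
Local Notation "c %:S" := (fpsC c) (at level 2, format "c %:S").
Local Notation a := (cn_a alpha).
Local Notation q := (fps_neg b).
Local Notation T := (cn_T alpha b).
Local Notation p3 := ((1 + X) * ((1 + X) * (1 + X))).

Let cb := fw_conv hb.

Lemma cn_a_conv : fps_conv a.
Proof. by apply: asum_conv; exact: (asum3_cn_a alpha (isT : (0 <= 3)%N)). Qed.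

Lemma cn_T_conv : fps_conv T.
Proof. by apply: asum_conv; exact: (asum3_cn_T alpha01 hb (isT : (0 <= 3)%N)). Qed.

Lemma lim1_lin (N : R) : (fun x : R => N + (1 - x)) @ (1 : R)^'- --> N.
Proof.
rewrite [X in _ --> X](_ : _ = N + (1 - 1)); last by rewrite subrr addr0.
apply: cvgD; first exact: cvg_cst.
by apply: cvgB; [exact: cvg_cst|exact: at_left_1_cvg].
Qed.

Arguments lim1_lin : clear implicits.

Lemma normc_sub_real (z : R[i]) (x : R) : x < 1 -> normc (z - x%:C%C) <= normc (1 - z) + (1 - x).
Proof.
move=> x1; apply: (le_trans (normc_distD _ 1 _)); rewrite normcB lerD2l.
by rewrite -(rmorph1 (real_complex R)) -rmorphB normcR gtr0_norm ?subr_gt0.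
Qed.

(** Evaluation lives in the open disc, so the Taylor expansion is made at a real x < 1 with the
    summable second derivative as remainder, and then x tends to 1, where both the value and the
    derivative vanish. *)
Lemma cn_T_bounds : exists2 K, 0 <= K & forall z, normc z < 1 ->
  normc (fps_ev T z) <= K * normc (1 - z) ^+ 2 /\
  normc (fps_ev (fpsD T) z) <= K * normc (1 - z).
Proof.
have [K hK] := asum3_cn_T alpha01 hb (isT : (2 <= 3)%N).
have K0 : 0 <= K by apply: le_trans (hK 0%N); rewrite big_ord0.
have cT := cn_T_conv; have cDT := fps_conv_deriv cT.
exists K => // z z1; set N := normc (1 - z).
have hN := lim1_lin N; have h0 := cn_T_cvg hb; have h1 := cn_DT_cvg alpha01 hb.
split.
  have h : (fun x : R => (normc (fps_ev T x%:C%C) + (N + (1 - x)) * normc (fps_ev (fpsD T) x%:C%C)) +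
      K * (N + (1 - x)) ^+ 2) @ (1 : R)^'- --> K * N ^+ 2.
    rewrite [X in _ --> X](_ : _ = (0 + N * 0) + K * (N * N)); last by rewrite mulr0 !add0r expr2.
    apply: cvgD; first by apply: cvgD => //; exact: cvgM.
    by apply: cvgM; [exact: cvg_cst|]; exact: cvgM.
  apply: (cvgr_to_ge h); near=> x.
  have x0 : 0 < x by near: x; exact: nbhs_left_gt.
  have x1 : x < 1 by near: x; exact: nbhs_left_lt.
  have nx : normc (x%:C)%C < 1 by rewrite normcR gtr0_norm.
  have t2 := fps_taylor2 cT hK z1 nx; have dx := normc_sub_real z x1.
  have alg (u v w : R[i]) : u = v + w + (u - v - w) by ring.
  rewrite (alg (fps_ev T z) (fps_ev T x%:C%C) ((z - x%:C%C) * fps_ev (fpsD T) x%:C%C)).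
  apply: (le_trans (normcD _ _)); apply: lerD.
    apply: (le_trans (normcD _ _)); rewrite lerD2l normcM.
    by apply: ler_wpM2r => //; exact: normc_ge0.
  apply: (le_trans t2); apply: ler_wpM2l => //.
  by rewrite lerXn2r// nnegrE ?normc_ge0// (le_trans _ dx)// normc_ge0.
have h : (fun x : R => normc (fps_ev (fpsD T) x%:C%C) + K * (N + (1 - x))) @ (1 : R)^'- --> K * N.
  rewrite [X in _ --> X](_ : _ = 0 + K * N); last by rewrite add0r.
  by apply: cvgD => //; apply: cvgM => //; exact: cvg_cst.
apply: (cvgr_to_ge h); near=> x.
have x0 : 0 < x by near: x; exact: nbhs_left_gt.
have x1 : x < 1 by near: x; exact: nbhs_left_lt.
have nx : normc (x%:C)%C < 1 by rewrite normcR gtr0_norm.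
have t1 := fps_taylor1 cDT hK z1 nx; have dx := normc_sub_real z x1.
rewrite -[X in normc X <= _](subrK (fps_ev (fpsD T) x%:C%C)) addrC.
apply: (le_trans (normcD _ _)); rewrite lerD2l; apply: (le_trans t1).
exact: ler_wpM2l.
Unshelve. all: by end_near.
Qed.

(** With S = |p + mu a(w)|, the two facts mu (1 - alpha) <= S and |p| <= S + mu give |p| + mu <= S +
    2 mu <= [C0] S. *)
Let C0 := 1 + 2 / (1 - alpha).

(* [Re p >= 0] and [Re (a(w)) >= 1 - alpha > 0] exclude cancellation in [p + mu a(w)]. *)
Lemma symbol_lower (p w : R[i]) (mu : R) : 0 <= complex.Re p -> normc w < 1 -> 0 <= mu ->
  normc p + mu <= C0 * normc (p + mu%:C%C * fps_ev a w).
Proof.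
move=> p0 w1 mu0; have /andP[a0 a1] := alpha01; have a1' : 0 < 1 - alpha by lra.
have -> : fps_ev a w = (1 - alpha / 2)%:C%C + (alpha / 2)%:C%C * w.
  have cX := @fps_convX R; have cC := @fps_convC R.
  by rewrite (fps_evD (cC _) (fps_convM (cC _) cX) w1) (fps_evM (cC _) cX w1) !fps_evC// fps_evX.
set A := _ + _ * w; set S := normc (p + _).
have A1 : normc A <= 1.
  apply: (le_trans (normcD _ _)); rewrite normcM !normcR !ger0_norm; [|lra|lra].
  by have := normc_ge0 w; nra.
have ReA : mu * (1 - alpha) <= S.
  apply: le_trans (le_trans (ler_norm _) (Re_le_normc _)).
  have ReE (u v : R[i]) : complex.Re (u + mu%:C%C * ((1 - alpha / 2)%:C%C + (alpha / 2)%:C%C * v)) =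
      complex.Re u + mu * (1 - alpha / 2 + alpha / 2 * complex.Re v).
    by case: u v => [u1 u2] [v1 v2] /=; ring.
  rewrite ReE; have := Re_le_normc w; rewrite ler_norml => /andP[h _].
  have h2 : -1 <= complex.Re w by lra.
  have h3 : 1 - alpha <= 1 - alpha / 2 + alpha / 2 * complex.Re w by nra.
  by apply: (le_trans (ler_wpM2l mu0 h3)); rewrite lerDr.
have pS : normc p <= S + mu.
  rewrite -[X in normc X <= _](addrK (mu%:C%C * A)); apply: (le_trans (normcD _ _)).
  rewrite normcNN lerD2l normcM normcR ger0_norm//; exact: ler_piMr.
have muS : mu <= S / (1 - alpha) by rewrite ler_pdivlMr.
rewrite /C0; have -> : (1 + 2 / (1 - alpha)) * S = S + 2 * (S / (1 - alpha)) by ring.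
lra.
Qed.

Lemma ode_jets (s c : R) (f g : fps R) : (1 + s%:S * X) * fpsD f = c%:S * f ->
  (1 + s%:S * X) * fpsD (fpsD f) = (c - s)%:S * fpsD f /\
  (1 + s%:S * X) * fpsD (fpsD (fpsD f)) = (c - s - s)%:S * fpsD (fpsD f).
Proof.
have step d h : (1 + s%:S * X) * fpsD h = d%:S * h ->
    (1 + s%:S * X) * fpsD (fpsD h) = (d - s)%:S * fpsD h.
  move=> /(congr1 (@fpsD R)).
  rewrite fpsD_mul fpsD_add fpsD_1 fpsD_CM fpsD_X fpsD_CM add0r mulr1 fpsC_B => E.
  by rewrite mulrBl -E; ring.
by move=> /[dup] /step h1 _; split; [exact: h1|exact: step h1].
Qed.

Lemma ode_jets_ev (s c : R) (f : fps R) z : fps_conv f -> normc z < 1 -> `|s| <= 1 ->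
  `|c| <= 1 -> `|c - s| <= 1 -> `|c - s - s| <= 2 ->
  (1 + s%:S * X) * fpsD f = c%:S * f ->
  [/\ normc (1 + s%:C%C * z) * normc (fps_ev (fpsD f) z) <= normc (fps_ev f z),
   normc (1 + s%:C%C * z) * normc (fps_ev (fpsD (fpsD f)) z) <= normc (fps_ev (fpsD f) z) &
   normc (1 + s%:C%C * z) * normc (fps_ev (fpsD (fpsD (fpsD f))) z) <=
     2 * normc (fps_ev (fpsD (fpsD f)) z)].
Proof.
move=> cf z1 s1 c1 c2 c3 E; have [E2 E3] := ode_jets f E.
have cX := @fps_convX R; have cC := @fps_convC R.
have cs : fps_conv (1 + s%:S * X) by apply: fps_convD; [exact: (cC 1)|exact: fps_convM].
have es : fps_ev (1 + s%:S * X) z = 1 + s%:C%C * z.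
  by rewrite (fps_evD (cC 1) (fps_convM (cC _) cX) z1) (fps_evM (cC _) cX z1) (fps_evC 1 z1) !fps_evC// fps_evX.
have go d h B : fps_conv h -> `|d| <= B -> (1 + s%:S * X) * fpsD h = d%:S * h ->
    normc (1 + s%:C%C * z) * normc (fps_ev (fpsD h) z) <= B * normc (fps_ev h z).
  move=> ch dB /(congr1 (fun u => normc (fps_ev u z))).
  rewrite (fps_evM cs (fps_conv_deriv ch) z1) (fps_evM (cC _) ch z1) es fps_evC//.
  by rewrite !normcM normcR => ->; apply: ler_wpM2r => //; exact: normc_ge0.
have cd := fps_conv_deriv cf; have cdd := fps_conv_deriv cd.
split; [rewrite -[leRHS]mul1r; exact: go E|rewrite -[leRHS]mul1r; exact: go E2|exact: go E3].
Qed.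

Lemma fw_ode' : (1 + (-1)%:S * X) * fpsD b = (- alpha)%:S * b.
Proof. by rewrite !fpsC_N mulN1r (fw_ode alpha01 hb) mulNr. Qed.

Lemma fw_neg_ode' : (1 + 1%:S * X) * fpsD q = alpha%:S * q.
Proof. by rewrite mul1r (fw_neg_ode alpha01 hb). Qed.

Lemma jets_chain (e0 e1 e2 e3 r : R) : 0 <= r -> 0 <= e0 ->
  r * e1 <= e0 -> r * e2 <= e1 -> r * e3 <= 2 * e2 ->
  [/\ e1 * r <= 2 * e0, e2 * r ^+ 2 <= 2 * e0 & e3 * r ^+ 3 <= 2 * e0].
Proof.
move=> r0 e00 h1 h2 h3.
have h12 : e2 * r ^+ 2 <= e0.
  by rewrite expr2 mulrA mulrC; apply: le_trans h1; apply: ler_wpM2l => //; rewrite mulrC.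
split; [by rewrite mulrC; lra|by lra|].
rewrite exprSr mulrA mulrAC; apply: (@le_trans _ _ (2 * e2 * r ^+ 2)).
  by apply: ler_wpM2r; [exact: exprn_ge0|rewrite mulrC].
by rewrite -mulrA ler_wpM2l.
Qed.

Lemma jets_flat (e0 e1 e2 e3 s : R) : 1 <= s -> 0 <= e0 -> 0 <= e1 -> 0 <= e2 -> 0 <= e3 ->
  s * e1 <= e0 -> s * e2 <= e1 -> s * e3 <= 2 * e2 ->
  [/\ e1 <= 2 * e0, e2 <= 2 * e0 & e3 <= 2 * e0].
Proof.
move=> s1 e00 e10 e20 e30.
have drop e f : 0 <= e -> s * e <= f -> e <= f.
  by move=> ?; apply: le_trans; rewrite ler_peMl.
by move=> /(drop _ _ e10) h1 /(drop _ _ e20) h2 /(drop _ _ e30) h3; split; lra.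
Qed.

Section families.
Context (I : Type) (z : I -> R[i]).
Hypothesis z1 : forall i, normc (z i) < 1.

(** The size is |b(z)| itself, not a power of |1 - z|: being relative, the bound can be compared
    directly with |b(z)| + mu in quotients. The differential equation loses one factor |1 - z| per
    derivative. *)
Lemma ucls_b : ucls z (fun i => normc (fps_ev b (z i))) (fun=> b).
Proof.
split=> [i|//|]; first exact: normc_ge0.
exists 2 => // i k; have /andP[a0 a1] := alpha01.
have h := ode_jets_ev cb (z1 i) _ _ _ _ fw_ode'; move: h; rewrite normrN normr1 => /(_ (lexx _)) h.
have {h} [|||h1 h2 h3] := h.
- by rewrite normrN gtr0_norm// ltW.
- by rewrite opprK ler_norml; lra.
- by rewrite opprK ler_norml; lra.
rewrite rmorphN rmorph1 mulN1r in h1 h2 h3; have r0 := ltW (jet_r_gt0 z1 i).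
have [j1 j2 j3] := jets_chain r0 (normc_ge0 _) h1 h2 h3.
case: k => [|[|[|[|//]]]] _; rewrite /jet //=.
by rewrite expr0 mulr1 ler_peMl ?normc_ge0// ler1n.
Qed.

(** In the right half-plane |1 + z| >= 1, so the differential equation of (1 + X)^alpha bounds its
    derivatives by 2 |q(z)| with no loss. *)
Lemma ucls_q : (forall i, 0 <= complex.Re (z i)) ->
  ucls z (fun i => normc (fps_ev q (z i))) (fun=> q).
Proof.
move=> Rez; have cq := fps_conv_neg cb.
split=> [i|//|]; first exact: normc_ge0.
(* 16 = 2 * 8: the factor 2 from [jets_flat], and |1 - z|^k <= 2^3. *)
exists 16 => // i k; have /andP[a0 a1] := alpha01.
have h := ode_jets_ev cq (z1 i) _ _ _ _ fw_neg_ode'; move: h; rewrite normr1 => /(_ (lexx _)) h.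
have {h} [|||h1 h2 h3] := h.
- by rewrite gtr0_norm// ltW.
- by rewrite ler_norml; lra.
- by rewrite ler_norml; lra.
rewrite rmorph1 mul1r in h1 h2 h3.
have z1' : 1 <= normc (1 + z i).
  apply: le_trans (le_trans (ler_norm _) (Re_le_normc _)).
  by rewrite (_ : complex.Re (1 + z i) = 1 + complex.Re (z i)) ?lerDl//; case: (z i).
have r0 := ltW (jet_r_gt0 z1 i); have r2 := jet_r_le2 z1 i.
have [j1 j2 j3] := jets_flat z1' (normc_ge0 _) (normc_ge0 _) (normc_ge0 _) (normc_ge0 _) h1 h2 h3.
have j0 : normc (fps_ev q (z i)) <= 2 * normc (fps_ev q (z i)).
  by rewrite ler_peMl ?normc_ge0// ler1n.
move=> k3; rewrite (_ : 16 * _ = (2 * normc (fps_ev q (z i))) * 8); last first.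
  by rewrite mulrAC -natrM.
apply: ler_pM; [exact: normc_ge0|exact: exprn_ge0| |].
  have jE n : jet n q = iter n (@fpsD R) q by [].
  rewrite jE; case: k k3 {jE} => [|[|[|[|k]]]] k3; last (exfalso; clear -k3; by []); clear k3.
  - by rewrite [iter _ _ _]/=; exact: j0.
  - by rewrite [iter _ _ _]/=; exact: j1.
  - by rewrite [iter _ _ _]/=; exact: j2.
  - by rewrite [iter _ _ _]/=; exact: j3.
apply: (@le_trans _ _ (2 ^+ k)); first by rewrite lerXn2r ?nnegrE.
by case: k k3 => [|[|[|[|//]]]] _; rewrite -natrX ler_nat.
Qed.

Lemma ucls_mul1 f g : ucls z (fun=> 1) f -> ucls z (fun=> 1) g ->
  ucls z (fun=> 1) (fun i => f i * g i).
Proof. by move=> uf ug; rewrite -[X in ucls _ (fun=> X)](mulr1 1); exact: ucls_mul. Qed.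

Lemma ucls_a : ucls z (fun=> 1) (fun=> a).
Proof.
apply: (ucls_add z1); first exact: ucls_const.
by apply: ucls_mul1; [exact: ucls_const|exact: ucls_X].
Qed.

Lemma ucls_nat n : ucls z (fun=> 1) (fun=> n%:R).
Proof.
have -> : (fun=> n%:R) = (fun=> n%:R%:S) :> (I -> fps R) by apply/funext => i; rewrite fpsC_nat.
exact: ucls_const.
Qed.

Lemma ucls_1DX : ucls z (fun=> 1) (fun=> 1 + X).
Proof. by apply: (ucls_add z1); [exact: (ucls_const z1 1)|exact: ucls_X]. Qed.

Lemma ucls_sqr_a : ucls z (fun=> 1) (fun=> fps_sqr a).
Proof.
rewrite fps_sqr_cn_a; apply: (ucls_add z1); first exact: ucls_const.
by apply: ucls_mul1; [exact: ucls_const|apply: ucls_mul1; exact: ucls_X].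
Qed.

(** Orders 0 and 1 come from the double zero at 1, orders 2 and 3 from summability alone; at order 3
    the surplus factor |1 - z| is at most 2. *)
Lemma ucls_T : ucls z (fun i => normc (1 - z i) ^+ 2) (fun=> T).
Proof.
have [K K0 hK] := cn_T_bounds.
have [K2 hK2] := asum3_cn_T alpha01 hb (isT : (2 <= 3)%N).
have [K3 hK3] := asum3_cn_T alpha01 hb (isT : (3 <= 3)%N).
have K20 : 0 <= K2 by apply: le_trans (hK2 0%N); rewrite big_ord0.
have K30 : 0 <= K3 by apply: le_trans (hK3 0%N); rewrite big_ord0.
split=> [i|i|]; [by rewrite exprn_ge0 ?normc_ge0|exact: cn_T_conv|].
exists (K + K2 + 2 * K3); first by rewrite !addr_ge0// mulr_ge0.
move=> i k; have [h0 h1] := hK _ (z1 i).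
have h2 := asum_ev hK2 (z1 i); have h3 := asum_ev hK3 (z1 i).
have r0 := ltW (jet_r_gt0 z1 i); have r2 := jet_r_le2 z1 i.
set r := normc (1 - z i) in r0 r2 h0 h1 *.
have rr : 0 <= r ^+ 2 by exact: exprn_ge0.
have KK : K * r ^+ 2 <= (K + K2 + 2 * K3) * r ^+ 2.
  by rewrite ler_wpM2r// -addrA lerDl addr_ge0// mulr_ge0.
case: k => [|[|[|[|//]]]] _.
- by rewrite expr0 mulr1; exact: le_trans h0 KK.
- rewrite expr1; apply: le_trans KK; rewrite expr2 mulrA; exact: ler_wpM2r.
- apply: ler_wpM2r => //; apply: (le_trans h2); rewrite (addrC K) -addrA lerDl addr_ge0// mulr_ge0//.
- rewrite exprSr mulrA mulrAC; apply: ler_wpM2r => //.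
  apply: (@le_trans _ _ (K3 * 2)); first by apply: ler_pM => //; exact: normc_ge0.
  by rewrite mulrC lerDr addr_ge0.
Qed.

End families.

End symbol_classes.

(** * Uniform jet bounds for the generating functions *)

Section coefficient_bounds.
Context (R : realType) (alpha : R) (b : fps R).
Hypothesis alpha01 : 0 < alpha < 1.
Hypothesis hb : frac_weights alpha b.
Local Notation X := (fpsX R).
Local Notation "c %:S" := (fpsC c) (at level 2, format "c %:S").
Local Notation a := (cn_a alpha).
Local Notation q := (fps_neg b).
Local Notation T := (cn_T alpha b).
Local Notation p3 := ((1 + X) * ((1 + X) * (1 + X))).

Let cb := fw_conv hb.
Let ca := cn_a_conv alpha.
Let cX := @fps_convX R.
Let cC := @fps_convC R.

(* With [mu = lambda tau^alpha], [cn_gf] and [be_gf] characterize the generating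
   functions of [Y n / Y 0 - 1] for the corrected Crank-Nicolson and the backward
   Euler scheme. *)
Definition cn_gf (mu : R) (W : fps R) := fps_conv W /\
  (b + mu%:S * a) * (2 * (1 - X) * W) = - (mu%:S * a * (X * (3 - X))).

Definition be_gf (mu : R) (V : fps R) := fps_conv V /\
  (b + mu%:S) * ((1 - X) * V) = - mu%:S.

Section families.
Context (I : Type) (z : I -> R[i]) (mu : I -> R).
Hypothesis z1 : forall i, normc (z i) < 1.
Hypothesis mu0 : forall i, 0 <= mu i.

Let P i := normc (fps_ev b (z i)).
Let Q i := normc (fps_ev q (z i)).
Let r i := normc (1 - z i).

Let P0 i : 0 < P i. Proof. exact: (fw_neq0 alpha01 hb). Qed.
Let r0 i : 0 < r i. Proof. exact: jet_r_gt0. Qed.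

Lemma ucls_bmu t (f : fps R) : 1 <= t -> ucls z (fun=> 1) (fun=> f) ->
  ucls z (fun i => P i + mu i) (fun i => t%:S * b + (mu i)%:S * f).
Proof.
move=> t1 uf; apply: (ucls_add z1).
- apply: (@ucls_le _ _ _ (fun i => 1 * P i) _ 1) => //.
  + by move=> i; rewrite !mul1r lerDl.
  + by move=> i; rewrite addr_ge0// ltW.
  + by apply: (ucls_mul z1); [exact: ucls_const|exact: (ucls_b alpha01 hb)].
- apply: (@ucls_le _ _ _ (fun i => mu i * 1) _ 1) => //.
  + by move=> i; rewrite mulr1 mul1r lerDr ltW.
  + by move=> i; rewrite addr_ge0// ltW.
  + by apply: (ucls_mul z1) => //; exact: ucls_C.
Qed.

Lemma ev_bmu t i : fps_ev (t%:S * b + (mu i)%:S * a) (z i) =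
  t%:C%C * fps_ev b (z i) + (mu i)%:C%C * fps_ev a (z i).
Proof.
rewrite (fps_evD (fps_convM (cC _) cb) (fps_convM (cC _) ca) (z1 i)).
by rewrite (fps_evM (cC _) cb (z1 i)) (fps_evM (cC _) ca (z1 i)) !fps_evC.
Qed.

Let c0 := (1 + 2 / (1 - alpha))^-1.
Let c0_gt0 : 0 < c0.
Proof.
by have /andP[a0 a1] := alpha01; rewrite invr_gt0 addr_gt0// divr_gt0// subr_gt0.
Qed.

Lemma bmu_lower t i : 1 <= t -> c0 * (P i + mu i) <=
  normc (fps_ev (t%:S * b + (mu i)%:S * a) (z i)).
Proof.
move=> t1; rewrite ev_bmu mulrC.
have C0p : 0 < 1 + 2 / (1 - alpha) by rewrite -invr_gt0.
rewrite (ler_pdivrMr _ _ C0p).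
have p0 : 0 <= complex.Re (t%:C%C * fps_ev b (z i)).
  have := fw_Re_gt0 alpha01 hb (z1 i); case: (fps_ev b (z i)) => u v /=.
  by move=> u0; rewrite mul0r subr0 mulr_ge0// ltW// (lt_le_trans _ t1).
rewrite [leRHS]mulrC; apply: (le_trans _ (symbol_lower alpha01 p0 (z1 i) (mu0 i))).
rewrite lerD2r normcM normcR ler_peMl ?normc_ge0//.
exact: le_trans t1 (ler_norm _).
Qed.

Lemma bmu1_lower i : P i + mu i <= 2 * normc (fps_ev (1%:S * b + (mu i)%:S * 1) (z i)).
Proof.
rewrite (fps_evD (fps_convM (cC _) cb) (fps_convM (cC _) (cC 1)) (z1 i)).
rewrite (fps_evM (cC _) cb (z1 i)) (fps_evM (cC _) (cC 1) (z1 i)) !fps_evC//.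
rewrite rmorph1 mul1r mulr1.
have := ltW (fw_Re_gt0 alpha01 hb (z1 i)).
rewrite /P; move: (fps_ev b (z i)) => p p0.
have h1 : mu i <= normc (p + (mu i)%:C%C).
  apply: le_trans (le_trans (ler_norm _) (Re_le_normc _)).
  by case: p p0 => u v /=; rewrite lerDr.
have h2 : normc p <= normc (p + (mu i)%:C%C).
  rewrite -(@ler_pXn2r _ 2)// ?nnegrE ?normc_ge0// !sqr_normcE.
  have := mu0 i; case: p p0 h1 => u v /= u0 _ m0; rewrite addr0 lerD2r lerXn2r ?nnegrE//.
    by rewrite addr_ge0.
  by rewrite lerDl.
by rewrite mulr_natl mulr2n lerD.
Qed.

(** The numerator has size mu and the denominator |1 - z| (|b| + mu), and mu <= |b| + mu removes
    [mu]. *)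
Lemma ucls_cn (W : I -> fps R) : (forall i, cn_gf (mu i) (W i)) -> ucls z (fun i => (r i)^-1) W.
Proof.
move=> hW.
have ug : ucls z (fun i => r i * (P i + mu i)) (fun i => 2 * (1 - X) * (1%:S * b + (mu i)%:S * a)).
  apply: (ucls_mul z1); last by apply: ucls_bmu => //; exact: ucls_a.
  apply: (@ucls_le _ _ _ (fun i => 1 * r i) _ 1) => //.
  - by move=> i; rewrite ltW.
  - by apply: (ucls_mul z1); [exact: ucls_nat|exact: ucls_1X].
have uh : ucls z mu (fun i => - ((mu i)%:S * a * (X * (3 - X)))).
  apply: ucls_opp => //; apply: (@ucls_le _ _ _ (fun i => mu i * 1 * 1) _ 1) => //.
    by move=> i; rewrite mul1r !mulr1.
  apply: (ucls_mul z1).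
    by apply: (ucls_mul z1); [exact: ucls_C|exact: ucls_a].
  apply: (ucls_mul1 z1); first exact: ucls_X.
  by apply: (ucls_add z1); [exact: ucls_nat|apply: ucls_opp => //; exact: ucls_X].
apply: (@ucls_le _ _ _ (fun i => mu i / (r i * (P i + mu i))) _ 1) => //.
- move=> i; rewrite mul1r invfM mulrCA ler_piMr ?invr_ge0 ?(ltW (r0 i))//.
  by rewrite ler_pdivrMr ?mul1r ?lerDr ?(ltW (P0 i))// ltr_wpDr.
- by move=> i; rewrite invr_ge0 ltW.
apply: (ucls_div z1 (c := 2 * c0) _ _ _ _ _ ug uh) => [|i|i|i|i].
- by rewrite mulr_gt0.
- by rewrite mulr_gt0// ltr_wpDr.
- rewrite (fps_evM (fps_convM _ (fps_convB (cC 1) cX)) _ (z1 i)); last 2 first.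
  + by rewrite -fpsC_nat; exact: cC.
  + by apply: fps_convD; apply: fps_convM => //; exact: cC.
  rewrite -fpsC_nat (fps_evM (cC _) (fps_convB (cC 1) cX) (z1 i)) (fps_evB (cC 1) cX (z1 i)).
  rewrite fps_evC// fps_evX// (fps_evC 1 (z1 i)) !normcM normcR normr_nat.
  rewrite -/(r i) mulrACA; apply: ler_wpM2l; first by rewrite mulr_ge0// ltW.
  exact: bmu_lower.
- by case: (hW i).
- by case: (hW i) => _ <-; rewrite fpsC_1; ring.
Qed.

(** Both series have the same pole at 1. Since X (3 - X) = 2 - (1 - X)(2 - X) and 2 (1 - a) = alpha
    (1 - X), the common numerator is mu (1 - X) ((2 - X) a (b + mu) + alpha b); its factor 1 - X
    cancels the pole. *)
Lemma ucls_cn_be (W V : I -> fps R) : (forall i, cn_gf (mu i) (W i)) ->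
  (forall i, be_gf (mu i) (V i)) -> ucls z (fun=> 1) (fun i => W i - V i).
Proof.
move=> hW hV.
pose m i := P i + mu i.
have m0 i : 0 < m i by rewrite ltr_wpDr.
have u1 : ucls z m (fun i => 1%:S * b + (mu i)%:S * a).
  by apply: ucls_bmu => //; exact: ucls_a.
have u2 : ucls z m (fun i => 1%:S * b + (mu i)%:S * 1).
  by apply: ucls_bmu => //; exact: (ucls_nat z1 1).
have ug : ucls z (fun i => r i * (m i * m i)) (fun i => 2 * (1 - X) *
    ((1%:S * b + (mu i)%:S * a) * (1%:S * b + (mu i)%:S * 1))).
  apply: (ucls_mul z1); last exact: (ucls_mul z1).
  apply: (@ucls_le _ _ _ (fun i => 1 * r i) _ 1) => //.
  - by move=> i; rewrite ltW.
  - by apply: (ucls_mul z1); [exact: ucls_nat|exact: ucls_1X].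
have uh : ucls z (fun i => mu i * (r i * m i)) (fun i => (mu i)%:S * ((1 - X) *
    ((2 - X) * a * (1%:S * b + (mu i)%:S * 1) + alpha%:S * b))).
  apply: (ucls_mul z1); first exact: ucls_C.
  apply: (ucls_mul z1); first exact: ucls_1X.
  apply: (ucls_add z1).
    apply: (@ucls_le _ _ _ (fun i => 1 * m i) _ 1) => //.
      - by move=> i; rewrite ltW.
    apply: (ucls_mul z1) => //; apply: (ucls_mul1 z1); last exact: ucls_a.
    by apply: (ucls_add z1); [exact: ucls_nat|apply: ucls_opp => //; exact: ucls_X].
  apply: (@ucls_le _ _ _ (fun i => 1 * P i) _ 1) => //.
  - by move=> i; rewrite !mul1r lerDl.
  - by move=> i; rewrite ltW.
  by apply: (ucls_mul z1); [exact: ucls_const|exact: (ucls_b alpha01 hb)].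
apply: (@ucls_le _ _ _ (fun i => (mu i * (r i * m i)) / (r i * (m i * m i))) _ 1) => //.
  move=> i; rewrite mulr1 (_ : _ / _ = mu i / m i); last first.
    by field; rewrite !gt_eqF.
  by rewrite ler_pdivrMr// mul1r lerDr ltW.
apply: (ucls_div z1 (c := 2 * (c0 * 2^-1)) _ _ _ _ _ ug uh) => [|i|i|i|i].
- by rewrite !mulr_gt0// invr_gt0.
- by rewrite !mulr_gt0.
- have cD1 : fps_conv (1%:S * b + (mu i)%:S * a) by apply: fps_convD; apply: fps_convM => //; exact: cC.
  have cD2 : fps_conv (1%:S * b + (mu i)%:S * 1).
    exact: (fps_convD (fps_convM (cC 1) cb) (fps_convM (cC (mu i)) (cC 1))).
  rewrite -fpsC_nat (fps_evM (fps_convM (cC _) (fps_convB (cC 1) cX)) (fps_convM cD1 cD2) (z1 i)).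
  rewrite (fps_evM (cC _) (fps_convB (cC 1) cX) (z1 i)) (fps_evB (cC 1) cX (z1 i)).
  rewrite (fps_evM cD1 cD2 (z1 i)) [fps_ev 2%:S _]fps_evC// fps_evX// (fps_evC 1 (z1 i)) 3!normcM normcR normr_nat.
  rewrite -/(r i) mulrACA; apply: ler_wpM2l; first by rewrite mulr_ge0// ltW.
  rewrite mulrACA; apply: ler_pM.
  + exact: mulr_ge0 (ltW c0_gt0) (ltW (m0 i)).
  + by rewrite mulr_ge0 ?invr_ge0// ltW.
  + exact: bmu_lower.
  + by rewrite mulrC ler_pdivrMr// mulrC; exact: bmu1_lower.
- by case: (hW i) => ? _; case: (hV i) => ? _; exact: fps_convB.
- case: (hW i) => _ e1; case: (hV i) => _ e2.
  rewrite fpsC_1 !mul1r mulr1.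
  transitivity ((b + (mu i)%:S) * ((b + (mu i)%:S * a) * (2 * (1 - X) * W i)) -
     2 * (b + (mu i)%:S * a) * ((b + (mu i)%:S) * ((1 - X) * V i))); first by ring.
  have aE : 2 * a = 2 - alpha%:S * (1 - X).
    rewrite /cn_a -(fpsC_nat _ 2) mulrDr mulrA -!fpsC_M.
    have -> : 2 * (1 - alpha / 2) = 2 - alpha by field.
    have -> : 2 * (alpha / 2) = alpha by field.
    by rewrite fpsC_B; ring.
  rewrite e1 e2; move: aE; move: (a) => A aE.
  have -> : 2 * (b + (mu i)%:S * A) = 2 * b + (mu i)%:S * (2 - alpha%:S * (1 - X)).
    by rewrite -aE; ring.
  have -> : (mu i)%:S * A * (X * (3 - X)) = (mu i)%:S * A * (2 - (1 - X) * (2 - X)) by ring.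
  have -> : (b + (mu i)%:S) * - ((mu i)%:S * A * (2 - (1 - X) * (2 - X))) =
     (b + (mu i)%:S) * ((mu i)%:S * (A * (1 - X) * (2 - X) - 2 * A)) by ring.
  by rewrite aE; ring.
Qed.

Lemma le_div_prod (m s rr m1 m2 P' : R) : 0 < rr -> 0 < m1 -> 0 < m2 -> 0 <= m -> m <= m1 ->
  0 <= P' -> P' <= m2 -> m * rr ^+ 2 * (m2 + P') / (rr * (m1 * m2)) <= 2 * rr.
Proof.
move=> rr0 m10 m20 m0 mm P'0 P'm.
rewrite (_ : _ / _ = rr * (m / m1) * ((m2 + P') / m2)); last by field; rewrite !gt_eqF.
rewrite (_ : 2 * rr = rr * 1 * 2); last by rewrite mulr1 mulrC.
have a1 : m / m1 <= 1 by rewrite ler_pdivrMr// mul1r.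
have a2 : (m2 + P') / m2 <= 2 by rewrite ler_pdivrMr//; lra.
apply: ler_pM => //; [|by rewrite divr_ge0 ?addr_ge0// ltW|by apply: ler_wpM2l => //; exact: ltW].
by rewrite mulr_ge0 ?divr_ge0 ?(ltW rr0) ?(ltW m10).
Qed.

(* [W(z^2)] at step [1] against [W(z)] at step [1/2]: the residue at [z = 1] is
   matched to second order. *)
Lemma ucls_doubling (W W2 : I -> fps R) : (forall i, 0 <= complex.Re (z i)) ->
  (forall i, cn_gf (mu i) (W i)) -> (forall i, cn_gf (2 `^ (- alpha) * mu i) (W2 i)) ->
  ucls z r (fun i => 2 * fps_sqr (W i) - W2 i).
Proof.
move=> Rez hW hW2; pose t := 2 `^ alpha : R.
have t1 : 1 <= t.
  have /andP[a0 _] := alpha01; have h12 : 1 <= 2 :> R by rewrite ler1n.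
  by have := ler_powR h12 (ltW a0); rewrite powRr0.
have t0 : 0 < t by apply: lt_le_trans t1.
have tN : 2 `^ (- alpha) = t^-1 by rewrite powRN.
pose m1 i := P i * Q i + mu i; pose m2 i := P i + mu i.
have cq := fps_conv_neg cb.
(* [D1] is the coarse symbol at X^2, with b(X^2) factored as b(X) b(-X). [D2] is 2^alpha times the
   symbol of the halved step, so that both carry the same [mu]. *)
pose D1 i := b * q + (mu i)%:S * fps_sqr a; pose D2 i := t%:S * b + (mu i)%:S * a.
have D1E i : D1 i = fps_sqr (1%:S * b + (mu i)%:S * a).
  rewrite /D1 (fw_mul_neg hb) (fps_sqrD (1%:S * b)) (fps_sqrM 1%:S) (fps_sqrM (mu i)%:S) !fps_sqr_C.
  by rewrite -[1%:S]/(1 : fps R) mul1r.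
have z21 i : normc (z i ^+ 2) < 1 by rewrite normcX exprn_ilt1// normc_ge0.
have PQE i : normc (fps_ev b (z i ^+ 2)) = P i * Q i.
  by rewrite -(fps_ev_sqr cb (z1 i)) -(fw_mul_neg hb) (fps_evM cb cq (z1 i)) normcM.
have Q0 i : 0 <= Q i by exact: normc_ge0.
have m10 i : 0 < m1 i by rewrite /m1 -PQE ltr_wpDr// (fw_neq0 alpha01 hb).
have m20 i : 0 < m2 i by rewrite ltr_wpDr.
have cD2 i : fps_conv (D2 i) by exact: (fps_convD (fps_convM (cC _) cb) (fps_convM (cC _) ca)).
have cD1 i : fps_conv (D1 i).
  rewrite D1E; apply: fps_conv_sqr.
  exact: (fps_convD (fps_convM (cC _) cb) (fps_convM (cC _) ca)).
have l1 i : c0 * m1 i <= normc (fps_ev (D1 i) (z i)).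
  rewrite D1E fps_ev_sqr//; last exact: (fps_convD (fps_convM (cC _) cb) (fps_convM (cC _) ca)).
  rewrite (fps_evD (fps_convM (cC _) cb) (fps_convM (cC _) ca) (z21 i)).
  rewrite (fps_evM (cC _) cb (z21 i)) (fps_evM (cC _) ca (z21 i)) (fps_evC 1 (z21 i)) fps_evC//.
  rewrite rmorph1 mul1r /m1 -PQE mulrC.
  have C0p : 0 < 1 + 2 / (1 - alpha) by rewrite -invr_gt0.
  rewrite (ler_pdivrMr _ _ C0p) [leRHS]mulrC; apply: symbol_lower => //.
  exact: ltW (fw_Re_gt0 alpha01 hb (z21 i)).
have l2 i : c0 * m2 i <= normc (fps_ev (D2 i) (z i)) by exact: bmu_lower.
have u1 : ucls z m1 D1.
  apply: (ucls_add z1).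
  - apply: (@ucls_le _ _ _ (fun i => P i * Q i) _ 1) => //.
    + by move=> i; rewrite mul1r lerDl.
    + by move=> i; rewrite ltW.
    + by apply: (ucls_mul z1); [exact: (ucls_b alpha01 hb)|exact: (ucls_q alpha01 hb)].
  - apply: (@ucls_le _ _ _ (fun i => mu i * 1) _ 1) => //.
    + by move=> i; rewrite mulr1 mul1r lerDr mulr_ge0// ltW.
    + by move=> i; rewrite ltW.
    + by apply: (ucls_mul z1); [exact: ucls_C|exact: ucls_sqr_a].
have u2 : ucls z m2 D2 by apply: ucls_bmu => //; exact: ucls_a.
have u1D := ucls_1DX z1.
(* One factor 1 + X comes from 1 - X^2 in the coarse equation, the other three are those built into
   [cn_T]. *)
have ug : ucls z (fun i => r i * (m1 i * m2 i)) (fun i => 2 * (1 - X) *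
    ((1 + X) * p3) * (D1 i * D2 i)).
  apply: (ucls_mul z1); last exact: (ucls_mul z1).
  apply: (@ucls_le _ _ _ (fun i => 1 * r i * 1) _ 1) => //.
  - by move=> i; rewrite !mul1r mulr1.
  - by move=> i; rewrite ltW.
  - apply: (ucls_mul z1); first by apply: (ucls_mul z1); [exact: ucls_nat|exact: ucls_1X].
    by do ?[apply: (ucls_mul1 z1)].
have uXX : ucls z (fun i => r i ^+ 2) (fun=> (1 - X) * (1 - X)).
  apply: (@ucls_le _ _ _ (fun i => r i * r i) _ 1) => //.
  - by move=> i; rewrite mul1r expr2.
  - by move=> i; rewrite exprn_ge0// ltW.
  - by apply: (ucls_mul z1); exact: ucls_1X.
(* Two cancellations. The corrected right-hand sides give X (3 - X)(1 + X) - 2 X^2 (3 - X^2) = (1 -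
   X)^2 X (2 X + 3), a double zero owed to the correction. In a D1 - a(X^2) D2 the terms with mu^2
   cancel, and what remains is - b [cn_T] / (1 + X)^3. *)
pose H i := (mu i)%:S * (((1 - X) * (1 - X)) * (X * (2 * X + 3) * p3 * fps_sqr a) * D2 i -
  (X * (3 - X) * (1 + X)) * T * b).
have uh : ucls z (fun i => mu i * r i ^+ 2 * (m2 i + P i)) H.
  have mP i : 0 <= r i ^+ 2 * (m2 i + P i).
    by rewrite mulr_ge0 ?exprn_ge0 ?addr_ge0 ?(ltW (m20 i)) ?(ltW (P0 i)) ?(ltW (r0 i)).
  apply: (@ucls_le _ _ _ (fun i => mu i * (r i ^+ 2 * (m2 i + P i))) _ 1) => //.
  - by move=> i; rewrite mul1r mulrA.
  - by move=> i; rewrite -mulrA mulr_ge0.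
  have uX := ucls_X z1.
  apply: (ucls_mul z1); first exact: ucls_C.
  apply: (ucls_add z1).
    apply: (@ucls_le _ _ _ (fun i => r i ^+ 2 * 1 * m2 i) _ 1) => //.
      by move=> i; rewrite mul1r mulr1 ler_wpM2l ?exprn_ge0 ?lerDl ?(ltW (P0 i)) ?(ltW (r0 i)).
    apply: (ucls_mul z1) => //; apply: (ucls_mul z1) => //.
    apply: (ucls_mul1 z1); last exact: ucls_sqr_a.
    apply: (ucls_mul1 z1); last by do ?[apply: (ucls_mul1 z1)].
    apply: (ucls_mul1 z1) => //; apply: (ucls_add z1); last exact: ucls_nat.
    by apply: (ucls_mul1 z1) => //; exact: ucls_nat.
  apply: ucls_opp => //.
  apply: (@ucls_le _ _ _ (fun i => 1 * r i ^+ 2 * P i) _ 1) => //.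
    by move=> i; rewrite !mul1r ler_wpM2l ?exprn_ge0 ?lerDr ?(ltW (m20 i)) ?(ltW (r0 i)).
  apply: (ucls_mul z1); last exact: (ucls_b alpha01 hb).
  apply: (ucls_mul z1); last exact: (ucls_T alpha01 hb).
  do 2 apply: (ucls_mul1 z1) => //.
  by apply: (ucls_add z1); [exact: ucls_nat|apply: ucls_opp].
apply: (@ucls_le _ _ _ (fun i => (mu i * r i ^+ 2 * (m2 i + P i)) / (r i * (m1 i * m2 i))) _ 2) => //.
- move=> i; apply: le_div_prod => //; last by rewrite lerDl.
    by rewrite lerDr mulr_ge0// ltW.
  exact: ltW.
- by move=> i; rewrite ltW.
apply: (ucls_div z1 (c := 2 * (c0 * c0)) _ _ _ _ _ ug uh) => [|i|i|i|i].
- by rewrite !mulr_gt0.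
- by rewrite !mulr_gt0.
- have c1 : fps_conv (1 + X) by exact: (fps_convD (cC 1) cX).
  have c1' : fps_conv (1 - X) by exact: (fps_convB (cC 1) cX).
  have c2 := fps_convM c1 c1; have c3 := fps_convM c1 c2; have c4 := fps_convM c1 c3.
  have c5 := fps_convM (cC 2) c1'; have cDD := fps_convM (cD1 i) (cD2 i).
  have e1 : fps_ev (1 + X) (z i) = 1 + z i.
    by rewrite (fps_evD (cC 1) cX (z1 i)) fps_evX// (fps_evC 1 (z1 i)) rmorph1.
  have e1' : fps_ev (1 - X) (z i) = 1 - z i.
    by rewrite (fps_evB (cC 1) cX (z1 i)) fps_evX// (fps_evC 1 (z1 i)) rmorph1.
  have n1 : 1 <= normc (1 + z i).
    apply: le_trans (le_trans (ler_norm _) (Re_le_normc _)).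
    by rewrite (_ : complex.Re (1 + z i) = 1 + complex.Re (z i)) ?lerDl//; case: (z i).
  rewrite -(fpsC_nat _ 2) (fps_evM (fps_convM c5 c4) cDD (z1 i)) (fps_evM c5 c4 (z1 i)).
  rewrite (fps_evM (cC _) c1' (z1 i)) (fps_evM c1 c3 (z1 i)) (fps_evM c1 c2 (z1 i)) (fps_evM c1 c1 (z1 i)).
  rewrite (fps_evM (cD1 i) (cD2 i) (z1 i)) [fps_ev 2%:S _]fps_evC// e1 e1' !normcM normcR normr_nat -/(r i).
  rewrite mulrACA (mulrACA c0); apply: ler_pM.
  + by rewrite mulr_ge0// ltW.
  + by rewrite !mulr_ge0// ltW.
  + rewrite ler_peMr ?mulr_ge0 ?(ltW (r0 i))//.
    by do 3 (apply: mulr_ege1 => //).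
  + by apply: ler_pM => //; rewrite mulr_ge0// ltW.
- case: (hW i) => cW _; case: (hW2 i) => cW2 _; apply: fps_convB => //.
  by rewrite -(fpsC_nat _ 2); apply: fps_convM; [exact: cC|exact: fps_conv_sqr].
- case: (hW i) => _ /(congr1 (@fps_sqr R)) e1; case: (hW2 i) => _ e2.
  have {}e1 : D1 i * (2 * ((1 - X) * (1 + X)) * fps_sqr (W i)) =
      - ((mu i)%:S * fps_sqr a * (X * X * (3 - X * X))).
    move: e1; rewrite !(fps_sqrM, fps_sqrD, fps_sqrB, fps_sqrN) -!fpsC_nat !fps_sqr_C fps_sqr_X.
    rewrite -!fpsC_D (_ : 1 + 1 = 2) // (_ : 1 + 2 = 3 :> R); last by ring.
    rewrite !fpsC_nat fpsC_1 /D1 (fw_mul_neg hb) !fps_sqr_cn_a => <-.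
    by congr (_ * (2 * _ * _)); ring.
  have {}e2 : D2 i * (2 * (1 - X) * W2 i) = - ((mu i)%:S * a * (X * (3 - X))).
    have := congr1 (fun f => t%:S * f) e2; rewrite tN mulrN !fpsC_M.
    have tt : t%:S * t^-1%:S = 1 by rewrite -fpsC_M mulfV ?gt_eqF.
    rewrite (_ : t%:S * (t^-1%:S * (mu i)%:S * a * (X * (3 - X))) =
      (t%:S * t^-1%:S) * ((mu i)%:S * a * (X * (3 - X)))); last by ring.
    rewrite (_ : t%:S * ((b + t^-1%:S * (mu i)%:S * a) * (2 * (1 - X) * W2 i)) =
      (t%:S * b + (t%:S * t^-1%:S) * ((mu i)%:S * a)) * (2 * (1 - X) * W2 i)); last by ring.
    by rewrite tt !mul1r.
  rewrite /H /cn_T.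
  transitivity (2 * p3 * D2 i * (D1 i * (2 * ((1 - X) * (1 + X)) * fps_sqr (W i))) -
    (1 + X) * p3 * D1 i * (D2 i * (2 * (1 - X) * W2 i))); first by ring.
  by rewrite e1 e2 /D1 /D2 -/t; ring.
Qed.

End families.
End coefficient_bounds.

(** * Crank-Nicolson sequences *)

Section coefficient_estimates.
Context (R : realType).
Local Notation X := (fpsX R).
Local Notation "c %:S" := (fpsC c) (at level 2, format "c %:S").

Lemma bernoulli_le (x : R) m : 0 <= x <= 1 -> 1 - m%:R * x <= (1 - x) ^+ m.
Proof.
move=> /andP[x0 x1]; elim: m => [|m IH]; first by rewrite mul0r subr0 expr0.
rewrite exprS -[m.+1%:R]natr1; apply: (@le_trans _ _ ((1 - x) * (1 - m%:R * x))).
  by have : 0 <= (m%:R : R) by []; nra.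
by apply: ler_wpM2l => //; rewrite subr_ge0.
Qed.

(* Radius [1 - 1/(2m)] costs only a constant factor on the [m]-th coefficient. *)
Lemma fps_coef3 (f : fps R) (A : R) N : fps_conv f -> 0 <= A -> (4 <= N)%N ->
  (forall z, normc z = 1 - (2 * (N - 3)%:R)^-1 -> normc (fps_ev (jet 3 f) z) <=
     A * (normc (1 - z) ^- 2 + normc (1 + z) ^- 2)) ->
  `|f N| <= 64 * A / N%:R ^+ 2.
Proof.
move=> cf A0 N4; have [m mE] : exists m, N = m.+4 by exists (N - 4)%N; lia.
rewrite {N N4}mE (_ : (m.+4 - 3)%N = m.+1); last by lia.
set M : R := m.+1%:R; have M1 : 1 <= M by rewrite ler1n.
set x := (2 * M)^-1 => hA.
have xM : M * x = 2^-1 by rewrite /x invfM mulrCA mulfV ?mulr1// gt_eqF// (lt_le_trans ltr01).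
have x0 : 0 < x by rewrite invr_gt0 mulr_gt0// (lt_le_trans ltr01).
have x1 : x <= 2^-1 by nra.
have r01 : 0 < 1 - x < 1 by apply/andP; split; lra.
have h := fps_coef_bound m.+1 (@jet_conv R 3 _ cf) r01 A0 hA.
have pw : 2^-1 <= (1 - x) ^+ m.+1.
  apply: le_trans (bernoulli_le _ _); first by rewrite -/M xM; lra.
  by apply/andP; split; lra.
have e8 : 8 * A / (1 - (1 - x)) = 16 * A * M.
  have -> : 1 - (1 - x) = x by ring.
  by rewrite /x invrK; ring.
rewrite e8 in h.
have {}h : `|jet 3 f m.+1| <= 32 * A * M.
  by have := normr_ge0 (jet 3 f m.+1); nra.
have jE : `|jet 3 f m.+1| = `|f m.+4| * ((M + 3) * (M + 2) * (M + 1)).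
  have -> : jet 3 f m.+1 = f m.+4 * ((M + 3) * (M + 2) * (M + 1)).
    have -> : jet 3 f m.+1 = f m.+4 *+ m.+4 *+ m.+3 *+ m.+2 by [].
    rewrite -!mulrnA -[LHS]mulr_natr; congr (_ * _).
    by rewrite !natrM mulrA /M natr1 -!natrD addn2 addn3.
  by rewrite normrM; congr (_ * _); rewrite ger0_norm// !mulr_ge0//; lra.
rewrite jE in h.
have NE : m.+4%:R = M + 3 :> R by rewrite /M -natrD; congr (_%:R); lia.
rewrite NE ler_pdivlMr ?exprn_gt0//; last by lra.
have f0 := normr_ge0 (f m.+4); move: (`|f m.+4|) f0 h => F F0 h.
(* One of the three factors gained by differentiation pays for the [M] of the circle mean. *)
have h2 : F * ((M + 3) * (M + 2)) <= 32 * A.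
  rewrite -(ler_pM2r (_ : 0 < M + 1)); last by lra.
  apply: (@le_trans _ _ (32 * A * M)); first by rewrite -!mulrA in h *; exact: h.
  by apply: ler_wpM2l; [rewrite mulr_ge0|lra].
apply: (@le_trans _ _ (2 * (F * ((M + 3) * (M + 2))))); last by lra.
by rewrite [leRHS]mulrCA ler_wpM2l// expr2; nra.
Qed.

(** Course-of-values recursion: [h n] reads only indices below [n], so the k-th iterate is already
    final at every index below k. *)
Lemma rec_exists (h : nat -> (nat -> R) -> R) :
  (forall n w w', (forall k, (k < n)%N -> w k = w' k) -> h n w = h n w') ->
  exists w, forall n, w n = h n w.
Proof.
move=> hl; pose it := fix it k : nat -> R := if k is k'.+1 then fun n => h n (it k') else fun=> 0.
have stab n k l : (n < k)%N -> (n < l)%N -> it k n = it l n.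
  elim/ltn_ind: n k l => n IH [//|k] [//|l] nk nl /=; apply: hl => j jn.
  by apply: IH => //; [exact: leq_trans jn _|exact: leq_trans jn _].
exists (fun n => it n.+1 n) => n; change (h n (it n) = h n (fun k => it k.+1 k)).
by apply: hl => k kn; exact: stab.
Qed.

Lemma fps_solve (f c : fps R) : f 0%N != 0 -> exists g : fps R, f * g = c.
Proof.
move=> f0; pose h n (w : nat -> R) := (c n - \sum_(i < n) f i.+1 * w (n - i.+1)%N) / f 0%N.
have [w hw] : exists w, forall n, w n = h n w.
  apply: rec_exists => n w w' ww; rewrite /h; congr ((_ - _) / _).
  by apply: eq_bigr => i _; rewrite ww// ltn_subrL; case: n i {ww} => // -[].
exists w; apply/funext => n; rewrite fpsME big_ord_recl subn0 hw /h mulrCA mulfV// mulr1.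
rewrite (eq_bigr (fun i : 'I_n => f i.+1 * w (n - i.+1)%N)) ?subrK//.
Qed.

End coefficient_estimates.

Section cn_sequence.
Context (R : realType) (alpha : R) (b : fps R).
Hypothesis alpha01 : 0 < alpha < 1.
Hypothesis hb : frac_weights alpha b.
Local Notation X := (fpsX R).
Local Notation "c %:S" := (fpsC c) (at level 2, format "c %:S").
Local Notation a := (cn_a alpha).

(* [X (3 - X) / (2 (1 - X))], the generating function of the corrected constant [1]. *)
Definition cn_k : fps R := fun n => match n with 0 => 0 | 1 => 3 / 2 | _ => 1 end.

Lemma cn_kE : 2 * (1 - X) * cn_k = X * (3 - X).
Proof.
rewrite -!(fpsC_nat R).
have -> : 2%:S * (1 - X) * cn_k = 2%:S * (cn_k - X * cn_k) by ring.
have -> : X * (3%:S - X) = 3%:S * X - X * X by ring.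
apply/funext => n; rewrite fpsCM !fpsBE fpsCM !fpsXM /fpsX.
by case: n => [|[|[|[|n]]]] /=; lra.
Qed.

Arguments cn_k : simpl never.

Lemma cn_aM (f : fps R) n : (a * f) n =
  (1 - alpha / 2) * f n + (alpha / 2) * (if n is m.+1 then f m else 0).
Proof. by rewrite mulrDl -mulrA fpsDE !fpsCM fpsXM. Qed.

(** The whole scheme for W n = Y n / Y 0 - 1. The coefficients of [a * cn_k] are 0, 3/2 - 3 alpha /
    4, 1 + alpha / 4 and then 1: the total weights of Y 0 in the first, second and later steps after
    Y n is written as Y 0 (1 + W n). *)
Definition cn_seq (mu : R) (W : fps R) := (b + mu%:S * a) * W = - (mu%:S * (a * cn_k)).

Lemma cn_seq_coef mu W n : cn_seq mu W -> \sum_(i < n.+1) b i * W (n - i)%N +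
  mu * ((1 - alpha / 2) * W n + (alpha / 2) * (if n is m.+1 then W m else 0)) =
  - (mu * ((1 - alpha / 2) * cn_k n + (alpha / 2) * (if n is m.+1 then cn_k m else 0))).
Proof.
move=> /(congr1 (fun f : fps R => f n)).
by rewrite mulrDl fpsDE fpsME -mulrA fpsCM cn_aM fpsNE fpsCM cn_aM.
Qed.

Lemma cn_seq_exists mu : 0 <= mu -> exists W, cn_seq mu W.
Proof.
move=> mu0; apply: fps_solve; rewrite fpsDE fpsCM (fw_0 hb).
rewrite /cn_a fpsDE fpsCM /fpsX /= mulr0 addr0 gt_eqF//.
by have /andP[a0 a1] := alpha01; nra.
Qed.

(** Gives the generating function radius of convergence at least 1, and settles the first index of
    [cn_doubling]. The bound B is chosen with (1 - alpha) B = 3/2, the largest value of [cn_k],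
    which makes the induction close for every [mu]. *)
Lemma cn_seq_bound mu W : 0 <= mu -> cn_seq mu W -> forall n, `|W n| <= 3 / 2 / (1 - alpha).
Proof.
move=> mu0 hW; have /andP[a0 a1] := alpha01.
have W0 : W 0%N = 0.
  have := cn_seq_coef 0 hW; rewrite big_ord1 (fw_0 hb)/= mul1r !mulr0 !addr0 mulr0 oppr0.
  move=> h; have : (1 + mu * (1 - alpha / 2)) * W 0%N = 0 by lra.
  by move/eqP; rewrite mulf_eq0 gt_eqF//=; [move/eqP|nra].
set B := 3 / 2 / (1 - alpha); have BE : B * (1 - alpha) = 3 / 2 by rewrite divfK// gt_eqF// subr_gt0.
have B0 : 0 < B by rewrite divr_gt0// ?subr_gt0//; lra.
have B32 : 3 / 2 <= B by nra.
elim/ltn_ind => -[|n] IH; first by rewrite W0 normr0; lra.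
have k0 m : 0 <= cn_k m <= 3 / 2 by case: m => [|[|m]]; rewrite /cn_k; lra.
have := cn_seq_coef n.+1 hW.
rewrite big_ord_recl/= subn0 (fw_0 hb) mul1r big_ord_recl/= subn1/=.
(* The weight of index 1 is separated because it combines with the averaging term into alpha - mu
   alpha / 2; the remaining weights sum to at most 1 - alpha in absolute value. *)
have b1 : b 1%N = - alpha by have := fw_rec alpha01 hb 0; rewrite (fw_0 hb) mul1r mulr1 sub0r.
rewrite /bump /= b1; set S := \sum_(i < n) _ => E.
have SB : `|S| <= (1 - alpha) * B.
  apply: (le_trans (ler_norm_sum _ _ _)).
  have tl : \sum_(i < n) `|b i.+2| <= 1 - alpha.
    have := fw_abs_tail alpha01 hb n.+1; rewrite big_ord_recl/= b1 normrN gtr0_norm//.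
    by under eq_bigr do rewrite /bump /= add1n; lra.
  apply: (@le_trans _ _ ((\sum_(i < n) `|b i.+2|) * B)); last by apply: ler_wpM2r => //; lra.
  rewrite mulr_suml; apply: ler_sum => i _; rewrite normrM !add1n ler_wpM2l// IH//.
  by rewrite !subSS ltnS (leq_trans (leq_subr _ _)).
have Wn := IH n (leqnn _).
have kn1 := k0 n.+1; have kn := k0 n.
have E2 : (1 + mu * (1 - alpha / 2)) * W n.+1 = (alpha - mu * (alpha / 2)) * W n - S -
   mu * ((1 - alpha / 2) * cn_k n.+1 + (alpha / 2) * cn_k n) by lra.
have cf0 : 0 < 1 + mu * (1 - alpha / 2) by nra.
rewrite -(ler_pM2l cf0) -[X in X * `|_|](gtr0_norm cf0) -normrM E2.
have kb : `|mu * ((1 - alpha / 2) * cn_k n.+1 + (alpha / 2) * cn_k n)| <= mu * (3 / 2).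
  rewrite ger0_norm; last by rewrite mulr_ge0// addr_ge0// mulr_ge0//; lra.
  by rewrite ler_wpM2l//; nra.
apply: (@le_trans _ _ (`|alpha - mu * (alpha / 2)| * B + (1 - alpha) * B + mu * (3 / 2))).
  apply: (le_trans (ler_normB _ _)); apply: lerD => //.
  apply: (le_trans (ler_normB _ _)); apply: lerD => //.
  by rewrite normrM ler_wpM2l.
have [m2|m2] := lerP mu 2.
  by rewrite ger0_norm; nra.
rewrite ler0_norm; last by nra.
rewrite -BE; nra.
Qed.

Lemma cn_seq_gf mu W : 0 <= mu -> cn_seq mu W -> cn_gf alpha b mu W.
Proof.
move=> mu0 hW; split; first by apply: fps_conv_bounded; exact: cn_seq_bound hW.
rewrite mulrCA hW -cn_kE; ring.
Qed.

Lemma cn_seq_unique mu W (Z : nat -> R) N : 0 <= mu -> cn_seq mu W ->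
  ((1 <= N)%N -> \sum_(j < 2) b (1 - j)%N * (Z j - Z 0%N) +
     mu * ((1 - alpha / 2) * Z 1%N + (1 / 2 - alpha / 4) * Z 0%N) = 0) ->
  ((2 <= N)%N -> \sum_(j < 3) b (2 - j)%N * (Z j - Z 0%N) +
     mu * ((1 - alpha / 2) * Z 2%N + alpha / 2 * Z 1%N + alpha / 4 * Z 0%N) = 0) ->
  (forall n, (3 <= n <= N)%N -> \sum_(j < n.+1) b (n - j)%N * (Z j - Z 0%N) +
     mu * ((1 - alpha / 2) * Z n + alpha / 2 * Z n.-1) = 0) ->
  forall n, (n <= N)%N -> Z n = Z 0%N * (1 + W n).
Proof.
move=> mu0 hW h1 h2 h3.
have /andP[a0 a1] := alpha01.
have W0 : W 0%N = 0.
  have := cn_seq_coef 0 hW; rewrite big_ord1 (fw_0 hb)/= mul1r !mulr0 !addr0 mulr0 oppr0.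
  move=> h; have : (1 + mu * (1 - alpha / 2)) * W 0%N = 0 by lra.
  by move/eqP; rewrite mulf_eq0 gt_eqF//=; [move/eqP|nra].
(* The difference satisfies the homogeneous scheme with V 0 = 0; as the leading coefficient 1 + mu
   (1 - alpha / 2) is positive, it vanishes step by step. *)
pose V n := Z n - Z 0%N - Z 0%N * W n.
have V0 : V 0%N = 0 by rewrite /V W0 subrr mulr0 subr0.
have hV n : (n < N)%N -> \sum_(j < n.+2) b (n.+1 - j)%N * V j +
    mu * ((1 - alpha / 2) * V n.+1 + alpha / 2 * V n) = 0.
  move=> nN.
  have e1 : \sum_(j < n.+2) b (n.+1 - j)%N * (Z j - Z 0%N) + mu * ((1 - alpha / 2) *
     (Z n.+1 - Z 0%N) + alpha / 2 * (Z n - Z 0%N)) +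
     mu * ((1 - alpha / 2) * cn_k n.+1 + alpha / 2 * cn_k n) * Z 0%N = 0.
    case: n nN => [|[|n]] nN.
    - by have := h1 nN; rewrite /cn_k => h; lra.
    - by have := h2 nN; rewrite /cn_k => h; lra.
    - by have := h3 n.+3 nN; rewrite /cn_k /= => h; lra.
  have := cn_seq_coef n.+1 hW.
  rewrite (reindex_inj rev_ord_inj).
  rewrite (eq_bigr (fun j : 'I_n.+2 => b (n.+1 - j)%N * W j)); last first.
    by move=> j _; rewrite [nat_of_ord (rev_ord j)]/= subSS subKn// -ltnS.
  move=> e2; rewrite /V.
  have -> : \sum_(j < n.+2) b (n.+1 - j)%N * (Z j - Z 0%N - Z 0%N * W j) =
     \sum_(j < n.+2) b (n.+1 - j)%N * (Z j - Z 0%N) - Z 0%N * \sum_(j < n.+2) b (n.+1 - j)%N * W j.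
    by rewrite mulr_sumr -sumrB; apply: eq_bigr => j _; ring.
  move: (\sum_(j < n.+2) _) (\sum_(j < n.+2) _) e1 e2 => S2 S1 e1 e2.
  have -> : S2 = - (mu * ((1 - alpha / 2) * W n.+1 + alpha / 2 * W n)) -
    mu * ((1 - alpha / 2) * cn_k n.+1 + alpha / 2 * cn_k n) by lra.
  have -> : S1 = - (mu * ((1 - alpha / 2) * (Z n.+1 - Z 0%N) + alpha / 2 * (Z n - Z 0%N))) -
     mu * ((1 - alpha / 2) * cn_k n.+1 + alpha / 2 * cn_k n) * Z 0%N by lra.
  ring.
suff hn n : (n <= N)%N -> V n = 0.
  by move=> n /hn; rewrite /V => h; lra.
elim/ltn_ind: n => -[//|n] IH nN.
have := hV n nN; rewrite big_ord_recr/= subnn (fw_0 hb) mul1r.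
rewrite big1 ?add0r; last first.
  by move=> j _; rewrite IH ?mulr0//; exact: ltnW (leq_trans (ltn_ord j) nN).
rewrite (IH n)// ?(ltnW nN)// mulr0 addr0 => h.
have : (1 + mu * (1 - alpha / 2)) * V n.+1 = 0 by lra.
by move/eqP; rewrite mulf_eq0 gt_eqF//=; [move/eqP|nra].
Qed.

End cn_sequence.

(** * Halving the step, and comparison with backward Euler *)

Section discrete_estimates.
Context (R : realType) (alpha : R) (b : fps R).
Hypothesis alpha01 : 0 < alpha < 1.
Hypothesis hb : frac_weights alpha b.

Lemma jet3_neg (f : fps R) : jet 3 (fps_neg f) = - fps_neg (jet 3 f).
Proof. by rewrite /jet /= fpsD_neg fpsD_opp fpsD_neg opprK fpsD_neg. Qed.

Lemma fps_neg_sqr (f : fps R) : fps_neg (fps_sqr f) = fps_sqr f.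
Proof.
apply/funext => n; rewrite /fps_neg /fps_sqr; case: ifPn; first by rewrite mulr0.
by move=> /negbTE no; rewrite -signr_odd no mul1r.
Qed.

Lemma fps_negK (f : fps R) : fps_neg (fps_neg f) = f.
Proof. by apply/funext => n; rewrite /fps_neg mulrA -exprMn mulrNN mulr1 expr1n mul1r. Qed.

Lemma doubling_jet : exists2 K, 0 <= K & forall mu (W W2 : fps R) z, 0 <= mu ->
  cn_gf alpha b mu W -> cn_gf alpha b (2 `^ (- alpha) * mu) W2 -> normc z < 1 ->
  normc (fps_ev (jet 3 (2 * fps_sqr W - W2 - fps_neg W2)) z) <=
    K * (normc (1 - z) ^- 2 + normc (1 + z) ^- 2).
Proof.
(* All admissible data form a single index type: one constant of [ucls] is then uniform in [mu], in
   the point and in the series. *)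
pose I1 := {p : R * R[i] * fps R * fps R | [/\ 0 <= p.1.1.1 /\ normc p.1.1.2 < 1,
   0 <= complex.Re p.1.1.2, cn_gf alpha b p.1.1.1 p.1.2 & cn_gf alpha b (2 `^ (- alpha) * p.1.1.1) p.2]}.
pose z1 (i : I1) := (sval i).1.1.2.
have z11 (i : I1) : normc (z1 i) < 1 by case: i => p [[]].
pose I2 := {p : R * R[i] * fps R | [/\ 0 <= p.1.1, normc p.1.2 < 1 & cn_gf alpha b p.1.1 p.2]}.
pose z2 (i : I2) := (sval i).1.2.
have z21 (i : I2) : normc (z2 i) < 1 by case: i => p [].
have [_ _ [K1 K10 h1]] : ucls z1 (fun i => normc (1 - z1 i)) (fun i => 2 * fps_sqr (sval i).1.2 - (sval i).2).
  by apply: (@ucls_doubling _ _ _ alpha01 hb _ z1 (fun i => (sval i).1.1.1)) => // -[p []] // [].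
have [_ _ [K2 K20 h2]] : ucls z2 (fun i => (normc (1 - z2 i))^-1) (fun i => (sval i).2).
  by apply: (@ucls_cn _ _ _ alpha01 hb _ z2 (fun i => (sval i).1.1)) => // -[p []].
exists (K1 + K2); first exact: addr_ge0.
move=> mu W W2 z mu0 hW hW2.
have mu20 : 0 <= 2 `^ (- alpha) * mu by rewrite mulr_ge0// powR_ge0.
have cW : fps_conv W by case: hW.
have cW2 : fps_conv W2 by case: hW2.
have cF : fps_conv (2 * fps_sqr W - W2).
  by apply: fps_convB => //; rewrite -(fpsC_nat _ 2); apply: fps_convM; [exact: fps_convC|exact: fps_conv_sqr].
have cG : fps_conv (2 * fps_sqr W - W2 - fps_neg W2) by apply: fps_convB => //; exact: fps_conv_neg.
set G := _ - fps_neg W2 in cG *.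
(* [G] is even, so its third derivative is odd and the right-hand side is symmetric. In the right
   half-plane W2(-z) is smooth: |1 + z| >= 1 weakens its bound |1 + z|^-4 to |1 + z|^-2. *)
suff main w : normc w < 1 -> 0 <= complex.Re w -> normc (fps_ev (jet 3 G) w) <=
    (K1 + K2) * (normc (1 - w) ^- 2 + normc (1 + w) ^- 2).
  move=> zlt1; have [rz|rz] := leP 0 (complex.Re z); first exact: main.
  have nz1 : normc (- z) < 1 by rewrite normcNN.
  have GE : fps_neg G = G.
    rewrite /G !fps_negB fps_negM fps_neg_sqr fps_negK -(fpsC_nat _ 2) fps_neg_C.
    by rewrite -!addrA (addrC (- _)).
  have -> : fps_ev (jet 3 G) z = - fps_ev (jet 3 G) (- z).
    have cj := @jet_conv R 3 _ cG.
    have e : jet 3 G = - fps_neg (jet 3 G) by rewrite -jet3_neg GE.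
    rewrite [in LHS]e (fps_evN (fps_conv_neg cj) zlt1); congr (- _).
    exact: fps_ev_neg.
  rewrite normcNN; have := main _ nz1; rewrite opprK [X in _ * X]addrC; apply.
  by move: rz; case: (z) => u v /= u0; rewrite oppr_ge0 ltW.
move=> w1 rw.
have nw1 : normc (- w) < 1 by rewrite normcNN.
have e1 : normc (fps_ev (jet 3 (2 * fps_sqr W - W2)) w) * normc (1 - w) ^+ 3 <= K1 * normc (1 - w).
  exact: h1 (exist _ (mu, w, W, W2) (And4 (conj mu0 w1) rw hW hW2)) 3 (leqnn _).
have e2 : normc (fps_ev (jet 3 W2) (- w)) * normc (1 - - w) ^+ 3 <= K2 * (normc (1 - - w))^-1.
  exact: h2 (exist _ (_, - w, W2) (And3 mu20 nw1 hW2)) 3 (leqnn _).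
rewrite opprK in e2.
have n1 : 1 <= normc (1 + w).
  apply: le_trans (le_trans (ler_norm _) (Re_le_normc _)).
  by rewrite (_ : complex.Re (1 + w) = 1 + complex.Re w) ?lerDl//; case: (w) rw.
have r0 : 0 < normc (1 - w).
  exact: (@jet_r_gt0 R unit (fun=> w) (fun=> w1) tt).
rewrite /G jetD jetN jet3_neg opprK fps_evD//; [|exact: jet_conv|by apply: fps_conv_neg; exact: jet_conv].
rewrite fps_ev_neg//; last exact: jet_conv.
apply: (le_trans (normcD _ _)).
have B0 := normc_ge0 (fps_ev (jet 3 W2) (- w)).
move: (normc (fps_ev (jet 3 W2) (- w))) B0 e2 => B B0 e2.
move: (normc (fps_ev (jet 3 (2 * fps_sqr W - W2)) w)) e1 => A e1.
move: (normc (1 - w)) r0 e1 => r r0 e1; move: (normc (1 + w)) n1 e2 => s s1 e2.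
clear -K10 K20 r0 e1 s1 e2 B0.
have s0 : 0 < s by lra.
have {}e1 : A <= K1 * r ^- 2.
  rewrite ler_pdivlMr ?exprn_gt0// -(ler_pM2r r0) -mulrA -exprSr.
  exact: e1.
have {}e2 : B <= K2 * s ^- 2.
  rewrite ler_pdivlMr ?exprn_gt0//; move: e2; rewrite ler_pdivlMr// -mulrA -exprSr.
  by apply: le_trans; rewrite ler_wpM2l// ler_weXn2l.
have : 0 <= r ^- 2 by rewrite invr_ge0 exprn_ge0// ltW.
have : 0 <= s ^- 2 by rewrite invr_ge0 exprn_ge0// ltW.
nra.
Qed.

Lemma cn_doubling : exists2 C, 0 <= C & forall mu (W W2 : fps R) n, 0 <= mu ->
  cn_seq alpha b mu W -> cn_seq alpha b (2 `^ (- alpha) * mu) W2 -> (1 <= n)%N ->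
  `|W n - W2 (2 * n)%N| <= C / n%:R ^+ 2.
Proof.
have [K K0 hK] := doubling_jet.
set B := 3 / 2 / (1 - alpha).
have B0 : 0 <= B by have /andP[a0 a1] := alpha01; rewrite !divr_ge0 ?subr_ge0// ltW.
(* [fps_coef3] needs an index of at least 4, that is n >= 2; for n = 1 the uniform bound [B] is used
   for each of the two values. *)
exists (64 * K + 2 * B); first by clear -K0 B0; lra.
move=> mu W W2 n mu0 hW hW2 n1.
have mu20 : 0 <= 2 `^ (- alpha) * mu by rewrite mulr_ge0// powR_ge0.
have gW := cn_seq_gf alpha01 hb mu0 hW.
have gW2 := cn_seq_gf alpha01 hb mu20 hW2.
have n0 : 0 < n%:R :> R by rewrite ltr0n.
rewrite ler_pdivlMr ?exprn_gt0//.
case: n n1 n0 => [//|[|n]] _ n0.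
  rewrite expr1n mulr1; apply: (le_trans (ler_normB _ _)).
  have := cn_seq_bound alpha01 hb mu0 hW 1; have := cn_seq_bound alpha01 hb mu20 hW2 (2 * 1).
  by rewrite -/B; lra.
have cG : fps_conv (2 * fps_sqr W - W2 - fps_neg W2).
  case: gW => cW _; case: gW2 => cW2 _.
  apply: fps_convB; last exact: fps_conv_neg.
  by apply: fps_convB => //; rewrite -(fpsC_nat _ 2); apply: fps_convM; [exact: fps_convC|exact: fps_conv_sqr].
have N4 : (4 <= 2 * n.+2)%N by lia.
have := fps_coef3 cG K0 N4.
have rlt (z : R[i]) : normc z = 1 - (2 * (2 * n.+2 - 3)%:R)^-1 -> normc z < 1.
  by move=> ->; rewrite ltrBlDr ltrDl invr_gt0 mulr_gt0// ltr0n; lia.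
move=> /(_ (fun z hz => hK mu W W2 z mu0 gW gW2 (rlt z hz))).
have -> : (2 * fps_sqr W - W2 - fps_neg W2) (2 * n.+2)%N = 2 * (W n.+2 - W2 (2 * n.+2)%N).
  rewrite !fpsBE -(fpsC_nat _ 2) fpsCM /fps_sqr /fps_neg mul2n odd_double doubleK.
  by rewrite -signr_odd odd_double mul1r; ring.
rewrite normrM normr_nat natrM exprMn ler_pdivlMr ?mulr_gt0 ?exprn_gt0//.
have := exprn_ge0 2 (ltW n0); move: (n.+2%:R ^+ 2) (`|_|) (normr_ge0 (W n.+2 - W2 (2 * n.+2)%N)) => s t t0 s0.
by have := mulr_ge0 t0 s0; nra.
Qed.

Lemma cn_be : exists2 C, 0 <= C & forall mu (W V : fps R) n, 0 <= mu ->
  cn_seq alpha b mu W -> be_gf b mu V -> (4 <= n)%N -> `|W n - V n| <= C / n%:R.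
Proof.
pose I2 := {p : R * R[i] * fps R * fps R | [/\ 0 <= p.1.1.1, normc p.1.1.2 < 1,
   cn_gf alpha b p.1.1.1 p.1.2 & be_gf b p.1.1.1 p.2]}.
pose z2 (i : I2) := (sval i).1.1.2.
have z21 (i : I2) : normc (z2 i) < 1 by case: i => p [].
have [_ _ [K K0 hK]] : ucls z2 (fun=> 1) (fun i => (sval i).1.2 - (sval i).2).
  by apply: (@ucls_cn_be _ _ _ alpha01 hb _ z2 (fun i => (sval i).1.1.1)) => // -[p []].
exists (128 * K); first exact: mulr_ge0.
move=> mu W V n mu0 hW gV n4.
have gW := cn_seq_gf alpha01 hb mu0 hW.
have cG : fps_conv (W - V) by case: gW => ? _; case: gV => ? _; exact: fps_convB.
set M : R := (n - 3)%:R.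
have M1 : 1 <= M by rewrite ler1n; lia.
(* The third derivative is only of size |1 - z|^-3 here. On the circle of radius 1 - 1/(2M) one
   factor is at most 2M, which costs one power of n in the result. *)
have A0 : 0 <= K * (2 * M) by rewrite !mulr_ge0//; lra.
have n0 : 0 < n%:R :> R by rewrite ltr0n; lia.
have Mn : M <= n%:R by rewrite ler_nat leq_subr.
have M0 : 0 < 2 * M by lra.
have x1 : 0 < (2 * M)^-1 <= 1.
  by rewrite invr_gt0 M0 invf_le1//; lra.
have := fps_coef3 cG A0 n4; rewrite -/M fpsBE => h.
have {}h : `|W n - V n| <= 64 * (K * (2 * M)) / n%:R ^+ 2.
  apply: h => z hz.
  have zlt : normc z < 1 by rewrite hz; lra.
  have := hK (exist _ (mu, z, W, V) (And4 mu0 zlt gW gV)) 3 (leqnn _).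
  rewrite /z2 /= mulr1 => e1.
  have r0 : 0 < normc (1 - z) by exact: (@jet_r_gt0 R unit (fun=> z) (fun=> zlt) tt).
  have rM : (2 * M)^-1 <= normc (1 - z).
    have : normc 1 <= normc (1 - z) + normc z by rewrite -{1}(subrK z 1) normcD.
    by rewrite normc1 hz; lra.
  apply: (@le_trans _ _ (K * (2 * M) * normc (1 - z) ^- 2)); last first.
    by rewrite ler_wpM2l// lerDl invr_ge0 exprn_ge0// normc_ge0.
  move: (normc (fps_ev _ z)) e1 => A e1; move: (normc (1 - z)) r0 rM e1 => r r0 rM e1.
  rewrite ler_pdivlMr ?exprn_gt0//.
  have : 1 <= 2 * M * r by rewrite -(ler_pdivrMl _ _ M0) mulr1.
  move: e1; rewrite (exprS r 2) mulrCA; have := exprn_gt0 2 r0; move: (r ^+ 2) => s s0 e1 e2.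
  rewrite -(ler_pM2l r0); apply: (le_trans e1).
  by rewrite mulrCA (mulrC r) ler_peMr.
apply: (le_trans h); rewrite ler_pdivrMr ?exprn_gt0//.
have -> : 128 * K / n%:R * n%:R ^+ 2 = 128 * K * n%:R by field; rewrite gt_eqF.
by clear -K0 Mn M1; nra.
Qed.

End discrete_estimates.

(** * The scalar Caputo equation *)

Section integration.
Context (R : realType).
Notation mu := (@lebesgue_measure R).
Implicit Types (f F g : R -> R) (a b : R).

Lemma Rintegral_cvg_sets (D : set R) (A : (set R)^nat) g :
  measurable D -> (forall n, measurable (A n)) -> (forall n, A n `<=` D) ->
  (forall x, D x -> \forall n \near \oo, A n x) ->
  mu.-integrable D (EFin \o g) ->
  (\int[mu]_(x in A n) g x) @[n --> \oo] --> \int[mu]_(x in D) g x.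
Proof.
move=> mD mA AD DA ig; apply: fine_cvg.
have /integrableP[mg _] := ig.
rewrite fineK; last exact: integrable_fin_num.
have := @dominated_cvg _ _ R mu D mD (fun n => (EFin \o g) \_ (A n)) (EFin \o g) (abse \o (EFin \o g)).
rewrite (_ : (fun n => \int[mu]_(x in A n) (g x)%:E)%E =
  (fun n => \int[mu]_(x in D) ((EFin \o g) \_ (A n)) x)%E); last first.
  apply/funext => n; rewrite integral_mkcond [RHS]integral_mkcond; congr (integral _ _ _).
  apply/funext => x; rewrite !patchE; case: ifPn => [xA|_]; last by case: ifP.
  by rewrite mem_set//; exact: (AD n _ (set_mem xA)).
apply.
- move=> n; apply/measurable_restrict => //; first exact: mA.
  by apply: measurable_funS mg => //; exact: subIsetl.
- move=> x Dx; apply: cvg_near_cst; apply: filterS (DA x Dx) => n An.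
  by rewrite patchE mem_set.
- by move=> x Dx.
- exact: integrable_abse.
- move=> n x Dx; rewrite patchE; case: ifPn => // _; rewrite abse0; exact: abse_ge0.
Qed.

Lemma ge0_integrable_sets (A : (set R)^nat) g (M : R) :
  (forall n, measurable (A n)) -> nondecreasing_seq A ->
  measurable_fun (\bigcup_n A n) g -> (forall x, (\bigcup_n A n) x -> 0 <= g x) ->
  (forall n, (\int[mu]_(x in A n) (g x)%:E <= M%:E)%E) ->
  mu.-integrable (\bigcup_n A n) (EFin \o g).
Proof.
move=> mA ndA mg g0 AM; apply/integrableP; split; first exact/measurable_EFinP.
have -> : (\int[mu]_(x in \bigcup_n A n) `|(EFin \o g) x| = \int[mu]_(x in \bigcup_n A n) (EFin \o g) x)%E.
  by apply: eq_integral => x /set_mem Dx /=; rewrite ger0_norm// g0.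
apply: (@le_lt_trans _ _ M%:E); last exact: ltry.
have h : (\int[mu]_(x in A n) (g x)%:E)%E @[n --> \oo] --> (\int[mu]_(x in \bigcup_n A n) (g x)%:E)%E.
  apply: (@ge0_nondecreasing_set_cvg_integral _ (measurableTypeR R) R A (EFin \o g) mu ndA mA).
  - move=> n; apply/measurable_EFinP; apply: measurable_funS mg.
    + exact: bigcup_measurable.
    + exact: bigcup_sup.
  - by move=> n x Ax; rewrite lee_fin g0//; exists n.
have := cvg_lim (@ereal_hausdorff R) h => <-.
by apply: lime_le; [exact: cvgP h|exact: nearW].
Qed.

Lemma FTC_cc f F a b : a < b ->
  (forall x, a <= x <= b -> is_derive x 1 F (f x)) ->
  (forall x, a <= x <= b -> {for x, continuous f}) ->
  (\int[mu]_(x in `[a, b]) (f x)%:E = (F b - F a)%:E)%E.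
Proof.
move=> ab dF cf.
have cF x : a <= x <= b -> {for x, continuous F}.
  by move=> xab; apply/differentiable_continuous/derivable1_diffP; case: (dF x xab).
have aab : a <= a <= b by rewrite lexx ltW.
have bab : a <= b <= b by rewrite lexx ltW.
rewrite EFinB; apply: continuous_FTC2 => //.
- by apply: continuous_in_subspaceT => x; rewrite inE/= in_itv/=; exact: cf.
- split; [|exact/cvg_at_right_filter/cF|exact/cvg_at_left_filter/cF].
  by move=> x; rewrite in_itv/= => /andP[ax xb]; case: (dF x); rewrite ?ltW.
- move=> x; rewrite in_itv/= => /andP[ax xb]; rewrite derive1E.
  by have := dF x; rewrite !ltW// => /(_ isT) [_ ->].
Qed.

Section open_interval.
Context (f F : R -> R) (a b la lb : R).
Hypothesis ab : a < b.
Hypothesis dF : forall x, a < x < b -> is_derive x 1 F (f x).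
Hypothesis cf : forall x, a < x < b -> {for x, continuous f}.
Hypothesis Fa : F x @[x --> a^'+] --> la.
Hypothesis Fb : F x @[x --> b^'-] --> lb.

(** Dividing by n + 3 gives 3 d n <= b - a, so [a + d n, b - d n] is never degenerate. *)
Let d n : R := (b - a) / n.+3%:R.
Let d0 n : 0 < d n. Proof. by rewrite divr_gt0// subr_gt0. Qed.
Let d3 n : 3 * d n <= b - a.
Proof.
rewrite /d mulrCA ler_piMr ?subr_ge0 ?(ltW ab)//.
by rewrite ler_pdivrMr// mul1r ler_nat.
Qed.
Let d_le n m : (n <= m)%N -> d m <= d n.
Proof.
move=> nm; rewrite /d ler_wpM2l ?subr_ge0 ?(ltW ab)// lef_pV2 ?posrE//.
by rewrite ler_nat.
Qed.
Let d_cvg : d n @[n --> \oo] --> (0 : R).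
Proof.
rewrite -(mulr0 (b - a)); apply: cvgMr.
have := @cvg_harmonic R; rewrite -(cvg_shiftn 2); apply: cvg_trans.
by apply: near_eq_cvg; apply: nearW => n; rewrite /= addn2.
Qed.
Let A n : set R := `[a + d n, b - d n]%classic.
Let mA n : measurable (A n). Proof. exact: measurable_itv. Qed.
Let ndA : nondecreasing_seq A.
Proof.
move=> n m nm; apply/subsetPset => x; rewrite /A/= !in_itv/= => /andP[h1 h2].
by have h := d_le nm; apply/andP; split; lra.
Qed.
Let AD n : A n `<=` `]a, b[.
Proof. by move=> x; rewrite /A/= !in_itv/= => /andP[h1 h2]; have h0 := d0 n; apply/andP; split; lra. Qed.
Let DA x : `]a, b[%classic x -> \forall n \near \oo, A n x.
Proof.
rewrite /= in_itv/= => /andP[ax xb].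
have e0 : 0 < Num.min (x - a) (b - x) by rewrite lt_min !subr_gt0 ax.
have /cvgr0Pnorm_lt /(_ _ e0) := d_cvg; apply: filterS => n.
rewrite gtr0_norm// lt_min => /andP[h1 h2].
by rewrite /A/= in_itv/=; apply/andP; split; lra.
Qed.
Let bigA : \bigcup_n A n = `]a, b[%classic.
Proof.
apply/seteqP; split => [x [n _]|x Dx]; first exact: AD.
by have [N _ /(_ N (leqnn _)) AN] := DA Dx; exists N.
Qed.
Let intA n : (\int[mu]_(x in A n) (f x)%:E = (F (b - d n) - F (a + d n))%:E)%E.
Proof.
have := d0 n; have := d3 n => h3 h0; apply: FTC_cc.
- by lra.
- by move=> x /andP[h1 h2]; apply: dF; apply/andP; split; lra.
- by move=> x /andP[h1 h2]; apply: cf; apply/andP; split; lra.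
Qed.
Let FA : F (b - d n) - F (a + d n) @[n --> \oo] --> lb - la.
Proof.
apply: cvgB.
- move/cvg_at_leftP : Fb; apply; split => [n|]; first by rewrite ltrBlDr ltrDl.
  by rewrite -[X in _ --> X]subr0; apply: cvgB => //; exact: cvg_cst.
- move/cvg_at_rightP : Fa; apply; split => [n|]; first by rewrite ltrDl.
  by rewrite -[X in _ --> X]addr0; apply: cvgD => //; exact: cvg_cst.
Qed.

Lemma FTC_oo : mu.-integrable `]a, b[ (EFin \o f) -> \int[mu]_(x in `]a, b[) f x = lb - la.
Proof.
move=> fi; have := Rintegral_cvg_sets (measurable_itv _) mA AD DA fi.
under eq_fun do rewrite /Rintegral intA /=.
by move/cvg_unique; apply.
Qed.

Lemma open_measurable_fun : measurable_fun `]a, b[ f.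
Proof.
apply: open_continuous_measurable_fun; first exact: itv_open.
by move=> x; rewrite inE/= in_itv/=; exact: cf.
Qed.

(** The increments of the primitive are bounded because it has limits at both ends, and monotone
    convergence does the rest. Used for kernels that are singular at an end point. *)
Lemma FTC_oo_ge0_integrable : (forall x, a < x < b -> 0 <= f x) -> mu.-integrable `]a, b[ (EFin \o f).
Proof.
move=> f0.
have [M _ FM] : exists2 M, True & forall n, F (b - d n) - F (a + d n) <= M.
  have [M [_ hM]] := cvg_seq_bounded (cvgP _ FA).
  exists (M + 1) => // n; apply: le_trans (ler_norm _) _.
  by apply: hM => //; rewrite ltrDl.
rewrite -bigA; apply: (@ge0_integrable_sets _ _ M) => //.
- by rewrite bigA; exact: open_measurable_fun.
- by rewrite bigA => x /=; rewrite in_itv/=; exact: f0.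
- by move=> n; rewrite intA lee_fin.
Qed.

End open_interval.
End integration.

(** * Integrals against the Caputo kernel *)

Section caputo_kernel.
Context (R : realType).
Notation mu := (@lebesgue_measure R).
Implicit Types (f g h y z : R -> R).

Lemma integrable_bounded_mul (D : set R) h g C : measurable D -> measurable_fun D h ->
  (forall x, D x -> `|h x| <= C) -> mu.-integrable D (EFin \o g) ->
  mu.-integrable D (EFin \o (fun x => h x * g x)).
Proof.
move=> mD mh hC ig.
have [mg _] := integrableP _ _ _ ig.
apply: (@le_integrable _ (measurableTypeR R) R mu D mD _ (EFin \o (fun x => C * g x))).
- apply/measurable_EFinP; apply: measurable_funM => //; exact/measurable_EFinP.
- move=> x Dx /=; rewrite lee_fin !normrM ler_wpM2r//.
  exact: le_trans (hC x Dx) (ler_norm C).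
- rewrite (_ : _ \o _ = fun x => (C%:E * (EFin \o g) x)%E); last by apply/funext.
  exact: integrableZl.
Qed.

Lemma integrableD_EFin (D : set R) f g : measurable D -> mu.-integrable D (EFin \o f) ->
  mu.-integrable D (EFin \o g) -> mu.-integrable D (EFin \o (fun x => f x + g x)).
Proof.
move=> mD fi gi; rewrite (_ : _ \o _ = (EFin \o f) \+ (EFin \o g))%E; last by apply/funext.
exact: integrableD.
Qed.

Lemma is_derive_kernel (t be s : R) : s < t ->
  is_derive s 1 (fun x => (t - x) `^ be) (- (be * (t - s) `^ (be - 1))).
Proof.
move=> st; have ts : 0 < t - s by rewrite subr_gt0.
have h3 := is_derive1_powR be ts.
have h2 : is_derive s 1 (fun x : R => t - x) (-1).
  by have := is_deriveB (is_derive_cst t s 1) (is_derive_id s (1 : R)); rewrite sub0r.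
have := @is_derive1_comp R (fun x => x `^ be) (fun x : R => t - x) s _ _ h3 h2.
by rewrite mulrN1.
Qed.

Lemma continuous_kernel (t be s : R) : s < t -> {for s, continuous (fun x => (t - x) `^ be)}.
Proof.
move=> st; apply/differentiable_continuous/derivable1_diffP.
by have [] := is_derive_kernel be st.
Qed.

Lemma measurable_kernel (D : set R) (t be : R) : measurable_fun D (fun x : R => (t - x) `^ be).
Proof.
apply: measurable_funTS; apply: (measurableT_comp (measurable_powR be)).
exact: measurable_funB.
Qed.

(* Regularity in time of a semidiscrete solution at a point of space. *)
Record caputo_regular y : Prop := {
  cr_cont : {within `[0, +oo[, continuous y};
  cr_derivable : forall t, 0 < t -> derivable y t 1;
  cr_C1 : forall t, 0 < t -> {for t, continuous (derive1 y)};
  cr_integrable : forall t, 0 < t -> mu.-integrable `]0, t[ (EFin \o derive1 y) }.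

Section regular.
Context (y : R -> R).
Hypothesis ry : caputo_regular y.

Lemma cr_at0 : y x @[x --> 0^'+] --> y 0.
Proof. by have /continuous_within_itvcyP[] := cr_cont ry. Qed.

Lemma cr_at (t : R) : 0 < t -> {for t, continuous y}.
Proof.
have /continuous_within_itvcyP[h _] := cr_cont ry.
by move=> t0; apply: h; rewrite in_itv/= t0.
Qed.

Lemma cr_is_derive (t : R) : 0 < t -> is_derive t 1 y (derive1 y t).
Proof. by move=> t0; split; [exact: cr_derivable ry _ t0|rewrite derive1E]. Qed.

Lemma cr_affine (c e : R) : caputo_regular (fun x => c + e * y x) /\
  forall t : R, 0 < t -> derive1 (fun x => c + e * y x) t = e * derive1 y t.
Proof.
have d (t : R) : 0 < t -> is_derive t 1 (fun x => c + e * y x) (e * derive1 y t).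
  move=> t0; have h := is_deriveZ e (cr_is_derive t0).
  by have := is_deriveD (is_derive_cst c t 1) h; rewrite add0r.
have dE t : 0 < t -> derive1 (fun x => c + e * y x) t = e * derive1 y t.
  by move=> t0; rewrite [LHS]derive1E; have [_ ->] := d _ t0.
split=> //; split.
- apply/continuous_within_itvcyP; split.
    move=> x; rewrite in_itv/= andbT => x0; apply: cvgD; first exact: cvg_cst.
    by apply: cvgM; [exact: cvg_cst|exact: cr_at].
  apply: cvgD; first exact: cvg_cst.
  by apply: cvgM; [exact: cvg_cst|exact: cr_at0].
- by move=> t t0; have [] := d _ t0.
- move=> t t0; rewrite /prop_for/continuous_at dE//.
  have h : (e * derive1 y x) @[x --> t] --> e * derive1 y t by apply: cvgMr; exact: (cr_C1 ry t0).
  apply: cvg_trans h.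
    apply: near_eq_cvg; near=> x; rewrite dE//.
    by near: x; exact: lt_nbhsr.
- move=> t t0; apply: (@eq_integrable _ (measurableTypeR R) R mu `]0, t[ (measurable_itv _)
    (EFin \o (fun x => e * derive1 y x))).
    by move=> x; rewrite inE/= in_itv/= => /andP[x0 _] /=; rewrite dE.
  apply: (@integrable_bounded_mul _ (fun=> e) (derive1 y) `|e|) => //.
  exact: cr_integrable ry _ t0.
Unshelve. all: by end_near. Qed.

End regular.

(** Integration by parts: the kernel increases in s and z >= 0, so the integral of k' z is
    nonnegative and may be dropped. Stopping at T < t stays away from the singularity. *)
Lemma kernel_integral_le (alpha : R) z (T t : R) : 0 < alpha -> 0 < T -> T < t -> caputo_regular z ->
  (forall s, 0 <= s <= T -> 0 <= z s) ->
  \int[mu]_(s in `]0, T[) ((t - s) `^ (- alpha) * derive1 z s) <=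
    (t - T) `^ (- alpha) * z T - t `^ (- alpha) * z 0.
Proof.
move=> a0 T0 Tt rz z0.
pose k s := (t - s) `^ (- alpha); pose k' s := alpha * (t - s) `^ (- alpha - 1).
have dk s : s < t -> is_derive s 1 k (k' s).
  by move=> st; rewrite /k' -[alpha * _]opprK -mulNr -[- (- _ * _)]opprK opprK; exact: is_derive_kernel.
pose f s := k s * derive1 z s + k' s * z s.
have cz s : 0 < s -> {for s, continuous z} by exact: cr_at.
have kpos s : 0 <= k' s by rewrite mulr_ge0 ?powR_ge0 ?(ltW a0).
have ck s : s < t -> {for s, continuous k} by exact: continuous_kernel.
have ck' s : s < t -> {for s, continuous k'}.
  by move=> st; apply: cvgM; [exact: cvg_cst|exact: continuous_kernel].
have mT : measurable (`]0, T[%classic : set R) by exact: measurable_itv.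
have i1 : mu.-integrable `]0, T[ (EFin \o (fun s => k s * derive1 z s)).
  apply: (@integrable_bounded_mul _ _ _ ((t - T) `^ (- alpha))) => //.
  - exact: measurable_kernel.
  - move=> s; rewrite /= in_itv/= => /andP[s0 sT]; rewrite ger0_norm ?powR_ge0//.
    rewrite /k !powRN lef_pV2 ?posrE ?powR_gt0 ?subr_gt0 ?(lt_trans sT)//.
    by rewrite ge0_ler_powR ?nnegrE ?subr_ge0 ?(ltW a0) ?(ltW Tt) ?(ltW (lt_trans sT Tt))// lerD2l lerN2 ltW.
  - exact: cr_integrable rz _ T0.
have i2 : mu.-integrable `]0, T[ (EFin \o (fun s => k' s * z s)).
  apply: (@integrableS _ (measurableTypeR R) R mu `[0, T]) => //.
    by apply: subset_itvW; rewrite ?bnd_simp.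
  apply: continuous_compact_integrable; first exact: segment_compact.
  apply/continuous_within_itvP => //; split.
  - move=> s; rewrite in_itv/= => /andP[s0 sT].
    by apply: cvgM; [exact/ck'/(lt_trans sT)|exact: cz].
  - apply: cvgM; last exact: cr_at0.
    by apply: cvg_at_right_filter; apply: ck'; exact: lt_trans Tt.
  - by apply: cvgM; apply: cvg_at_left_filter; [exact: ck'|exact: cz].
have i : mu.-integrable `]0, T[ (EFin \o f) by exact: integrableD_EFin.
have <- : \int[mu]_(s in `]0, T[) f s = (t - T) `^ (- alpha) * z T - t `^ (- alpha) * z 0.
  apply: (@FTC_oo _ _ (fun s => k s * z s)) => //.
  - move=> s /andP[s0 sT]; have h1 := dk _ (lt_trans sT Tt).
    have h2 := cr_is_derive rz s0; have := is_deriveM h1 h2.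
    by rewrite /f /GRing.scale /= (mulrC (k' s)).
  - move=> s /andP[s0 sT]; have sit := lt_trans sT Tt; apply: cvgD; apply: cvgM.
    + exact: ck.
    + exact: cr_C1 rz _ s0.
    + exact: ck'.
    + exact: cz.
  - apply: cvgM; last exact: cr_at0.
    rewrite -(subr0 t); apply: cvg_at_right_filter; apply: ck; exact: lt_trans Tt.
  - by apply: cvgM; apply: cvg_at_left_filter; [exact: ck|exact: cz].
apply: le_Rintegral => // s; rewrite /= in_itv/= => /andP[s0 sT].
by rewrite lerDl mulr_ge0// z0// !ltW.
Qed.

(** Split at t / 2: on the left the kernel is bounded and z' is integrable, on the right z' is
    bounded and the kernel is integrable. *)
Lemma kernel_integrable (alpha : R) z (t : R) : 0 < alpha < 1 -> 0 < t -> caputo_regular z ->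
  mu.-integrable `]0, t[ (EFin \o (fun s => (t - s) `^ (- alpha) * derive1 z s)).
Proof.
move=> /andP[a0 a1] t0 rz.
have t2 : 0 < t / 2 by rewrite divr_gt0.
have t2t : t / 2 < t by lra.
have mt : measurable (`]0, t[%classic : set R) by exact: measurable_itv.
have iz := cr_integrable rz t0.
have mz : measurable_fun (`]0, t[%classic : set R) (derive1 z).
  by have /integrableP[/measurable_EFinP] := iz.
have ik : mu.-integrable `]0, t[ (EFin \o (fun s => (t - s) `^ (- alpha))).
  have a1' : 0 < 1 - alpha by rewrite subr_gt0.
  apply: (@FTC_oo_ge0_integrable _ _ (fun s => - ((1 - alpha)^-1 * (t - s) `^ (1 - alpha)))
     0 t (- ((1 - alpha)^-1 * (t - 0) `^ (1 - alpha))) (- ((1 - alpha)^-1 * 0))); first exact: t0.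
  - move=> s /andP[_ st].
    have h := is_deriveN (is_deriveZ (1 - alpha)^-1 (is_derive_kernel (1 - alpha) st)).
    apply: is_derive_eq h _; rewrite scalerN opprK /GRing.scale /= mulrA mulVf ?gt_eqF// mul1r.
    by congr (_ `^ _); ring.
  - by move=> s /andP[_ st]; exact: continuous_kernel.
  - apply: cvgN; apply: cvgM; first exact: cvg_cst.
    by apply: cvg_at_right_filter; exact: continuous_kernel.
  - apply: cvgN; apply: cvgM; first exact: cvg_cst.
    apply/cvg_at_leftP => u [ut cu].
    have /cvg_at_rightP := powR_cvg0 a1'; apply; split=> [n|]; first by rewrite subr_gt0.
    by rewrite -(subrr t); apply: cvgB => //; exact: cvg_cst.
  - by move=> s _; exact: powR_ge0.
have [C hC] : exists C, forall s, t / 2 <= s <= t -> `|derive1 z s| <= C.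
  have cz : {within `[t / 2, t], continuous (derive1 z)}.
    apply: continuous_in_subspaceT => s; rewrite inE/= in_itv/= => /andP[s0 _].
    by apply: (cr_C1 rz); exact: lt_le_trans s0.
  have /compact_bounded[M [_ hM]] := continuous_compact cz (@segment_compact _ _ _).
  exists (M + 1) => s st; apply: (hM (M + 1)); first by rewrite ltrDl.
  by exists s.
have C0 : 0 <= C by apply: le_trans (hC t _); rewrite ?lexx ?andbT ?(ltW t2t).
have h2 := powR_ge0 (t / 2) (- alpha).
apply: (@le_integrable _ (measurableTypeR R) R mu _ mt _
  (EFin \o (fun s => (t / 2) `^ (- alpha) * `|derive1 z s| + C * (t - s) `^ (- alpha)))).
- apply/measurable_EFinP; apply: measurable_funM => //; exact: measurable_kernel.
- move=> s; rewrite /= in_itv/= => /andP[s0 st]; rewrite lee_fin normrM ger0_norm ?powR_ge0//.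
  rewrite [leRHS]ger0_norm ?addr_ge0 ?mulr_ge0 ?powR_ge0//.
  have [sh|sh] := leP s (t / 2).
    apply: (@le_trans _ _ ((t / 2) `^ (- alpha) * `|derive1 z s|)); last first.
      by rewrite lerDl mulr_ge0 ?powR_ge0.
    rewrite ler_wpM2r// !powRN lef_pV2 ?posrE ?powR_gt0 ?subr_gt0//.
    by rewrite ge0_ler_powR ?nnegrE ?(ltW a0)//; lra.
  apply: (@le_trans _ _ (C * (t - s) `^ (- alpha))); last by rewrite lerDr mulr_ge0.
  by rewrite mulrC ler_wpM2r ?powR_ge0// hC// ltW//= ltW.
- apply: integrableD_EFin => //.
    apply: (@integrable_bounded_mul _ (fun=> (t / 2) `^ (- alpha)) _ ((t / 2) `^ (- alpha))) => //.
      by move=> s _; rewrite ger0_norm.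
    exact: integrable_norm iz.
  apply: (@integrable_bounded_mul _ (fun=> C) _ C) => //.
  by move=> s _; rewrite ger0_norm.
Qed.

End caputo_kernel.

(** * The Laplace transform of t^-alpha *)

Section affine_change.
Context (R : realType).
Notation mu := (@lebesgue_measure R).

(** The image of Lebesgue measure under x -> p x + c, multiplied by p, agrees with Lebesgue measure
    on half-open intervals, hence everywhere. *)
Lemma ge0_integral_affine (p c : R) (f : R -> \bar R) : 0 < p ->
  measurable_fun setT f -> (forall x, (0 <= f x)%E) ->
  (\int[mu]_x f x = p%:E * \int[mu]_x f (p * x + c)%R)%E.
Proof.
move=> p0 mf f0.
pose phi (x : measurableTypeR R) : measurableTypeR R := p * x + c.
have mphi : measurable_fun setT phi.
  by apply: measurable_funD => //; exact: measurable_funM.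
pose P : {measure set (measurableTypeR R) -> \bar R} :=
  measure_function_pushforward__canonical__measure_function_Measure mu mphi.
pose M : {measure set (measurableTypeR R) -> \bar R} := mscale (NngNum (ltW p0)) P.
have e A : measurable A -> mu A = M A.
  apply: lebesgue_measure_unique => X /ocitvP[->|[[a b] /= ab ->]].
    by rewrite !measure0.
  rewrite lebesgue_measure_itv/= /M /mscale /P /= /pushforward.
  have -> : phi @^-1` `]a, b]%classic = `](a - c) / p, (b - c) / p]%classic.
    apply/seteqP; split=> x; rewrite /phi /= !in_itv/= ltr_pdivrMr// ler_pdivlMr// mulrC => /andP[h1 h2].
      by apply/andP; split; lra.
    by apply/andP; split; lra.
  rewrite lebesgue_measure_itv/= !lte_fin ltr_pM2r ?invr_gt0// ltrD2r ab.
  by rewrite -!EFinB -EFinM; congr EFin; field; rewrite gt_eqF.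
have -> : (\int[mu]_x f x = \int[M]_x f x)%E.
  by apply: eq_measure_integral => A mA _; rewrite -e.
rewrite ge0_integral_mscale//; congr (_ * _)%E.
by rewrite ge0_integral_pushforward.
Qed.

End affine_change.

Section gamma_kernel.
Context (R : realType) (alpha : R).
Hypothesis alpha01 : 0 < alpha < 1.
Notation mu := (@lebesgue_measure R).

Lemma is_derive_continuous (f : R -> R) (t df : R) : is_derive t 1 f df -> f x @[x --> t] --> f t.
Proof. by move=> [d _]; apply/differentiable_continuous/derivable1_diffP. Qed.

Lemma is_derive_expN (p t : R) :
  is_derive t 1 (fun x => expR (- (p * x))) (- (p * expR (- (p * t)))).
Proof.
have h := is_deriveN (is_deriveZ p (is_derive_id t (1 : R))).
have := @is_derive1_comp R expR (fun x => - (p * x)) t _ _ (is_derive_expR _) h.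
by rewrite /GRing.scale /= mulr1 mulrN mulrC.
Qed.

Lemma continuous_expN (p : R) : continuous (fun x : R => expR (- (p * x))).
Proof.
move=> t; apply/differentiable_continuous/derivable1_diffP.
by have [] := is_derive_expN p t.
Qed.

Lemma measurable_expN (p : R) (D : set R) : measurable_fun D (fun x : R => expR (- (p * x))).
Proof. by apply: measurable_funTS; apply: continuous_measurable_fun; exact: continuous_expN. Qed.

Lemma measurable_gamma_kernel (p : R) (D : set R) :
  measurable_fun D (fun t : R => t `^ (- alpha) * expR (- (p * t))).
Proof.
apply: measurable_funM; last exact: measurable_expN.
exact: measurable_funTS (measurable_powR _).
Qed.

Lemma expN_cvg0 (p : R) : 0 < p -> expR (- (p * x)) @[x --> +oo] --> (0 : R).
Proof.
move=> p0.
apply: (@cvg_comp _ _ _ (fun t => p * t) (fun t => expR (- t)) (pinfty_nbhs R) (pinfty_nbhs R)).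
  by apply: gt0_cvgMry => //; exact: cvg_id.
exact: cvgr_expR.
Qed.

Lemma integral_expN (p : R) : 0 < p ->
  (\int[mu]_(t in `[0%R, +oo[) (expR (- (p * t)))%:E = (p^-1)%:E)%E.
Proof.
move=> p0.
have d t := is_deriveN (is_deriveZ p^-1 (is_derive_expN p t)).
have dF t : derivable (fun t => - (p^-1 * expR (- (p * t)))) t 1 by have [] := d t.
rewrite (_ : p^-1 = 0 - - (p^-1 * expR (- (p * 0)))); last first.
  by rewrite mulr0 oppr0 expR0 mulr1 opprK add0r.
rewrite EFinB; apply: (@ge0_continuous_FTC2y _ _ (fun t => - (p^-1 * expR (- (p * t))))).
- by move=> t _; exact: expR_ge0.
- by apply: continuous_subspaceT => t; exact: continuous_expN.
- by rewrite -oppr0 -(mulr0 p^-1); apply: cvgN; apply: cvgMr; exact: expN_cvg0.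
- by move=> t _; exact: dF.
- exact: cvg_at_right_filter (is_derive_continuous (d 0)).
- move=> t _; rewrite derive1E; have [_ h] := d t; apply: etrans h _.
  by rewrite /GRing.scale /= mulrN opprK mulrA mulVf ?gt_eqF// mul1r.
Qed.

(** Dominated by t^-alpha below 1 and by exp(- p t) above. *)
Lemma gamma_kernel_integrable (p : R) : 0 < p ->
  mu.-integrable `]0, +oo[ (EFin \o (fun t => t `^ (- alpha) * expR (- (p * t)))).
Proof.
move=> p0; have /andP[a0 a1] := alpha01.
have m0 (i : interval R) : measurable ([set` i] : set (measurableTypeR R)) by exact: measurable_itv.
have eD : `]0, +oo[%classic = `]0, 1[%classic `|` `[1, +oo[%classic :> set R.
  by rewrite -itv_bndbnd_setU ?bnd_simp.
have i1 : (\int[mu]_(t in `]0%R, 1%R[) `|t `^ (- alpha) * expR (- (p * t))|%:E < +oo)%E.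
  have a1' : 0 < 1 - alpha by rewrite subr_gt0.
  have : mu.-integrable `]0, 1[ (EFin \o (fun s : R => s `^ (- alpha))).
    apply: (@FTC_oo_ge0_integrable _ _ (fun s => (1 - alpha)^-1 * s `^ (1 - alpha))
       0 1 ((1 - alpha)^-1 * 0) ((1 - alpha)^-1 * 1 `^ (1 - alpha))); first exact: ltr01.
    - move=> s /andP[s0 _].
      have h := is_deriveZ (1 - alpha)^-1 (is_derive1_powR (1 - alpha) s0).
      apply: is_derive_eq h _; rewrite /GRing.scale /= mulrA mulVf ?gt_eqF// mul1r.
      by congr (_ `^ _); ring.
    - move=> s /andP[s0 _]; apply/differentiable_continuous/derivable1_diffP.
      by have [] := is_derive1_powR (- alpha) s0.
    - by apply: cvgMr; exact: powR_cvg0.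
    - apply: cvgMr; apply: cvg_at_left_filter.
      exact: is_derive_continuous (is_derive1_powR (1 - alpha) (@ltr01 R)).
    - by move=> s _; exact: powR_ge0.
  move=> /integrableP[_]; apply: le_lt_trans; apply: ge0_le_integral => //.
  - by apply/measurable_EFinP; apply: measurableT_comp => //; exact: measurable_gamma_kernel.
  - by apply/measurable_EFinP; apply: measurableT_comp => //; exact: measurable_funTS (measurable_powR _).
  move=> t; rewrite /= in_itv/= => /andP[t0 _]; rewrite lee_fin normrM ler_piMr//.
  by rewrite ger0_norm ?expR_ge0// expR_le1 oppr_le0 mulr_ge0 ?ltW.
have i2 : (\int[mu]_(t in `[1%R, +oo[) `|t `^ (- alpha) * expR (- (p * t))|%:E < +oo)%E.
  apply: (@le_lt_trans _ _ (\int[mu]_(t in `[0%R, +oo[) (expR (- (p * t)))%:E)%E).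
    apply: (@le_trans _ _ (\int[mu]_(t in `[1%R, +oo[) (expR (- (p * t)))%:E)%E).
      apply: ge0_le_integral => //.
      - by apply/measurable_EFinP; apply: measurableT_comp => //; exact: measurable_gamma_kernel.
      - by apply/measurable_EFinP; exact: measurable_expN.
      move=> t; rewrite /= in_itv/= andbT => t1; rewrite lee_fin ger0_norm; last first.
        by rewrite mulr_ge0 ?powR_ge0 ?expR_ge0.
      rewrite ler_piMl ?expR_ge0// powRN invf_le1 ?powR_gt0 ?(lt_le_trans _ t1)//.
      by rewrite -[leLHS](powRr0 t) ler_powR// ltW.
    apply: ge0_subset_integral => //.
    - by apply/measurable_EFinP; exact: measurable_expN.
    - by apply: subset_itvr; rewrite bnd_simp.
  by rewrite integral_expN// ltry.
apply/integrableP; split.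
  by apply/measurable_EFinP; exact: measurable_gamma_kernel.
rewrite eD ge0_integral_setU//.
- exact: lte_add_pinfty.
- by apply: measurableT_comp => //; apply/measurable_EFinP; exact: measurable_gamma_kernel.
- rewrite disj_set2E; apply/eqP/seteqP; split=> // t [] /=; rewrite !in_itv/= andbT => /andP[_ t1].
  by rewrite leNgt t1.
Qed.

(* The Laplace kernel of [t^-alpha], extended by [0] to the negative axis. *)
Definition laplace_kernel (p x : R) : R := if 0 < x then x `^ (- alpha) * expR (- (p * x)) else 0.

Lemma laplace_kernelE p : laplace_kernel p =
  (fun t => t `^ (- alpha) * expR (- (p * t))) \_ `]0, +oo[.
Proof.
by apply/funext => x; rewrite patchE /laplace_kernel mem_setE in_itv/= andbT.
Qed.

Lemma laplace_kernel_ge0 p x : 0 <= laplace_kernel p x.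
Proof. by rewrite /laplace_kernel; case: ifP => // _; rewrite mulr_ge0 ?powR_ge0 ?expR_ge0. Qed.

Lemma measurable_laplace_kernel p : measurable_fun setT (laplace_kernel p).
Proof.
rewrite laplace_kernelE; apply/(measurable_restrictT _ _).1 => //.
exact: measurable_gamma_kernel.
Qed.

Lemma Gamma_integral : (\int[mu]_x (laplace_kernel 1 x)%:E = (Gamma (1 - alpha))%:E)%E.
Proof.
rewrite laplace_kernelE.
transitivity (\int[mu]_(t in `]0%R, +oo[) (t `^ (- alpha) * expR (- (1 * t)))%:E)%E.
  by rewrite [RHS]integral_mkcond; apply: eq_integral => x _; rewrite !patchE; case: ifP.
have -> : Gamma (1 - alpha) = \int[mu]_(t in `]0, +oo[) (t `^ (- alpha) * expR (- (1 * t))).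
  by apply: eq_Rintegral => t _; rewrite mul1r; congr (_ `^ _ * _); ring.
by rewrite /Rintegral fineK// integrable_fin_num//; exact: gamma_kernel_integrable ltr01.
Qed.

Lemma integral_laplace_kernel (p : R) : 0 < p ->
  (\int[mu]_x (laplace_kernel p x)%:E = (p `^ (alpha - 1) * Gamma (1 - alpha))%:E)%E.
Proof.
move=> p0.
have h : laplace_kernel p = fun x => p `^ alpha * laplace_kernel 1 (p * x + 0).
  apply/funext => x; rewrite /laplace_kernel addr0 pmulr_rgt0//; case: ifPn => x0; last by rewrite mulr0.
  rewrite mul1r mulrA powRM ?(ltW x0) ?(ltW p0)// !mulrA -powRD; last by rewrite (gt_eqF p0) implybT.
  by rewrite subrr powRr0 mul1r.
have m1 : measurable_fun setT (EFin \o laplace_kernel 1).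
  by apply/measurable_EFinP; exact: measurable_laplace_kernel.
have e := @ge0_integral_affine R p 0 (EFin \o laplace_kernel 1) p0 m1 (fun x => laplace_kernel_ge0 1 x).
rewrite h.
have -> : (\int[mu]_x (p `^ alpha * laplace_kernel 1 (p * x + 0))%:E =
  (p `^ alpha)%:E * \int[mu]_x (laplace_kernel 1 (p * x + 0))%:E)%E.
  rewrite -ge0_integralZl_EFin//.
  - by move=> x _; rewrite lee_fin laplace_kernel_ge0.
  - apply: (measurableT_comp m1); apply: measurable_funD => //; exact: measurable_funM.
  - exact: powR_ge0.
move: e; rewrite /= Gamma_integral.
set I := (\int[mu]_x _)%E => e.
have -> : p `^ (alpha - 1) = p `^ alpha / p.
  by rewrite powRB ?powRr1 ?(ltW p0)// (gt_eqF p0) implybT.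
rewrite EFinM e EFinM -!muleA; congr (_ * _)%E.
by rewrite muleA -EFinM mulVf ?gt_eqF// mul1e.
Qed.

Lemma Gamma_gt0 : 0 < Gamma (1 - alpha).
Proof.
have /andP[a0 a1] := alpha01.
have m0 (i : interval R) : measurable ([set` i] : set (measurableTypeR R)) by exact: measurable_itv.
rewrite -lte_fin -Gamma_integral.
have m1 : measurable_fun setT (EFin \o laplace_kernel 1).
  by apply/measurable_EFinP; exact: measurable_laplace_kernel.
apply: (@lt_le_trans _ _ (\int[mu]_(t in `]0%R, 1%R[) (expR (- 1))%:E)%E).
  by rewrite integral_cst//= lebesgue_measure_itv/= lte_fin ltr01/= -EFinB -EFinM lte_fin subr0 mulr1 expR_gt0.
apply: (@le_trans _ _ (\int[mu]_(t in `]0%R, 1%R[) (laplace_kernel 1 t)%:E)%E).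
  apply: ge0_le_integral => //.
  - exact: measurable_funTS.
  - move=> t; rewrite /= in_itv/= => /andP[t0 t1]; rewrite lee_fin /laplace_kernel t0.
    rewrite -[leLHS]mul1r ler_pM ?expR_ge0//.
      by rewrite powRN invf_ge1 ?powR_gt0// -(powRr0 t) ger_powR ?t0 ?ltW.
    by rewrite ler_expR mul1r lerN2 ltW.
apply: ge0_subset_integral => //.
by move=> t _; rewrite lee_fin laplace_kernel_ge0.
Qed.

End gamma_kernel.

(** * Maximum principle for the Caputo equation *)

Section caputo_equation.
Context (R : realType) (alpha : R).
Hypothesis alpha01 : 0 < alpha < 1.
Notation mu := (@lebesgue_measure R).

Lemma kernel_integrable_lt (y : R -> R) (T t : R) : T <= t -> 0 < t -> caputo_regular y ->
  mu.-integrable `]0, T[ (EFin \o (fun s => (t - s) `^ (- alpha) * derive1 y s)).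
Proof.
move=> Tt t0 ry; apply: (@integrableS _ (measurableTypeR R) R mu `]0, t[) => //.
  by apply: subset_itvl; rewrite bnd_simp.
exact: kernel_integrable.
Qed.

Lemma kernel_integral_affine (y : R -> R) (c e T t : R) : T <= t -> 0 < t -> caputo_regular y ->
  \int[mu]_(s in `]0, T[) ((t - s) `^ (- alpha) * derive1 (fun x => c + e * y x) s) =
  e * \int[mu]_(s in `]0, T[) ((t - s) `^ (- alpha) * derive1 y s).
Proof.
move=> Tt t0 ry; have [_ dz] := cr_affine ry c e.
have mT : measurable (`]0, T[%classic : set (measurableTypeR R)) by exact: measurable_itv.
rewrite -(@RintegralZl _ (measurableTypeR R) R mu _ _ e mT (kernel_integrable_lt Tt t0 ry)).
apply: eq_Rintegral => s; rewrite inE/= in_itv/= => /andP[s0 _].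
by rewrite dz// mulrCA.
Qed.

(** Apply [kernel_integral_le] to M + y and M - y: both lie in [0, 2M], and the constant does not
    change the derivative. *)
Lemma kernel_integral_bound (y : R -> R) (M T t : R) : 0 < T -> T < t -> caputo_regular y ->
  (forall s, 0 <= s -> `|y s| <= M) ->
  `|\int[mu]_(s in `]0, T[) ((t - s) `^ (- alpha) * derive1 y s)| <= 2 * M * (t - T) `^ (- alpha).
Proof.
move=> T0 Tt ry yM; have /andP[a0 _] := alpha01; have t0 := lt_trans T0 Tt.
have h (e : R) : e \in [:: 1; -1] ->
    e * \int[mu]_(s in `]0, T[) ((t - s) `^ (- alpha) * derive1 y s) <= 2 * M * (t - T) `^ (- alpha).
  move=> e1; rewrite -(kernel_integral_affine M e (ltW Tt) t0 ry).
  have [rz _] := cr_affine ry M e.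
  have z0 s : 0 <= s -> 0 <= M + e * y s <= 2 * M.
    by move=> s0; move: e1 (yM _ s0); rewrite !inE ler_norml => /orP[]/eqP-> /andP[? ?]; apply/andP; split; lra.
  apply: (le_trans (kernel_integral_le a0 T0 Tt rz _)).
    by move=> s /andP[s0 _]; have /andP[] := z0 _ s0.
  have /andP[h1 h2] := z0 _ (ltW T0); have /andP[h3 _] := z0 _ (lexx 0).
  have k1 := powR_ge0 t (- alpha); have k2 := powR_ge0 (t - T) (- alpha).
  have := mulr_ge0 k1 h3; have := ler_wpM2l k2 h2; lra.
rewrite ler_norml lerNl -mulN1r h ?inE ?eqxx ?orbT//= -[X in X <= _]mul1r.
by rewrite h ?inE ?eqxx.
Qed.

Section solution.
Context (lambda : R) (y : R -> R).
Hypothesis l0 : 0 <= lambda.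
Hypothesis ry : caputo_regular y.
Hypothesis ey : forall t, 0 < t -> caputo alpha y t = - (lambda * y t).

(** At a maximum point c with y c > |y 0| the function z = y c - y is nonnegative on [0, c], so its
    kernel integral is at most - c^-alpha z 0 < 0. The Caputo derivative of y at c is then positive,
    against - lambda y c <= 0. *)
Lemma caputo_upper (t : R) : 0 <= t -> y t <= `|y 0|.
Proof.
have /andP[a0 a1] := alpha01; have a1' : 0 < 1 - alpha by rewrite subr_gt0.
rewrite le_eqVlt => /predU1P[<-|t0]; first exact: ler_norm.
rewrite leNgt; apply/negP => yt.
have cyt : {within `[0, t], continuous y}.
  apply: continuous_subspaceW (cr_cont ry).
  by apply: subset_itvl; rewrite bnd_simp.
have [c + cmax] := EVT_max (ltW t0) cyt.
rewrite in_itv/= => /andP[c0 ct].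
have yc : `|y 0| < y c by apply: lt_le_trans yt (cmax _ _); rewrite in_itv/= lexx ltW.
have {}c0 : 0 < c.
  move: c0; rewrite le_eqVlt => /predU1P[c0|//].
  by move: yc; rewrite -c0 ltNge ler_norm.
have [rz dz] := cr_affine ry (y c) (-1).
set z := (fun x => y c + -1 * y x) in rz dz.
have z0 s : 0 <= s <= c -> 0 <= z s.
  move=> /andP[s0 sc]; rewrite /z mulN1r subr_ge0; apply: cmax.
  by rewrite in_itv/= s0 (le_trans sc).
pose d n : R := c / n.+2%:R.
have d0 n : 0 < d n by rewrite divr_gt0.
have dc n : d n < c.
  by rewrite /d ltr_pdivrMr// ltr_pMr// ltr1n.
have d_cvg : d n @[n --> \oo] --> (0 : R).
  rewrite -(mulr0 c); apply: cvgMr.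
  have := @cvg_harmonic R; rewrite -(cvg_shiftn 1); apply: cvg_trans.
  by apply: near_eq_cvg; apply: nearW => n; rewrite /= addn1.
have iz : mu.-integrable `]0, c[ (EFin \o (fun s => (c - s) `^ (- alpha) * derive1 z s)).
  exact: kernel_integrable.
have l1 : \int[mu]_(s in `]0, c - d n[) ((c - s) `^ (- alpha) * derive1 z s) @[n --> \oo] -->
    \int[mu]_(s in `]0, c[) ((c - s) `^ (- alpha) * derive1 z s).
  apply: (@Rintegral_cvg_sets R `]0, c[ (fun n => `]0, c - d n[%classic)) => //.
  - by move=> n; apply: subset_itvl; rewrite bnd_simp gerBl ltW.
  - move=> s; rewrite /= in_itv/= => /andP[s0 sc].
    have e0 : 0 < c - s by rewrite subr_gt0.
    have /cvgr0Pnorm_lt /(_ _ e0) := d_cvg; apply: filterS => n.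
    by rewrite gtr0_norm// in_itv/= s0/=; lra.
(* The boundary term at c disappears: z (c - d) / d tends to y'(c), and d^(1 - alpha) tends to 0. *)
have l2 : (d n) `^ (- alpha) * z (c - d n) - c `^ (- alpha) * z 0 @[n --> \oo] --> 0 - c `^ (- alpha) * z 0.
  apply: cvgB; last exact: cvg_cst.
  rewrite -(mul0r (derive1 y c)).
  have -> : (fun n => d n `^ (- alpha) * z (c - d n)) =
            (fun n => d n `^ (1 - alpha) * (z (c - d n) / d n)).
    apply/funext => n; rewrite -(mulr_powRB1 (ltW (d0 n)) a1').
    rewrite (_ : 1 - alpha - 1 = - alpha); last by ring.
    by field; rewrite gt_eqF.
  have h1 : d n `^ (1 - alpha) @[n --> \oo] --> (0 : R).
    by have /cvg_at_rightP := powR_cvg0 a1'; apply.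
  apply: cvgM h1 _.
  have := cr_derivable ry c0 => /cvg_ex[l hl].
  have lE : l = derive1 y c by rewrite derive1E; apply/esym/cvg_lim.
  rewrite -lE.
  have : (fun n => (- d n)^-1 *: (y (- d n *: 1 + c) - y c)) @ \oo --> l.
    have /cvgr_dnbhsP := hl; apply; split=> [n|]; first by rewrite oppr_eq0 gt_eqF.
    by rewrite -oppr0; exact: cvgN.
  apply: cvg_trans; apply: near_eq_cvg; apply: nearW => n.
  rewrite /GRing.scale/= mulr1 /z [- d n + c]addrC mulN1r invrN mulNr -mulrN opprB mulrC.
  done.
have h : \int[mu]_(s in `]0, c[) ((c - s) `^ (- alpha) * derive1 z s) <= 0 - c `^ (- alpha) * z 0.
  apply: ler_cvg_to l1 l2 _; apply: nearW => n.
  have := @kernel_integral_le R alpha z (c - d n) c a0 _ _ rz _.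
  rewrite subr_gt0 dc ltrBlDr ltrDl d0 => /(_ isT isT); rewrite subKr; apply.
  by move=> s /andP[s0 sc]; apply: z0; rewrite s0 (le_trans sc)// gerBl ltW.
have e : \int[mu]_(s in `]0, c[) ((c - s) `^ (- alpha) * derive1 z s) =
   - \int[mu]_(s in `]0, c[) ((c - s) `^ (- alpha) * derive1 y s).
  by rewrite kernel_integral_affine// mulN1r.
have := ey c0; rewrite /caputo => ec.
have z00 : 0 < z 0 by rewrite /z mulN1r subr_gt0; exact: le_lt_trans (ler_norm _) yc.
have I0 : 0 < \int[mu]_(s in `]0, c[) ((c - s) `^ (- alpha) * derive1 y s).
  rewrite -oppr_lt0; apply: le_lt_trans (_ : _ <= 0 - c `^ (- alpha) * z 0) _; first by rewrite -e.
  by rewrite sub0r oppr_lt0 mulr_gt0 ?powR_gt0.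
have G0 := Gamma_gt0 alpha01; rewrite -invr_gt0 in G0.
have := mulr_gt0 G0 I0; rewrite ec oppr_gt0 ltNge mulr_ge0//.
by rewrite ltW// (le_lt_trans _ yc).
Qed.

End solution.

Lemma caputo_max_principle (lambda : R) (y : R -> R) : 0 <= lambda -> caputo_regular y ->
  (forall t, 0 < t -> caputo alpha y t = - (lambda * y t)) ->
  forall t, 0 <= t -> `|y t| <= `|y 0|.
Proof.
move=> l0 ry ey t t0; have [rz _] := cr_affine ry 0 (-1).
have ez (s : R) : 0 < s -> caputo alpha (fun x => 0 + -1 * y x) s = - (lambda * (0 + -1 * y s)).
  by move=> s0; rewrite /caputo kernel_integral_affine// add0r mulrCA -/(caputo alpha y s) ey//; ring.
have h1 := caputo_upper l0 ry ey t0; have := caputo_upper l0 rz ez t0.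
rewrite !add0r !mulN1r normrN => h2.
by rewrite ler_norml h1 andbT lerNl.
Qed.

End caputo_equation.

(** * The Laplace transform of a solution *)

Section laplace_transform.
Context (R : realType) (alpha : R).
Hypothesis alpha01 : 0 < alpha < 1.
Notation mu := (@lebesgue_measure R).
Local Notation K := (laplace_kernel alpha).

Lemma integrable_restrictT (D : set R) (f : R -> R) : measurable D ->
  mu.-integrable D (EFin \o f) -> mu.-integrable setT (EFin \o (f \_ D)).
Proof.
move=> mD fi; have := (@integrable_mkcond _ (measurableTypeR R) R mu D (EFin \o f) mD).1 fi.
by rewrite restrict_EFin.
Qed.

Lemma cvg0_scale (u : nat -> R) (a e : R) : u n @[n --> \oo] --> (0 : R) ->
  a * u n * e @[n --> \oo] --> (0 : R).
Proof.
move=> cu; rewrite [X in _ --> X](_ : _ = a * 0 * e); last by rewrite mulr0 mul0r.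
by apply: cvgM; [apply: cvgM => //; exact: cvg_cst|exact: cvg_cst].
Qed.

Lemma expN_integrable (p : R) : 0 < p ->
  mu.-integrable `[0, +oo[ (EFin \o (fun t => expR (- (p * t)))).
Proof.
move=> p0; apply/integrableP; split.
  by apply/measurable_EFinP; exact: measurable_expN.
rewrite (_ : (\int[mu]_(x in _) _)%E = \int[mu]_(t in `[0%R, +oo[) (expR (- (p * t)))%:E)%E.
  by rewrite integral_expN// ltry.
by apply: eq_integral => x _ /=; rewrite ger0_norm ?expR_ge0.
Qed.

Lemma laplace_integrable (p M : R) (y : R -> R) : 0 < p ->
  measurable_fun (`]0, +oo[%classic : set R) y -> (forall t, 0 < t -> `|y t| <= M) ->
  mu.-integrable `]0, +oo[ (EFin \o (fun t => expR (- (p * t)) * y t)).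
Proof.
move=> p0 my yM.
have m0 : measurable (`]0, +oo[%classic : set (measurableTypeR R)) by exact: measurable_itv.
have i : mu.-integrable `]0, +oo[ (EFin \o (fun t => expR (- (p * t)))).
  apply: (@integrableS _ (measurableTypeR R) R mu `[0, +oo[) => //; last exact: expN_integrable.
  by apply: subset_itvr; rewrite bnd_simp.
rewrite (_ : _ \o _ = EFin \o (fun t => y t * expR (- (p * t)))); last first.
  by apply/funext => t /=; rewrite mulrC.
apply: (@integrable_bounded_mul _ _ _ _ M) => // t; rewrite /= in_itv/= andbT => t0; exact: yM.
Qed.

Lemma cr_measurable (y : R -> R) : caputo_regular y -> measurable_fun (`]0, +oo[%classic : set R) y.
Proof.
move=> ry; apply: open_continuous_measurable_fun; first exact: interval_open.
by move=> x; rewrite inE/= in_itv/= andbT; exact: cr_at.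
Qed.

Section truncated.
Context (lambda : R) (y : R -> R) (p T : R).
Hypothesis l0 : 0 <= lambda.
Hypothesis ry : caputo_regular y.
Hypothesis ey : forall t, 0 < t -> caputo alpha y t = - (lambda * y t).
Hypothesis p0 : 0 < p.
Hypothesis T0 : 0 < T.

Let G1 := Gamma (1 - alpha).
Let c := p `^ (alpha - 1) * G1.
Let M := `|y 0|.
Let phi s := expR (- (p * s)) * ((derive1 y) \_ `]0, T[) s.
(** exp(- p t) (t - s)^-alpha y'(s), factored as a convolution of the Laplace kernel with [phi], so
    that Fubini's theorem separates the variables. The derivative is known to be integrable only on
    bounded intervals, hence the cut at T. *)
Let G (ts : R * R) : R := K p (ts.1 - ts.2) * phi ts.2.

Let mT : measurable (`]0, T[%classic : set (measurableTypeR R)).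
Proof. exact: measurable_itv. Qed.

Let G1_gt0 : 0 < G1. Proof. exact: Gamma_gt0. Qed.
Let c0 : 0 <= c. Proof. by rewrite mulr_ge0 ?powR_ge0 ?ltW. Qed.

Let yM t : 0 <= t -> `|y t| <= M.
Proof. exact: caputo_max_principle l0 ry ey t. Qed.

Let iphi : mu.-integrable setT (EFin \o phi).
Proof.
rewrite (_ : EFin \o phi = EFin \o (fun s => expR (- (p * s)) * derive1 y s) \_ `]0, T[); last first.
  by apply/funext => s; rewrite /phi /= !patchE; case: ifP => // _; rewrite mulr0.
apply: integrable_restrictT => //.
apply: (@integrable_bounded_mul _ _ _ _ 1) => //.
- exact: measurable_expN.
- move=> s; rewrite /= in_itv/= => /andP[s0 _]; rewrite ger0_norm ?expR_ge0//.
  by rewrite expR_le1 oppr_le0 mulr_ge0 ?ltW.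
- exact: cr_integrable ry _ T0.
Qed.

Let mphi : measurable_fun setT phi.
Proof. by have /integrableP[/measurable_EFinP] := iphi. Qed.

Let mG : measurable_fun setT (EFin \o G).
Proof.
apply/measurable_EFinP; apply: measurable_funM.
  apply: (measurableT_comp (measurable_laplace_kernel alpha p)); exact: measurable_funB.
exact: (measurableT_comp mphi).
Qed.

Let intK (a : R) (s : R) : 0 <= a -> (\int[mu]_t (a * K p (t - s))%:E = (a * c)%:E)%E.
Proof.
move=> a0.
have mK : measurable_fun setT (EFin \o K p).
  by apply/measurable_EFinP; exact: measurable_laplace_kernel.
have := @ge0_integral_affine R 1 (- s) (EFin \o K p) ltr01 mK (fun x => laplace_kernel_ge0 alpha p x).
rewrite mul1e /= integral_laplace_kernel// -/c => e.
rewrite EFinM e -ge0_integralZl_EFin; [|exact: measurableT|..|exact: a0].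
- by apply: eq_integral => t _; rewrite mul1r EFinM.
- by move=> x _; rewrite lee_fin laplace_kernel_ge0.
- by apply: (measurableT_comp mK); apply: measurable_funD => //; exact: measurable_funM.
Qed.

Let iG : (mu \x mu)%E.-integrable setT (EFin \o G).
Proof.
apply/integrable21ltyP => //.
rewrite (_ : (\int[mu]_s _)%E = \int[mu]_s (c * `|phi s|)%:E)%E.
  have : mu.-integrable setT (EFin \o (fun s => c * `|phi s|)).
    apply: (@integrable_bounded_mul _ _ (fun=> c) _ c) => //.
      by move=> s _; rewrite ger0_norm.
    exact: integrable_norm iphi.
  move=> /integrableP[_]; apply: le_lt_trans; apply: ge0_le_integral => //.
  - by move=> s _; rewrite lee_fin mulr_ge0.
  - by apply/measurable_EFinP; apply: measurable_funM => //; exact: measurableT_comp.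
  - apply: measurableT_comp => //; apply/measurable_EFinP; apply: measurable_funM => //.
    exact: measurableT_comp.
  - by move=> s _; rewrite lee_fin ler_norm.
apply: eq_integral => s _; rewrite mulrC -(intK s (normr_ge0 _)).
apply: eq_integral => t _.
have -> : (`|(EFin \o G) (t, s)| = (`|G (t, s)|)%:E)%E by [].
by rewrite /G normrM mulrC [X in _ * X]ger0_norm// laplace_kernel_ge0.
Qed.

Let g t := \int[mu]_s G (t, s).

Let Gpatch t : (fun s => G (t, s)) =
  (fun s => expR (- (p * t)) * ((t - s) `^ (- alpha) * derive1 y s)) \_ `]0, Num.min t T[.
Proof.
apply/funext => s; rewrite /G /phi /= !patchE !mem_setE !in_itv/= lt_min /laplace_kernel subr_gt0.
case: (ltP s t) => st; last by rewrite mul0r andbF.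
case: (ltP 0 s) => s0; last by rewrite !mulr0.
case: (ltP s T) => sT /=; last by rewrite !mulr0.
have -> : expR (- (p * t)) = expR (- (p * (t - s))) * expR (- (p * s)).
  by rewrite -expRD; congr expR; ring.
ring.
Qed.

Let i_sec t : mu.-integrable setT (fun s => (G (t, s))%:E).
Proof.
have [t0|t0] := ltP 0 t; last first.
  rewrite (_ : (fun s => _) = cst 0%E); first exact: integrable0.
  apply/funext => s; have /(congr1 (@^~ s)) /= -> := Gpatch t.
  rewrite patchE mem_setE in_itv/= lt_min; case: ifP => // /and3P[h1 h2 _].
  by have := lt_trans h1 h2; rewrite ltNge t0.
have -> : (fun s => (G (t, s))%:E) = EFin \o (fun s => G (t, s)) by [].
rewrite Gpatch; apply: integrable_restrictT; first exact: measurable_itv.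
apply: (@integrable_bounded_mul _ _ (fun=> expR (- (p * t))) _ (expR (- (p * t)))) => //.
- by move=> s _; rewrite ger0_norm ?expR_ge0.
- by apply: kernel_integrable_lt => //; rewrite ge_min lexx.
Qed.

Let gE t : 0 < t -> g t = expR (- (p * t)) *
   \int[mu]_(s in `]0, Num.min t T[) ((t - s) `^ (- alpha) * derive1 y s).
Proof.
move=> t0; rewrite /g Gpatch -Rintegral_mkcond RintegralZl//.
by apply: kernel_integrable_lt => //; rewrite ge_min lexx.
Qed.

Let g_le0 t : t <= 0 -> g t = 0.
Proof.
move=> t0; rewrite /g Gpatch -Rintegral_mkcond set_itv_ge ?Rintegral_set0//.
by rewrite bnd_simp -leNgt ge_min t0.
Qed.

Let h t := ((fun t => expR (- (p * t)) * (- (G1 * lambda) * y t)) \_ `]0, T]) t.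

(** Up to T the equation identifies [g] with [h]. Beyond T only [g] remains, and its bound is again
    a translated Laplace kernel, with integral of order exp(- p T). *)
Let gh t : `|g t - h t| <= 2 * M * expR (- (p * T)) * K p (t - T).
Proof.
have M0 : 0 <= M by exact: normr_ge0.
have r0 : 0 <= 2 * M * expR (- (p * T)) * K p (t - T).
  by rewrite !mulr_ge0 ?expR_ge0 ?laplace_kernel_ge0.
rewrite /h patchE mem_setE in_itv/=; have [t0|t0] := ltP 0 t; last by rewrite g_le0 ?subrr ?normr0.
rewrite gE//; have [tT|Tt] := leP t T.
  rewrite /= -mulrBr.
  have := ey t0; rewrite /caputo -/G1 => e.
  have -> : \int[mu]_(s in `]0, t[) ((t - s) `^ (- alpha) * derive1 y s) = - (G1 * lambda) * y t.
    by rewrite mulNr -mulrA -mulrN -e mulrA mulfV ?mul1r// gt_eqF.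
  by rewrite subrr mulr0 normr0.
rewrite /= subr0 normrM ger0_norm ?expR_ge0// /laplace_kernel subr_gt0 Tt.
have := kernel_integral_bound alpha01 T0 Tt ry yM => b.
apply: (le_trans (ler_wpM2l (expR_ge0 _) b)).
rewrite le_eqVlt; apply/orP; left; apply/eqP.
rewrite [RHS]mulrACA -expRD mulrC; congr (_ * expR _); ring.
Qed.

Let iy : mu.-integrable `]0, +oo[ (EFin \o (fun t => expR (- (p * t)) * y t)).
Proof.
apply: (@laplace_integrable _ M) => //; first exact: cr_measurable.
by move=> t t0; apply: yM; exact: ltW.
Qed.

Lemma laplace_truncated :
  `|c * (expR (- (p * T)) * y T - y 0 + p * \int[mu]_(t in `]0, T[) (expR (- (p * t)) * y t)) +
    G1 * lambda * \int[mu]_(t in `]0, T[) (expR (- (p * t)) * y t)| <=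
  2 * M * expR (- (p * T)) * c.
Proof.
have iyT : mu.-integrable `]0, T] (EFin \o (fun t => expR (- (p * t)) * y t)).
  apply: (@integrableS _ (measurableTypeR R) R mu `]0, +oo[) => //.
  by apply: subset_itvl; rewrite bnd_simp.
have iyT' : mu.-integrable `]0, T[ (EFin \o (fun t => expR (- (p * t)) * y t)).
  apply: (@integrableS _ (measurableTypeR R) R mu `]0, +oo[) => //.
  by apply: subset_itvl; rewrite bnd_simp.
set L := \int[mu]_(t in `]0, T[) _.
have hL : \int[mu]_t h t = - (G1 * lambda) * L.
  rewrite /h -Rintegral_mkcond /L (Rintegral_itv_bndo_bndc iyT').
  rewrite -RintegralZl//.
  by apply: eq_Rintegral => t _; rewrite mulrCA.
have ih : mu.-integrable setT (EFin \o h).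
  apply: integrable_restrictT; first exact: measurable_itv.
  rewrite (_ : _ \o _ = EFin \o (fun t => - (G1 * lambda) * (expR (- (p * t)) * y t))).
    exact: (@integrable_bounded_mul _ _ (fun=> - (G1 * lambda)) _ `|- (G1 * lambda)|).
  by apply/funext => t /=; congr EFin; ring.
have ig : mu.-integrable setT (EFin \o g).
  have := integrable_fubini_F iG; congr (_.-integrable _ _); apply/funext => t.
  by rewrite /fubini_F /g /= /Rintegral fineK// integrable_fin_num.
have gL : \int[mu]_t g t = c * (expR (- (p * T)) * y T - y 0 + p * L).
  have e : (\int[mu]_t (g t)%:E = \int[mu]_s (c * phi s)%:E)%E.
    transitivity (\int[mu]_t \int[mu]_s (EFin \o G) (t, s))%E.
      by apply: eq_integral => t _; rewrite /g /Rintegral fineK// integrable_fin_num.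
    rewrite (Fubini iG); apply: eq_integral => s _; rewrite /G /=.
    (* [intK] takes a nonnegative factor, so a negative [phi s] goes through its opposite. *)
    have [f0|f0] := leP 0 (phi s).
      by rewrite mulrC -(intK s f0); apply: eq_integral => t _; rewrite mulrC.
    rewrite (_ : (\int[mu]_x _)%E = \int[mu]_x (- (- phi s * K p (x - s))%:E))%E; last first.
      by apply: eq_integral => t _; rewrite mulNr EFinN oppeK mulrC.
    rewrite integral_ge0N; last first.
      by move=> t _; rewrite lee_fin mulr_ge0 ?laplace_kernel_ge0// oppr_ge0 ltW.
    by rewrite intK ?oppr_ge0 ?(ltW f0)// mulNr EFinN oppeK mulrC.
  rewrite /Rintegral e -/(Rintegral mu setT (fun s => c * phi s)).
  rewrite RintegralZl//; congr (_ * _).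
  have -> : \int[mu]_s phi s = \int[mu]_(s in `]0, T[) (expR (- (p * s)) * derive1 y s).
    rewrite [RHS]Rintegral_mkcond; apply: eq_Rintegral => s _.
    by rewrite /phi !patchE; case: ifP => //; rewrite mulr0.
  have i1 : mu.-integrable `]0, T[ (EFin \o (fun s => expR (- (p * s)) * derive1 y s)).
    apply: (@integrable_bounded_mul _ _ _ _ 1) => //.
    - exact: measurable_expN.
    - move=> s; rewrite /= in_itv/= => /andP[s0 _]; rewrite ger0_norm ?expR_ge0//.
      by rewrite expR_le1 oppr_le0 mulr_ge0 ?ltW.
    - exact: cr_integrable ry _ T0.
  have i2 : mu.-integrable `]0, T[ (EFin \o (fun s => - p * (expR (- (p * s)) * y s))).
    by apply: (@integrable_bounded_mul _ _ (fun=> - p) _ `|- p|).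
  have F : \int[mu]_(s in `]0, T[) (expR (- (p * s)) * derive1 y s + - p * (expR (- (p * s)) * y s)) =
      expR (- (p * T)) * y T - expR (- (p * 0)) * y 0.
    have cE t : expR (- (p * x)) @[x --> t] --> expR (- (p * t)) by exact: continuous_expN.
    apply: (@FTC_oo _ _ (fun s => expR (- (p * s)) * y s)); first exact: T0.
    - move=> t /andP[t0 _]; have := is_deriveM (is_derive_expN p t) (cr_is_derive ry t0).
      rewrite /GRing.scale /= (_ : _ + y t * _ = expR (- (p * t)) * derive1 y t +
        - p * (expR (- (p * t)) * y t)) //; ring.
    - move=> t /andP[t0 _]; apply: cvgD; first by apply: cvgM; [exact: cE|exact: cr_C1 ry _ t0].
      by apply: cvgMr; apply: cvgM; [exact: cE|exact: cr_at].
    - by apply: cvgM; [exact: cvg_at_right_filter (cE 0)|exact: cr_at0].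
    - by apply: cvgM; apply: cvg_at_left_filter; [exact: cE|exact: cr_at].
    - exact: integrableD_EFin.
  move: F; rewrite RintegralD// RintegralZl// -/L mulr0 oppr0 expR0 mul1r => F.
  by rewrite -F mulNr subrK.
have igh : mu.-integrable setT (EFin \o (fun t => g t - h t)).
  rewrite (_ : _ \o _ = (EFin \o g) \- (EFin \o h))%E; last by apply/funext.
  exact: integrableB.
have -> : c * (expR (- (p * T)) * y T - y 0 + p * L) + G1 * lambda * L =
    \int[mu]_t g t - \int[mu]_t h t by rewrite gL hL mulNr opprK.
rewrite -RintegralB//.
apply: (le_trans (le_normr_Rintegral _ igh)) => //.
have cM : 0 <= 2 * M * expR (- (p * T)) by rewrite mulr_ge0 ?expR_ge0// mulr_ge0// normr_ge0.
apply: (@le_trans _ _ (\int[mu]_t (2 * M * expR (- (p * T)) * K p (t - T)))).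
  apply: le_Rintegral => //; first exact: integrable_norm igh.
  apply/integrableP; split.
    apply/measurable_EFinP; apply: measurable_funM => //.
    by apply: (measurableT_comp (measurable_laplace_kernel alpha p)); exact: measurable_funB.
  rewrite (_ : (\int[mu]_x _)%E = (2 * M * expR (- (p * T)) * c)%:E) ?ltry// -(intK T cM).
  by apply: eq_integral => t _ /=; rewrite ger0_norm// mulr_ge0 ?laplace_kernel_ge0.
by rewrite /Rintegral intK.
Qed.

End truncated.

(* The truncation of [laplace_truncated] is removed by [T --> +oo]. *)
Lemma laplace_solution (lambda p : R) (y : R -> R) : 0 <= lambda -> 0 < p -> caputo_regular y ->
  (forall t, 0 < t -> caputo alpha y t = - (lambda * y t)) ->
  (p `^ alpha + lambda) * \int[mu]_(t in `]0, +oo[) (expR (- (p * t)) * y t) = p `^ (alpha - 1) * y 0.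
Proof.
move=> l0 p0 ry ey.
have yM := caputo_max_principle alpha01 l0 ry ey.
have iy : mu.-integrable `]0, +oo[ (EFin \o (fun t => expR (- (p * t)) * y t)).
  apply: (@laplace_integrable _ `|y 0|) => //; first exact: cr_measurable.
  by move=> t t0; apply: yM; exact: ltW.
set L := \int[mu]_(t in `]0, +oo[) _.
pose LT n := \int[mu]_(t in `]0, n.+1%:R[) (expR (- (p * t)) * y t).
have cL : LT n @[n --> \oo] --> L.
  apply: (@Rintegral_cvg_sets R `]0, +oo[ (fun n => `]0, n.+1%:R[%classic)) => //.
  - by move=> n; apply: subset_itvl; rewrite bnd_simp.
  - move=> x; rewrite /= in_itv/= andbT => x0; apply: filterS (nbhs_infty_gtr x) => n xn.
    by rewrite in_itv/= x0/= (lt_le_trans xn)// ler_nat.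
have cE : expR (- (p * n.+1%:R)) @[n --> \oo] --> (0 : R).
  apply: (@cvg_comp _ _ _ (fun n : nat => n.+1%:R) (fun t => expR (- (p * t))) \oo (pinfty_nbhs R)).
    by rewrite (cvg_shiftS (fun n : nat => n%:R : R)); exact: cvgr_idn.
  exact: expN_cvg0.
set c := p `^ (alpha - 1) * Gamma (1 - alpha).
have cEy : expR (- (p * n.+1%:R)) * y n.+1%:R @[n --> \oo] --> (0 : R).
  have c1 : expR (- (p * n.+1%:R)) * `|y 0| @[n --> \oo] --> (0 : R).
    by under eq_fun do rewrite -[expR _]mul1r; exact: cvg0_scale.
  apply/cvgr0Pnorm_le => e e0; move/cvgr0Pnorm_le : c1 => /(_ e e0); apply: filterS => n.
  apply: le_trans; rewrite !normrM normr_id; apply: ler_wpM2l => //; exact: yM.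
have h1 : c * (expR (- (p * n.+1%:R)) * y n.+1%:R - y 0 + p * LT n) + Gamma (1 - alpha) * lambda * LT n
     @[n --> \oo] --> c * (0 - y 0 + p * L) + Gamma (1 - alpha) * lambda * L.
  apply: cvgD; last exact: cvgMr.
  apply: cvgMr; apply: cvgD; last exact: cvgMr.
  by apply: cvgB => //; exact: cvg_cst.
have h2 : c * (expR (- (p * n.+1%:R)) * y n.+1%:R - y 0 + p * LT n) + Gamma (1 - alpha) * lambda * LT n
     @[n --> \oo] --> (0 : R).
  have c1 : 2 * `|y 0| * expR (- (p * n.+1%:R)) * c @[n --> \oo] --> (0 : R).
    exact: cvg0_scale.
  apply/cvgr0Pnorm_le => e e0; move/cvgr0Pnorm_le : c1 => /(_ e e0); apply: filterS => n.
  apply: le_trans; apply: le_trans (ler_norm _).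
  exact: (laplace_truncated l0 ry ey p0 (ltr0Sn R n)).
have G0 := Gamma_gt0 alpha01.
have e := @cvg_unique _ (@Rhausdorff R) _ _ _ _ h1 h2.
apply: (mulfI (lt0r_neq0 G0)).
have pE : p `^ (alpha - 1) * p = p `^ alpha.
  rewrite powRB; last by rewrite (gt_eqF p0) implybT.
  by rewrite powRr1 ?(ltW p0)// divfK// gt_eqF.
rewrite -pE; rewrite /c in e; apply/eqP; rewrite -subr_eq0; apply/eqP; rewrite -[RHS]e; ring.
Qed.

End laplace_transform.

(** * Post-Widder means and backward Euler *)

Section post_widder.
Context (R : realType).
Notation mu := (@lebesgue_measure R).
Local Notation D := (`]0, +oo[%classic : set (measurableTypeR R)).

(** Density of a sum of k + 1 independent exponential variables of rate p; its mean is (k + 1) /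
    p. *)
Definition erlang (p : R) k (t : R) : R := p * ((p * t) ^+ k / k`!%:R) * expR (- (p * t)).

Let mD : measurable D. Proof. exact: measurable_itv. Qed.

Lemma integrableB_EFin (A : set (measurableTypeR R)) (f g : R -> R) : measurable A ->
  mu.-integrable A (EFin \o f) -> mu.-integrable A (EFin \o g) ->
  mu.-integrable A (EFin \o (fun x => f x - g x)).
Proof.
move=> mA fi gi; rewrite (_ : _ \o _ = (EFin \o f) \- (EFin \o g))%E; last by apply/funext.
exact: integrableB.
Qed.

Section density.
Context (p : R).
Hypothesis p0 : 0 < p.

Lemma erlang_ge0 k t : 0 <= t -> 0 <= erlang p k t.
Proof. by move=> t0; rewrite /erlang !mulr_ge0 ?expR_ge0 ?exprn_ge0 ?mulr_ge0 ?(ltW p0). Qed.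

(** The distribution function minus 1: the primitive that is -1 at 0 and vanishes at +oo. *)
Fixpoint erlang_cdf k (t : R) : R :=
  if k is k'.+1 then erlang_cdf k' t - (p * t) ^+ k / k`!%:R * expR (- (p * t))
  else - expR (- (p * t)).

Lemma is_derive_power (k : nat) (t : R) :
  is_derive t 1 (fun x => (p * x) ^+ k.+1) (k.+1%:R * p * (p * t) ^+ k).
Proof.
have h := is_deriveX k.+1 (is_deriveZ p (is_derive_id t (1 : R))).
have -> : (fun x : R => (p * x) ^+ k.+1) = (p \*: id) ^+ k.+1.
  by apply/funext => x; rewrite exprfctE.
apply: is_derive_eq h _; rewrite /GRing.scale /=; ring.
Qed.

Lemma continuous_power (k : nat) (t : R) : (p * x) ^+ k @[x --> t] --> (p * t) ^+ k.
Proof.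
case: k => [|k]; first exact: cvg_cst.
exact: is_derive_continuous (is_derive_power k t).
Qed.

Lemma is_derive_erlang_cdf k (t : R) : is_derive t 1 (erlang_cdf k) (erlang p k t).
Proof.
elim: k => [|k IH].
  have := is_deriveN (is_derive_expN p t); rewrite opprK.
  by rewrite /erlang expr0 fact0 divr1 mulr1.
have hp : is_derive t 1 (fun x => (p * x) ^+ k.+1 / k.+1`!%:R : R) (p * ((p * t) ^+ k / k`!%:R)).
  have h2 := is_deriveM (is_derive_power k t) (is_derive_cst (k.+1`!%:R^-1 : R) t 1).
  apply: is_derive_eq h2 _; rewrite /GRing.scale /= mulr0 add0r.
  rewrite factS natrM; have k1 : k.+1%:R != 0 :> R by rewrite pnatr_eq0.
  have kf : k`!%:R != 0 :> R by rewrite pnatr_eq0 -lt0n fact_gt0.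
  by move: (k.+1%:R) k1 (k`!%:R) kf => a a0 f f0; field; rewrite a0 f0.
have h := is_deriveB IH (is_deriveM hp (is_derive_expN p t)).
apply: is_derive_eq h _; rewrite /erlang /GRing.scale /=; ring.
Qed.

Lemma continuous_erlang k : continuous (erlang p k).
Proof.
move=> t; apply: cvgM; last exact: continuous_expN.
apply: cvgM; first exact: cvg_cst.
apply: cvgM; last exact: cvg_cst.
exact: continuous_power.
Qed.

Lemma measurable_erlang k (A : set R) : measurable_fun A (erlang p k).
Proof. by apply: measurable_funTS; apply: continuous_measurable_fun; exact: continuous_erlang. Qed.

Lemma power_expN_cvg0 k : (p * x) ^+ k / k`!%:R * expR (- (p * x)) @[x --> +oo] --> (0 : R).
Proof.
have h : 2 ^+ k * expR (- (p / 2 * x)) @[x --> +oo] --> (0 : R).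
  rewrite [X in _ --> X](_ : _ = 2 ^+ k * 0); last by rewrite mulr0.
  by apply: cvgM; [exact: cvg_cst|apply: expN_cvg0; rewrite divr_gt0].
apply: (squeeze_cvgr _ (@cvg_cst _ (0 : R) _ _ _) h); near=> x.
have x0 : 0 < p * x by rewrite mulr_gt0//; near: x; exact: nbhs_pinfty_gt.
rewrite mulr_ge0 ?expR_ge0 ?divr_ge0 ?exprn_ge0 ?(ltW x0)//=.
(* With u = p x / 2, one half of the exponential absorbs the power through u^k / k! <= exp u, the
   other half tends to 0. *)
have -> : expR (- (p * x)) = expR (- (p / 2 * x)) * expR (- (p / 2 * x)).
  by rewrite -expRD; congr expR; field.
rewrite mulrA ler_wpM2r ?expR_ge0// expRN ler_pdivrMr ?expR_gt0//.
have -> : p * x = 2 * (p / 2 * x) by field.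
have u0 : 0 <= p / 2 * x by rewrite mulrAC divr_ge0 ?ltW.
move: (p / 2 * x) u0 => u u0; rewrite exprMn -mulrA; apply: ler_wpM2l; first exact: exprn_ge0.
case: k {h} => [|k]; first by rewrite expr0 fact0 divr1 -expR0 ler_expR.
by apply: le_trans (expR_ge1Dxn k u0); rewrite lerDr.
Unshelve. all: by end_near. Qed.

Lemma erlang_cdf_cvg k : erlang_cdf k x @[x --> +oo] --> (0 : R).
Proof.
elim: k => [|k IH] /=; first by rewrite -oppr0; apply: cvgN; exact: expN_cvg0.
by rewrite -(subr0 0); apply: cvgB => //; exact: power_expN_cvg0.
Qed.

Lemma erlang_cdf0 k : erlang_cdf k 0 = -1.
Proof.
elim: k => [|k IH] /=; first by rewrite mulr0 oppr0 expR0.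
by rewrite IH mulr0 expr0n /= mul0r mul0r subr0.
Qed.

Lemma integral_erlang k : (\int[mu]_(t in D) (erlang p k t)%:E = 1)%E.
Proof.
rewrite integral_itv_obnd_cbnd; last by apply/measurable_EFinP; exact: measurable_erlang.
rewrite (@ge0_continuous_FTC2y R (erlang p k) (erlang_cdf k) 0 0).
- by rewrite erlang_cdf0 EFinN oppeK add0e.
- exact: erlang_ge0.
- by apply: continuous_subspaceT; exact: continuous_erlang.
- exact: erlang_cdf_cvg.
- by move=> t _; have [] := is_derive_erlang_cdf k t.
- apply: cvg_at_right_filter; exact: is_derive_continuous (is_derive_erlang_cdf k 0).
- by move=> t _; rewrite derive1E; have [_ ->] := is_derive_erlang_cdf k t.
Qed.

Lemma erlang_integrable k : mu.-integrable D (EFin \o erlang p k).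
Proof.
apply/integrableP; split; first by apply/measurable_EFinP; exact: measurable_erlang.
rewrite (_ : (\int[mu]_(x in _) _)%E = \int[mu]_(t in D) (erlang p k t)%:E)%E.
  by rewrite integral_erlang ltry.
apply: eq_integral => x; rewrite inE/= in_itv/= andbT => x0.
by rewrite ger0_norm ?erlang_ge0 ?ltW.
Qed.

Lemma Rintegral_erlang k : \int[mu]_(t in D) erlang p k t = 1.
Proof. by rewrite /Rintegral integral_erlang. Qed.

Lemma erlang_mulX k t : t * erlang p k t = k.+1%:R / p * erlang p k.+1 t.
Proof.
rewrite /erlang exprS factS natrM; have k1 : k.+1%:R != 0 :> R by rewrite pnatr_eq0.
have kf : k`!%:R != 0 :> R by rewrite pnatr_eq0 -lt0n fact_gt0.
by move: (k.+1%:R) k1 (k`!%:R) kf => a a0 f f0; field; rewrite a0 f0 gt_eqF.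
Qed.

(** Multiplication by t raises the index ([erlang_mulX]), so all moments reduce to total masses,
    which are 1. *)
Lemma erlang_variance k x :
  mu.-integrable D (EFin \o (fun t => (t - x) ^+ 2 * erlang p k t)) /\
  \int[mu]_(t in D) ((t - x) ^+ 2 * erlang p k t) =
    k.+1%:R * k.+2%:R / p ^+ 2 - 2 * x * k.+1%:R / p + x ^+ 2.
Proof.
pose f1 t := k.+1%:R * k.+2%:R / p ^+ 2 * erlang p k.+2 t.
pose f2 t := - (2 * x * k.+1%:R / p) * erlang p k.+1 t.
pose f3 t := x ^+ 2 * erlang p k t.
have fE t : (t - x) ^+ 2 * erlang p k t = f1 t + f2 t + f3 t.
  have e1 := erlang_mulX k t; have e2 := erlang_mulX k.+1 t.
  have -> : (t - x) ^+ 2 * erlang p k t =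
    t * (t * erlang p k t) - 2 * x * (t * erlang p k t) + x ^+ 2 * erlang p k t by ring.
  rewrite e1 (mulrCA t) e2 /f1 /f2 /f3; field; by rewrite gt_eqF.
have i (c : R) m : mu.-integrable D (EFin \o (fun t => c * erlang p m t)).
  by apply: (@integrable_bounded_mul _ _ (fun=> c) _ `|c|) => //; exact: erlang_integrable.
have iE (c : R) m : \int[mu]_(t in D) (c * erlang p m t) = c.
  by rewrite RintegralZl ?Rintegral_erlang ?mulr1//; exact: erlang_integrable.
have -> : (fun t => (t - x) ^+ 2 * erlang p k t) = (fun t => f1 t + f2 t + f3 t) by apply/funext.
have i12 := integrableD_EFin mD (i _ _) (i _ _) : mu.-integrable D (EFin \o (fun t => f1 t + f2 t)).
split; first exact: integrableD_EFin mD i12 (i _ _).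
by rewrite (RintegralD mD i12 (i _ _)) (RintegralD mD (i _ _) (i _ _)) /f1 /f2 /f3 !iE.
Qed.

End density.

(** Post's inversion formula (-1)^k p^(k+1) L^(k)(p) / k! for the Laplace transform L of y, written
    as a mean. *)
Definition pw_coef (y : R -> R) p k := \int[mu]_(t in D) (erlang p k t * y t).

Section bounded.
Context (y : R -> R) (M : R).
Hypothesis my : measurable_fun D y.
Hypothesis yM : forall t, 0 < t -> `|y t| <= M.

Lemma erlang_mul_integrable p k : 0 < p -> mu.-integrable D (EFin \o (fun t => erlang p k t * y t)).
Proof.
move=> p0; rewrite (_ : _ \o _ = EFin \o (fun t => y t * erlang p k t)); last first.
  by apply/funext => t /=; rewrite mulrC.
apply: (@integrable_bounded_mul _ _ _ _ M) => //; last exact: erlang_integrable.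
by move=> t; rewrite /= in_itv/= andbT => t0; exact: yM.
Qed.

Lemma pw_coef_bound p k : 0 < p -> `|pw_coef y p k| <= M.
Proof.
move=> p0; apply: (le_trans (le_normr_Rintegral mD (erlang_mul_integrable k p0))).
have i : mu.-integrable D (EFin \o (fun t => M * erlang p k t)).
  by apply: (@integrable_bounded_mul _ _ (fun=> M) _ `|M|) => //; exact: erlang_integrable.
apply: (@le_trans _ _ (\int[mu]_(t in D) (M * erlang p k t))).
  apply: le_Rintegral => //; first exact: integrable_norm (erlang_mul_integrable k p0).
  move=> t; rewrite /= in_itv/= andbT => t0; rewrite normrM mulrC (ger0_norm (erlang_ge0 p0 k (ltW t0))).
  by rewrite ler_wpM2r ?erlang_ge0 ?yM ?ltW.
by rewrite RintegralZl ?Rintegral_erlang ?mulr1//; exact: erlang_integrable.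
Qed.

(* Chebyshev's inequality for the Erlang density of mean [x (k + 1) / k]. *)
Lemma pw_coef_cvg (x : R) : 0 < x -> {for x, continuous y} ->
  pw_coef y (k.+1%:R / x) k.+1 @[k --> \oo] --> y x.
Proof.
move=> x0 cy; apply/cvgrPdist_le => e e0.
have e2 : 0 < e / 2 by rewrite divr_gt0.
have /cvgrPdist_le /(_ _ e2) [d /= d0 hd] := cy.
have M0 : 0 <= M by apply: le_trans (normr_ge0 _) (yM x0).
have C0 : 0 <= 2 * M / d ^+ 2 by apply: divr_ge0; [apply: mulr_ge0|apply: sqr_ge0].
(* Continuity serves when |t - x| < d; otherwise 2M is at most 2M (t - x)^2 / d^2, whose mean is the
   second moment about x. *)
have bd t : 0 < t -> `|y x - y t| <= e / 2 + 2 * M / d ^+ 2 * (t - x) ^+ 2.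
  move=> t0; have [tx|tx] := ltP `|x - t| d.
    by apply: (le_trans (hd _ tx)); rewrite lerDl; apply: mulr_ge0 => //; exact: sqr_ge0.
  apply: (@le_trans _ _ (2 * M)).
    by apply: (le_trans (ler_normB _ _)); rewrite mulr_natl mulr2n lerD ?yM.
  apply: (@le_trans _ _ (2 * M / d ^+ 2 * (t - x) ^+ 2)); last by rewrite lerDr ltW.
  rewrite mulrAC ler_pdivlMr ?exprn_gt0// ler_wpM2l ?mulr_ge0//.
  by rewrite -[leRHS]real_normK ?num_real// distrC lerXn2r ?nnegrE ?(ltW d0).
(* With a = k + 1 the second moment about x is x^2 (a + 2) / a^2, at most 3 x^2 / a. The final
   factor 1 only fits the shape of [cvg0_scale]. *)
have key k : `|y x - pw_coef y (k.+1%:R / x) k.+1| <= e / 2 + 2 * M / d ^+ 2 * x ^+ 2 * 3 * k.+1%:R^-1 * 1.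
  set p := k.+1%:R / x; have p0 : 0 < p by rewrite divr_gt0.
  have [iv Ev] := erlang_variance p0 k.+1 x.
  have ie := erlang_integrable p0 k.+1; have iy := erlang_mul_integrable k.+1 p0.
  have i1 : mu.-integrable D (EFin \o (fun t => y x * erlang p k.+1 t)).
    by apply: (@integrable_bounded_mul _ _ (fun=> y x) _ `|y x|).
  have i2 : mu.-integrable D (EFin \o (fun t => y x * erlang p k.+1 t - erlang p k.+1 t * y t)).
    exact: integrableB_EFin.
  have i3 : mu.-integrable D (EFin \o (fun t => e / 2 * erlang p k.+1 t)).
    by apply: (@integrable_bounded_mul _ _ (fun=> e / 2) _ `|e / 2|).
  have i4 : mu.-integrable D (EFin \o (fun t => 2 * M / d ^+ 2 * ((t - x) ^+ 2 * erlang p k.+1 t))).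
    by apply: (@integrable_bounded_mul _ _ (fun=> 2 * M / d ^+ 2) _ `|2 * M / d ^+ 2|).
  have -> : y x - pw_coef y p k.+1 = \int[mu]_(t in D) (y x * erlang p k.+1 t - erlang p k.+1 t * y t).
    by rewrite RintegralB// RintegralZl// Rintegral_erlang// mulr1.
  apply: (le_trans (le_normr_Rintegral mD i2)).
  apply: (@le_trans _ _ (\int[mu]_(t in D) (e / 2 * erlang p k.+1 t +
      2 * M / d ^+ 2 * ((t - x) ^+ 2 * erlang p k.+1 t)))).
    apply: le_Rintegral => //; first exact: integrable_norm i2.
      exact: integrableD_EFin.
    move=> t; rewrite /= in_itv/= andbT => t0.
    rewrite (mulrC (erlang _ _ _)) -mulrBl normrM (ger0_norm (erlang_ge0 p0 k.+1 (ltW t0))).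
    by rewrite mulrA -mulrDl ler_wpM2r ?erlang_ge0 ?bd// ltW.
  rewrite RintegralD// !RintegralZl// Rintegral_erlang// mulr1 Ev /p.
  rewrite !mulr1 lerD2l -[leRHS]mulrA -[leRHS]mulrA; apply: ler_wpM2l => //.
  have -> : k.+3%:R = k.+1%:R + 2 :> R by rewrite -natrD addn2.
  have -> : k.+2%:R = k.+1%:R + 1 :> R by rewrite natr1.
  have k1 : 1 <= k.+1%:R :> R by rewrite ler1n.
  move: (k.+1%:R) k1 => a a1; have a0 : 0 < a by lra.
  have -> : (a + 1) * (a + 2) / (a / x) ^+ 2 - 2 * x * (a + 1) / (a / x) + x ^+ 2 =
    x ^+ 2 * ((a + 2) / a / a) by field; rewrite !gt_eqF.
  by rewrite ler_wpM2l ?sqr_ge0// ler_wpM2r ?invr_ge0 ?(ltW a0)// ler_pdivrMr//; lra.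
have c0 : 2 * M / d ^+ 2 * x ^+ 2 * 3 * k.+1%:R^-1 * 1 @[k --> \oo] --> (0 : R).
  apply: cvg0_scale; exact: cvg_harmonic.
move/cvgr0Pnorm_le : c0 => /(_ _ e2); apply: filterS => k ck.
by apply: (le_trans (key k)); rewrite [leRHS](splitr e) lerD2l; exact: le_trans (ler_norm _) ck.
Qed.

End bounded.
End post_widder.

(** * Erlang means as backward Euler values *)

Section backward_euler.
Context (R : realType) (alpha : R) (b : fps R).
Hypothesis alpha01 : 0 < alpha < 1.
Hypothesis hb : frac_weights alpha b.
Notation mu := (@lebesgue_measure R).
Local Notation D := (`]0, +oo[%classic : set (measurableTypeR R)).
Local Notation X := (fpsX R).
Local Notation "c %:S" := (fpsC c) (at level 2, format "c %:S").

Let mD : measurable D. Proof. exact: measurable_itv. Qed.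

(** The sum of (p t x)^k / k! is exp(p t x), so the weighted densities add up to p exp(- (1 - x) p
    t). Partial sums of the exponential stay below it, which gives the dominating function. *)
Lemma pw_partial_cvg (y : R -> R) (M p x : R) : measurable_fun D y ->
  (forall t, 0 < t -> `|y t| <= M) -> 0 < p -> 0 < x < 1 ->
  (fun n => \sum_(k < n) pw_coef y p k * x ^+ k) @ \oo -->
    p * \int[mu]_(t in D) (expR (- ((1 - x) * p * t)) * y t).
Proof.
move=> my yM p0 /andP[x0 x1].
have q0 : 0 < (1 - x) * p by rewrite mulr_gt0 ?subr_gt0.
pose S n t := \sum_(k < n) (erlang p k t * y t) * x ^+ k.
have iS n : mu.-integrable D (EFin \o S n) /\
    \int[mu]_(t in D) S n t = \sum_(k < n) pw_coef y p k * x ^+ k.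
  elim: n => [|n [IH1 IH2]].
    have -> : S 0%N = cst 0 by apply/funext => t; rewrite /S big_ord0.
    split; last by rewrite big_ord0 Rintegral_cst// mul0r.
    rewrite (_ : _ \o _ = cst 0%E); last by apply/funext.
    exact: integrable0.
  have -> : S n.+1 = fun t => S n t + x ^+ n * (erlang p n t * y t).
    by apply/funext => t; rewrite /S big_ord_recr/= [x ^+ n * _]mulrC.
  have i2 := erlang_mul_integrable my yM n p0.
  have i3 : mu.-integrable D (EFin \o (fun t => x ^+ n * (erlang p n t * y t))).
    by apply: (@integrable_bounded_mul _ _ (fun=> x ^+ n) _ `|x ^+ n|).
  split; first exact: integrableD_EFin.
  by rewrite RintegralD// IH2 RintegralZl// big_ord_recr/= [x ^+ n * _]mulrC.
have SE n t : S n t = p * expR (- (p * t)) * y t * series (exp_coeff (p * t * x)) n.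
  rewrite /S /series /= big_mkord mulr_sumr; apply: eq_bigr => k _.
  by rewrite /erlang /exp_coeff /= !exprMn; ring.
have iL : mu.-integrable D (EFin \o (fun t => p * (expR (- ((1 - x) * p * t)) * y t))).
  apply: (@integrable_bounded_mul _ _ (fun=> p) _ `|p|) => //.
  exact: laplace_integrable my yM.
rewrite -RintegralZl//; last exact: laplace_integrable my yM.
under eq_fun do rewrite -(iS _).2.
have ff (f : R -> R) : mu.-integrable D (EFin \o f) ->
    (\int[mu]_(t in D) f t)%:E = (\int[mu]_(t in D) (f t)%:E)%E.
  by move=> fi; rewrite /Rintegral fineK// integrable_fin_num.
apply: fine_cvg; rewrite ff//.
apply: (@dominated_cvg _ (measurableTypeR R) R mu D mD (fun n t => (S n t)%:E) _
  (fun t => (p * M * expR (- ((1 - x) * p * t)))%:E)).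
- by move=> n; have /integrableP[] := (iS n).1.
- move=> t _; apply: cvg_EFin; first exact: nearW.
  rewrite (_ : p * _ = p * expR (- (p * t)) * y t * expR (p * t * x)); last first.
    have -> : expR (- ((1 - x) * p * t)) = expR (- (p * t)) * expR (p * t * x).
      by rewrite -expRD; congr expR; ring.
    ring.
  rewrite (_ : fine \o _ = fun n => p * expR (- (p * t)) * y t * series (exp_coeff (p * t * x)) n).
    by apply: cvgM; [exact: cvg_cst|exact: is_cvg_series_exp_coeff].
  by apply/funext => n /=.
- by [].
- rewrite (_ : (fun t => _) = EFin \o (fun t => p * M * expR (- ((1 - x) * p * t)))); last by apply/funext.
  apply: (@integrable_bounded_mul _ _ (fun=> p * M) _ `|p * M|) => //.
  apply: (@integrableS _ (measurableTypeR R) R mu `[0, +oo[) => //; last exact: expN_integrable.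
  by apply: subset_itvr; rewrite bnd_simp.
- move=> n t; rewrite /= in_itv/= andbT => t0; rewrite lee_fin SE !normrM.
  have u0 : 0 <= p * t * x by rewrite !mulr_ge0 ?ltW.
  rewrite (gtr0_norm p0) (ger0_norm (expR_ge0 _)).
  have -> : expR (- ((1 - x) * p * t)) = expR (- (p * t)) * expR (p * t * x).
    by rewrite -expRD; congr expR; ring.
  have s0 : 0 <= series (exp_coeff (p * t * x)) n <= expR (p * t * x).
    rewrite sumr_ge0/=; last by move=> i _; exact: exp_coeff_ge0.
    apply: nondecreasing_cvgn_le; last exact: is_cvg_series_exp_coeff.
    by apply/nondecreasing_seqP => m; rewrite /series /= big_nat_recr//= lerDl exp_coeff_ge0.
  have /andP[s1 s2] := s0; rewrite (ger0_norm s1).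
  have e0 := expR_ge0 (- (p * t)); have yt := yM t t0; have y0 := normr_ge0 (y t).
  have -> : p * M * (expR (- (p * t)) * expR (p * t * x)) = p * expR (- (p * t)) * M * expR (p * t * x) by ring.
  have pe : 0 <= p * expR (- (p * t)) by apply: mulr_ge0 => //; exact: ltW.
  by apply: ler_pM => //; [exact: mulr_ge0|exact: ler_wpM2l].
Qed.

(* The Post-Widder coefficients of a solution are its backward Euler
   convolution-quadrature approximations. *)
Lemma pw_coef_be (lambda p : R) (y : R -> R) : 0 <= lambda -> 0 < p -> caputo_regular y ->
  (forall t, 0 < t -> caputo alpha y t = - (lambda * y t)) ->
  fps_conv (pw_coef y p : fps R) /\
  (b + (lambda * p `^ (- alpha))%:S) * ((1 - X) * pw_coef y p) = (y 0)%:S * b.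
Proof.
move=> l0 p0 ry ey.
have yM t : 0 < t -> `|y t| <= `|y 0|.
  by move=> t0; apply: (caputo_max_principle alpha01 l0 ry ey); exact: ltW.
have my := cr_measurable ry.
set v : fps R := pw_coef y p; set m := lambda * p `^ (- alpha).
have cv : fps_conv v by apply: (@fps_conv_bounded _ _ `|y 0|) => n; exact: pw_coef_bound.
split=> //; have cb := fw_conv hb; have cC c := @fps_convC R c; have cX := @fps_convX R.
have c1 : fps_conv (b + m%:S) by exact: fps_convD.
have c2 : fps_conv (1 - X) by exact: fps_convB (cC 1) cX.
have c3 := fps_convM c2 cv; have c4 := fps_convM c1 c3; have c5 := fps_convM (cC (y 0)) cb.
apply/eqP; rewrite -subr_eq0; apply/eqP; apply: fps_identity; first exact: fps_convB.
move=> x /[dup] x01 /andP[x0 x1].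
have xn : `|x| < 1 by rewrite ger0_norm ?ltW.
have zn : normc x%:C%C < 1 by rewrite normcR.
have x1' : 0 < 1 - x by rewrite subr_gt0.
have q0 : 0 < (1 - x) * p by rewrite mulr_gt0.
have hL := laplace_solution alpha01 l0 q0 ry ey.
set L := \int[mu]_(t in _) _ in hL.
have ev := fps_ev_real cv xn (pw_partial_cvg my yM p0 x01).
rewrite (fps_evB c4 c5 zn) (fps_evM c1 c3 zn) (fps_evM c2 cv zn) (fps_evM (cC _) cb zn).
rewrite (fps_evD cb (cC m) zn) (fps_evB (cC 1) cX zn) (fw_ev hb xn) (fps_evC m zn) (fps_evC (y 0) zn).
rewrite (fps_evC 1 zn) (fps_evX zn) ev.
(* This is the Laplace identity at the point (1 - x) p, divided by p^alpha. *)
have E : ((1 - x) `^ alpha + m) * ((1 - x) * (p * L)) - y 0 * (1 - x) `^ alpha = 0.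
  have P0 : 0 < p `^ alpha by rewrite powR_gt0.
  rewrite /m powRN; rewrite powRM ?(ltW x1') ?(ltW p0)// in hL.
  have qE : ((1 - x) * p) `^ (alpha - 1) = (1 - x) `^ alpha * p `^ alpha / ((1 - x) * p).
    rewrite powRB; last by rewrite (gt_eqF q0) implybT.
    by rewrite powRr1 ?(ltW q0)// powRM ?(ltW x1') ?(ltW p0).
  rewrite qE in hL; move: ((1 - x) `^ alpha) (p `^ alpha) P0 hL => A P P0 hL.
  have -> : (A + lambda / P) * ((1 - x) * (p * L)) = ((A * P + lambda) * L) * ((1 - x) * p) / P.
    by field; rewrite gt_eqF.
  by rewrite hL; field; rewrite !gt_eqF.
by rewrite -!(rmorphM, rmorphD, rmorphB) E.
Qed.

Lemma be_gf_solution (lambda p : R) (y : R -> R) : 0 <= lambda -> 0 < p -> caputo_regular y ->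
  (forall t, 0 < t -> caputo alpha y t = - (lambda * y t)) -> y 0 != 0 ->
  be_gf b (lambda * p `^ (- alpha)) (fun n => pw_coef y p n / y 0 - 1).
Proof.
move=> l0 p0 ry ey y0; have [cv e] := pw_coef_be l0 p0 ry ey.
pose one : fps R := fun=> 1.
have one1 : (1 - X) * one = 1.
  rewrite mulrBl mul1r -[RHS]fpsC_1; apply/funext => n; rewrite fpsBE fpsXM.
  by case: n => [|n]; rewrite /fpsC /one ?subr0 ?subrr.
have -> : (fun n => pw_coef y p n / y 0 - 1) = (y 0)^-1%:S * (pw_coef y p : fps R) - one.
  by apply/funext => n; rewrite fpsBE fpsCM mulrC.
have cone : fps_conv one by apply: (@fps_conv_bounded _ _ 1) => n; rewrite normr1.
split; first by apply: fps_convB => //; apply: fps_convM => //; exact: fps_convC.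
rewrite mulrBr one1.
have -> : (b + (lambda * p `^ (- alpha))%:S) * ((1 - X) * ((y 0)^-1%:S * (pw_coef y p : fps R)) - 1) =
  (y 0)^-1%:S * ((b + (lambda * p `^ (- alpha))%:S) * ((1 - X) * (pw_coef y p : fps R))) -
    (b + (lambda * p `^ (- alpha))%:S).
  by ring.
rewrite e mulrA -fpsC_M mulVf// fpsC_1 mul1r; ring.
Qed.

End backward_euler.

(** * The scalar error estimate *)

Section scalar_error.
Context (R : realType) (alpha : R) (b : fps R).
Hypothesis alpha01 : 0 < alpha < 1.
Hypothesis hb : frac_weights alpha b.

(* Halving the step infinitely often, [cn_doubling] sums to [O(n^-2)] and the
   limit is identified through backward Euler. *)
Theorem scalar_cn_error : exists2 C, 0 <= C &
  forall (lambda tau : R) (y : R -> R) (W : fps R) n, 0 <= lambda -> 0 < tau -> (0 < n)%N ->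
  caputo_regular y -> (forall t, 0 < t -> caputo alpha y t = - (lambda * y t)) ->
  cn_seq alpha b (lambda * tau `^ alpha) W ->
  `|y (n%:R * tau) - y 0 * (1 + W n)| <= C / n%:R ^+ 2 * `|y 0|.
Proof.
have [C1 C10 hC1] := cn_doubling alpha01 hb.
have [C2 C20 hC2] := cn_be alpha01 hb.
exists (2 * C1); first exact: mulr_ge0.
move=> lambda tau y W n l0 tau0 n0 ry ey hW.
set x := n%:R * tau.
have nR : 0 < n%:R :> R by rewrite ltr0n.
have x0 : 0 < x by rewrite mulr_gt0.
have yM := caputo_max_principle alpha01 l0 ry ey.
have [y00|y00] := eqVneq (y 0) 0.
  have := yM x (ltW x0); rewrite y00 normr0 normr_le0 => /eqP ->.
  by rewrite mul0r subrr normr0 mulr0.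
set m := lambda * tau `^ alpha in hW.
have m0 : 0 <= m by rewrite mulr_ge0 ?powR_ge0.
(* The parameter [mu] of the scheme with step tau / 2^k. The choice below is pinned to the given
   series at k = 0. *)
pose mk k := (2 `^ (- alpha)) ^+ k * m.
have mk0 k : 0 <= mk k by rewrite mulr_ge0// exprn_ge0// powR_ge0.
have /choice[Wk hWk] : forall k, exists V, cn_seq alpha b (mk k) V /\ (k = 0%N -> V = W).
  case=> [|k]; first by exists W; rewrite /mk expr0 mul1r.
  by have [V hV] := cn_seq_exists alpha01 hb (mk0 k.+1); exists V.
have W0 : Wk 0%N = W by exact: (hWk 0%N).2.
have step k : `|Wk k (2 ^ k * n)%N - Wk k.+1 (2 ^ k.+1 * n)%N| <= C1 / n%:R ^+ 2 * 4^-1 ^+ k.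
  have h1 := (hWk k).1; have h2 := (hWk k.+1).1.
  rewrite /mk exprS -mulrA -/(mk k) in h2.
  have kn : (1 <= 2 ^ k * n)%N by rewrite muln_gt0 expn_gt0.
  have := hC1 _ _ _ _ (mk0 k) h1 h2 kn; rewrite mulnA -expnS => h.
  apply: (le_trans h); rewrite natrM natrX exprMn -exprM mulnC exprM exprVn.
  rewrite (_ : 2 ^+ 2 = 4); last by rewrite expr2; ring.
  by rewrite invfM mulrA mulrAC.
(* The sum of 4^-j for j < k is 4/3 (1 - 4^-k); the factor 2 leaves room in the induction. *)
have tele k : `|W n - Wk k (2 ^ k * n)%N| <= C1 / n%:R ^+ 2 * (2 * (1 - 4^-1 ^+ k)).
  elim: k => [|k IH]; first by rewrite expn0 mul1n W0 subrr normr0 expr0 subrr !mulr0.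
  apply: (le_trans (ler_distD (Wk k (2 ^ k * n)%N) _ _)).
  apply: (le_trans (lerD IH (step k))); rewrite -mulrDr; apply: ler_wpM2l.
    by rewrite divr_ge0// exprn_ge0// ltW.
  have q0 : 0 <= 4^-1 ^+ k :> R by rewrite exprn_ge0.
  by rewrite exprS; lra.
have C0 : 0 <= C1 / n%:R ^+ 2 by rewrite divr_ge0// exprn_ge0// ltW.
have main : `|W n - (y x / y 0 - 1)| <= C1 / n%:R ^+ 2 * 2.
  apply/ler_addgt0Pr => e e0.
  have e2 : 0 < e / 2 by rewrite divr_gt0.
  have e2y : 0 < e / 2 * `|y 0| by rewrite mulr_gt0 ?normr_gt0.
  have yM' t : 0 < t -> `|y t| <= `|y 0| by move=> t0; apply: yM; exact: ltW.
  have /cvgrPdist_le /(_ _ e2y) [K _ hK] := pw_coef_cvg (cr_measurable ry) yM' x0 (cr_at ry x0).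
  have [L _ hL] := nbhs_infty_gtr (C2 / (e / 2)).
  (* [K] is for the convergence of the Erlang means, [L] for C2 / N <= e / 2, and 3 for the
     condition N >= 4 of [cn_be]. The rate N / x equals 2^k / tau, so index N corresponds to time x
     on the refined grid. *)
  pose k := (K + L + 3)%N; set N := (2 ^ k * n)%N.
  have k3 : (3 <= k)%N by rewrite /k leq_addl.
  have kL : (L <= k)%N by rewrite /k -addnA (leq_trans _ (leq_addl _ _))// leq_addr.
  have kK : (K <= k)%N by rewrite /k -addnA leq_addr.
  have kN : (k < N)%N by apply: leq_trans (ltn_expl k (ltnSn 1)) _; rewrite leq_pmulr.
  have pE : N%:R / x = 2 ^+ k / tau.
    by rewrite /N natrM natrX /x; field; rewrite !gt_eqF.
  have p0 : 0 < 2 ^+ k / tau by rewrite divr_gt0// exprn_gt0.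
  have lE : lambda * (2 ^+ k / tau) `^ (- alpha) = mk k.
    have e1 : (2 ^+ k) `^ (- alpha) = (2 `^ (- alpha)) ^+ k :> R.
      by rewrite -powR_mulrn// -powRrM mulrC powRrM powR_mulrn ?powR_ge0.
    have e3 : (tau^-1) `^ (- alpha) = tau `^ alpha.
      by rewrite -powR_inv1 ?(ltW tau0)// -powRrM mulrNN mul1r.
    by rewrite /mk /m powRM ?exprn_ge0 ?invr_ge0 ?(ltW tau0)// e1 e3; ring.
  have gV := be_gf_solution alpha01 hb l0 p0 ry ey y00; rewrite lE in gV.
  have N4 : (4 <= N)%N by exact: leq_ltn_trans k3 kN.
  have N0 : (0 < N)%N by exact: leq_ltn_trans kN.
  have b1 := hC2 _ _ _ _ (mk0 k) (hWk k).1 gV N4.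
  have NR : 0 < N%:R :> R by rewrite ltr0n.
  have b2 : C2 / N%:R <= e / 2.
    rewrite ler_pdivrMr// mulrC -ler_pdivrMr//; apply: ltW; apply: hL; exact: leq_trans kL (ltnW kN).
  have b3 : `|y x / y 0 - 1 - (pw_coef y (2 ^+ k / tau) N / y 0 - 1)| <= e / 2.
    have -> : y x / y 0 - 1 - (pw_coef y (2 ^+ k / tau) N / y 0 - 1) =
      (y x - pw_coef y (2 ^+ k / tau) N) / y 0 by rewrite mulrBl; ring.
    rewrite normrM normfV ler_pdivrMr ?normr_gt0//.
    have := hK N.-1; rewrite prednK// pE; apply.
    by rewrite /= -ltnS prednK// (leq_ltn_trans kK).
  have t1 := tele k; rewrite -/N in t1.
  have q0 : 0 <= 4^-1 ^+ k :> R by rewrite exprn_ge0.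
  have t2 : `|W n - Wk k N| <= C1 / n%:R ^+ 2 * 2.
    by apply: (le_trans t1); apply: ler_wpM2l => //; lra.
  apply: (le_trans (ler_distD (Wk k N) _ _)); rewrite [in leRHS](splitr e); apply: lerD => //.
  apply: (le_trans (ler_distD (pw_coef y (2 ^+ k / tau) N / y 0 - 1) _ _)); apply: lerD.
    exact: le_trans b1 b2.
  by rewrite distrC.
have -> : y x - y 0 * (1 + W n) = - (y 0 * (W n - (y x / y 0 - 1))).
  by field.
rewrite normrN normrM mulrC; apply: ler_wpM2r => //; apply: (le_trans main).
by rewrite mulrC mulrA.
Qed.

End scalar_error.

(** * Finite elements *)

Section borel_rV.
Context (R : realType) (d : nat).
Notation T := 'rV[R]_d.
Notation lam := (lebesgue_rV R d).

Lemma measurable_box (A : 'I_d -> set R) : (forall i, measurable (A i : set (measurableTypeR R))) ->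
  measurable [set x : T | forall i, A i (x 0 i)].
Proof.
move=> mA; rewrite (_ : [set x | _] =
  \bigcap_(i in [set: 'I_d]) ((fun x : T => x 0 i) @^-1` A i)).
  apply: fin_bigcap_measurable => // i _.
  by rewrite -[X in measurable X]setTI; exact: (@measurable_coord R d i measurableT _ (mA i)).
by apply/seteqP; split => x /= h i; [move=> _; exact: h|exact: h].
Qed.

Lemma rV_ballE (x : T) (e : R) : 0 < e -> ball x e = [set y : T | forall i, `]x 0 i - e, x 0 i + e[%classic (y 0 i)].
Proof.
move=> e0; apply/seteqP; split=> y.
  case=> _ h i; have := h 0 i; rewrite /ball /= ltr_distlC.
  by rewrite in_itv.
move=> h; split=> // i j; have := h j; rewrite /= in_itv/= (ord1 i) /ball /=.
by rewrite ltr_distlC.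
Qed.

Lemma measurable_rV_ball (x : T) (e : R) : 0 < e -> measurable (ball x e).
Proof.
move=> e0; rewrite rV_ballE//.
by apply: (@measurable_box (fun i => `]x 0 i - e, x 0 i + e[%classic)) => i; exact: measurable_itv.
Qed.

(** For the maximum norm balls are boxes, and an open set is the countable union of the balls it
    contains with rational centre and radius 1 / (k + 1). *)
Lemma measurable_rV_open (U : set T) : open U -> measurable U.
Proof.
move=> oU.
pose q2r (q : 'rV[rat]_d) : T := map_mx ratr q.
pose F (qk : 'rV[rat]_d * nat) : set T :=
  if `[< ball (q2r qk.1) qk.2.+1%:R^-1 `<=` U >] then ball (q2r qk.1) qk.2.+1%:R^-1 else set0.
rewrite (_ : U = \bigcup_qk F qk).
  apply: countable_bigcupT_measurable; first exact: countableP.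
  by move=> qk; rewrite /F; case: ifP => // _; exact: measurable_rV_ball.
apply/seteqP; split=> [x Ux|x [qk _]]; last by rewrite /F; case: asboolP => // + Fx; apply.
have /nbhs_ballP[e /= e0 eU] : nbhs x U by exact: open_nbhs_nbhs.
have [k ke] : exists k, k.+1%:R^-1 < e / 2.
  have e2 : 0 < e / 2 by rewrite divr_gt0.
  have /cvgr0Pnorm_lt /(_ _ e2) [k _ hk] := @cvg_harmonic R.
  exists k; have := hk k (leqnn _); rewrite ger0_norm// invr_ge0//.
have k0 : 0 < k.+1%:R^-1 :> R by rewrite invr_gt0.
have /fin_all_exists[q hq] : forall i : 'I_d, exists q : rat, x 0 i - k.+1%:R^-1 < ratr q < x 0 i + k.+1%:R^-1.
  move=> i; have := @rat_in_itvoo R (x 0 i - k.+1%:R^-1) (x 0 i + k.+1%:R^-1).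
  have lt : x 0 i - k.+1%:R^-1 < x 0 i + k.+1%:R^-1 by rewrite ltrBlDr -addrA ltrDl addr_gt0.
  by move=> /(_ lt) [q]; rewrite in_itv/=; exists q.
pose Q : 'rV[rat]_d := \row_i q i.
have bx : ball (q2r Q) k.+1%:R^-1 x.
  rewrite rV_ballE// => i; rewrite /= in_itv/= !mxE.
  by have := hq i; move: (x 0 i) (ratr (q i)) (k.+1%:R^-1) => a c r /andP[h1 h2]; apply/andP; split; lra.
exists (Q, k) => //; rewrite /F /=; case: asboolP => //; case.
move=> y; rewrite rV_ballE// => hy; apply: eU; rewrite rV_ballE// => i.
have := hy i; rewrite /= !in_itv/= !mxE; have := hq i; move: ke.
move: (x 0 i) (y 0 i) (ratr (q i)) (k.+1%:R^-1) => a c f r ke /andP[h1 h2] /andP[h3 h4].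
by apply/andP; split; lra.
Qed.

Lemma measurable_rV_continuous (f : T -> R) (D : set T) : continuous f -> measurable_fun D f.
Proof.
move=> cf; apply: measurable_funTS.
apply: (measurability _ (RGenOpens.measurableE R)).
move=> _ [_ [a [b ->] <-]]; rewrite setTI; apply: measurable_rV_open.
by apply: open_comp => // x _; exact: cf.
Qed.

Lemma lebesgue_rV_bounded (A : set T) : measurable A -> bounded_set A -> (lam A < +oo)%E.
Proof.
move=> mA [M [_ hM]].
pose B : set T := [set x | forall i, `[- (M + 1), M + 1]%classic (x 0 i)].
apply: (@le_lt_trans _ _ (lam B)).
  apply: le_measure; rewrite ?inE//.
    by apply: (@measurable_box (fun=> `[- (M + 1), M + 1]%classic)) => i; exact: measurable_itv.
  move=> x Ax i; have := hM (M + 1); rewrite ltrDl => /(_ ltr01 _ Ax) nx.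
  have : `|x 0 i| <= `|x|.
    by rewrite [leRHS]/Num.Def.normr /= mx_normrE; apply/bigmax_geP; right => /=; exists (0, i).
  by move=> /le_trans /(_ nx); rewrite ler_norml /= in_itv.
rewrite (@lebesgue_rV_box R d (fun=> `[- (M + 1), M + 1]%classic)); last by move=> i; exact: measurable_itv.
set P := (\prod_(i < d) _)%E; suff /andP[] : (0 <= P < +oo)%E by []; rewrite /P.
elim/big_ind: _ => [|x y /andP[x0 xoo] /andP[y0 yoo]|i _].
- by rewrite lee_fin ler01 ltry.
- by rewrite mule_ge0//= lte_mul_pinfty// ge0_fin_numE.
- by rewrite measure_ge0/= lebesgue_measure_itv/=; case: ifP => _; rewrite -?EFinB ?ltry.
Qed.

Lemma lebesgue_rV_ball_gt0 (x : T) (e : R) : 0 < e -> (0 < lam (ball x e))%E.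
Proof.
move=> e0; rewrite rV_ballE// (@lebesgue_rV_box R d (fun i => `]x 0 i - e, x 0 i + e[%classic)); last first.
  by move=> i; exact: measurable_itv.
elim/big_ind: _ => // [a c a0 c0|i _]; first exact: mule_gt0.
by rewrite lebesgue_measure_itv/= lte_fin; case: ifP => h; rewrite ?lte_fin ?subr_gt0//; lra.
Qed.

End borel_rV.

Section finite_element_space.
Context (R : realType) (d : nat) (Omega : set 'rV[R]_d) (Th : mesh R d).
Hypothesis hOmega : convex_polygonal_domain Omega.
Hypothesis hTh : triangulation Omega Th.
Notation lam := (lebesgue_rV R d).
Local Notation T := 'rV[R]_d.
Local Notation Xh := (fe_space Omega Th).
Local Notation nd := (@node R d Th).
Implicit Types (u w : T -> R).

Lemma open_Omega : open Omega.
Proof.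
have [_ _ [m [A [c ->]]]] := hOmega.
rewrite openE => x /= hx.
change (\forall y \near x, forall i, (A *m y^T) i 0 < c i 0).
apply: (@filter_forall T 'I_m (fun i y => (A *m y^T) i 0 < c i 0) (nbhs x) _) => i; have := hx i; rewrite mxE => hi.
have cf (s : seq 'I_d) : \sum_(j <- s) A i j * (y : T) 0 j @[y --> x] --> \sum_(j <- s) A i j * x 0 j.
  elim: s => [|j s IH]; first by rewrite big_nil; under eq_fun do rewrite big_nil; exact: (@cvg_cst R 0 T (nbhs x) _).
  rewrite big_cons; under eq_fun do rewrite big_cons.
  have h : (y : T) 0 j @[y --> x] --> x 0 j by exact: coord_continuous.
  exact: cvgD (cvgM (@cvg_cst R (A i j) T (nbhs x) _) h) IH.
have hs : \sum_(j <- index_enum 'I_d) A i j * x 0 j < c i 0.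
  by apply: le_lt_trans hi; rewrite le_eqVlt; apply/orP; left; apply/eqP/eq_bigr => j _; rewrite mxE.
apply: filterS (cvgr_lt _ (cf _) _ hs) => y; rewrite mxE; apply: le_lt_trans.
by rewrite le_eqVlt; apply/orP; left; apply/eqP/eq_bigr => j _; rewrite mxE.
Qed.

Lemma measurable_Omega : measurable Omega.
Proof. exact: measurable_rV_open open_Omega. Qed.

Lemma Omega_lty : (lam Omega < +oo)%E.
Proof. by apply: lebesgue_rV_bounded; [exact: measurable_Omega|have [] := hOmega]. Qed.

Lemma hull_node (S : {set 'I_(nnode Th)}) i : i \in S -> hull S (nd i).
Proof.
move=> iS; exists (fun j => (j == i)%:R); split.
- by move=> j; case: eqP.
- by rewrite (bigD1 i)//= eqxx big1 ?addr0// => j /andP[_ /negbTE->].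
- by rewrite (bigD1 i)//= eqxx scale1r big1 ?addr0// => j /andP[_ /negbTE->]; rewrite scale0r.
Qed.

Lemma fe_nodal u S (l : 'I_(nnode Th) -> R) : Xh u -> S \in cells Th ->
  (forall i, 0 <= l i) -> \sum_(i in S) l i = 1 ->
  u (\sum_(i in S) l i *: nd i) = \sum_(i in S) l i * u (nd i).
Proof.
move=> [_ _ /(_ S) h] SC l0 l1; have [g [c hg]] := h SC.
rewrite hg; last by exists l.
rewrite mulmx_suml summxE -[c]mul1r -l1 mulr_suml -big_split/=; apply: eq_bigr => i iS.
by rewrite hg ?mulrDr -?scalemxAl ?mxE//; exact: hull_node.
Qed.

(** Reduces functions of the space to finitely many nodal values; boundedness and injectivity of the
    nodal map follow. *)
Lemma fe_point u x : Xh u -> u x = 0 \/ exists (S : {set 'I_(nnode Th)}) (l : 'I_(nnode Th) -> R),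
  [/\ forall i, 0 <= l i, \sum_(i in S) l i = 1 & u x = \sum_(i in S) l i * u (nd i)].
Proof.
move=> Xu; have [Ox|nOx] := pselect (Omega x); last by left; case: Xu => _ /(_ x nOx).
right; have := subset_closure Ox; have [_ _ <-] := hTh => -[S /= SC [l [l0 l1 ->]]].
by exists S, l; split=> //; exact: fe_nodal.
Qed.

Lemma fe_bounded u x : Xh u -> `|u x| <= \sum_i `|u (nd i)|.
Proof.
move=> Xu; have := fe_point x Xu; case=> [->|[S [l [l0 l1 ->]]]]; first by rewrite normr0 sumr_ge0.
apply: (le_trans (ler_norm_sum _ _ _)); rewrite [leRHS](bigID (mem S))/=.
rewrite -[leLHS]addr0; apply: lerD; last exact: sumr_ge0.
apply: ler_sum => i iS; rewrite normrM ler_piMl// ger0_norm// -l1 (bigD1 i)//= lerDl.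
exact: sumr_ge0.
Qed.

Lemma fe_inj u : Xh u -> (forall i, u (nd i) = 0) -> u = 0.
Proof.
move=> Xu u0; apply/funext => x; have := fe_bounded x Xu.
by rewrite big1 ?normr_le0; [move/eqP|move=> i _; rewrite u0 normr0].
Qed.

Lemma fe_add u w : Xh u -> Xh w -> Xh (u + w).
Proof.
move=> [cu u0 gu] [cw w0 gw]; split.
- by move=> x; have h1 := cu x; have h2 := cw x; exact: cvgD h1 h2.
- by move=> x nx; rewrite /GRing.add/= u0// w0// addr0.
- move=> S SC; have [g [c hg]] := gu S SC; have [g' [c' hg']] := gw S SC.
  exists (g + g'), (c + c') => x hx; rewrite mulmxDr mxE addrACA.
  by rewrite -hg// -hg'.
Qed.

Lemma fe_scale (a : R) u : Xh u -> Xh (a *: u).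
Proof.
move=> [cu u0 gu]; split.
- by move=> x; have h1 := cu x; exact: cvgMr h1.
- by move=> x nx; have -> : (a *: u) x = a * u x by []; rewrite u0// mulr0.
- move=> S SC; have [g [c hg]] := gu S SC.
  exists (a *: g), (a * c) => x hx; rewrite -scalemxAr mxE -mulrDr.
  by rewrite -hg.
Qed.

Lemma fe_zero : Xh 0.
Proof.
split=> //.
- by move=> x; exact: (@cvg_cst R 0 T (nbhs x) _).
- by move=> S _; exists 0, 0 => x _; rewrite mulmx0 mxE addr0.
Qed.

Lemma fe_sub u w : Xh u -> Xh w -> Xh (u - w).
Proof. by move=> Xu Xw; rewrite -scaleN1r; apply: fe_add => //; exact: fe_scale. Qed.

Lemma fe_restrict u : Xh u -> u \_ Omega = u.
Proof.
move=> [_ u0 _]; apply/funext => x; rewrite patchE; case: ifPn => // /negP xO.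
by rewrite u0// => Ox; apply: xO; rewrite inE.
Qed.

Lemma poweR_sqr (a : R) : (`|a%:E| `^ 2 = (a * a)%:E)%E.
Proof. by rewrite /= powR_mulrn// -normrX ger0_norm ?sqr_ge0. Qed.

Lemma fe_L2 u : Xh u -> L2 Omega u.
Proof.
move=> Xu; rewrite /L2 fe_restrict// inE; have [cu u0 _] := Xu.
have mu : measurable_fun setT u by exact: measurable_rV_continuous.
apply/andP; split; rewrite inE//= /finite_norm unlock.
apply: poweR_lty; set M := \sum_i `|u (nd i)|.
under eq_integral do rewrite poweR_sqr.
have mO := measurable_Omega.
apply: (@le_lt_trans _ _ ((M ^+ 2)%:E * lam Omega)%E); last first.
  by rewrite lte_mul_pinfty ?lee_fin ?sqr_ge0 ?Omega_lty.
rewrite -integral_cst// [leRHS]integral_mkcond; apply: ge0_le_integral => //.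
- by move=> x _; rewrite lee_fin -expr2 sqr_ge0.
- by apply/measurable_EFinP; exact: measurable_funM.
- exact: (measurable_restrictT _ mO).1.
- move=> x _; rewrite patchE; case: ifPn => xO; last first.
    by rewrite u0 ?mulr0// => Ox; move/negP: xO; rewrite inE.
  rewrite /= lee_fin -expr2 -real_normK ?num_real// lerXn2r ?nnegrE ?sumr_ge0//.
  exact: fe_bounded.
Qed.

Section dot.

Lemma L2_mul_integrable u w : L2 Omega u -> L2 Omega w ->
  lam.-integrable Omega (EFin \o (fun x => u x * w x)).
Proof.
move=> Lu Lw; have /Lfun1_integrable := Lfun2_mul_Lfun1 Lu Lw.
rewrite (_ : _ \* _ = (fun x => u x * w x) \_ Omega); last first.
  by apply/funext => x /=; rewrite !patchE; case: ifP; rewrite ?mul0r.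
rewrite -restrict_EFin => h.
exact: (integrable_mkcond _ measurable_Omega).2.
Qed.

Lemma L2dotC u w : L2dot Omega u w = L2dot Omega w u.
Proof. by apply: eq_Rintegral => x _; rewrite mulrC. Qed.

Lemma L2dotDl u1 u2 w : L2 Omega u1 -> L2 Omega u2 -> L2 Omega w ->
  L2dot Omega (u1 + u2) w = L2dot Omega u1 w + L2dot Omega u2 w.
Proof.
move=> L1 L2' Lw; rewrite /L2dot -RintegralD//.
- by apply: eq_Rintegral => x _; rewrite -mulrDl.
- exact: measurable_Omega.
- exact: L2_mul_integrable.
- exact: L2_mul_integrable.
Qed.

Lemma L2_add u w : L2 Omega u -> L2 Omega w -> L2 Omega (u + w).
Proof.
move=> Lu Lw; rewrite /L2 (_ : _ \_ _ = u \_ Omega + w \_ Omega); last first.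
  by apply/funext => x; rewrite patchE /GRing.add/= !patchE; case: ifP; rewrite ?addr0.
have p1 : (1 <= 2%:E :> \bar R)%E by rewrite lee_fin ler1n.
by have [_ h] := @Lfun_addr_closed _ _ _ lam _ p1; exact: h.
Qed.

Lemma L2_scale (a : R) u : L2 Omega u -> L2 Omega (a *: u).
Proof.
move=> Lu; rewrite /L2 (_ : _ \_ _ = a \o* (u \_ Omega)); last first.
  by apply/funext => x /=; rewrite !patchE; case: ifP; rewrite ?mul0r// mulrC.
by apply: Lfun_scale => //; rewrite ler1n.
Qed.

Lemma L2dotZl (a : R) u w : L2 Omega u -> L2 Omega w ->
  L2dot Omega (a *: u) w = a * L2dot Omega u w.
Proof.
move=> Lu Lw; rewrite /L2dot -RintegralZl//.
- by apply: eq_Rintegral => x _; rewrite mulrA.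
- exact: measurable_Omega.
- exact: L2_mul_integrable.
Qed.

Lemma L2_sub u w : L2 Omega u -> L2 Omega w -> L2 Omega (u - w).
Proof. by move=> Lu Lw; rewrite -scaleN1r; apply: L2_add => //; exact: L2_scale. Qed.

Lemma L2dotBl u1 u2 w : L2 Omega u1 -> L2 Omega u2 -> L2 Omega w ->
  L2dot Omega (u1 - u2) w = L2dot Omega u1 w - L2dot Omega u2 w.
Proof.
move=> L1 L2' Lw; rewrite -scaleN1r L2dotDl// ?L2dotZl ?mulN1r//.
exact: L2_scale.
Qed.

Lemma L2dot_ge0 u : 0 <= L2dot Omega u u.
Proof. by apply: Rintegral_ge0 => x _; rewrite -expr2 sqr_ge0. Qed.

Lemma L2dot_eq0 u : Xh u -> L2dot Omega u u = 0 -> u = 0.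
Proof.
move=> Xu u0; apply/funext => x; apply/eqP; apply/negP => /negP ux.
have [cu uO _] := Xu.
have Ox : Omega x by apply: contrapT => /uO /eqP; rewrite (negbTE ux).
have ux0 : 0 < `|u x| / 2 by rewrite divr_gt0 ?normr_gt0.
have /nbhs_ballP[e /= e0 he] : nbhs x (Omega `&` [set y | `|u x| / 2 < `|u y|]).
  apply: filterI; first by apply: open_nbhs_nbhs; split => //; exact: open_Omega.
  have : `|u y| @[y --> x] --> `|u x| by have h1 := cu x; exact: cvg_norm h1.
  by move/cvgr_gt; apply; rewrite ltr_pdivrMr// ltr_pMr ?normr_gt0 ?ltr1n.
have i := L2_mul_integrable (fe_L2 Xu) (fe_L2 Xu).
have mO := measurable_Omega.
have mB := measurable_rV_ball x e0.
have BO : ball x e `<=` Omega by move=> y /he[].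
have h1 : (((`|u x| / 2) ^+ 2)%:E * lam (ball x e) <= \int[lam]_(y in Omega) (u y * u y)%:E)%E.
  have mu : measurable_fun setT u by exact: measurable_rV_continuous.
  have mE (D : set T) : measurable_fun D (fun y => (u y * u y)%:E).
    by apply: measurable_funTS; apply/measurable_EFinP; exact: measurable_funM.
  have p0 (y : T) : (0 <= (u y * u y)%:E)%E by rewrite lee_fin -expr2 sqr_ge0.
  apply: (@le_trans _ _ (\int[lam]_(y in ball x e) (u y * u y)%:E)%E); last first.
    by apply: ge0_subset_integral.
  rewrite -integral_cst//; apply: ge0_le_integral => //.
    by move=> y _; rewrite lee_fin sqr_ge0.
  move=> y /he[_ /= hy]; rewrite lee_fin -expr2 -[leRHS]real_normK ?num_real//.
  by rewrite lerXn2r ?nnegrE ?(ltW ux0) ?(ltW hy).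
have : (0 < \int[lam]_(y in Omega) (u y * u y)%:E)%E.
  by apply: lt_le_trans h1; rewrite mule_gt0 ?lebesgue_rV_ball_gt0// lte_fin exprn_gt0.
have := integrable_fin_num mO i; move/fineK => <-.
by rewrite -/(Rintegral _ _ _) -/(L2dot _ _ _) u0 ltxx.
Qed.

Lemma L2norm_sqrt u : L2 Omega u -> L2norm Omega u = (Num.sqrt (L2dot Omega u u))%:E.
Proof.
move=> Lu; have i := L2_mul_integrable Lu Lu.
rewrite /L2norm unlock; under eq_integral do rewrite poweR_sqr.
have -> : (fun x => ((u \_ Omega) x * (u \_ Omega) x)%:E) = (fun x => (u x * u x)%:E) \_ Omega.
  by apply/funext => x; rewrite !patchE; case: ifP; rewrite ?mul0r.
rewrite -integral_mkcond.
have := integrable_fin_num measurable_Omega i; move/fineK => <-.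
by rewrite -/(Rintegral _ _ _) -/(L2dot _ _ _) poweR_EFin powR12_sqrt ?L2dot_ge0.
Qed.

(** Expand the square of v - Ph v; testing the projection with Ph v itself identifies the mixed
    product with the square of Ph v. *)
Lemma L2_projection_le Ph v : is_L2_projection Omega Th Ph -> L2 Omega v ->
  L2dot Omega (Ph v) (Ph v) <= L2dot Omega v v.
Proof.
move=> hP Lv; have [Xp hp] := hP v Lv; have Lp := fe_L2 Xp.
have e := hp _ Xp.
have i1 := L2_mul_integrable Lv Lv; have i2 := L2_mul_integrable Lp Lp.
have i3 := L2_mul_integrable Lv Lp.
have mO := measurable_Omega.
suff : 0 <= L2dot Omega (v - Ph v) (v - Ph v).
  have Lvp : L2 Omega (v - Ph v) by exact: L2_sub.
  rewrite L2dotBl// ![L2dot _ _ (v - Ph v)]L2dotC !L2dotBl// (L2dotC (Ph v) v) -e; lra.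
exact: L2dot_ge0.
Qed.

End dot.

Section gradient.

(** A gradient chosen for each cell. It turns [grad_dot] into a finite weighted sum, from which
    symmetry, linearity and sign are read off. *)
Definition fe_slope u (g : {set 'I_(nnode Th)} -> 'cV[R]_d) := forall S, S \in cells Th ->
  exists c, forall x, hull S x -> u x = (x *m g S) 0 0 + c.

Lemma fe_slope_exists u : Xh u -> exists g, fe_slope u g.
Proof.
move=> [_ _ h]; have /choice[g hg] : forall S, exists g : 'cV[R]_d, S \in cells Th ->
    exists c, forall x, hull S x -> u x = (x *m g) 0 0 + c.
  move=> S; have [SC|] := boolP (S \in cells Th); last by exists 0.
  by have [g [c hg]] := h S SC; exists g => _; exists c.
by exists g.
Qed.

Lemma fe_slope_derive u g S x v : fe_slope u g -> S \in cells Th -> (hull S)° x ->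
  'D_v u x = (v *m g S) 0 0.
Proof.
move=> ug SC Sx; have [c hc] := ug S SC.
apply: cvg_lim => //; apply: cvg_near_cst.
have h0 : nbhs (0 : R) (fun h => hull S (h *: v + x)).
  have ch : h *: v + x @[h --> (0 : R)] --> 0 *: v + x.
    by apply: cvgD; [apply: cvgZl; exact: cvg_id|exact: cvg_cst].
  by apply: ch; rewrite scale0r add0r.
have hx := interior_subset Sx.
near=> h; rewrite /= (hc _ hx) hc; last by near: h; exact: nbhs_dnbhs.
have hn : h != 0 by near: h; exact: nbhs_dnbhs_neq.
have -> : ((h *: v + x) *m g S) 0 0 + c - ((x *m g S) 0 0 + c) = h * (v *m g S) 0 0.
  by rewrite mulmxDl -scalemxAl !mxE; ring.
by rewrite /GRing.scale/= mulKf.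
Unshelve. all: by end_near. Qed.

Let vol (S : {set 'I_(nnode Th)}) : R := fine (lam (hull S)°).

Lemma grad_dotE u w gu gw : fe_slope u gu -> fe_slope w gw ->
  grad_dot Th u w = \sum_(S in cells Th) (\sum_i gu S i 0 * gw S i 0) * vol S.
Proof.
move=> ug wg; apply: eq_bigr => S SC.
rewrite -Rintegral_cst; last by apply: measurable_rV_open; exact: open_interior.
apply: eq_Rintegral => x; rewrite inE => Sx; apply: eq_bigr => i _.
rewrite (fe_slope_derive _ ug SC Sx) (fe_slope_derive _ wg SC Sx).
by rewrite -!rowE !mxE.
Qed.

Lemma grad_dotC u w : Xh u -> Xh w -> grad_dot Th u w = grad_dot Th w u.
Proof.
move=> /fe_slope_exists[gu hu] /fe_slope_exists[gw hw].
rewrite (grad_dotE hu hw) (grad_dotE hw hu); apply: eq_bigr => S _.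
by congr (_ * _); apply: eq_bigr => i _; rewrite mulrC.
Qed.

Lemma grad_dot_ge0 u : Xh u -> 0 <= grad_dot Th u u.
Proof.
move=> /fe_slope_exists[gu hu]; rewrite (grad_dotE hu hu); apply: sumr_ge0 => S _.
apply: mulr_ge0; last by rewrite fine_ge0// measure_ge0.
by apply: sumr_ge0 => i _; rewrite -expr2 sqr_ge0.
Qed.

Lemma grad_dot_lin (a : R) u1 u2 w : Xh u1 -> Xh u2 -> Xh w ->
  grad_dot Th (a *: u1 + u2) w = a * grad_dot Th u1 w + grad_dot Th u2 w.
Proof.
move=> /fe_slope_exists[g1 h1] /fe_slope_exists[g2 h2] /fe_slope_exists[gw hw].
have h : fe_slope (a *: u1 + u2) (fun S => a *: g1 S + g2 S).
  move=> S SC; have [c1 e1] := h1 S SC; have [c2 e2] := h2 S SC.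
  exists (a * c1 + c2) => x hx; have -> : (a *: u1 + u2) x = a * u1 x + u2 x by [].
  have -> : (x *m (a *: g1 S + g2 S)) 0 0 = a * (x *m g1 S) 0 0 + (x *m g2 S) 0 0.
    by rewrite mulmxDr -scalemxAr mxE [X in X + _]mxE.
  by rewrite e1// e2//; ring.
rewrite (grad_dotE h hw) (grad_dotE h1 hw) (grad_dotE h2 hw) mulr_sumr -big_split/=.
apply: eq_bigr => S _; rewrite mulrA -mulrDl; congr (_ * _).
by rewrite mulr_sumr -big_split/=; apply: eq_bigr => i _; rewrite !mxE; ring.
Qed.

End gradient.
End finite_element_space.

(** * Self-adjoint operators on finite-dimensional subspaces *)

Section selfadjoint_operator.
Context (R : rcfType) (V : lmodType R) (X : set V) (L : V -> V) (B : V -> V -> R).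
Hypothesis XD : forall u w, X u -> X w -> X (u + w).
Hypothesis XZ : forall a u, X u -> X (a *: u).
Hypothesis X0 : X 0.
Hypothesis XL : forall u, X u -> X (L u).
Hypothesis LD : forall u w, X u -> X w -> L (u + w) = L u + L w.
Hypothesis LZ : forall a u, X u -> L (a *: u) = a *: L u.
Hypothesis BC : forall u w, X u -> X w -> B u w = B w u.
Hypothesis BD : forall u1 u2 w, X u1 -> X u2 -> X w -> B (u1 + u2) w = B u1 w + B u2 w.
Hypothesis BZ : forall a u w, X u -> X w -> B (a *: u) w = a * B u w.
Hypothesis B_ge0 : forall u, X u -> 0 <= B u u.
Hypothesis B_eq0 : forall u, X u -> B u u = 0 -> u = 0.
Hypothesis LB : forall u w, X u -> X w -> B (L u) w = B u (L w).
Implicit Types (u v w : V) (p q : {poly R}).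

Let XB u w : X u -> X w -> X (u - w).
Proof. by move=> Xu Xw; rewrite -scaleN1r; apply: XD => //; exact: XZ. Qed.

Let BB u1 u2 w : X u1 -> X u2 -> X w -> B (u1 - u2) w = B u1 w - B u2 w.
Proof. by move=> h1 h2 h; rewrite -scaleN1r BD// ?BZ ?mulN1r//; exact: XZ. Qed.

Let Xsum I (s : seq I) (P : pred I) (F : I -> V) : (forall i, P i -> X (F i)) -> X (\sum_(i <- s | P i) F i).
Proof. by move=> h; elim/big_ind: _. Qed.

Let Bsum I (s : seq I) (F : I -> V) w : (forall i, X (F i)) -> X w ->
  B (\sum_(i <- s) F i) w = \sum_(i <- s) B (F i) w.
Proof.
move=> XF Xw; elim: s => [|i s IH]; last by rewrite !big_cons BD ?IH//; exact: Xsum.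
by rewrite !big_nil -(scale0r w) BZ// mul0r.
Qed.

Let Lsum I (s : seq I) (F : I -> V) : (forall i, X (F i)) ->
  L (\sum_(i <- s) F i) = \sum_(i <- s) L (F i).
Proof.
move=> XF; elim: s => [|i s IH]; last by rewrite !big_cons LD ?IH//; exact: Xsum.
by rewrite !big_nil -(scale0r 0) LZ// !scale0r.
Qed.

Let Xiter i u : X u -> X (iter i L u).
Proof. by move=> Xu; elim: i => //= i; exact: XL. Qed.

Let LS u w : X u -> X w -> L (u - w) = L u - L w.
Proof. move=> Xu Xw; rewrite -scaleN1r LD//; last exact: XZ.
by rewrite LZ// scaleN1r. Qed.

Definition poly_apply p w := \sum_(i < size p) p`_i *: iter i L w.

Lemma poly_applyE n p w : (size p <= n)%N ->
  poly_apply p w = \sum_(i < n) p`_i *: iter i L w.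
Proof.
move=> pn; rewrite /poly_apply (big_ord_widen n (fun i => p`_i *: iter i L w) pn).
rewrite [RHS](bigID (fun i : 'I_n => (i < size p)%N))/= [X in _ + X]big1 ?addr0// => i.
by rewrite -leqNgt => h; rewrite nth_default// scale0r.
Qed.

Lemma X_poly_apply p w : X w -> X (poly_apply p w).
Proof. by move=> Xw; apply: Xsum => i _; apply: XZ; exact: Xiter. Qed.

Lemma poly_applyD p q w : poly_apply (p + q) w = poly_apply p w + poly_apply q w.
Proof.
set n := maxn (size p) (size q).
rewrite !(@poly_applyE n) ?leq_maxl ?leq_maxr ?size_polyD// -big_split/=.
by apply: eq_bigr => i _; rewrite coefD scalerDl.
Qed.

Lemma poly_applyC (c : R) w : poly_apply c%:P w = c *: w.
Proof.
by rewrite (@poly_applyE 1) ?size_polyC_leq1// big_ord_recl big_ord0 addr0 coefC.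
Qed.

Lemma poly_applyZ (c : R) p w : poly_apply (c *: p) w = c *: poly_apply p w.
Proof.
rewrite (@poly_applyE (size p)) ?size_scale_leq// scaler_sumr.
by apply: eq_bigr => i _; rewrite coefZ scalerA.
Qed.

Lemma poly_applyMX p w : poly_apply (p * 'X) w = poly_apply p (L w).
Proof.
rewrite (@poly_applyE (size p).+1); last first.
  by apply: leq_trans (size_polyMleq _ _) _; rewrite size_polyX addnC.
rewrite big_ord_recl coefMX /= scale0r add0r.
by apply: eq_bigr => i _; rewrite coefMX /= -iterSr.
Qed.

Lemma poly_apply_comm p w : X w -> poly_apply p (L w) = L (poly_apply p w).
Proof.
move=> Xw; rewrite /poly_apply Lsum; last by move=> i; apply: XZ; exact: Xiter.
by apply: eq_bigr => i _; rewrite -iterSr LZ//; exact: Xiter.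
Qed.

Lemma poly_applyM p q w : X w -> poly_apply (p * q) w = poly_apply p (poly_apply q w).
Proof.
elim/poly_ind: p w => [|p c IH] w Xw; first by rewrite mul0r /poly_apply size_poly0 !big_ord0.
have -> : (p * 'X + c%:P) * q = p * q * 'X + c *: q.
  by rewrite mulrDl mul_polyC mulrAC.
rewrite !poly_applyD poly_applyMX poly_applyZ IH; last exact: XL.
by rewrite poly_applyMX poly_applyC poly_apply_comm.
Qed.

Lemma poly_apply_B p w v : X w -> X v -> B (poly_apply p w) v = B w (poly_apply p v).
Proof.
have h n : forall u v, X u -> X v -> B (iter n L u) v = B u (iter n L v).
  by elim: n => // n IH u v' Xu Xv'; rewrite iterS LB ?IH -?iterSr//; [exact: XL|exact: Xiter].
move=> Xw Xv; have Xi i u : X u -> X (p`_i *: iter i L u) by move=> Xu; apply: XZ; exact: Xiter.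
rewrite [RHS]BC//; last exact: X_poly_apply.
rewrite /poly_apply !Bsum//; try by move=> i; exact: Xi.
by apply: eq_bigr => i _; rewrite !BZ//; try exact: Xiter; rewrite h// BC//; exact: Xiter.
Qed.

Lemma poly_apply_eigen p a u : X u -> L u = a *: u -> poly_apply p u = p.[a] *: u.
Proof.
move=> Xu Lu; have h i : iter i L u = a ^+ i *: u.
  by elim: i => [|i IH]; rewrite ?expr0 ?scale1r//= IH LZ// Lu scalerA exprSr.
by rewrite horner_coef scaler_suml; apply: eq_bigr => i _; rewrite h scalerA.
Qed.

Definition eigenpair (x : R * V) := X x.2 /\ L x.2 = x.1 *: x.2.

Lemma eigen_orthogonal x y : eigenpair x -> eigenpair y -> x.1 != y.1 -> B x.2 y.2 = 0.
Proof.
move=> [Xx Lx] [Xy Ly] xy; have := LB Xx Xy; rewrite Lx Ly BZ// [RHS]BC ?BZ//; last exact: XZ.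
rewrite (BC Xy Xx) => /eqP; rewrite -subr_eq0 -mulrBl mulf_eq0 subr_eq0 (negbTE xy)/=.
by move/eqP.
Qed.

(** A complex root is either real or a + i c with c nonzero. In the latter case the remainder modulo
    (X - a)^2 + c^2 is real of degree at most 1 and vanishes at a + i c, so it is 0. *)
Lemma poly_real_factor p : (1 < size p)%N ->
  (exists a q, p = q * ('X - a%:P)) \/
  (exists a c q, c != 0 /\ p = q * (('X - a%:P) ^+ 2 + (c ^+ 2)%:P)).
Proof.
move=> p1; have : size (map_poly (real_complex R) p) != 1%N.
  by rewrite size_map_poly; case: (size p) p1 => [|[]].
move/closed_rootP => [[a c]] rz; have [c0|c0] := eqVneq c 0.
  left; exists a; apply/factor_theorem; move: rz; rewrite c0.
  by rewrite -[Complex a 0]/(real_complex R a) fmorph_root.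
right; exists a, c; set Q := _ + _.
have Qz : (map_poly (real_complex R) Q).[Complex a c] = 0.
  rewrite /Q rmorphD/= rmorphXn/= rmorphB/= map_polyX !map_polyC/= !hornerE.
  by rewrite expr2; apply/eqP; rewrite eq_complex /=; apply/andP; split; apply/eqP; rewrite /=; ring.
have sQ : size Q = 3%N.
  rewrite /Q size_polyDl size_exp_XsubC// size_polyC; by case: eqP.
exists (p %/ Q); split=> //; have e := divp_eq p Q.
suff r0 : p %% Q = 0 by rewrite {1}e r0 addr0.
set r := p %% Q in e *.
have sr : (size r <= 2)%N by rewrite -ltnS -sQ ltn_modp -size_poly_gt0 sQ.
have : (map_poly (real_complex R) r).[Complex a c] = 0.
  move/rootP: rz; rewrite {1}e rmorphD/= rmorphM/= hornerD hornerM Qz mulr0 add0r.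
  by [].
rewrite (@horner_coef_wide _ 2); last by rewrite size_map_poly.
rewrite !big_ord_recl big_ord0 !coef_map/= expr0 expr1 => /eqP.
rewrite eq_complex /= => /andP[/eqP h1 /eqP h2].
have r1 : r`_1 = 0.
  by move/eqP: h2; rewrite !(mulr0,mul0r,add0r,addr0,mulr1) /= mulf_eq0 (negbTE c0) orbF => /eqP.
have r00 : r`_0 = 0 by move: h1; rewrite r1 !(mul0r,mulr0,mulr1,addr0,subr0).
apply/polyP => i; rewrite coef0; case: i => [//|[//|i]].
by rewrite nth_default// (leq_trans sr).
Qed.

Lemma eigen_decomposition p w : p != 0 -> X w -> poly_apply p w = 0 ->
  exists s : seq (R * V), [/\ forall x, x \in s -> eigenpair x,
    forall x, x \in s -> root p x.1, uniq (map fst s) & w = \sum_(x <- s) x.2].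
Proof.
have [n] := ubnP (size p); elim: n p w => // n IH p w sp p0 Xw pw.
have [p1|p1] := leqP (size p) 1.
  exists [::]; split=> //; rewrite big_nil; move: p0 pw.
  by rewrite [p]size1_polyC// poly_applyC polyC_eq0 => /negbTE p0 /eqP; rewrite scaler_eq0 p0 => /eqP.
have reduce q Q : p = q * Q -> (1 < size Q)%N -> poly_apply q w = 0 ->
  exists s : seq (R * V), [/\ forall x, x \in s -> eigenpair x,
    forall x, x \in s -> root p x.1, uniq (map fst s) & w = \sum_(x <- s) x.2].
  move=> e Q1 qw; have q0 : q != 0 by apply: contraNneq p0 => q0; rewrite e q0 mul0r.
  have Q0 : Q != 0 by rewrite -size_poly_gt0 ltnW.
  have sq : (size q < n)%N.
    by move: sp; rewrite e size_mul// ltnS; move: (size q) (size Q) Q1 => a c; clear; lia.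
  have [s [h1 h2 h3 h4]] := IH _ _ sq q0 Xw qw; exists s; split=> // x xs.
  by rewrite e rootM h2.
case: (poly_real_factor p1) => [[a [q e]]|[a [c [q [c0 e]]]]].
- have Xu := X_poly_apply q Xw; set u := poly_apply q w in Xu.
  have Lu : L u = a *: u.
    move: pw; rewrite e mulrC poly_applyM// -/u poly_applyD -polyCN poly_applyC.
    rewrite -[X in poly_apply X]mul1r poly_applyMX poly_applyC scale1r scaleNr => /eqP.
    by rewrite subr_eq0 => /eqP.
  (* [u] is an eigenvector for a, and by self-adjointness B u u = B w (q(L) u) = q(a) B w u. If q(a)
     = 0 then u = 0, that is, [q] already annihilates [w]. *)
  have [qa|qa] := eqVneq q.[a] 0.
    apply: (reduce q _ e); first by rewrite size_XsubC.
    apply: B_eq0 => //; rewrite -/u {1}/u poly_apply_B// (poly_apply_eigen _ Xu Lu) qa scale0r.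
    by rewrite BC// -(scale0r u) BZ// mul0r.
  (* The component of [w] along a: q(L) z = u = q(L) w, so [q] annihilates w - z. As q(a) is
     nonzero, a is not among the eigenvalues of the rest. *)
  set z := q.[a]^-1 *: u.
  have Xz : X z by exact: XZ.
  have Lz : L z = a *: z by rewrite LZ// Lu !scalerA mulrC.
  have q0 : q != 0 by apply: contraNneq p0 => q0; rewrite e q0 mul0r.
  have sq : (size q < n)%N.
    by move: sp; rewrite e size_Mmonic// ?monicXsubC// size_XsubC !addnS addn0 /=.
  have qw' : poly_apply q (w - z) = 0.
    rewrite (_ : poly_apply q (w - z) = poly_apply q w - poly_apply q z).
      by rewrite (poly_apply_eigen _ Xz Lz) -/u scalerA mulfV// scale1r subrr.
    rewrite /poly_apply -sumrB; apply: eq_bigr => i _; rewrite -scalerBr; congr (_ *: _).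
    by elim: (nat_of_ord i) => //= k ->; apply: LS; exact: Xiter.
  have [s [h1 h2 h3 h4]] := IH _ _ sq q0 (XB Xw Xz) qw'.
  exists ((a, z) :: s); split.
  + by move=> x; rewrite inE => /predU1P[->|/h1].
  + move=> x; rewrite inE e rootM => /predU1P[->|/h2 ->//].
    by rewrite root_XsubC /= eqxx orbT.
  + rewrite /= h3 andbT; apply: contra qa => /mapP[x xs ->].
    exact/eqP/rootP/h2.
  + by rewrite big_cons/= -h4 addrC subrK.
- apply: (reduce q _ e).
    by rewrite size_polyDl size_exp_XsubC// size_polyC; case: eqP.
  have Xu := X_poly_apply q Xw; set u := poly_apply q w in Xu *.
  (* Pairing ((L - a)^2 + c^2) u = 0 with [u] gives B Y Y + c^2 B u u = 0, where both terms are
     nonnegative; hence u = 0. *)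
  set Y := L u - a *: u.
  have XY : X Y by apply: XB; [exact: XL|exact: XZ].
  have aL v : poly_apply ('X - a%:P) v = L v - a *: v.
    rewrite poly_applyD -polyCN poly_applyC scaleNr.
    by rewrite -[X in poly_apply X]mul1r poly_applyMX poly_applyC scale1r.
  have : poly_apply ('X - a%:P) Y + c ^+ 2 *: u = 0.
    by rewrite -pw e mulrC poly_applyM// -/u [poly_apply (_ + (c ^+ 2)%:P) _]poly_applyD poly_applyC
      [('X - _) ^+ 2]expr2 poly_applyM// (aL u).
  move=> h; have : B (poly_apply ('X - a%:P) Y) u + c ^+ 2 * B u u = 0.
    rewrite -BZ// -BD//; [|exact: X_poly_apply|exact: XZ].
    by rewrite h -(scale0r u) BZ// mul0r.
  rewrite poly_apply_B// aL -/Y => /eqP.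
  have BY := B_ge0 XY; have Bu := mulr_ge0 (sqr_ge0 c) (B_ge0 Xu).
  rewrite paddr_eq0// => /andP[_].
  by rewrite mulf_eq0 sqrf_eq0 (negbTE c0) => /eqP; exact: B_eq0.
Qed.

(** Distinct eigenvalues make the components orthogonal, so changing their signs preserves the
    norm. *)
Lemma eigen_sign_norm (s : seq (R * V)) (eps : R * V -> R) :
  (forall x, x \in s -> eigenpair x) -> uniq (map fst s) -> (forall x, eps x ^+ 2 = 1) ->
  B (\sum_(x <- s) eps x *: x.2) (\sum_(x <- s) eps x *: x.2) = \sum_(x <- s) B x.2 x.2.
Proof.
move=> + + eps1; elim: s => [|x s IH] hs; first by rewrite !big_nil -{1}(scale0r 0) BZ// mul0r.
rewrite /= => /andP[xs us]; have hs' y : y \in s -> eigenpair y.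
  by move=> ys; apply: hs; rewrite inE ys orbT.
have hx := hs x (mem_head _ _); have [Xx _] := hx.
have orth : forall t, {subset t <= s} ->
    X (\sum_(y <- t) eps y *: y.2) /\ B (\sum_(y <- t) eps y *: y.2) x.2 = 0.
  elim=> [|y t IHt] ts; first by rewrite big_nil -{2}(scale0r x.2) BZ// mul0r.
  have ys : y \in s by apply: ts; exact: mem_head.
  have [Xt Bt] : X (\sum_(y <- t) eps y *: y.2) /\ B (\sum_(y <- t) eps y *: y.2) x.2 = 0.
    by apply: IHt => z zt; apply: ts; rewrite inE zt orbT.
  have [Xy _] := hs' y ys; rewrite big_cons BD ?Bt ?BZ//; try exact: XZ.
  split; first by apply: XD => //; exact: XZ.
  rewrite (eigen_orthogonal (hs' y ys) hx) ?mulr0 ?addr0//.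
  by apply: contraNneq xs => <-; exact: map_f.
have [XA xA] := orth s (fun _ h => h); move: XA xA; rewrite !big_cons -IH//.
move: (\sum_(y <- s) eps y *: y.2) => A XA xA.
have Xe : X (eps x *: x.2) by exact: XZ.
have XeA : X (eps x *: x.2 + A) by exact: XD.
have xx : B (eps x *: x.2) (eps x *: x.2 + A) = B x.2 x.2.
  by rewrite BZ// (BC Xx XeA) BD// xA addr0 BZ// mulrA -expr2 eps1 mul1r.
rewrite BD// xx (BC XA XeA); congr (_ + _).
by rewrite BD// BZ// (BC Xx XA) xA mulr0 add0r.
Qed.

Lemma selfadjoint_bound (K : R) p e v : 0 <= K -> p != 0 -> X e -> X v -> poly_apply p e = 0 ->
  (forall a u, X u -> L u = a *: u -> `|B e u| <= K * `|B v u|) ->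
  B e e <= K ^+ 2 * B v v.
Proof.
move=> K0 p0 Xe Xv pe h; have [s [hs _ us es]] := eigen_decomposition p0 Xe pe.
(* The signs [eps] turn [sum |B v w_k|] into [B v z], where [z] has the norm of [e]
   by orthogonality. *)
pose eps (x : R * V) : R := Num.sg (B v x.2) + (B v x.2 == 0)%:R.
have eps1 x : eps x ^+ 2 = 1.
  rewrite /eps; case: (eqVneq (B v x.2) 0) => [->|b0].
    by rewrite sgr0 add0r expr1n.
  by rewrite addr0 sqr_sg b0.
have epsB x : eps x * B v x.2 = `|B v x.2|.
  rewrite /eps; case: (eqVneq (B v x.2) 0) => [->|b0]; first by rewrite mulr0 normr0.
  by rewrite addr0 -normrEsg.
set z := \sum_(x <- s) eps x *: x.2.
(* Extended by 0 off [s], since [Bsum] and [Xsum] ask for membership of every term. *)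
pose s2 (x : R * V) := if x \in s then x.2 else 0.
have Xs2 x : X (s2 x) by rewrite /s2; case: ifPn => // /hs[].
have zE : z = \sum_(x <- s) eps x *: s2 x by apply: eq_big_seq => x xs; rewrite /s2 xs.
have Xz : X z by rewrite zE; apply: Xsum => x _; exact: XZ.
have ee : B e e = \sum_(x <- s) B x.2 x.2.
  rewrite -(eigen_sign_norm (eps := fun=> 1) hs us) ?expr1n//.
  by congr (B _ _); rewrite es; apply: eq_bigr => x _; rewrite scale1r.
have zz : B z z = B e e by rewrite ee; exact: eigen_sign_norm.
have ez : B e e <= K * B v z.
  have -> : B e e = \sum_(x <- s) B (s2 x) e.
    by rewrite -Bsum//; congr (B _ _); rewrite es; apply: eq_big_seq => x xs; rewrite /s2 xs.
  rewrite BC// zE Bsum//; last by move=> x; exact: XZ.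
  rewrite mulr_sumr big_seq [leRHS]big_seq; apply: ler_sum => x xs.
  have [Xx Lx] := hs x xs; rewrite /s2 xs BZ// (BC Xx Xv) epsB (BC Xx Xe).
  exact: le_trans (ler_norm _) (h _ _ Xx Lx).
have XKv : X (K *: v) by exact: XZ.
(* Nonnegativity on K v - z gives K^2 B v v >= 2 K B v z - B z z, and the right-hand side is at
   least B e e because B z z = B e e <= K B v z. *)
have XK : X (K *: v - z) by exact: XB.
have := B_ge0 XK; rewrite BB// (BC XKv XK) (BC Xz XK) !BB// (BC Xz XKv) !BZ// (BC Xv XKv) BZ// zz.
by lra.
Qed.

End selfadjoint_operator.

(** * The discrete Laplacian and the modes *)

Section caputo_combination.
Context (R : realType) (alpha : R).
Hypothesis alpha01 : 0 < alpha < 1.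
Notation mu := (@lebesgue_measure R).
Implicit Types (y z : R -> R).

Lemma cr_mul_add (e : R) y z : caputo_regular y -> caputo_regular z ->
  caputo_regular (fun x => e * y x + z x) /\
  forall t : R, 0 < t -> derive1 (fun x => e * y x + z x) t = e * derive1 y t + derive1 z t.
Proof.
move=> ry rz.
have d (t : R) : 0 < t -> is_derive t 1 (fun x => e * y x + z x) (e * derive1 y t + derive1 z t).
  by move=> t0; exact: is_deriveD (is_deriveZ e (cr_is_derive ry t0)) (cr_is_derive rz t0).
have dE t : 0 < t -> derive1 (fun x => e * y x + z x) t = e * derive1 y t + derive1 z t.
  by move=> t0; rewrite [LHS]derive1E; have [_ ->] := d _ t0.
split=> //; split.
- apply/continuous_within_itvcyP; split.
    move=> x; rewrite in_itv/= andbT => x0; apply: cvgD; last exact: (cr_at rz x0).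
    by apply: cvgM; [exact: cvg_cst|exact: (cr_at ry x0)].
  apply: cvgD; last exact: (cr_at0 rz).
  by apply: cvgM; [exact: cvg_cst|exact: (cr_at0 ry)].
- by move=> t t0; have [] := d _ t0.
- move=> t t0; rewrite /prop_for/continuous_at dE//.
  have h : (e * derive1 y x + derive1 z x) @[x --> t] --> e * derive1 y t + derive1 z t.
    by apply: cvgD; [apply: cvgMr; exact: (cr_C1 ry t0)|exact: (cr_C1 rz t0)].
  apply: cvg_trans h.
  apply: near_eq_cvg; near=> x; rewrite dE//.
  by near: x; exact: lt_nbhsr.
- move=> t t0; apply: (@eq_integrable _ (measurableTypeR R) R mu `]0, t[ (measurable_itv _)
    (EFin \o (fun x => e * derive1 y x + derive1 z x))).
    by move=> x; rewrite inE/= in_itv/= => /andP[x0 _] /=; rewrite dE.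
  apply: integrableD_EFin => //; last exact: cr_integrable rz _ t0.
  apply: (@integrable_bounded_mul _ _ (fun=> e) (derive1 y) `|e|) => //.
  exact: cr_integrable ry _ t0.
Unshelve. all: by end_near. Qed.

Lemma caputo_mul_add (e : R) y z (t : R) : 0 < t -> caputo_regular y -> caputo_regular z ->
  caputo alpha (fun x => e * y x + z x) t = e * caputo alpha y t + caputo alpha z t.
Proof.
move=> t0 ry rz; have [_ dE] := cr_mul_add e ry rz.
have iy := kernel_integrable alpha01 t0 ry; have iz := kernel_integrable alpha01 t0 rz.
rewrite /caputo mulrCA -mulrDr; congr (_ * _).
have mD : measurable (`]0, t[ : set (measurableTypeR R)) by exact: measurable_itv.
have iey : mu.-integrable `]0, t[ (EFin \o (fun s => e * ((t - s) `^ (- alpha) * derive1 y s))).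
  exact: (@integrable_bounded_mul _ _ (fun=> e) _ `|e|).
rewrite -(@RintegralZl _ (measurableTypeR R) R mu _ _ e mD iy).
rewrite -(@RintegralD _ (measurableTypeR R) R mu _ _ _ mD iey iz).
apply: eq_Rintegral => s; rewrite inE/= in_itv/= => /andP[s0 _].
by rewrite dE//; ring.
Qed.

Lemma cr_zero : caputo_regular (fun=> 0 : R).
Proof.
have d : derive1 (fun=> 0 : R) = (fun=> 0) :> (R -> R).
  by apply/funext => x; rewrite derive1_cst.
split.
- by apply: continuous_subspaceT => x; exact: cvg_cst.
- by move=> t _; exact: derivable_cst.
- by move=> t _; rewrite d; exact: cvg_cst.
- by move=> t _; rewrite d; exact: integrable0.
Qed.

Lemma caputo_sum (I : Type) (s : seq I) (c : I -> R) (y : I -> R -> R) :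
  (forall i, caputo_regular (y i)) ->
  caputo_regular (fun t => \sum_(i <- s) c i * y i t) /\
  forall t, 0 < t -> caputo alpha (fun t => \sum_(i <- s) c i * y i t) t =
    \sum_(i <- s) c i * caputo alpha (y i) t.
Proof.
move=> ry; elim: s => [|i s [IH1 IH2]].
  under eq_fun do rewrite big_nil; split; first exact: cr_zero.
  move=> t t0; rewrite big_nil /caputo; under eq_Rintegral do rewrite derive1_cst mulr0.
  by rewrite Rintegral_cst// mul0r mulr0.
under eq_fun do rewrite big_cons; split; first by have [] := cr_mul_add (c i) (ry i) IH1.
by move=> t t0; rewrite caputo_mul_add// IH2// big_cons.
Qed.

End caputo_combination.

Section discrete_laplacian.
Context (R : realType) (d : nat) (Omega : set 'rV[R]_d) (Th : mesh R d).
Hypothesis hOmega : convex_polygonal_domain Omega.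
Hypothesis hTh : triangulation Omega Th.
Local Notation T := 'rV[R]_d.
Local Notation Xh := (fe_space Omega Th).
Local Notation nd := (@node R d Th).
Local Notation dot := (L2dot Omega).
Implicit Types (u w : T -> R).

Let XD := @fe_add R d Omega Th.
Let XZ := @fe_scale R d Omega Th.
Let XL2 := fe_L2 hOmega hTh.

Lemma L2dotZl_fe (a : R) u w : Xh u -> Xh w -> dot (a *: u) w = a * dot u w.
Proof. by move=> Xu Xw; apply: (L2dotZl hOmega); exact: XL2. Qed.

Lemma L2dotDl_fe u1 u2 w : Xh u1 -> Xh u2 -> Xh w -> dot (u1 + u2) w = dot u1 w + dot u2 w.
Proof. by move=> X1 X2 Xw; apply: (L2dotDl hOmega); exact: XL2. Qed.

Lemma fe_sum I (s : seq I) (F : I -> T -> R) : (forall i, Xh (F i)) -> Xh (\sum_(i <- s) F i).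
Proof. by move=> h; elim/big_ind: _ => [|u w|i _]; [exact: fe_zero|exact: XD|exact: h]. Qed.

Lemma L2dot_sum_fe I (s : seq I) (F : I -> T -> R) w : (forall i, Xh (F i)) -> Xh w ->
  dot (\sum_(i <- s) F i) w = \sum_(i <- s) dot (F i) w.
Proof.
move=> XF Xw; elim: s => [|i s IH]; last by rewrite !big_cons L2dotDl_fe ?IH//; exact: fe_sum.
by rewrite !big_nil -(scale0r w) L2dotZl_fe// mul0r.
Qed.

Lemma fe_functional (l : (T -> R) -> R) :
  (forall a u w, Xh u -> Xh w -> l (a *: u + w) = a * l u + l w) ->
  exists c, forall u, Xh u -> l u = \sum_i c i * u (nd i).
Proof.
(* The nodal values of a family of maximal rank span those of every element. *)
move=> ll; pose M := nnode Th; pose nodal u : 'rV[R]_M := \row_i u (nd i).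
pose nodalmx m (f : 'I_m -> T -> R) : 'M[R]_(m, M) := \matrix_(i, j) f i (nd j).
pose P r := `[< exists m (f : 'I_m -> T -> R), (forall i, Xh (f i)) /\ \rank (nodalmx m f) = r >].
have exP : exists r, P r.
  exists (\rank (nodalmx 0 (fun=> 0))); apply/asboolP; exists 0%N, (fun=> 0); split=> // i.
  exact: fe_zero.
have bP r : P r -> (r <= M)%N by move=> /asboolP[m [f [_ <-]]]; exact: rank_leq_col.
have [r /asboolP[m [f [Xf rf]]] rmax] := ex_maxnP exP bP.
have sub u : Xh u -> (nodal u <= nodalmx m f)%MS.
  move=> Xu; pose g (i : 'I_(m + 1)) := match fintype.split i with inl j => f j | inr _ => u end.
  have gE : nodalmx (m + 1)%N g = col_mx (nodalmx m f) (nodal u).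
    by apply/matrixP => i j; rewrite !mxE /g; case: fintype.split => k; rewrite !mxE.
  have := rmax (\rank (nodalmx (m + 1)%N g)).
  have -> : P (\rank (nodalmx (m + 1)%N g)).
    by apply/asboolP; exists (m + 1)%N, g; split=> // i; rewrite /g; case: fintype.split.
  rewrite gE -rf => /(_ isT) le.
  have s : (nodalmx m f <= col_mx (nodalmx m f) (nodal u))%MS by rewrite -addsmxE addsmxSl.
  have := geq_leqif (mxrank_leqif_sup s); rewrite le => /esym.
  by rewrite col_mx_sub => /andP[].
have XZsum (x : 'rV[R]_m) : Xh (\sum_i x 0 i *: f i) by apply: fe_sum => i; exact: XZ.
have lsum (s : seq 'I_m) (x : 'rV[R]_m) : l (\sum_(i <- s) x 0 i *: f i) = \sum_(i <- s) x 0 i * l (f i).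
  elim: s => [|i s IH]; last by rewrite !big_cons ll ?IH//; apply: fe_sum => j; exact: XZ.
  have := ll 1 0 0 (fe_zero _ _) (fe_zero _ _); rewrite scale1r addr0 mul1r !big_nil => h.
  by apply: (addrI (l 0)); rewrite addr0.
exists (fun j => (pinvmx (nodalmx m f) *m \col_i l (f i)) j 0) => u Xu.
pose x := nodal u *m pinvmx (nodalmx m f).
have uE : u = \sum_i x 0 i *: f i.
  apply/eqP; rewrite -subr_eq0; apply/eqP; apply: (fe_inj hTh); first exact: fe_sub.
  move=> j; have := mulmxKpV (sub u Xu) => /matrixP /(_ 0 j); rewrite !mxE -/x => h.
  rewrite -[LHS]/(u (nd j) - (\sum_i x 0 i *: f i) (nd j)) fct_sumE -h.
  by apply/eqP; rewrite subr_eq0; apply/eqP/eq_bigr => i _; rewrite !mxE.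
transitivity ((nodal u *m (pinvmx (nodalmx m f) *m \col_i l (f i))) 0 0); last first.
  by rewrite mxE; apply: eq_bigr => j _; rewrite [nodal u _ _]mxE mulrC.
rewrite mulmxA -/x; transitivity (l (\sum_i x 0 i *: f i)); first by rewrite -uE.
by rewrite lsum [RHS]mxE; apply: eq_bigr => i _; congr (_ * _); rewrite mxE.
Qed.

Section operator.
Context (Lh : (T -> R) -> T -> R).
Hypothesis hL : is_discrete_laplacian Omega Th Lh.

Let XL u : Xh u -> Xh (Lh u). Proof. by case/hL. Qed.

Lemma laplacian_dot u w : Xh u -> Xh w -> dot (Lh u) w = - grad_dot Th u w.
Proof. by move=> Xu Xw; have [_ <-] := hL Xu; rewrite ?opprK. Qed.

Lemma laplacian_sym u w : Xh u -> Xh w -> dot (Lh u) w = dot u (Lh w).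
Proof. by move=> Xu Xw; rewrite [RHS]L2dotC (laplacian_dot Xu Xw) (laplacian_dot Xw Xu) (grad_dotC Xu Xw). Qed.

Lemma laplacian_le0 u : Xh u -> dot (Lh u) u <= 0.
Proof. by move=> Xu; rewrite laplacian_dot// oppr_le0 (grad_dot_ge0 Xu). Qed.

(** [is_discrete_laplacian] determines the operator by its products with test functions: the defect
    of linearity is orthogonal to the whole space, in particular to itself. *)
Lemma laplacian_lin (a : R) u w : Xh u -> Xh w -> Lh (a *: u + w) = a *: Lh u + Lh w.
Proof.
move=> Xu Xw; have Xa : Xh (a *: u + w) by apply: XD => //; exact: XZ.
have X1 : Xh (a *: Lh u + Lh w) by apply: XD; [apply: XZ|]; exact: XL.
set D := Lh (a *: u + w) - (a *: Lh u + Lh w).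
have XDD : Xh D by apply: fe_sub => //; exact: XL.
apply/eqP; rewrite -subr_eq0; apply/eqP; apply: (L2dot_eq0 hOmega hTh) => //.
rewrite -/D {1}/D (L2dotBl hOmega) ?L2dotDl_fe ?L2dotZl_fe//; try exact: XL; try exact: XL2.
- have e1 := laplacian_dot Xa XDD; have e2 := laplacian_dot Xu XDD.
  have e3 := laplacian_dot Xw XDD; rewrite (grad_dot_lin a Xu Xw XDD) in e1; rewrite e1 e2 e3.
  by move: (grad_dot Th u D) (grad_dot Th w D); clear => x y; ring.
- by apply: XZ; exact: XL.
- by apply: XL2; exact: XL.
Qed.

(** Among the first M + 1 iterates, each known by its M nodal values, there is a linear relation. *)
Lemma annihilating_poly e : Xh e -> exists2 p : {poly R}, p != 0 & poly_apply Lh p e = 0.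
Proof.
move=> Xe; pose M := nnode Th; have Xi i : Xh (iter i Lh e) by elim: i => //= i; exact: XL.
pose N : 'M[R]_(M.+1, M) := \matrix_(i, j) iter i Lh e (nd j).
have : kermx N != 0.
  by rewrite -mxrank_eq0 mxrank_ker subn_eq0 -ltnNge ltnS rank_leq_col.
case/rowV0Pn => k /sub_kermxP kN k0; exists (rVpoly k).
  by apply: contraNneq k0 => h; rewrite -(rVpolyK k) h linear0.
rewrite (@poly_applyE _ _ _ M.+1) ?size_poly//.
apply: (fe_inj hTh); first by apply: fe_sum => i; exact: XZ.
move=> j; rewrite fct_sumE; have /matrixP /(_ 0 j) := kN; rewrite !mxE => h; rewrite -[RHS]h.
by apply: eq_bigr => i _; rewrite coef_rVpoly_ord mxE.
Qed.

End operator.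
End discrete_laplacian.

(** * From modes to the error in L^2 *)

Section fully_discrete.
Context (R : realType) (d : nat) (Omega : set 'rV[R]_d) (Th : mesh R d).
Hypothesis hOmega : convex_polygonal_domain Omega.
Hypothesis hTh : triangulation Omega Th.
Context (alpha : R) (b : nat -> R).
Hypothesis alpha01 : 0 < alpha < 1.
Hypothesis hb : frac_weights alpha b.
Context (Lh : ('rV[R]_d -> R) -> 'rV[R]_d -> R).
Hypothesis hL : is_discrete_laplacian Omega Th Lh.
Local Notation T := 'rV[R]_d.
Local Notation Xh := (fe_space Omega Th).
Local Notation nd := (@node R d Th).
Local Notation dot := (L2dot Omega).
Implicit Types (u w vh : T -> R).

Let XL u : Xh u -> Xh (Lh u). Proof. by case/hL. Qed.
Let XZ := @fe_scale R d Omega Th.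
Let XL2 := fe_L2 hOmega hTh.

(** Regularity in time is given pointwise in space. The product with [w] is a combination of nodal
    values, so it inherits this regularity and commutes with the Caputo derivative. That combination
    is taken as [y] because [uh] is arbitrary at negative times. *)
Lemma semidiscrete_mode vh (uh : R -> T -> R) w (lambda : R) :
  semidiscrete_solution Omega Th alpha Lh (fun=> 0) vh uh -> Xh w -> Lh w = - lambda *: w ->
  exists y : R -> R, [/\ caputo_regular y, forall t, 0 <= t -> y t = dot (uh t) w &
    forall t, 0 < t -> caputo alpha y t = - (lambda * y t)].
Proof.
move=> su Xw Lw.
have [c hc] : exists c, forall u, Xh u -> dot u w = \sum_i c i * u (nd i).
  apply: (fe_functional hTh (l := fun u => dot u w)) => a u u' Xu Xu'.
  by rewrite (L2dotDl_fe hOmega hTh)// ?(L2dotZl_fe hOmega hTh)//; exact: XZ.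
have ru i : caputo_regular (uh ^~ (nd i)).
  by split; [exact: (sds_cont su)|exact: (sds_derivable su)|exact: (sds_C1 su)|exact: (sds_integrable su)].
have [ry ey] := caputo_sum alpha01 (index_enum _) c ru.
have yE t : 0 <= t -> \sum_i c i * uh t (nd i) = dot (uh t) w.
  by move=> t0; rewrite hc//; exact: (sds_space su).
exists (fun t => \sum_i c i * uh t (nd i)); split=> // t t0.
have Xut := sds_space su (ltW t0).
rewrite ey// yE ?(ltW t0)//.
have e x : caputo alpha (uh ^~ x) t = Lh (uh t) x.
  by have /(congr1 (fun u => u x)) /eqP := sds_eq su t0; rewrite -[_ x]/(_ - Lh (uh t) x) subr_eq0 => /eqP.
under eq_bigr do rewrite e.
rewrite -hc ?(laplacian_sym hL)//; last exact: XL.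
by rewrite Lw L2dotC (L2dotZl_fe hOmega hTh)// L2dotC mulNr.
Qed.

Lemma discrete_mode vh (U : nat -> T -> R) w (lambda tau : R) N :
  0 < tau -> Xh vh -> corrected_CN_solution Omega Th alpha Lh b tau N (fun=> 0) vh U ->
  Xh w -> Lh w = - lambda *: w -> 0 <= lambda ->
  exists2 W, cn_seq alpha b (lambda * tau `^ alpha) W &
    forall n, (n <= N)%N -> dot (U n) w = dot vh w * (1 + W n).
Proof.
move=> tau0 Xv sU Xw Lw l0; pose Z n := dot (U n) w.
have g0 : 0 < tau `^ alpha by exact: powR_gt0.
have mu0 : 0 <= lambda * tau `^ alpha by apply: mulr_ge0 => //; exact: ltW.
have [W hW] := cn_seq_exists alpha01 hb mu0; exists W => //.
have XU n : (n <= N)%N -> Xh (U n) by exact: (cn_space sU).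
have U0 := cn_init sU.
have dotL u : Xh u -> dot (Lh u) w = - (lambda * dot u w).
  move=> Xu; rewrite (laplacian_sym hL)// Lw L2dotC (L2dotZl_fe hOmega hTh)//.
  by rewrite L2dotC mulNr.
have dotB u1 u2 : Xh u1 -> Xh u2 -> dot (u1 - u2) w = dot u1 w - dot u2 w.
  by move=> X1 X2; apply: (L2dotBl hOmega); exact: XL2.
have dotBL (a : R) u1 u2 : Xh u1 -> Xh u2 ->
    Xh (u1 - a *: Lh u2) /\ dot (u1 - a *: Lh u2) w = dot u1 w + lambda * (a * dot u2 w).
  move=> X1 X2; have X3 : Xh (a *: Lh u2) by apply: XZ; exact: XL.
  split; first exact: fe_sub.
  by rewrite dotB// (L2dotZl_fe hOmega hTh) ?dotL//; [ring|exact: XL].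
have dot0 : dot 0 w = 0 by rewrite -(scale0r w) (L2dotZl_fe hOmega hTh)// mul0r.
pose S n := \sum_(j < n.+1) b (n - j)%N * (Z j - Z 0%N).
have fd n : (n <= N)%N -> Xh (frac_difference alpha tau b (fun j => U j - vh) n) /\
    dot (frac_difference alpha tau b (fun j => U j - vh) n) w = (tau `^ alpha)^-1 * S n.
  move=> nN; have Xj (j : 'I_n.+1) : Xh (U j - vh).
    by apply: fe_sub => //; apply: XU; apply: leq_trans nN; rewrite -ltnS.
  have XS : Xh (\sum_(j < n.+1) b (n - j)%N *: (U j - vh)) by apply: fe_sum => j; exact: XZ.
  split; first exact: XZ.
  rewrite (L2dotZl_fe hOmega hTh)// powRN; congr (_ * _).
  rewrite (L2dot_sum_fe hOmega hTh)//; last by move=> j; exact: XZ.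
  apply: eq_bigr => j _; rewrite (L2dotZl_fe hOmega hTh)// dotB ?/Z ?U0//.
  by apply: XU; apply: leq_trans nN; rewrite -ltnS.
have scaled n (E : R) : (tau `^ alpha)^-1 * S n + lambda * E = 0 -> S n + lambda * tau `^ alpha * E = 0.
  move=> /(congr1 ( *%R (tau `^ alpha))); rewrite mulr0 mulrDr mulVKf ?gt_eqF// => h.
  by rewrite -[RHS]h; congr (_ + _); ring.
move=> n nN; rewrite -[LHS]/(Z n) -[in RHS]U0 -/(Z 0%N).
apply: (cn_seq_unique alpha01 hb mu0 hW _ _ _ nN) => [N1|N2|k /andP[k3 kN]].
- have := congr1 (fun u => dot u w) (cn_step1 sU N1); rewrite /= !(scaler0, addr0) dot0.
  have [XF eF] := fd _ N1; have [X1 e1] := dotBL (1 - alpha / 2) _ _ XF (XU _ N1).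
  rewrite (dotBL _ _ _ X1 Xv).2 e1 eF -U0 -!/(Z _) -addrA -mulrDr.
  exact: scaled.
- have N1 : (1 <= N)%N by exact: ltnW.
  have := congr1 (fun u => dot u w) (cn_step2 sU N2); rewrite /= !(scaler0, addr0) dot0.
  have [XF eF] := fd _ N2; have [X1 e1] := dotBL (1 - alpha / 2) _ _ XF (XU _ N2).
  have [X2 e2] := dotBL (alpha / 2) _ _ X1 (XU _ N1).
  rewrite (dotBL _ _ _ X2 Xv).2 e2 e1 eF -U0 -!/(Z _) -!addrA -!mulrDr.
  by rewrite !addrA; exact: scaled.
- have kN' : (k.-1 <= N)%N by apply: leq_trans kN; exact: leq_pred.
  have h3 : (3 <= k <= N)%N by rewrite k3.
  have := congr1 (fun u => dot u w) (cn_step sU h3); rewrite /= !(scaler0, addr0) dot0.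
  have [XF eF] := fd _ kN; have [X1 e1] := dotBL (1 - alpha / 2) _ _ XF (XU _ kN).
  rewrite (dotBL _ _ _ X1 (XU _ kN')).2 e1 eF -!/(Z _) -addrA -mulrDr.
  exact: scaled.
Qed.

(** The scalar estimate is a hypothesis so that its constant is fixed before the mesh, the step and
    the data. *)
Lemma fully_discrete_error (C : R) v Ph uh (tau : R) N U n : 0 <= C ->
  (forall (lambda tau : R) (y : R -> R) (W : fps R) n, 0 <= lambda -> 0 < tau -> (0 < n)%N ->
     caputo_regular y -> (forall t, 0 < t -> caputo alpha y t = - (lambda * y t)) ->
     cn_seq alpha b (lambda * tau `^ alpha) W ->
     `|y (n%:R * tau) - y 0 * (1 + W n)| <= C / n%:R ^+ 2 * `|y 0|) ->
  is_L2_projection Omega Th Ph -> L2 Omega v ->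
  semidiscrete_solution Omega Th alpha Lh (fun=> 0) (Ph v) uh ->
  0 < tau -> corrected_CN_solution Omega Th alpha Lh b tau N (fun=> 0) (Ph v) U ->
  (1 <= n <= N)%N ->
  (L2norm Omega (uh (n%:R * tau) - U n)%R <= (C / n%:R ^+ 2)%:E * L2norm Omega v)%E.
Proof.
move=> C0 hC hP Lv su tau0 sU /andP[n1 nN].
have [Xv _] := hP v Lv.
have t0 : 0 <= n%:R * tau by apply: mulr_ge0 => //; exact: ltW.
set K := C / n%:R ^+ 2; have K0 : 0 <= K by apply: divr_ge0 => //; exact: sqr_ge0.
set e := uh (n%:R * tau) - U n.
have Xut := sds_space su t0; have XUn := cn_space sU nN.
have Xe : Xh e by exact: fe_sub.
have [p p0 pe] := annihilating_poly hTh hL Xe.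
have LLD u w : Xh u -> Xh w -> Lh (u + w) = Lh u + Lh w.
  by move=> Xu Xw; have := laplacian_lin hOmega hTh hL 1 Xu Xw; rewrite !scale1r.
have LLZ (a : R) u : Xh u -> Lh (a *: u) = a *: Lh u.
  move=> Xu; have Xz := fe_zero Omega Th.
  have L0 : Lh 0 = 0 by have := laplacian_lin hOmega hTh hL (-1) Xz Xz; rewrite scaler0 add0r scaleN1r addNr.
  by have := laplacian_lin hOmega hTh hL a Xu Xz; rewrite L0 !addr0.
have bound : dot e e <= K ^+ 2 * dot (Ph v) (Ph v).
  apply: (@selfadjoint_bound R _ Xh Lh dot _ _ _ _ _ _ _ _ _ _ _ _ K p e (Ph v)) => //.
  - by move=> u w; exact: fe_add.
  - exact: fe_zero.
  - by move=> u w _ _; exact: L2dotC.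
  - by move=> u1 u2 w; exact: (L2dotDl_fe hOmega hTh).
  - by move=> a u w; exact: (L2dotZl_fe hOmega hTh).
  - by move=> u _; exact: L2dot_ge0.
  - by move=> u; exact: (L2dot_eq0 hOmega hTh).
  - by move=> u w; exact: (laplacian_sym hL).
  (* The bound is requested for every solution of L w = a w, including w = 0, for which the sign of
     a is undetermined. *)
  move=> a w Xw Lw; have [w0|w0] := eqVneq (dot w w) 0.
    have -> : w = 0 by exact: (L2dot_eq0 hOmega hTh).
    have d0 u : Xh u -> dot u 0 = 0.
      by move=> Xu; rewrite L2dotC -(scale0r w) (L2dotZl_fe hOmega hTh)// mul0r.
    by rewrite !d0// normr0 mulr0.
  have ww : 0 < dot w w by rewrite lt_neqAle eq_sym w0 L2dot_ge0.
  have a0 : 0 <= - a.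
    have := laplacian_le0 hL Xw; rewrite Lw (L2dotZl_fe hOmega hTh)// pmulr_lle0//.
    by rewrite oppr_ge0.
  have Lw' : Lh w = - (- a) *: w by rewrite opprK.
  have [y [ry yE ye]] := semidiscrete_mode su Xw Lw'.
  have [W hW ZE] := discrete_mode tau0 Xv sU Xw Lw' a0.
  have := hC _ _ _ _ n a0 tau0 n1 ry ye hW.
  rewrite !yE// (sds_init su) -ZE//.
  by rewrite (L2dotBl hOmega)//; exact: XL2.
rewrite !(L2norm_sqrt hOmega)//; last exact: XL2.
rewrite -EFinM lee_fin -[K]ger0_norm// -sqrtr_sqr -sqrtrM ?sqr_ge0//.
apply: ler_wsqrtr; apply: le_trans bound _; apply: ler_wpM2l; first exact: sqr_ge0.
exact: (L2_projection_le hOmega hTh).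
Qed.

End fully_discrete.

Theorem theorem3p2 (R : realType) (d : nat) (Omega : set 'rV[R]_d)
    (T alpha : R) (b : nat -> R) (Ths : set (mesh R d))
    (hd : (1 <= d <= 3)%N) (hOmega : convex_polygonal_domain Omega)
    (hT : 0 < T) (halpha : 0 < alpha < 1) (hb : frac_weights alpha b)
    (hThs : forall Th, Ths Th -> triangulation Omega Th)
    (hshape : shape_regular Ths) (hquasi : quasi_uniform Ths) :
  exists2 c : R, 0 < c &
    forall (Th : mesh R d), Ths Th ->
    forall Ph Lh : ('rV[R]_d -> R) -> 'rV[R]_d -> R,
    is_L2_projection Omega Th Ph -> is_discrete_laplacian Omega Th Lh ->
    forall v : 'rV[R]_d -> R, L2 Omega v ->
    forall uh : R -> 'rV[R]_d -> R,
    semidiscrete_solution Omega Th alpha Lh (fun=> 0) (Ph v) uh ->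
    forall (N : nat) (tau : R), (0 < N)%N -> tau = T / N%:R ->
    forall U : nat -> 'rV[R]_d -> R,
    corrected_CN_solution Omega Th alpha Lh b tau N (fun=> 0) (Ph v) U ->
    forall n : nat, (1 <= n <= N)%N ->
    (L2norm Omega (uh (n%:R * tau) - U n)%R
      <= (c * tau ^+ 2 * (n%:R * tau) ^- 2)%:E * L2norm Omega v)%E.
Proof.
have [C C0 hC] := scalar_cn_error halpha hb.
(* [C] is only known to be nonnegative, whereas the constant has to be positive. *)
exists (C + 1); first exact: ltr_wpDl.
move=> Th hTh Ph Lh hP hL v Lv uh su N tau N0 tauE U sU n hn.
have tau0 : 0 < tau by rewrite tauE divr_gt0// ltr0n.
apply: (le_trans (fully_discrete_error hOmega (hThs _ hTh) halpha hb hL C0 hC hP Lv su tau0 sU hn)).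
apply: lee_wpmul2r; first exact: Lnorm_ge0.
have /andP[n1 _] := hn.
have -> : (C + 1) * tau ^+ 2 * (n%:R * tau) ^- 2 = (C + 1) / n%:R ^+ 2.
  have t0 : tau != 0 by rewrite gt_eqF.
  have nn : n%:R != 0 :> R by rewrite pnatr_eq0 -lt0n.
  by rewrite exprMn invfM [(n%:R ^+ 2)^-1 * _]mulrC mulrA mulfK ?sqrf_eq0.
by rewrite lee_fin ler_wpM2r ?invr_ge0 ?sqr_ge0// lerDl.
Qed.
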